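(* Let $\mu_s=(a_s,b_s,c_s,d_s,e_s)$ with $a_s,b_s,c_s,d_s,e_s\in\mathbb R$, $b_s\neq 0$, $s=1,2$, and write $\mathbf{bw}=(b_1w_1,b_2w_2)$ for $\mathbf w=(w_1,w_2)\in\mathbb R^2$. Let $f\in L^2(\mathbb R^2,\mathbb H)$ and let $d\ge0$ be a real number such that $$\int_{\mathbb R^2}\int_{\mathbb R^2}\frac{|f(\mathbf x)|\,\left|\mathbb Q^{\mathbb H}_{\mu_1,\mu_2}[f](\mathbf w)\right|}{(1+|\mathbf x|+|\mathbf{bw}|)^d}\,e^{|\mathbf x||\mathbf{bw}|}\,d\mathbf x\,d\mathbf w<\infty .$$ Then (almost everywhere) $$f(\mathbf x)=e^{i(a_1x_1^2+d_1x_1)}\,P'(\mathbf x)\,e^{-k|\mathbf x|^2}\,e^{j(a_2x_2^2+d_2x_2)},$$ where $k>0$ and $P'(\mathbf x)=\frac{1}{\sqrt{b_1i}}P(\mathbf x)\frac{1}{\sqrt{b_2j}}$, with $P$ a polynomial in $x_1,x_2$ with quaternion coefficients, is a polynomial of degree $<\frac{d-2}{2}$. In particular, $f=0$ when $d\le2$.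
   Context: $\mathbb H$ is the real quaternion algebra with imaginary units $i,j,k$; $|\mathbf x|$ is the Euclidean norm on $\mathbb R^2$. $L^p(\mathbb R^2,\mathbb H)$ is the space of $\mathbb H$-valued functions $f$ with $|f|\in L^p(\mathbb R^2)$. The exponent $d$ is unrelated to the parameters $d_1,d_2$, and the positive real $k$ in the conclusion is unrelated to the imaginary unit. Two-sided quaternion quadratic-phase Fourier transform (Q-QPFT) of $f\in L^1(\mathbb R^2,\mathbb H)$: $$\mathbb Q^{\mathbb H}_{\mu_1,\mu_2}[f](\mathbf w)=\int_{\mathbb R^2}\Lambda^i_{\mu_1}(x_1,w_1)f(\mathbf x)\Lambda^j_{\mu_2}(x_2,w_2)\,d\mathbf x,$$ where $\Lambda^i_{\mu_1}(x_1,w_1)=\sqrt{\tfrac{b_1i}{2\pi}}\,e^{-i(a_1x_1^2+b_1x_1w_1+c_1w_1^2+d_1x_1+e_1w_1)}$ and $\Lambda^j_{\mu_2}(x_2,w_2)=\sqrt{\tfrac{b_2j}{2\pi}}\,e^{-j(a_2x_2^2+b_2x_2w_2+c_2w_2^2+d_2x_2+e_2w_2)}$. The square roots are principal square roots in the complex planes $\mathbb R+\mathbb R i$ and $\mathbb R+\mathbb R j$ respectively. On $L^2(\mathbb R^2,\mathbb H)$ the Q-QPFT is the unique continuous extension to $L^2(\mathbb R^2,\mathbb H)$ of its restriction to $L^1\cap L^2$ (which is an isometry for the $L^2$ norm). *)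

(* Defs.v *)
From HB Require Import structures.
From mathcomp Require Import all_boot all_order all_algebra.
From mathcomp Require Import ring.
From mathcomp Require Import all_classical all_reals all_analysis.
From mathcomp Require Import complex.

Set Implicit Arguments.
Unset Strict Implicit.
Unset Printing Implicit Defensive.

Import Order.TTheory GRing.Theory Num.Theory.
Import numFieldNormedType.Exports.

Local Open Scope classical_set_scope.
Local Open Scope ring_scope.

(* [Quat a b c d] is a + b i + c j + d k. *)
Record quat (R : Type) : Type := Quat { q0 : R; q1 : R; q2 : R; q3 : R }.

Section QuatChoice.
Variable R : Type.

Definition quat_prod (q : quat R) : R * R * R * R := (q0 q, q1 q, q2 q, q3 q).

Definition prod_quat (p : R * R * R * R) : quat R :=
  let: (a, b, c, d) := p in Quat a b c d.

Lemma quat_prodK : cancel quat_prod prod_quat.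
Proof. by case. Qed.

End QuatChoice.

HB.instance Definition _ (R : choiceType) :=
  Choice.copy (quat R) (can_type (@quat_prodK R)).

Section QuatAlgebra.
Variable R : comNzRingType.
Implicit Types x y z : quat R.

Definition addq x y :=
  Quat (q0 x + q0 y) (q1 x + q1 y) (q2 x + q2 y) (q3 x + q3 y).
Definition oppq x := Quat (- q0 x) (- q1 x) (- q2 x) (- q3 x).
Definition zeroq : quat R := Quat 0 0 0 0.
Definition oneq : quat R := Quat 1 0 0 0.
Definition mulq x y :=
  Quat (q0 x * q0 y - q1 x * q1 y - q2 x * q2 y - q3 x * q3 y)
       (q0 x * q1 y + q1 x * q0 y + q2 x * q3 y - q3 x * q2 y)
       (q0 x * q2 y - q1 x * q3 y + q2 x * q0 y + q3 x * q1 y)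
       (q0 x * q3 y + q1 x * q2 y - q2 x * q1 y + q3 x * q0 y).
Definition scaleq (a : R) x := Quat (a * q0 x) (a * q1 x) (a * q2 x) (a * q3 x).

Fact addqA : associative addq.
Proof. by move=> x y z; rewrite /addq /= !addrA. Qed.
Fact addqC : commutative addq.
Proof. by move=> x y; congr Quat; rewrite addrC. Qed.
Fact add0q : left_id zeroq addq.
Proof. by case=> *; rewrite /addq /= !add0r. Qed.
Fact addNq : left_inverse zeroq oppq addq.
Proof. by case=> *; rewrite /addq /= !addNr. Qed.

HB.instance Definition _ := GRing.isZmodule.Build (quat R)
  addqA addqC add0q addNq.

Fact mulqA : associative mulq.
Proof. by move=> [????] [????] [????]; congr Quat => /=; ring. Qed.
Fact mul1q : left_id oneq mulq.
Proof. by case=> *; congr Quat => /=; ring. Qed.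
Fact mulq1 : right_id oneq mulq.
Proof. by case=> *; congr Quat => /=; ring. Qed.
Fact mulqDl : left_distributive mulq addq.
Proof. by move=> [????] [????] [????]; congr Quat => /=; ring. Qed.
Fact mulqDr : right_distributive mulq addq.
Proof. by move=> [????] [????] [????]; congr Quat => /=; ring. Qed.
Fact oneq_neq0 : oneq != 0.
Proof. by apply/eqP => -[/eqP]; rewrite oner_eq0. Qed.

HB.instance Definition _ := GRing.Zmodule_isNzRing.Build (quat R)
  mulqA mul1q mulq1 mulqDl mulqDr oneq_neq0.

Fact scaleqA a b x : scaleq a (scaleq b x) = scaleq (a * b) x.
Proof. by rewrite /scaleq /= !mulrA. Qed.
Fact scale1q : left_id 1 scaleq.
Proof. by case=> *; rewrite /scaleq /= !mul1r. Qed.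
Fact scaleqDr : right_distributive scaleq +%R.
Proof. by move=> a x y; rewrite /scaleq /= !mulrDr. Qed.
Fact scaleqDl x : {morph scaleq^~ x : a b / a + b}.
Proof. by move=> a b; rewrite /scaleq /= !mulrDl. Qed.

HB.instance Definition _ := GRing.Zmodule_isLmodule.Build R (quat R)
  scaleqA scale1q scaleqDr scaleqDl.

Fact scaleqAl a x y : a *: (x * y) = (a *: x) * y.
Proof. by congr Quat => /=; ring. Qed.
Fact scaleqAr a x y : a *: (x * y) = x * (a *: y).
Proof. by congr Quat => /=; ring. Qed.

HB.instance Definition _ := GRing.Lmodule_isLalgebra.Build R (quat R) scaleqAl.
HB.instance Definition _ := GRing.Lalgebra_isAlgebra.Build R (quat R) scaleqAr.

Definition qi : quat R := Quat 0 1 0 0.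
Definition qj : quat R := Quat 0 0 1 0.
Definition qk : quat R := Quat 0 0 0 1.

Lemma qiqi : qi * qi = -1. Proof. by congr Quat => /=; ring. Qed.
Lemma qjqj : qj * qj = -1. Proof. by congr Quat => /=; ring. Qed.
Lemma qkqk : qk * qk = -1. Proof. by congr Quat => /=; ring. Qed.
Lemma qiqj : qi * qj = qk. Proof. by congr Quat => /=; ring. Qed.
Lemma qjqi : qj * qi = - qk. Proof. by congr Quat => /=; ring. Qed.

(* The image of a + b sqrt(-1) in the plane R + R u, for u = i or u = j. *)
Definition inplane (u : quat R) (z : R[i]) : quat R :=
  (complex.Re z)%:A + complex.Im z *: u.

(* The value at (x1, x2) of P = \sum_n P_n X2^n with P_n = \sum_m P_(n, m) X1^m;
   real scalars are central, so the sides of the coefficients do not matter. *)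
Definition eval2 (P : {poly {poly (quat R)}}) (x : R * R) : quat R :=
  P.[(x.2%:A)%:P].[x.1%:A].

End QuatAlgebra.

Arguments qi {R}.
Arguments qj {R}.
Arguments qk {R}.

Definition qnorm (R : rcfType) (q : quat R) : R :=
  Num.sqrt (q0 q ^+ 2 + q1 q ^+ 2 + q2 q ^+ 2 + q3 q ^+ 2).

(* The Euclidean norm; the library's norm on [R * R] is the sup norm. *)
Definition enorm (R : rcfType) (x : R * R) : R :=
  Num.sqrt (x.1 ^+ 2 + x.2 ^+ 2).

(* Total degree < s; the zero polynomial has degree -oo. *)
Definition total_degree_lt (R : realType) (P : {poly {poly (quat R)}}) (s : R) :=
  forall m n : nat, P`_n`_m != 0 -> (m + n)%:R < s.

Section Plane.
Variable R : realType.

(* [measurableTypeR R] is R with the Borel sigma-algebra on which the library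
   defines [lebesgue_measure]. *)
Local Notation plane := (measurableTypeR R * measurableTypeR R)%type.

Definition leb2 : {measure set plane -> \bar R} :=
  (@lebesgue_measure R \x @lebesgue_measure R)%E.

Definition measurable_quat (f : R * R -> quat R) : Prop :=
  [/\ measurable_fun [set: plane] (fun x => q0 (f x)),
      measurable_fun [set: plane] (fun x => q1 (f x)),
      measurable_fun [set: plane] (fun x => q2 (f x)) &
      measurable_fun [set: plane] (fun x => q3 (f x))].

Definition LpH (p : \bar R) : set (R * R -> quat R) :=
  [set f | measurable_quat f /\ (fun x => qnorm (f x)) \in Lfun leb2 p].

Definition Rintegral_quat (f : R * R -> quat R) : quat R :=
  Quat (\int[leb2]_x (q0 (f x))) (\int[leb2]_x (q1 (f x)))
       (\int[leb2]_x (q2 (f x))) (\int[leb2]_x (q3 (f x))).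

Definition L2dist (f g : R * R -> quat R) : \bar R :=
  Lnorm leb2 2%:E (fun x => (qnorm (f x - g x))%:E).

End Plane.

Record qpft_param (R : Type) : Type :=
  QpftParam { pa : R; pb : R; pc : R; pd : R; pe : R }.

Section QQPFT.
Variable R : realType.
Implicit Types mu : qpft_param R.

(* exp (u t) for the imaginary unit u *)
Definition expu (u : quat R) (t : R) : quat R :=
  inplane u (Complex (cos t) (sin t)).

Definition qphase mu (x w : R) : R :=
  pa mu * x ^+ 2 + pb mu * x * w + pc mu * w ^+ 2 + pd mu * x + pe mu * w.

(* [sqrtc] is the principal complex square root. *)
Definition qpft_kernel (u : quat R) mu (x w : R) : quat R :=
  inplane u (sqrtc (Complex 0 (pb mu / (2 * pi)))) * expu u (- qphase mu x w).

(* Meaningful for f in L^1 only. *)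
Definition QQPFT mu1 mu2 (f : R * R -> quat R) (w : R * R) : quat R :=
  Rintegral_quat (fun x =>
    qpft_kernel qi mu1 x.1 w.1 * f x * qpft_kernel qj mu2 x.2 w.2).

(* [T] is the continuous extension to L^2 of the restriction of the transform
   to the intersection of L^1 and L^2. Elements of L^2 are represented by
   functions, so [T] is determined up to almost everywhere equality. *)
Definition is_QQPFT_L2 mu1 mu2 (T : (R * R -> quat R) -> (R * R -> quat R)) :=
  [/\ forall f, LpH 2%:E f -> LpH 2%:E (T f),
      forall f, LpH 2%:E f -> forall eps : R, 0 < eps ->
        exists2 delta : R, 0 < delta & forall g, LpH 2%:E g ->
          (L2dist g f < delta%:E)%E -> (L2dist (T g) (T f) < eps%:E)%E &
      forall f, LpH 1%:E f -> LpH 2%:E f ->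
        {ae @leb2 R, forall w, T f w = QQPFT mu1 mu2 f w}].

End QQPFT.

(* Main.v *)
(* Remove the chirps: [g = e^{-i(..)} f e^{-j(..)}] has [|g| = |f|], and put [B_a(p u) =
   \int e^{-|x|^2/2 + u p.x} q0 (a g x) dx] for [a] a quaternion, [p] a unit vector and [u]
   complex. Directly, [|B_a(p u)| <= \int e^{-|x|^2/2 + |Re u||x|} |f|]; by Gaussian
   duality (Fubini for integrable [f], then density), [|B_a(p u)| <= C e^{(Re u^2 - Im
   u^2)/2} \int e^{-|bw|^2/2 + |Im u||bw|} |Q f(w)| dw]. Multiplying the two, the
   hypothesis shows that [W u = B_a(p u) B_a'(q i u)] is at most [C (1 + |u|)^N e^{min((Re
   u)^2, (Im u)^2)/2}], so [W] is a polynomial by Phragmen-Lindelof and Liouville. Factors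
   of order two of a nonzero polynomial have finitely many zeros, so (Hadamard, via
   Borel-Caratheodory) all the [B_a(p .)] are polynomials times one Gaussian [e^{kappa
   u^2}], and exponential moments of [|f|] and [|Q f|] give [0 < kappa < 1/2]. Inverting
   explicitly and using uniqueness of the Fourier transform, [g] is a polynomial times
   [e^{-k|x|^2}] with [2 kappa (1 + 2k) = 1]. For the degree, the dual inequality at [u = i
   (1 + 2k)|x|] bounds the inner integral of the hypothesis from below by a multiple of [|f
   x| e^{k|x|^2} |x|^N (1 + |x|)^{-d}], [N] being the largest degree among the [B_a(p .)],
   which is at least the degree of [g]; integrating over boxes inside a cone where the top
   degree part of [g] does not vanish yields [deg g + N < d - 2]. *)
Require Import Defs.
From mathcomp Require Import all_boot all_order all_algebra.
From mathcomp Require Import all_classical all_reals all_analysis.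
From mathcomp Require Import complex.
From HB Require Import structures.
From mathcomp Require Import ring lra.
From mathcomp Require Import measurable_realfun.

Set Implicit Arguments.
Unset Strict Implicit.
Unset Printing Implicit Defensive.

Import Order.TTheory GRing.Theory Num.Theory.
Import numFieldNormedType.Exports.

Local Open Scope classical_set_scope.
Local Open Scope ring_scope.

(** * Complex exponential *)

(** Slicing along a direction [p] reduces everything to one complex variable, and reading only real
    coordinates [q0 (a * _)] replaces the noncommutative two-sided transform by scalar entire
    functions. The growth allowed for [W] is critical: it has order two on quadrants, whose opening
    pi/2 is exactly where the Phragmen-Lindelof principle breaks down. The minimum of the two
    squares rescues the argument, since it is small near both axes, and the price paid in slightly
    smaller sectors can be sent to zero. One factor of [W] is a fixed reference function while the
    other varies; this is what produces the same [kappa] for all [a] and [p]. The complex analysis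
    uses no contour integral: a maximum principle on rectangles, proved by comparing a point with
    four neighbours, gives Liouville and Borel-Caratheodory, and entire functions are handled
    through power series with explicit remainders. On each slice the Taylor coefficients are
    homogeneous forms in [p], which is why a family of one-variable polynomials can be inverted into
    a polynomial on the plane. *)

Notation cn := (@ComplexField.Normc.normc _).

Section ComplexModulus.
Variable R : rcfType.
Implicit Types z w : R[i].

Lemma cnE z : cn z = Num.sqrt (complex.Re z ^+ 2 + complex.Im z ^+ 2).
Proof. by case: z. Qed.

Lemma cn_ge0 z : 0 <= cn z.
Proof. by rewrite cnE sqrtr_ge0. Qed.

Lemma cn_sq z : cn z ^+ 2 = complex.Re z ^+ 2 + complex.Im z ^+ 2.
Proof. by rewrite cnE sqr_sqrtr // addr_ge0 ?sqr_ge0. Qed.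

Lemma cnM z w : cn (z * w) = cn z * cn w.
Proof. exact: ComplexField.Normc.normcM. Qed.

Lemma cn0 : cn (0 : R[i]) = 0.
Proof. exact: ComplexField.Normc.normc0. Qed.

Lemma cn1 : cn (1 : R[i]) = 1.
Proof. exact: ComplexField.Normc.normc1. Qed.

Lemma cnV z : cn z^-1 = (cn z)^-1.
Proof. exact: ComplexField.Normc.normcV. Qed.

Lemma cn_eq0 z : (cn z == 0) = (z == 0).
Proof.
apply/eqP/eqP => [|->]; last exact: cn0.
exact: ComplexField.Normc.eq0_normc.
Qed.

Lemma cn_gt0 z : (0 < cn z) = (z != 0).
Proof. by rewrite lt0r cn_ge0 andbT cn_eq0. Qed.

Lemma cnN z : cn (- z) = cn z.
Proof. by rewrite !cnE /=; case: z => a b /=; rewrite !sqrrN. Qed.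

Lemma cnD z w : cn (z + w) <= cn z + cn w.
Proof. exact: le_normcD. Qed.

Lemma cnB z w : cn (z - w) <= cn z + cn w.
Proof. by rewrite -(cnN w); exact: cnD. Qed.

Lemma cnBC z w : cn (z - w) = cn (w - z).
Proof. by rewrite -cnN opprB. Qed.

Lemma cnX z n : cn (z ^+ n) = cn z ^+ n.
Proof. by elim: n => [|n IH]; rewrite ?expr0 ?cn1 // !exprS cnM IH. Qed.

Lemma cn_real (x : R) : cn x%:C%C = `|x|.
Proof. by rewrite cnE /= expr0n /= addr0 sqrtr_sqr. Qed.

Lemma cn_nat n : cn (n%:R : R[i]) = n%:R.
Proof. by rewrite -(rmorph_nat (real_complex R)) cn_real ger0_norm. Qed.

Lemma Re_le_cn z : `|complex.Re z| <= cn z.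
Proof. by rewrite cnE -sqrtr_sqr ler_sqrt ?addr_ge0 ?sqr_ge0 // lerDl sqr_ge0. Qed.

Lemma Im_le_cn z : `|complex.Im z| <= cn z.
Proof. by rewrite cnE -sqrtr_sqr ler_sqrt ?addr_ge0 ?sqr_ge0 // lerDr sqr_ge0. Qed.

Lemma cn_le_ReIm z : cn z <= `|complex.Re z| + `|complex.Im z|.
Proof.
rewrite -(ler_pXn2r (n := 2)) ?nnegrE ?cn_ge0 ?addr_ge0 // cn_sq.
rewrite -(real_normK (num_real (complex.Re z))) -(real_normK (num_real (complex.Im z))).
by rewrite sqrrD lerD2r lerDl mulrn_wge0 // mulr_ge0.
Qed.

Lemma cn_sum (I : Type) (r : seq I) (P : pred I) (F : I -> R[i]) :
  cn (\sum_(i <- r | P i) F i) <= \sum_(i <- r | P i) cn (F i).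
Proof.
elim/big_rec2: _ => [|i x y _ IH]; first by rewrite cn0.
by rewrite (le_trans (cnD _ _)) // lerD2l.
Qed.

Lemma cn_conj z : cn (z^*)%C = cn z.
Proof. by case: z => a b; rewrite !cnE /= sqrrN. Qed.

Lemma Re_mul z w :
  complex.Re (z * w) = complex.Re z * complex.Re w - complex.Im z * complex.Im w.
Proof. by case: z w => [??] [??]. Qed.

Lemma Im_mul z w :
  complex.Im (z * w) = complex.Re z * complex.Im w + complex.Im z * complex.Re w.
Proof. by case: z w => [??] [??]. Qed.

Lemma ReD z w : complex.Re (z + w) = complex.Re z + complex.Re w.
Proof. by case: z w => [??] [??]. Qed.

Lemma ImD z w : complex.Im (z + w) = complex.Im z + complex.Im w.
Proof. by case: z w => [??] [??]. Qed.

Lemma ReN z : complex.Re (- z) = - complex.Re z.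
Proof. by case: z => [??]. Qed.

Lemma ImN z : complex.Im (- z) = - complex.Im z.
Proof. by case: z => [??]. Qed.

Lemma ReZ (a : R) z : complex.Re (a%:C%C * z) = a * complex.Re z.
Proof. by case: z => ? ? /=; rewrite mul0r subr0. Qed.

Lemma ImZ (a : R) z : complex.Im (a%:C%C * z) = a * complex.Im z.
Proof. by case: z => ? ? /=; rewrite mul0r addr0. Qed.

Lemma complex_eq z w :
  complex.Re z = complex.Re w -> complex.Im z = complex.Im w -> z = w.
Proof. by case: z w => [??] [??] /= -> ->. Qed.

End ComplexModulus.

Ltac le_eq := rewrite le_eqVlt; apply/orP; left; apply/eqP.

Ltac nneg := repeat match goal with
  | |- is_true (0 <= _ + _) => apply: addr_ge0
  | |- is_true (0 <= _ * _) => apply: mulr_ge0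
  | |- is_true (0 <= _ ^+ 2) => exact: sqr_ge0
  | |- is_true (0 <= _ ^+ _) => apply: exprn_ge0
  | |- is_true (0 <= _^-1) => rewrite invr_ge0
  | |- is_true (0 <= expR _) => exact: expR_ge0
  | |- is_true (0 <= cn _) => exact: cn_ge0
  | |- is_true (0 <= `|_|) => exact: normr_ge0
  | |- is_true (0 <= _%:R) => exact: ler0n
  | |- is_true (0 <= powR _ _) => exact: powR_ge0
  | |- is_true (0 <= Num.sqrt _) => exact: sqrtr_ge0
  | |- _ => by [] || (by apply: ltW)
  end.

Section ComplexExponential.
Variable R : realType.
Implicit Types z w : R[i].

Definition cexp z : R[i] :=
  Complex (expR (complex.Re z) * cos (complex.Im z))
          (expR (complex.Re z) * sin (complex.Im z)).

Lemma cexpD z w : cexp (z + w) = cexp z * cexp w.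
Proof.
by case: z w => [a b] [c d]; apply: complex_eq;
  rewrite /= expRD ?cosD ?sinD; ring.
Qed.

Lemma cexp0 : cexp 0 = 1.
Proof. by rewrite /cexp /= expR0 cos0 sin0 !mul1r. Qed.

Lemma cn_cexp z : cn (cexp z) = expR (complex.Re z).
Proof.
rewrite cnE /= !exprMn -mulrDr cos2Dsin2 mulr1 sqrtr_sqr.
by rewrite ger0_norm ?expR_ge0.
Qed.

Lemma cexp_real (x : R) : cexp x%:C%C = (expR x)%:C%C.
Proof. by rewrite /cexp /= cos0 sin0 mulr1 mulr0. Qed.

Lemma derive_ge0_le (f df : R -> R) (t : R) : 0 <= t ->
  (forall x : R, is_derive x 1 f (df x)) -> (forall x, 0 <= x -> 0 <= df x) ->
  f 0 <= f t.
Proof.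
move=> t0 fd df0.
have cf : {within `[0, t], continuous f}.
  apply: continuous_subspaceT => x; apply: differentiable_continuous.
  by apply/derivable1_diffP; case: (fd x).
have [c /[!in_itv]/= /andP[c0 _] e] := MVT_segment t0 (fun x _ => fd x) cf.
by rewrite -subr_ge0 e subr0 mulr_ge0 // df0.
Qed.

Definition exp_tail n z := cexp z - \sum_(k < n) z ^+ k / k`!%:R.

Lemma is_derive_Re_cexp c z (t : R) :
  is_derive t 1 (fun s : R => complex.Re (c * cexp (s%:C%C * z)))
    (complex.Re (c * z * cexp (t%:C%C * z))).
Proof.
case: c z => [c1 c2] [a b].
rewrite (_ : (fun s => _) = (fun s : R => c1 * (expR (s * a) * cos (s * b))
    - c2 * (expR (s * a) * sin (s * b)))); last first.
  by apply/funext => s; rewrite /= !mul0r !subr0 !addr0.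
apply: is_derive_eq; rewrite /GRing.scale /= !mul0r !subr0 !addr0.
by ring.
Qed.

Lemma is_derive_monomial (c t : R) k :
  is_derive t 1 (fun s : R => s ^+ k * c) (k%:R * t ^+ k.-1 * c).
Proof.
elim: k => [|k IH].
  by rewrite !mul0r; under eq_fun do rewrite expr0; exact: is_derive_cst.
under eq_fun do rewrite exprS -mulrA.
apply: is_derive_eq; rewrite /GRing.scale /= !mulr1.
by case: k {IH} => [|k] /=; rewrite ?exprS -?natr1 ?expr0; ring.
Qed.

Lemma is_derive_Re_tail c z n (t : R) :
  is_derive t 1 (fun s : R => complex.Re (c * exp_tail n.+1 (s%:C%C * z)))
    (complex.Re (c * z * exp_tail n (t%:C%C * z))).
Proof.
have eq_sum m (s : R) d : complex.Re (d * \sum_(k < m) (s%:C%C * z) ^+ k / k`!%:R) =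
    \sum_(k < m) s ^+ k * complex.Re (d * z ^+ k / k`!%:R).
  rewrite mulr_sumr (raddf_sum (@complex.Re R : {additive Rcomplex R -> R})).
  apply: eq_bigr => k _; rewrite -ReZ exprMn -rmorphXn; congr complex.Re.
  by rewrite /=; ring.
rewrite (_ : (fun s => _) = (fun s : R => complex.Re (c * cexp (s%:C%C * z)))
   - \sum_(k < n.+1) (fun s => s ^+ k * complex.Re (c * z ^+ k / k`!%:R))); last first.
  apply/funext => s; rewrite /exp_tail mulrBr ReD ReN eq_sum.
  by rewrite /= fctE /= fct_sumE.
have dd := is_derive_Re_cexp c z t.
pose C k := complex.Re (c * z ^+ k / k`!%:R).
have ds : is_derive t 1 (\sum_(k < n.+1) (fun s : R => s ^+ k * C k))
    (\sum_(k < n.+1) (k%:R * t ^+ k.-1 * C k)).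
  by apply: is_derive_sum => k; exact: is_derive_monomial.
apply: is_derive_eq.
rewrite /exp_tail mulrBr ReD ReN eq_sum; congr (_ - _).
rewrite big_ord_recl /= mul0r mul0r add0r.
apply: eq_bigr => k _; rewrite /= /bump /= add1n /C mulrAC mulrC; congr (_ * _).
rewrite -ReZ rmorph_nat factS natrM exprS; congr complex.Re.
have k1 : k.+1%:R != 0 :> R[i] by rewrite pnatr_eq0.
have k0 : k`!%:R != 0 :> R[i] by rewrite pnatr_eq0 -lt0n fact_gt0.
move: k1 k0; move: k.+1%:R k`!%:R => u v u0 v0.
by field; rewrite u0 v0.
Qed.

Lemma exp_tail0 n : exp_tail n.+1 0 = 0.
Proof.
rewrite /exp_tail cexp0 big_ord_recl expr0 fact0 divr1.
by rewrite big1 ?addr0 ?subrr // => i _; rewrite expr0n /= mul0r.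
Qed.

(** Along the ray [t z] the derivative of the tail of order [n + 1] is [z] times the tail of order
    [n], so each bound integrates the previous one. A real mean value argument is enough because the
    modulus at the endpoint is recovered as a real part against a fixed conjugate. *)
Lemma exp_tail_bound n z : cn (exp_tail n z) <= cn z ^+ n / n`!%:R * expR (cn z).
Proof.
suff H t : 0 <= t ->
    cn (exp_tail n (t%:C%C * z)) <= (t * cn z) ^+ n / n`!%:R * expR (t * cn z).
  by have := H 1 ler01; rewrite rmorph1 !mul1r.
elim: n t => [|n IH] t t0.
  rewrite /exp_tail big_ord0 subr0 cn_cexp expr0 fact0 divr1 mul1r ler_expR ReZ.
  by rewrite ler_wpM2l // (le_trans (ler_norm _)) // Re_le_cn.
set E := exp_tail n.+1 _; set r := cn z.
have r0 : 0 <= r by exact: cn_ge0.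
have [->|E0] := eqVneq E 0.
  by rewrite cn0; nneg.
(* With this constant [Re (c * E) = |E|^2]; the factor [|E|] placed in [K] is divided out at the
   end. *)
pose c := (E^*)%C.
pose K := cn E * r ^+ n.+1 / n.+1`!%:R.
pose g s := s ^+ n.+1 * (K : R) * expR (s * r)
            - complex.Re (c * exp_tail n.+1 (s%:C%C * z)).
have dg (s : R) : is_derive s 1 g (n.+1%:R * s ^+ n * K * expR (s * r)
    + s ^+ n.+1 * K * (r * expR (s * r))
    - complex.Re (c * z * exp_tail n (s%:C%C * z))).
  have d1 := is_derive_monomial K s n.+1.
  have d2 := is_derive_Re_tail c z n s.
  apply: is_derive_eq; rewrite /GRing.scale /= mulr0 add0r mulr1.
  by ring.
have : g 0 <= g t.
  apply: (derive_ge0_le t0 dg) => s s0.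
  have s1 : 0 <= s * r by rewrite mulr_ge0.
  have K0 : 0 <= K by rewrite /K; nneg.
  rewrite addrAC addr_ge0 //; last by nneg.
  rewrite subr_ge0 (le_trans (ler_norm _)) // (le_trans (Re_le_cn _)) //.
  rewrite !cnM cn_conj (le_trans (ler_wpM2l _ (IH s s0))) ?mulr_ge0 ?cn_ge0 //.
  rewrite -/r mulrA ler_wpM2r ?expR_ge0 // /K factS natrM exprMn exprS invfM.
  have : n.+1%:R != 0 :> R by rewrite pnatr_eq0.
  move: (n.+1%:R) (n`!%:R^-1) => u w u0.
  by le_eq; field.
rewrite /g expr0n /= !mul0r exp_tail0.
rewrite mulr0 /= subrr subr_ge0 -/E => H.
have {H} : cn E ^+ 2 <= t ^+ n.+1 * K * expR (t * r).
  apply: le_trans H; rewrite cn_sq /c; case: (E) => a b /=.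
  by rewrite mulNr opprK -!expr2.
rewrite expr2 /K => H.
rewrite -(ler_pM2l (_ : 0 < cn E)) ?cn_gt0 // (le_trans H) // exprMn.
by le_eq; ring.
Qed.
End ComplexExponential.

(** * Maximum principle *)

Section Expansions.
Variable R : realType.
Local Notation C := R[i].
Implicit Types (F G : C -> C) (z w h : C).

Definition bounded_near0 (r : C -> C) :=
  exists K d : R, [/\ 0 < d, 0 <= K & forall h, cn h <= d -> cn (r h) <= K].

Lemma bounded_near0_cst c : bounded_near0 (fun=> c).
Proof. by exists (cn c), 1; split; rewrite ?cn_ge0. Qed.

Lemma bounded_near0_id : bounded_near0 id.
Proof. by exists 1, 1. Qed.

Lemma bounded_near0D r s : bounded_near0 r -> bounded_near0 s ->
  bounded_near0 (fun h => r h + s h).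
Proof.
move=> [K [d [d0 K0 H]]] [L [e [e0 L0 G]]].
exists (K + L), (Num.min d e); split; first by rewrite lt_min d0.
  exact: addr_ge0.
move=> h; rewrite le_min => /andP[hd he].
by rewrite (le_trans (cnD _ _)) // lerD ?H ?G.
Qed.

Lemma bounded_near0M r s : bounded_near0 r -> bounded_near0 s ->
  bounded_near0 (fun h => r h * s h).
Proof.
move=> [K [d [d0 K0 H]]] [L [e [e0 L0 G]]].
exists (K * L), (Num.min d e); split; first by rewrite lt_min d0.
  exact: mulr_ge0.
move=> h; rewrite le_min => /andP[hd he].
by rewrite cnM ler_pM ?cn_ge0 ?H ?G.
Qed.

Lemma bounded_near0_comp r s : bounded_near0 r -> bounded_near0 s ->
  bounded_near0 (fun h => r (h * s h)).
Proof.
move=> [K [d [d0 K0 H]]] [L [e [e0 L0 G]]].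
exists K, (Num.min e (d / (L + 1))).
have L1 : 0 < L + 1 by rewrite ltr_wpDl.
split => //; first by rewrite lt_min e0 divr_gt0.
move=> h; rewrite le_min => /andP[he hd]; apply: H.
rewrite cnM (le_trans (ler_pM _ _ hd (G _ he))) ?cn_ge0 //.
by rewrite mulrAC ler_pdivrMr // ler_pM2l // lerDl.
Qed.

(* A second order expansion at [z] with cubic error: closed under all the
   operations needed below, and enough for the maximum principle. *)
Definition cderiv F z a := exists b r, bounded_near0 r /\
  exists2 d : R, 0 < d & forall h, cn h <= d ->
    F (z + h) = F z + a * h + b * h ^+ 2 + h ^+ 3 * r h.

Definition pe2 F z := exists a, cderiv F z a.

Lemma cderiv_cst c z : cderiv (fun=> c) z 0.
Proof.
exists 0, (fun=> 0); split; first exact: bounded_near0_cst.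
by exists 1 => // h _; ring.
Qed.

Lemma cderiv_id z : cderiv id z 1.
Proof.
exists 0, (fun=> 0); split; first exact: bounded_near0_cst.
by exists 1 => // h _; ring.
Qed.

Lemma cderivD F G z a a' : cderiv F z a -> cderiv G z a' ->
  cderiv (fun u => F u + G u) z (a + a').
Proof.
move=> [b [r [br [d d0 HF]]]] [b' [r' [br' [e e0 HG]]]].
exists (b + b'), (fun h => r h + r' h).
split; first exact: bounded_near0D.
exists (Num.min d e); first by rewrite lt_min d0.
by move=> h; rewrite le_min => /andP[hd he]; rewrite HF // HG //; ring.
Qed.

Lemma cderivM F G z a a' : cderiv F z a -> cderiv G z a' ->
  cderiv (fun u => F u * G u) z (F z * a' + a * G z).
Proof.
move=> [b [r [br [d d0 HF]]]] [b' [r' [br' [e e0 HG]]]].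
exists (F z * b' + a * a' + b * G z),
  (fun h => F z * r' h + a * b' + b * a' + r h * G z
   + h * (a * r' h + b * b' + r h * a' + h * (b * r' h + r h * b' + h * (r h * r' h)))).
split.
  by do ?[exact: br|exact: br'|exact: bounded_near0_cst|exact: bounded_near0_id
         |apply: bounded_near0M|apply: bounded_near0D].
exists (Num.min d e); first by rewrite lt_min d0.
by move=> h; rewrite le_min => /andP[hd he]; rewrite HF // HG //; ring.
Qed.

Lemma cderiv_comp F G z A a : cderiv F (G z) A -> cderiv G z a ->
  cderiv (fun u => F (G u)) z (A * a).
Proof.
move=> [B [rho [brho [e e0 HF]]]] [b [r [br [d d0 HG]]]].
pose t h := b + h * r h.
pose s h := a + h * t h.
have bt : bounded_near0 t.
  by do ?[exact: br|exact: bounded_near0_cst|exact: bounded_near0_id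
         |apply: bounded_near0M|apply: bounded_near0D].
have bs : bounded_near0 s.
  by do ?[exact: bt|exact: bounded_near0_cst|exact: bounded_near0_id
         |apply: bounded_near0M|apply: bounded_near0D].
exists (A * b + B * a ^+ 2), (fun h => A * r h
   + B * (2 * a * t h + h * (t h * t h)) + s h * (s h * s h) * rho (h * s h)).
split.
  by do ?[exact: br|exact: bt|exact: bs|exact: bounded_near0_cst
         |exact: bounded_near0_id|exact: bounded_near0_comp
         |apply: bounded_near0M|apply: bounded_near0D].
have [K [c [c0 K0 Hs]]] := bs.
have K1 : 0 < K + 1 by rewrite ltr_wpDl.
exists (Num.min d (Num.min c (e / (K + 1)))).
  by rewrite !lt_min d0 c0 divr_gt0.
move=> h; rewrite !le_min => /and3P[hd hc he].
have -> : G (z + h) = G z + h * s h by rewrite HG // /s /t; ring.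
rewrite HF; first by rewrite /s /t; ring.
rewrite cnM (le_trans (ler_pM _ _ he (Hs _ hc))) ?cn_ge0 //.
by rewrite mulrAC ler_pdivrMr // ler_pM2l // lerDl.
Qed.

Lemma pe2_cst c z : pe2 (fun=> c) z.
Proof. by exists 0; exact: cderiv_cst. Qed.

Lemma pe2_id z : pe2 id z.
Proof. by exists 1; exact: cderiv_id. Qed.

Lemma pe2D F G z : pe2 F z -> pe2 G z -> pe2 (fun u => F u + G u) z.
Proof. by move=> [a Fa] [b Gb]; exists (a + b); exact: cderivD. Qed.

Lemma pe2M F G z : pe2 F z -> pe2 G z -> pe2 (fun u => F u * G u) z.
Proof. by move=> [a Fa] [b Gb]; eexists; exact: cderivM Fa Gb. Qed.

Lemma pe2_comp F G z : pe2 F (G z) -> pe2 G z -> pe2 (fun u => F (G u)) z.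
Proof. by move=> [a Fa] [b Gb]; eexists; exact: cderiv_comp Fa Gb. Qed.

Lemma pe2_inv w : w != 0 -> pe2 (fun u => u^-1) w.
Proof.
move=> w0; have cw : 0 < cn w by rewrite cn_gt0.
exists (- w ^- 2), (w ^- 3), (fun h => - (w ^- 3 / (w + h))).
have low h : cn h <= cn w / 2 -> cn w / 2 <= cn (w + h).
  move=> hw; have := cnB (w + h) h; rewrite addrK; lra.
split.
  exists ((cn w ^+ 3)^-1 * (cn w / 2)^-1), (cn w / 2); split.
  - by rewrite divr_gt0.
  - by nneg.
  - move=> h hw; rewrite cnN cnM !cnV cnX ler_wpM2l //; first by nneg.
    by rewrite lef_pV2 ?posrE ?divr_gt0 // ?low // (lt_le_trans _ (low _ hw)) // divr_gt0.
exists (cn w / 2); first by rewrite divr_gt0.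
move=> h hw; have : w + h != 0.
  by rewrite -cn_gt0 (lt_le_trans _ (low _ hw)) // divr_gt0.
by move=> wh; field; rewrite w0 wh.
Qed.

Lemma cderiv_cexp z : cderiv (@cexp R) z (cexp z).
Proof.
(* At [h = 0] the quotient is [0] by the convention [0^-1 = 0], and the tail vanishes there too. *)
exists (cexp z / 2), (fun h => cexp z * (exp_tail 3 h / h ^+ 3)).
split.
  apply: bounded_near0M; first exact: bounded_near0_cst.
  exists (expR 1), 1; split; [by []|exact: expR_ge0|].
  move=> h h1; have [->|h0] := eqVneq h 0.
    by rewrite expr0n /= invr0 mulr0 cn0 expR_ge0.
  rewrite cnM cnV cnX ler_pdivrMr ?exprn_gt0 ?cn_gt0 //.
  rewrite (le_trans (exp_tail_bound 3 h)) // -mulrA [leRHS]mulrC.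
  rewrite ler_wpM2l //; first by nneg.
  rewrite -[leRHS]mul1r ler_pM ?expR_ge0 ?invr_ge0 ?ler_expR //.
  by rewrite invf_le1 ?ltr0n ?fact_gt0 // ler1n fact_gt0.
exists 1 => // h _.
have -> : h ^+ 3 * (cexp z * (exp_tail 3 h / h ^+ 3)) = cexp z * exp_tail 3 h.
  have [->|h0] := eqVneq h 0; last by field.
  by rewrite exp_tail0 mul0r !mulr0.
rewrite cexpD /exp_tail !big_ord_recl big_ord0 /= /bump /=.
rewrite !addn0 !addn1 (_ : 2`! = 2)%N // (_ : 1`! = 1)%N // fact0.
by field.
Qed.

Lemma pe2_cexp z : pe2 (@cexp R) z.
Proof. by exists (cexp z); exact: cderiv_cexp. Qed.

Lemma pe2_continuous F z : pe2 F z -> forall e : R, 0 < e ->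
  exists2 d : R, 0 < d & forall h, cn h <= d -> cn (F (z + h) - F z) <= e.
Proof.
move=> [a [b [r [br [d d0 HF]]]]] e e0.
have [K [c [c0 K0 Hs]]] : bounded_near0 (fun h => a + h * (b + h * r h)).
  by do ?[exact: br|exact: bounded_near0_cst|exact: bounded_near0_id
         |apply: bounded_near0M|apply: bounded_near0D].
have K1 : 0 < K + 1 by rewrite ltr_wpDl.
exists (Num.min d (Num.min c (e / (K + 1)))).
  by rewrite !lt_min d0 c0 divr_gt0.
move=> h; rewrite !le_min => /and3P[hd hc he]; rewrite HF //.
have -> : F z + a * h + b * h ^+ 2 + h ^+ 3 * r h - F z
  = h * (a + h * (b + h * r h)) by ring.
rewrite cnM (le_trans (ler_pM _ _ he (Hs _ hc))) ?cn_ge0 //.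
by rewrite mulrAC ler_pdivrMr // ler_pM2l // lerDl.
Qed.

End Expansions.

Section MaximumPrinciple.
Variable R : realType.
Local Notation C := R[i].
Implicit Types (V : C -> C).

Let rect (x1 x2 y1 y2 : R) : set (R * R) := `[x1, x2] `*` `[y1, y2].

Lemma continuous_modulus V (p : R * R) : pe2 V (Complex p.1 p.2) ->
  {for p, continuous (fun q : R * R => cn (V (Complex q.1 q.2)))}.
Proof.
move=> pV; apply/cvgrPdist_le => e e0.
have [d d0 H] := pe2_continuous pV e0.
near=> q.
have qd : `|p - q| <= d / 2.
  by near: q; apply: cvgr_dist_le => //; rewrite divr_gt0.
have {}H : cn (V (Complex q.1 q.2) - V (Complex p.1 p.2)) <= e.
  have -> : Complex q.1 q.2 = Complex p.1 p.2 + Complex (q.1 - p.1) (q.2 - p.2).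
    by apply: complex_eq => /=; ring.
  apply: H; rewrite (le_trans (cn_le_ReIm _)) //= (distrC q.1) (distrC q.2).
  move: qd; rewrite prod_normE /= ge_max => /andP[]; lra.
rewrite ler_norml; have := cnD (V (Complex q.1 q.2) - V (Complex p.1 p.2)) (V (Complex p.1 p.2)).
have := cnD (V (Complex p.1 p.2) - V (Complex q.1 q.2)) (V (Complex q.1 q.2)).
rewrite !subrK (cnBC (V (Complex p.1 p.2))); lra.
Unshelve. all: by end_near.
Qed.

(** For the quadratic part, the sum of [|V0 + a h + b h^2|^2] over [h = t, -t, i t, -i t] is
    [4 (|V0|^2 + |a|^2 t^2 + |b|^2 t^4)], since the cross terms cancel over the fourth roots of
    unity. The cubic remainder costs [O(t^3)], which is below [eta t^2] for small [t]. *)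
Lemma four_point_sum V z : pe2 V z -> forall eta : R, 0 < eta ->
  forall t0 : R, 0 < t0 -> exists2 t : R, 0 < t < t0 &
  4 * cn (V z) ^+ 2 < cn (V (z + t%:C%C)) ^+ 2 + cn (V (z - t%:C%C)) ^+ 2
    + cn (V (z + 'i%C * t%:C%C)) ^+ 2 + cn (V (z - 'i%C * t%:C%C)) ^+ 2
    + 4 * eta * t ^+ 2.
Proof.
move=> [a [b [r [[K [e [e0 K0 rK]]] [d d0 HV]]]]] eta eta0 t0 t00.
set V0 := V z in HV *.
pose S := cn V0 + cn a + cn b.
have S0 : 0 <= S by rewrite /S; nneg.
have SK0 : 0 < 2 * S * K + 1 by rewrite ltr_wpDl //; nneg.
pose t := Num.min (Num.min d e) (Num.min (Num.min 1 t0) (eta / (2 * S * K + 1))) / 2.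
have t_gt0 : 0 < t by rewrite divr_gt0 // !lt_min d0 e0 ltr01 t00 divr_gt0.
have : t < Num.min (Num.min d e) (Num.min (Num.min 1 t0) (eta / (2 * S * K + 1))).
  by move: t_gt0; rewrite /t; lra.
rewrite !lt_min => /andP[/andP[td te] /andP[/andP[t1 tt0] teta]].
exists t; first by rewrite t_gt0 tt0.
have low h : cn h = t ->
  cn (V0 + a * h + b * h ^+ 2) ^+ 2 - 2 * S * K * t ^+ 3 <= cn (V (z + h)) ^+ 2.
  move=> ht; rewrite HV; last by rewrite ht ltW.
  set A := V0 + _ + _; set B := h ^+ 3 * _.
  have AS : cn A <= S.
    rewrite /S (le_trans (cnD _ _)) // lerD // ?cnM ?cnX ?ht; last first.
      by rewrite ler_piMr ?cn_ge0 // mulr_ile1 ?ltW.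
    rewrite (le_trans (cnD _ _)) // lerD // cnM ht ler_piMr ?cn_ge0 // ltW //.
  have BK : cn B <= K * t ^+ 3.
    by rewrite cnM cnX ht mulrC ler_wpM2r ?rK ?ht ?ltW ?exprn_gt0.
  have AB : cn A - cn B <= cn (A + B) by have := cnB (A + B) B; rewrite addrK; lra.
  have A0 := cn_ge0 A; have B0 := cn_ge0 B; have AB0 := cn_ge0 (A + B).
  have AB2 : cn A * cn B <= S * (K * t ^+ 3) by rewrite ler_pM.
  suff : cn A ^+ 2 - 2 * (cn A * cn B) <= cn (A + B) ^+ 2 by lra.
  have [|/ltW AleB] := leP (cn B) (cn A); nra.
have ct : cn t%:C%C = t by rewrite cn_real gtr0_norm.
have ci : cn ('i%C * t%:C%C) = t.
  by rewrite cnM ct (_ : cn 'i%C = 1) ?mul1r // cnE /= expr0n expr1n add0r sqrtr1.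
have l1 := low _ ct.
have l2 := low (- t%:C%C) (etrans (cnN _) ct).
have l3 := low _ ci.
have l4 := low (- ('i%C * t%:C%C)) (etrans (cnN _) ci).
have sum : cn (V0 + a * t%:C%C + b * t%:C%C ^+ 2) ^+ 2
  + cn (V0 + a * - t%:C%C + b * (- t%:C%C) ^+ 2) ^+ 2
  + cn (V0 + a * ('i%C * t%:C%C) + b * ('i%C * t%:C%C) ^+ 2) ^+ 2
  + cn (V0 + a * - ('i%C * t%:C%C) + b * (- ('i%C * t%:C%C)) ^+ 2) ^+ 2
  = 4 * cn V0 ^+ 2 + 4 * cn a ^+ 2 * t ^+ 2 + 4 * cn b ^+ 2 * t ^+ 4.
  rewrite !cn_sq; move: (V0) (a) (b) => [v1 v2] [a1 a2] [b1 b2] /=.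
  by ring.
have : 0 <= 4 * cn a ^+ 2 * t ^+ 2 + 4 * cn b ^+ 2 * t ^+ 4 by nneg.
have : 2 * S * K * t ^+ 3 < eta * t ^+ 2.
  rewrite exprS mulrA ltr_pM2r ?exprn_gt0 // mulrC.
  by move: teta; rewrite ltr_pdivlMr //; lra.
lra.
Qed.

(** Adding [eta |z|^2] to [|V|^2] contributes exactly [4 eta t^2] to the four-point sum. By
    [four_point_sum] the perturbed function then exceeds its own interior maximum at one of the four
    neighbours. *)
Lemma maximum_principle V (x1 x2 y1 y2 M : R) :
  (forall x y, x1 <= x <= x2 -> y1 <= y <= y2 -> pe2 V (Complex x y)) ->
  (forall x y, x1 <= x <= x2 -> y1 <= y <= y2 ->
    [|| x == x1, x == x2, y == y1 | y == y2] -> cn (V (Complex x y)) <= M) ->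
  forall x y, x1 <= x <= x2 -> y1 <= y <= y2 -> cn (V (Complex x y)) <= M.
Proof.
move=> pV bV x0 y0 x0P y0P; rewrite leNgt; apply/negP => MV.
have M0 : 0 <= M.
  have [/andP[xx1 xx2]] := x0P.
  apply: le_trans (bV x1 y0 _ y0P _); rewrite ?cn_ge0 ?eqxx ?lexx //=.
  exact: le_trans xx2.
pose L := (`|x1| + `|x2|) ^+ 2 + (`|y1| + `|y2|) ^+ 2 + 1.
have L0 : 0 < L by rewrite ltr_wpDl // addr_ge0 ?sqr_ge0.
have sq_le x y : x1 <= x <= x2 -> y1 <= y <= y2 -> x ^+ 2 + y ^+ 2 <= L.
  move=> /andP[a1 a2] /andP[b1 b2]; rewrite /L.
  have h (a b c : R) : a <= b -> b <= c -> b ^+ 2 <= (`|a| + `|c|) ^+ 2.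
    move=> ab bc; rewrite -[b ^+ 2]real_normK ?num_real //.
    rewrite ler_pXn2r ?nnegrE ?addr_ge0 // ler_norml.
    have := ler_norm c; have := ler_norm (- a); rewrite normrN.
    have := normr_ge0 a; have := normr_ge0 c; lra.
  by rewrite ler_wpDr // lerD // h.
set D := cn (V (Complex x0 y0)) ^+ 2 - M ^+ 2.
have D0 : 0 < D.
  by rewrite subr_gt0 ltr_pXn2r // ?nnegrE ?cn_ge0.
(* Since [|z|^2 <= L] on the rectangle, the perturbation is at most [D / 2], too small to bring the
   boundary values up to the interior value that exceeds [M]. *)
pose eta := D / (2 * L).
have eta0 : 0 < eta by rewrite divr_gt0 // mulr_gt0.
pose phi (p : R * R) := cn (V (Complex p.1 p.2)) ^+ 2 + eta * (p.1 ^+ 2 + p.2 ^+ 2).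
have cphi : {within rect x1 x2 y1 y2, continuous phi}.
  apply: continuous_in_subspaceT => p /[!inE] -[/= /[!in_itv]/= p1 p2].
  apply: (@continuousD _ _ _ (fun q : R * R => cn (V (Complex q.1 q.2)) ^+ 2)).
    by apply: continuousM; apply: continuous_modulus; exact: pV.
  apply: continuousM; first exact: cst_continuous.
  by apply: continuousD; apply: continuousM; (exact: cvg_fst || exact: cvg_snd).
have crect : compact (rect x1 x2 y1 y2).
  by apply: compact_setX; exact: segment_compact.
have nrect : rect x1 x2 y1 y2 !=set0 by exists (x0, y0); split; rewrite /= in_itv.
have [[x y] /[!inE]/= -[/=] /[!in_itv]/= xP yP phiM] := compact_EVT_max nrect crect cphi.
have {}phiM x' y' : x1 <= x' <= x2 -> y1 <= y' <= y2 -> phi (x', y') <= phi (x, y).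
  by move=> *; apply: phiM; rewrite inE; split; rewrite /= in_itv.
have etaL : eta * (2 * L) = D by rewrite /eta divfK // mulf_neq0 // gt_eqF.
have notb : ~~ [|| x == x1, x == x2, y == y1 | y == y2].
  apply/negP => xyb; have := phiM _ _ x0P y0P; rewrite /phi /= leNgt => /negP; apply.
  have h1 : cn (V (Complex x y)) ^+ 2 <= M ^+ 2.
    by rewrite ler_pXn2r ?nnegrE ?cn_ge0 // bV.
  have h2 : eta * (x ^+ 2 + y ^+ 2) <= eta * L by rewrite ler_pM2l // sq_le.
  have h3 : 0 <= eta * (x0 ^+ 2 + y0 ^+ 2) by nneg.
  by move: etaL D0; rewrite /D; lra.
have {notb} [xlt ylt] : x1 < x < x2 /\ y1 < y < y2.
  by move: notb xP yP; rewrite !negb_or => /and4P[*]; rewrite !lt_neqAle; lra.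
have [/andP[xl xr] /andP[yl yr]] := (xlt, ylt).
have [|t /andP[t0 td]] := four_point_sum (pV x y xP yP) eta0 (t0 :=
    Num.min (Num.min (x - x1) (x2 - x)) (Num.min (y - y1) (y2 - y))).
  by rewrite !lt_min !subr_gt0 xl xr yl yr.
move: td; rewrite !lt_min => /andP[/andP[t1 t2] /andP[t3 t4]].
have -> : Complex x y + t%:C%C = Complex (x + t) y by apply: complex_eq => /=; ring.
have -> : Complex x y - t%:C%C = Complex (x - t) y by apply: complex_eq => /=; ring.
have -> : Complex x y + 'i%C * t%:C%C = Complex x (y + t) by apply: complex_eq => /=; ring.
have -> : Complex x y - 'i%C * t%:C%C = Complex x (y - t) by apply: complex_eq => /=; ring.
have := phiM (x + t) y; have := phiM (x - t) y.
have := phiM x (y + t); have := phiM x (y - t); rewrite /phi /=.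
have -> : x1 <= x + t <= x2 by apply/andP; lra.
have -> : x1 <= x - t <= x2 by apply/andP; lra.
have -> : y1 <= y + t <= y2 by apply/andP; lra.
have -> : y1 <= y - t <= y2 by apply/andP; lra.
rewrite xP yP => /(_ isT isT) a1 /(_ isT isT) a2 /(_ isT isT) a3 /(_ isT isT) a4.
by lra.
Qed.
End MaximumPrinciple.

(** * The Phragmen-Lindelof principle *)

Section PhragmenLindelof.
Variable R : realType.
Local Notation C := R[i].

(** The passage to the limit by which the auxiliary damping parameters of the sector argument are
    removed. *)
Lemma le_expR_eps (A M B : R) : 0 <= M ->
  (forall e, 0 < e -> A <= M * expR (e * B)) -> A <= M.
Proof.
move=> M0 H; rewrite leNgt; apply/negP => MA.
have [/eqP Mz|Mn] := boolP (M == 0).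
  by have := H 1 ltr01; rewrite Mz mul0r leNgt -{1}Mz MA.
have {Mn M0} M0 : 0 < M by rewrite lt0r Mn.
have AM : 1 < A / M by rewrite ltr_pdivlMr // mul1r.
pose l := ln (A / M); have l0 : 0 < l by rewrite ln_gt0.
have B0 : 0 < `|B| + 1 by rewrite ltr_wpDl.
have : M * expR (l / (`|B| + 1) * B) < A.
  rewrite mulrC -ltr_pdivlMr // -[ltRHS]lnK ?posrE ?(lt_trans _ AM) // ltr_expR -/l.
  rewrite mulrAC ltr_pdivrMr // ltr_pM2l // (le_lt_trans (ler_norm _)) //.
  by rewrite ltrDl.
by apply/negP; rewrite -leNgt H // divr_gt0.
Qed.

Lemma sin_le_id (x : R) : 0 <= x -> sin x <= x.
Proof.
move=> x0; pose f (y : R) := y - sin y.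
have fd (y : R) : is_derive y 1 f (1 - cos y) by apply: is_derive_eq.
have := derive_ge0_le x0 fd; rewrite /f sin0 subr0 subr_ge0; apply.
by move=> y _; rewrite subr_ge0 cos_le1.
Qed.

(** Logarithmic coordinates turn a truncated sector into a rectangle, the shape to which the maximum
    principle applies. *)
Lemma polar_quadrant (x y : R) : 0 < x -> 0 < y -> exists s t : R,
  [/\ 0 < t < pi / 2, Complex x y = cexp (Complex s t) & expR s = cn (Complex x y)].
Proof.
move=> x0 y0; set r := cn (Complex x y).
have r2 : r ^+ 2 = x ^+ 2 + y ^+ 2 by rewrite cn_sq.
have r0 : 0 < r by rewrite cn_gt0; apply/negP => /eqP [] xz; rewrite xz ltxx in x0.
have xr1 : 0 < x / r < 1.
  rewrite divr_gt0 //= ltr_pdivrMr // mul1r.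
  rewrite -(ltr_pXn2r (n := 2)) ?nnegrE ?(ltW r0) ?(ltW x0) // r2 ltrDl.
  by rewrite exprn_gt0.
have xr1' : -1 <= x / r <= 1 by move: xr1; lra.
pose t := acos (x / r).
have ct : cos t = x / r by rewrite acosK // in_itv.
have st : sin t = y / r.
  rewrite sin_acos // -[RHS]gtr0_norm ?divr_gt0 // -sqrtr_sqr; congr Num.sqrt.
  rewrite !expr_div_n r2; field; rewrite -r2 expf_neq0 //.
  by rewrite gt_eqF.
have t0 : 0 <= t by rewrite acos_ge0.
exists (ln r), t; split.
- apply/andP; split.
    rewrite lt0r t0 andbT; apply/eqP => tz.
    by move: st; rewrite tz sin0 => /esym/eqP; rewrite gt_eqF // divr_gt0.
  have tpi : t <= pi by rewrite acos_lepi.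
  rewrite -ltr_cos ?in_itv /= ?t0 ?tpi ?cos_pihalf ?ct ?divr_gt0 //.
  by have := pi_gt0 R; lra.
- rewrite /cexp /= lnK ?posrE // ct st.
  by apply: complex_eq => /=; field; rewrite gt_eqF.
- by rewrite lnK ?posrE.
Qed.

Variables (W : C -> C) (K0 c : R) (N : nat).
Hypothesis K0_ge0 : 0 <= K0.
Hypothesis c_ge0 : 0 <= c.
Hypothesis pW : forall z, pe2 W z.
Hypothesis bW : forall x y, cn (W (Complex x y)) <=
  K0 * (1 + cn (Complex x y)) ^+ N * expR (c * Num.min (x ^+ 2) (y ^+ 2)).

Let bW' z (m : R) : Num.min (complex.Re z ^+ 2) (complex.Im z ^+ 2) <= m ->
  cn (W z) <= K0 * (1 + cn z) ^+ N * expR (c * m).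
Proof.
case: z => x y /= mle; rewrite (le_trans (bW x y)) //.
by rewrite ler_wpM2l ?ler_expR ?ler_wpM2l //; nneg; rewrite addr_ge0 ?cn_ge0.
Qed.

(** The sector [d <= t <= pi/2 - d] has opening less than pi/2, so a damping of order [b > 2] is
    available. The side growth, which is only of size [c r^2 sin^2 d], is paid for by the factor
    [expR (K r^2)] in the conclusion. The constant [B] does not depend on [e], so [e] can afterwards
    tend to zero. *)
Lemma sector_bound (d K s0 t0 : R) : 0 < K -> 0 < d < pi / 4 ->
  c * sin d <= 2 * K * cos d -> 0 <= s0 -> d <= t0 <= pi / 2 - d ->
  exists B : R, forall e, 0 < e ->
  cn (W (cexp (Complex s0 t0))) <=
    K0 * 2 ^+ N * expR c * expR s0 ^+ N * expR (K * expR s0 ^+ 2) * expR (e * B).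
Proof.
move=> Kgt0 /andP[dgt0 dlt] cK s0ge t0P.
have pi0 := pi_gt0 R.
(* This exponent exceeds [2], so the damping outgrows [r^2], while [b (pi/4 - d) < pi/2] keeps its
   cosine bounded below by [cos th] on the sector. *)
pose b := 2 * pi / (pi - 2 * d).
have pd0 : 0 < pi - 2 * d by lra.
have b2 : 2 < b by rewrite ltr_pdivlMr //; lra.
pose th := b * (pi / 4 - d).
have th0 : 0 < th by rewrite mulr_gt0 //; lra.
have thlt : th < pi / 2.
  by rewrite /th /b mulrAC ltr_pdivrMr //; nra.
have cth : 0 < cos th by rewrite cos_gt0_pihalf //; lra.
exists (expR (b * s0)) => e e0.
pose q : C := Complex 0 (- (pi / 4)).
(* With [r = expR s], the three added factors have moduli [r^(-N)], [exp (- K r^2 sin 2t)] and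
   [exp (- e r^b cos (b (t - pi/4)))]: they offset the polynomial growth, the two sides and the far
   edge. *)
pose V z := W (cexp z) * cexp (Complex (- N%:R) 0 * z)
  * cexp (Complex 0 K * cexp (Complex 2 0 * z))
  * cexp (Complex (- e) 0 * cexp (Complex b 0 * (z + q))).
have pV z : pe2 V z.
  have pm (a : C) : pe2 (fun z => a * z) z by apply: pe2M; [exact: pe2_cst|exact: pe2_id].
  apply: pe2M; first apply: pe2M; first apply: pe2M.
  - by apply: (pe2_comp (F := W)); [exact: pW|exact: pe2_cexp].
  - by apply: (pe2_comp (F := @cexp R)); [exact: pe2_cexp|exact: pm].
  - apply: (pe2_comp (F := @cexp R)); first exact: pe2_cexp.
    apply: pe2M; first exact: pe2_cst.
    by apply: (pe2_comp (F := @cexp R)); [exact: pe2_cexp|exact: pm].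
  - apply: (pe2_comp (F := @cexp R)); first exact: pe2_cexp.
    apply: pe2M; first exact: pe2_cst.
    apply: (pe2_comp (F := @cexp R)); first exact: pe2_cexp.
    apply: pe2M; first exact: pe2_cst.
    by apply: pe2D; [exact: pe2_id|exact: pe2_cst].
have nV s t : cn (V (Complex s t)) = cn (W (cexp (Complex s t))) * (expR s ^+ N)^-1
   * expR (- (K * expR s ^+ 2 * sin (2 * t)))
   * expR (- (e * expR (b * s) * cos (b * (t - pi / 4)))).
  rewrite /V !cnM !cn_cexp /=.
  have -> : expR (- N%:R * s - 0 * t) = (expR s ^+ N)^-1.
    by rewrite mul0r subr0 mulNr expRN expRM_natl.
  congr (_ * _ * expR _ * expR _).
  - rewrite !mul0r subr0 addr0 add0r -expRM_natl; ring.
  - rewrite !mul0r !subr0 !addr0; ring.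
have nonneg s t : 0 <= s -> d <= t <= pi / 2 - d -> forall m : R,
  Num.min ((expR s * cos t) ^+ 2) ((expR s * sin t) ^+ 2) <= m ->
  cn (W (cexp (Complex s t))) * (expR s ^+ N)^-1 <= K0 * 2 ^+ N * expR (c * m).
  move=> sge tP m mle.
  rewrite ler_pdivrMr ?exprn_gt0 ?expR_gt0 //.
  rewrite (le_trans (bW' (z := cexp (Complex s t)) mle)) // cn_cexp /= [leRHS]mulrAC ler_pM2r ?expR_gt0 //.
  rewrite -mulrA ler_wpM2l // -exprMn lerXn2r ?nnegrE ?addr_ge0 ?mulr_ge0 ?expR_ge0 //.
  have : 1 <= expR s by rewrite -expR0 ler_expR.
  by lra.
have sin2 t : d <= t <= pi / 2 - d -> 0 <= sin (2 * t).
  by move=> tP; rewrite sin_ge0_pi //; apply/andP; lra.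
have cosb t : d <= t <= pi / 2 - d -> cos th <= cos (b * (t - pi / 4)).
  move=> tP.
  have [tge|tlt] := leP 0 (t - pi / 4).
    rewrite leNgt ltr_cos ?in_itv /= -?leNgt; last 2 first.
    + by apply/andP; lra.
    + apply/andP; split; first by rewrite mulr_ge0 //; lra.
      have : b * (t - pi / 4) <= th by rewrite ler_wpM2l //; lra.
      by lra.
    by rewrite ler_wpM2l //; lra.
  rewrite -[leRHS]cosN -mulrN.
  rewrite leNgt ltr_cos ?in_itv /= -?leNgt; last 2 first.
  + by apply/andP; lra.
  + apply/andP; split; first by rewrite mulr_ge0 //; lra.
    have : b * - (t - pi / 4) <= th by rewrite ler_wpM2l //; lra.
    by lra.
  by rewrite ler_wpM2l //; lra.
(* Far enough that [1 + (b - 2) s <= expR ((b - 2) s)] yields [c <= e cos th * expR ((b - 2) s)], so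
   that the damping beats [c r^2] on the edge [s = s1]. *)
pose s1 := Num.max s0 (c / (e * cos th) / (b - 2)).
have s1ge : s0 <= s1 by rewrite le_max lexx.
have bnd s t : 0 <= s <= s1 -> d <= t <= pi / 2 - d ->
  [|| s == 0, s == s1, t == d | t == pi / 2 - d] ->
  cn (V (Complex s t)) <= K0 * 2 ^+ N * expR c.
  move=> /andP[sge sle] tP; rewrite nV -[leRHS]mulr1 => bd.
  have f3 : expR (- (e * expR (b * s) * cos (b * (t - pi / 4)))) <= 1.
    rewrite -[leRHS]expR0 ler_expR oppr_le0; apply: mulr_ge0; first by nneg.
    by rewrite (le_trans _ (cosb t tP)) // ltW.
  have f2 : expR (- (K * expR s ^+ 2 * sin (2 * t))) <= 1.
    rewrite -[leRHS]expR0 ler_expR oppr_le0; apply: mulr_ge0; [by nneg|exact: sin2].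
  (* On the sides [t = d] and [t = pi/2 - d] the smaller square is [r^2 sin^2 d], and
     [c sin d <= 2 K cos d] lets the factor with [K] absorb it. *)
  have side : sin (2 * t) = 2 * (sin d * cos d) ->
     Num.min ((expR s * cos t) ^+ 2) ((expR s * sin t) ^+ 2) <= expR s ^+ 2 * sin d ^+ 2 ->
     cn (W (cexp (Complex s t))) / expR s ^+ N *
       expR (- (K * expR s ^+ 2 * sin (2 * t))) *
       expR (- (e * expR (b * s) * cos (b * (t - pi / 4)))) <=
     K0 * 2 ^+ N * expR c * 1.
    move=> e1 e2; apply: ler_pM => //; try by nneg.
    rewrite (le_trans (ler_wpM2r _ (nonneg s t sge tP _ e2))) ?expR_ge0 //.
    rewrite -[leLHS]mulrA -expRD ler_wpM2l //; first by nneg.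
    rewrite ler_expR (le_trans _ c_ge0) // subr_le0 e1.
    have -> : c * (expR s ^+ 2 * sin d ^+ 2) = (expR s ^+ 2 * sin d) * (c * sin d) by ring.
    have -> : K * expR s ^+ 2 * (2 * (sin d * cos d)) = expR s ^+ 2 * sin d * (2 * K * cos d) by ring.
    rewrite ler_wpM2l // mulr_ge0 ?sqr_ge0 // sin_ge0_pi //.
    by apply/andP; lra.
  case/or4P: bd => /eqP st.
  - apply: ler_pM => //; try by nneg.
    rewrite -[leRHS]mulr1; apply: ler_pM => //; try by nneg.
    have := nonneg s t sge tP 1; rewrite mulr1; apply.
    rewrite ge_min st expR0 !mul1r.
    by apply/orP; left; rewrite -(cos2Dsin2 t) lerDl sqr_ge0.
  - have f1 := nonneg s t sge tP (expR s ^+ 2).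
    have {}f1 : cn (W (cexp (Complex s t))) / expR s ^+ N <= K0 * 2 ^+ N * expR (c * expR s ^+ 2).
      apply: f1; rewrite ge_min exprMn; apply/orP; left.
      by rewrite ler_piMr ?sqr_ge0 // -(cos2Dsin2 t) lerDl sqr_ge0.
    have {}f3 : expR (- (e * expR (b * s) * cos (b * (t - pi / 4)))) <=
        expR (- (e * expR (b * s) * cos th)).
      by rewrite ler_expR lerN2 ler_wpM2l ?cosb //; nneg.
    apply: (le_trans (ler_pM _ _ (ler_pM _ _ f1 f2) f3)); try by nneg.
    rewrite !mulr1 -[leLHS]mulrA -expRD ler_wpM2l //; first by nneg.
    rewrite ler_expR (le_trans _ c_ge0) // subr_le0.
    have -> : expR (b * s) = expR s ^+ 2 * expR ((b - 2) * s).
      by rewrite -expRM_natl -expRD; congr expR; ring.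
    have -> : e * (expR s ^+ 2 * expR ((b - 2) * s)) * cos th =
      e * cos th * expR ((b - 2) * s) * expR s ^+ 2 by ring.
    rewrite ler_wpM2r ?sqr_ge0 //.
    have : c / (e * cos th) / (b - 2) <= s by rewrite st le_max lexx orbT.
    have ecth : 0 < e * cos th by rewrite mulr_gt0.
    rewrite ler_pdivrMr ?subr_gt0 // ler_pdivrMr // => /le_trans; apply.
    rewrite mulrC ler_pM2l // mulrC (le_trans _ (expR_ge1Dx _)) //.
    by rewrite lerDr.
  - apply: side; rewrite st; first by rewrite mulr_natl sin_mulr2n; ring.
    by rewrite ge_min !exprMn lexx orbT.
  - apply: side; rewrite st.
      have -> : 2 * (pi / 2 - d) = pi - 2 * d by field.
      rewrite sinB sinpi cospi mul0r sub0r mulN1r opprK mulr_natl sin_mulr2n; ring.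
    rewrite ge_min; apply/orP; left.
    by rewrite exprMn cosB cos_pihalf sin_pihalf mul0r mul1r add0r.
have s0s1 : 0 <= s0 <= s1 by rewrite s0ge.
have := maximum_principle (fun x y _ _ => pV (Complex x y)) bnd s0s1 t0P.
rewrite nV !expRN !ler_pdivrMr ?exprn_gt0 ?expR_gt0 // => /le_trans; apply.
have gen (m a a' r' u u' : R) : 0 <= m -> 0 <= r' -> 0 <= a -> 0 <= u -> a <= a' ->
    u <= u' -> m * u * a * r' <= m * r' * a' * u'.
  move=> m0 r0 a0 u0 aa uu.
  have -> : m * u * a * r' = m * r' * (a * u) by ring.
  by rewrite -[leRHS]mulrA ler_wpM2l ?ler_pM //; nneg.
apply: gen; rewrite ?expR_ge0 ?exprn_ge0 ?expR_ge0 ?mulr_ge0 ?exprn_ge0 ?expR_ge0 // ler_expR.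
  by rewrite -[leRHS]mulr1 ler_wpM2l ?sin_le1 //; nneg.
by rewrite -[leRHS]mulr1 ler_wpM2l ?cos_le1 //; nneg.
Qed.

(** The quadrant is exhausted by sectors: for fixed [K] the parameter [e] tends to zero first, and
    then [K] does, with the aperture [d] depending on [K] and on the point. *)
Lemma phragmen_lindelof_quadrant x y : 0 < x -> 0 < y ->
  cn (W (Complex x y)) <= K0 * 2 ^+ N * expR c * (1 + cn (Complex x y)) ^+ N.
Proof.
move=> x0 y0; have pi0 := pi_gt0 R.
have [r1|r1] := leP (cn (Complex x y)) 1.
  apply: (le_trans (bW x y)); apply: (@le_trans _ _ (K0 * 2 ^+ N * expR c * 1)).
    rewrite mulr1 ler_pM //; try by nneg; rewrite ?addr_ge0 ?cn_ge0.
      by rewrite ler_wpM2l // lerXn2r ?nnegrE ?addr_ge0 ?cn_ge0 //; lra.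
    rewrite ler_expR -[leRHS]mulr1 ler_wpM2l // ge_min; apply/orP; left.
    rewrite -(ler_pXn2r (n := 2)) ?nnegrE ?cn_ge0 // cn_sq /= expr1n in r1.
    by rewrite (le_trans _ r1) // lerDl sqr_ge0.
  by rewrite ler_wpM2l ?exprn_ege1 ?lerDl ?cn_ge0 //; nneg.
have [s [t [/andP[t0 tlt] xyE rE]]] := polar_quadrant x0 y0.
have s0 : 0 <= s by rewrite -ler_expR expR0 rE ltW.
apply: (@le_trans _ _ (K0 * 2 ^+ N * expR c * expR s ^+ N)); last first.
  rewrite ler_wpM2l //; first by nneg.
  by rewrite lerXn2r ?nnegrE ?expR_ge0 ?addr_ge0 ?cn_ge0 // rE lerDr.
apply: (@le_expR_eps _ _ (expR s ^+ 2)) => [|K Kgt0]; first by nneg.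
have c1 := cos1_gt0 R.
(* The first two entries keep the point inside the sector, [1/4] keeps [d] below both [pi/4] and
   [1], and the last one, with [sin d <= d] and [cos 1 <= cos d], gives the side condition. *)
pose d := Num.min (Num.min t (pi / 2 - t)) (Num.min (1 / 4) (2 * K * cos 1 / (c + 1))).
have d0 : 0 < d.
  rewrite !lt_min t0 subr_gt0 tlt /= !divr_gt0 ?mulr_gt0 //.
  by rewrite ltr_wpDl.
have : d <= d by [].
rewrite {2}/d !le_min => /andP[/andP[dt dpt] /andP[d1 dK]].
have dpi : 0 < d < pi / 4.
  by rewrite d0 /=; have := pihalf_ge1 R; lra.
have cd : cos 1 <= cos d.
  have p1 := pihalf_ge1 R.
  by rewrite leNgt ltr_cos ?in_itv /= -?leNgt; try apply/andP; lra.
have cK : c * sin d <= 2 * K * cos d.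
  apply: (@le_trans _ _ (2 * K * cos 1)); last by rewrite ler_wpM2l //; nneg.
  rewrite (le_trans (ler_wpM2l c_ge0 (sin_le_id (ltW d0)))) //.
  rewrite ler_pdivlMr ?ltr_wpDl // in dK; apply: le_trans dK.
  by rewrite mulrC ler_pM2l // lerDl.
have tP : d <= t <= pi / 2 - d by apply/andP; lra.
have [B HB] := sector_bound Kgt0 dpi cK s0 tP.
rewrite xyE; apply: (@le_expR_eps _ _ B) => [|e e0]; last first.
  by rewrite (le_trans (HB e e0)).
by nneg.
Qed.
End PhragmenLindelof.

Section FullPlane.
Variable R : realType.
Local Notation C := R[i].

(** The growth hypothesis is invariant under [u |-> i u], so one, two or three quarter turns carry
    the quadrant case to the other quadrants. On the axes the minimum of the squares is [0] and the
    hypothesis itself is the bound. *)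
Lemma phragmen_lindelof (W : C -> C) (K c : R) (N : nat) : 0 <= K -> 0 <= c ->
  (forall z, pe2 W z) ->
  (forall x y, cn (W (Complex x y)) <=
    K * (1 + cn (Complex x y)) ^+ N * expR (c * Num.min (x ^+ 2) (y ^+ 2))) ->
  exists2 K' : R, 0 <= K' & forall z, cn (W z) <= K' * (1 + cn z) ^+ N.
Proof.
move=> K0 c0 pW bW; pose K' := K * 2 ^+ N * expR c.
have K'0 : 0 <= K' by rewrite /K'; nneg.
have quad (V : C -> C) : (forall z, pe2 V z) -> (forall x y, cn (V (Complex x y)) <=
      K * (1 + cn (Complex x y)) ^+ N * expR (c * Num.min (x ^+ 2) (y ^+ 2))) ->
    forall x y, 0 < x -> 0 < y ->
    cn (V (Complex x y)) <= K' * (1 + cn (Complex x y)) ^+ N.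
  by move=> pV bV x y; exact: phragmen_lindelof_quadrant.
pose T (V : C -> C) u := V ('i%C * u).
have pT V : (forall z, pe2 V z) -> forall z, pe2 (T V) z.
  move=> pV z; apply: (pe2_comp (F := V) (G := fun u => 'i%C * u)) => //.
  by apply: pe2M; [exact: pe2_cst|exact: pe2_id].
have TE V x y : T V (Complex x y) = V (Complex (- y) x).
  by rewrite /T; congr V; apply: complex_eq => /=; ring.
have cnT (x y : R) : cn (Complex (- y) x) = cn (Complex x y).
  by rewrite !cnE /= sqrrN addrC.
have cnT2 (x y : R) : cn (Complex (- x) (- y)) = cn (Complex x y).
  by rewrite !cnE /= !sqrrN.
have cnT3 (x y : R) : cn (Complex y (- x)) = cn (Complex x y).
  by rewrite !cnE /= sqrrN addrC.
have bT V : (forall x y, cn (V (Complex x y)) <=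
      K * (1 + cn (Complex x y)) ^+ N * expR (c * Num.min (x ^+ 2) (y ^+ 2))) ->
    forall x y, cn (T V (Complex x y)) <=
      K * (1 + cn (Complex x y)) ^+ N * expR (c * Num.min (x ^+ 2) (y ^+ 2)).
  by move=> bV x y; rewrite TE (le_trans (bV _ _)) // cnT sqrrN minC.
have axis x y : (x == 0) || (y == 0) ->
    cn (W (Complex x y)) <= K' * (1 + cn (Complex x y)) ^+ N.
  move=> xy0; rewrite (le_trans (bW x y)) //.
  have -> : Num.min (x ^+ 2) (y ^+ 2) = 0.
    apply/eqP; rewrite eq_le le_min !sqr_ge0 /= andbT ge_min.
    by case/orP: xy0 => /eqP ->; rewrite expr0n lexx ?orbT.
  rewrite mulr0 expR0 mulr1 ler_wpM2r //; first by nneg; rewrite addr_ge0 ?cn_ge0.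
  rewrite /K' -[leLHS]mulr1 -mulrA ler_wpM2l // -[leLHS]mulr1 ler_pM //.
    by rewrite exprn_ege1 // ler1n.
  by rewrite -expR0 ler_expR.
exists K' => // -[x y].
have [x0|x0|x0] := ltgtP x 0; have [y0|y0|y0] := ltgtP y 0;
  try by apply: axis; rewrite ?x0 ?y0 eqxx ?orbT.
- have := quad _ (pT _ (pT _ pW)) (bT _ (bT _ bW)) (- x) (- y).
  by rewrite !TE !opprK !oppr_gt0 cnT2; apply.
- have := quad _ (pT _ pW) (bT _ bW) y (- x).
  by rewrite !TE !opprK oppr_gt0 cnT3; apply.
- have := quad _ (pT _ (pT _ (pT _ pW))) (bT _ (bT _ (bT _ bW))) (- y) x.
  by rewrite !TE !opprK oppr_gt0 cnT; apply.
- exact: quad.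
Qed.
End FullPlane.

(** * Entire power series *)

Section PowerSeries.
Variable R : realType.
Local Notation C := R[i].
Implicit Types (F G : C -> C) (a b : nat -> C) (z w h : C).

Definition psum a n z := \sum_(k < n) a k * z ^+ k.

(* [F] is the sum of the everywhere convergent power series with coefficients [a]. *)
Definition ent F a := forall r : R, 0 < r -> exists M : R, forall n z,
  cn z <= r -> cn (F z - psum a n z) <= M * (cn z / r) ^+ n.

(** Cauchy's estimates without an integral: [a n * r^n] is the difference of two consecutive
    remainders at the point [r]. *)
Lemma ent_coef F a : ent F a ->
  forall r : R, 0 < r -> exists2 M : R, 0 <= M & forall n, cn (a n) <= M / r ^+ n.
Proof.
move=> Fa r r0; have [M HM] := Fa r r0.
have cr : cn r%:C%C = r by rewrite cn_real gtr0_norm.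
have H n : cn (F r%:C%C - psum a n r%:C%C) <= M.
  have := HM n r%:C%C; rewrite cr lexx => /(_ isT).
  by rewrite divff ?gt_eqF // expr1n mulr1.
have M0 : 0 <= M by rewrite (le_trans _ (H 0%N)) ?cn_ge0.
exists (M + M); first exact: addr_ge0.
move=> n; rewrite ler_pdivlMr ?exprn_gt0 // -[X in X ^+ n]cr -cnX -cnM.
have -> : a n * r%:C%C ^+ n = (F r%:C%C - psum a n r%:C%C) - (F r%:C%C - psum a n.+1 r%:C%C).
  by rewrite /psum big_ord_recr /=; ring.
by rewrite (le_trans (cnB _ _)) // lerD.
Qed.

(** The form in which limits of partial sums are taken throughout: equality of two functions is
    reduced to a geometric bound on the modulus of their difference. *)
Lemma le0_geometric (A M : R) : (forall n, A <= M * (1 / 2) ^+ n) -> A <= 0.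
Proof.
move=> H; rewrite leNgt; apply/negP => A0.
have M0 : 0 < M by rewrite (lt_le_trans A0) // (le_trans (H 0%N)) // expr0 mulr1.
pose n := Num.truncn (M / A).
have : M / A < n.+1%:R by rewrite truncnS_gt.
have : n.+1%:R <= 2 ^+ n.+1 :> R by rewrite -natrX ler_nat ltnW // ltn_expl.
move=> /[swap]/lt_le_trans/[apply].
rewrite ltr_pdivrMr // => lt; have := H n.+1.
rewrite expr_div_n expr1n mul1r ler_pdivlMr ?exprn_gt0 // leNgt => /negP; apply.
by rewrite mulrC.
Qed.

Lemma ent_ext F G a : ent F a -> ent G a -> F =1 G.
Proof.
move=> Fa Ga z; pose r := 2 * (cn z + 1).
have r0 : 0 < r by rewrite mulr_gt0 // ltr_wpDl ?cn_ge0.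
have zr : cn z <= r by rewrite /r; have := cn_ge0 z; lra.
have [M HM] := Fa r r0; have [M' HM'] := Ga r r0.
have q : cn z / r <= 1 / 2.
  by rewrite ler_pdivrMr // /r; lra.
have M0 : 0 <= M by have := le_trans (cn_ge0 _) (HM 0%N z zr); rewrite expr0 mulr1.
have M'0 : 0 <= M' by have := le_trans (cn_ge0 _) (HM' 0%N z zr); rewrite expr0 mulr1.
apply/eqP; rewrite -subr_eq0 -cn_eq0 eq_le cn_ge0 andbT.
apply: (@le0_geometric _ (M + M')) => n.
have -> : F z - G z = (F z - psum a n z) - (G z - psum a n z) by ring.
rewrite (le_trans (cnB _ _)) // mulrDl lerD //.
  rewrite (le_trans (HM n z zr)) // ler_wpM2l // lerXn2r ?nnegrE ?divr_ge0 ?cn_ge0 //.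
  exact: ltW.
rewrite (le_trans (HM' n z zr)) // ler_wpM2l // lerXn2r ?nnegrE ?divr_ge0 ?cn_ge0 //.
exact: ltW.
Qed.

Lemma ent_bounded F a : ent F a -> forall r : R, exists M : R, forall z, cn z <= r -> cn (F z) <= M.
Proof.
move=> Fa r; have r0 : 0 < `|r| + 1 by rewrite ltr_wpDl.
have [M HM] := Fa _ r0; exists M => z zr.
have := HM 0%N z; rewrite /psum big_ord0 subr0 expr0 mulr1; apply.
by rewrite (le_trans zr) // (le_trans (ler_norm _)) // lerDl.
Qed.

Lemma half_geometric_sum (t : R) n m : 0 <= t <= 1 -> (n <= m)%N ->
  \sum_(n <= k < m) (t / 2) ^+ k <= 2 * (t / 2) ^+ n.
Proof.
move=> /andP[t0 t1] nm.
suff : \sum_(n <= k < m) (t / 2) ^+ k <= 2 * (t / 2) ^+ n - 2 * (t / 2) ^+ m.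
  by move=> /le_trans; apply; rewrite gerBl; nneg.
rewrite -(subnKC nm); elim: (m - n)%N => [|k IH]; first by rewrite addn0 big_geq // subrr.
rewrite addnS big_nat_recr ?leq_addr //= exprS.
have : (t / 2) ^+ (n + k) * t <= (t / 2) ^+ (n + k) * 1 by rewrite ler_wpM2l //; nneg.
by move: IH; lra.
Qed.

(** The limit is the supremum of the lower bounds [x n - e n], each of which lies below every
    [x m + e m]. *)
Lemma limit_with_rate (x e : nat -> R) :
  (forall n m, (n <= m)%N -> `|x m - x n| <= e n) ->
  exists l : R, forall n, `|l - x n| <= e n.
Proof.
move=> H; pose E := [set x n - e n | n in setT].
have E0 : E !=set0 by exists (x 0%N - e 0%N); exists 0%N.
have e0 n : 0 <= e n by rewrite (le_trans _ (H n n _)).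
have ubE m : ubound E (x m + e m).
  move=> _ [n _ <-]; have := e0 n; have := e0 m.
  by have [nm|/ltnW mn] := leqP n m; [have := H n m nm|have := H m n mn];
    rewrite ler_norml => /andP[]; lra.
exists (sup E) => n; rewrite ler_norml.
have h1 : sup E <= x n + e n by apply: ge_sup.
have h2 : x n - e n <= sup E.
  by apply: ub_le_sup; [exists (x 0%N + e 0%N)|exists n].
by apply/andP; lra.
Qed.

Lemma psum_tail a (M r : R) z n m : 0 < r -> 0 <= M -> cn z <= r ->
  (forall k, cn (a k) <= M / (2 * r) ^+ k) -> (n <= m)%N ->
  cn (psum a m z - psum a n z) <= 2 * M * (cn z / r) ^+ n.
Proof.
move=> r0 M0 zr aM nm.
have -> : psum a m z - psum a n z = \sum_(n <= k < m) a k * z ^+ k.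
  rewrite /psum -!(big_mkord xpredT (fun k => a k * z ^+ k)).
  by rewrite (big_cat_nat _ nm) //= addrAC subrr add0r.
have t01 : 0 <= cn z / r <= 1.
  by rewrite ler_pdivrMr // mul1r zr andbT; nneg.
rewrite (le_trans (cn_sum _ _ _)) //.
apply: (@le_trans _ _ (\sum_(n <= k < m) M * (cn z / r / 2) ^+ k)).
  apply: ler_sum => k _; rewrite cnM cnX.
  rewrite (le_trans (ler_wpM2r _ (aM k))) ?exprn_ge0 ?cn_ge0 //.
  rewrite -[leLHS]mulrA ler_wpM2l //.
  have -> : cn z / r / 2 = (2 * r)^-1 * cn z by rewrite invfM; ring.
  by rewrite [leRHS]exprMn exprVn.
rewrite -mulr_sumr (le_trans (ler_wpM2l M0 (half_geometric_sum t01 nm))) //.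
have /andP[t0 t1] := t01.
have -> : 2 * M * (cn z / r) ^+ n = M * (2 * (cn z / r) ^+ n) by ring.
rewrite ler_wpM2l // ler_wpM2l // exprMn ler_piMr //; first by nneg.
by rewrite exprn_ile1 // ?invr_ge0 // invf_le1 ?ler1n // ltr0n.
Qed.

Lemma ent_of_coef a : (forall r : R, 0 < r -> exists2 M : R, 0 <= M &
  forall n, cn (a n) <= M / r ^+ n) -> exists F, ent F a.
Proof.
move=> aM.
(* The value at [z] has to be chosen once and satisfy the remainder bound for every admissible
   radius, because [ent] quantifies over radii after the function is fixed. The rate at the
   particular radius [r0] only serves to identify the limit. *)
have lim z : {l : C | forall r M : R, 0 < r -> 0 <= M -> cn z <= r ->
    (forall k, cn (a k) <= M / (2 * r) ^+ k) ->
    forall n, cn (l - psum a n z) <= 4 * M * (cn z / r) ^+ n}.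
  apply: cid; pose r0 := 2 * (cn z + 1).
  have r00 : 0 < r0 by rewrite mulr_gt0 // ltr_wpDl ?cn_ge0.
  have r02 : 0 < 2 * r0 by rewrite mulr_gt0.
  have [M0 M00 HM0] := aM _ r02.
  have zr0 : cn z <= r0 by rewrite /r0; have := cn_ge0 z; lra.
  have tail n m (nm : (n <= m)%N) := psum_tail r00 M00 zr0 HM0 nm.
  have [l1 H1] : exists l : R, forall n, `|l - complex.Re (psum a n z)| <= 2 * M0 * (cn z / r0) ^+ n.
    apply: limit_with_rate => n m nm.
    by rewrite -ReN -ReD (le_trans (Re_le_cn _)) // tail.
  have [l2 H2] : exists l : R, forall n, `|l - complex.Im (psum a n z)| <= 2 * M0 * (cn z / r0) ^+ n.
    apply: limit_with_rate => n m nm.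
    by rewrite -ImN -ImD (le_trans (Im_le_cn _)) // tail.
  exists (Complex l1 l2) => r M rgt0 Mge0 zr HM n.
  suff : cn (Complex l1 l2 - psum a n z) - 2 * M * (cn z / r) ^+ n <= 0.
    rewrite subr_le0 => /le_trans; apply; rewrite ler_wpM2r ?ler_wpM2r ?ler_nat //.
    by apply: exprn_ge0; apply: divr_ge0; [exact: cn_ge0|exact: ltW].
  apply: (@le0_geometric _ (4 * M0)) => k.
  have q : cn z / r0 <= 1 / 2 by rewrite ler_pdivrMr // /r0; lra.
  have le1 : (cn z / r0) ^+ (n + k) <= (1 / 2) ^+ k.
    rewrite exprD -[leRHS]mul1r ler_pM //; try by apply: exprn_ge0; apply: divr_ge0; [exact: cn_ge0|exact: ltW].
      by apply: exprn_ile1; [apply: divr_ge0; [exact: cn_ge0|exact: ltW]|lra].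
    by apply: lerXn2r; rewrite ?nnegrE //; apply: divr_ge0; [exact: cn_ge0|exact: ltW].
  have := psum_tail rgt0 Mge0 zr HM (leq_addr k n).
  have := cnD (Complex l1 l2 - psum a (n + k) z) (psum a (n + k) z - psum a n z).
  rewrite addrA subrK => h1 h2.
  have := cn_le_ReIm (Complex l1 l2 - psum a (n + k) z).
  rewrite !ReD !ImD !ReN !ImN /= => h3.
  have h4 := H1 (n + k)%N; have h5 := H2 (n + k)%N.
  have : 2 * M0 * (cn z / r0) ^+ (n + k) <= 2 * M0 * (1 / 2) ^+ k.
    by rewrite ler_wpM2l //; nneg.
  by lra.
pose F z := sval (lim z).
exists F => r r0.
have r2 : 0 < 2 * r by rewrite mulr_gt0.
have [M M0 HM] := aM _ r2.
by exists (4 * M) => n z zr; exact: (svalP (lim z)).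
Qed.

Lemma ent_half F a : ent F a -> forall rho : R, 0 < rho -> exists2 M : R, 0 <= M &
  forall n z, cn z <= rho -> cn (F z - psum a n z) <= M * (1 / 2) ^+ n.
Proof.
move=> Fa rho r0; have r2 : 0 < 2 * rho by rewrite mulr_gt0.
have [M HM] := Fa _ r2.
have M0 : 0 <= M.
  have := HM 0%N 0; rewrite cn0 expr0 mulr1 => /(_ (ltW r2)).
  by apply: le_trans; exact: cn_ge0.
exists M => // n z zr; rewrite (le_trans (HM n z _)) //; first by lra.
rewrite ler_wpM2l //; apply: lerXn2r; rewrite ?nnegrE //.
  by apply: divr_ge0; [exact: cn_ge0|exact: ltW].
by rewrite ler_pdivrMr //; lra.
Qed.

(** The identity theorem: once the coefficients below [n] agree, comparing remainders of order
    [n + 1] at [x = 2^-k] gives [|a n - b n| <= (M + M') x]. It extends every formula checked for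
    real arguments to complex ones. *)
Lemma ent_real_unique F G a b : ent F a -> ent G b ->
  (forall x : R, F x%:C%C = G x%:C%C) -> a =1 b.
Proof.
move=> Fa Gb FG n; elim/ltn_ind: n => n IH.
have [M HM] := Fa 1 ltr01; have [M' HM'] := Gb 1 ltr01.
apply/eqP; rewrite -subr_eq0 -cn_eq0 eq_le cn_ge0 andbT.
apply: (@le0_geometric _ (M + M')) => k.
pose x : R := (1 / 2) ^+ k.
have x0 : 0 < x by rewrite exprn_gt0.
have x1 : x <= 1 by apply: exprn_ile1; lra.
have cx : cn x%:C%C = x by rewrite cn_real gtr0_norm.
rewrite -/x -(ler_pM2r (exprn_gt0 n x0)).
have -> : cn (a n - b n) * x ^+ n = cn ((F x%:C%C - psum b n.+1 x%:C%C) - (F x%:C%C - psum a n.+1 x%:C%C)).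
  rewrite -[X in X ^+ n]cx -cnX -cnM; congr cn; rewrite /psum !big_ord_recr /=.
  have -> : \sum_(k < n) a k * x%:C%C ^+ k = \sum_(k < n) b k * x%:C%C ^+ k.
    by apply: eq_bigr => j _; rewrite IH.
  by ring.
rewrite (le_trans (cnB _ _)) // [X in cn (X - _) + _]FG.
have h1 := HM n.+1 x%:C%C; have h2 := HM' n.+1 x%:C%C.
rewrite cx divr1 in h1 h2; rewrite -mulrA -exprS.
by have := h1 x1; have := h2 x1; lra.
Qed.

(** The truncated product differs from the truncated Cauchy product only in degrees [n] to [2n].
    There the coefficients are estimated at radius [4r]: one factor [2^-m] absorbs the number
    [m + 1] of summands, and the other makes the sum geometric. *)
Lemma ent_mul F G a b : ent F a -> ent G b ->
  ent (fun z => F z * G z) (fun n => \sum_(k < n.+1) a k * b (n - k)%N).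
Proof.
move=> Fa Gb r r0; pose c : nat -> C := fun n => \sum_(k < n.+1) a k * b (n - k)%N.
rewrite -/c.
have r4 : 0 < 4 * r by rewrite mulr_gt0.
have [M1 H1] := Fa r r0; have [M2 H2] := Gb r r0.
have [Ma Ma0 Ha] := ent_coef Fa r4; have [Mb Mb0 Hb] := ent_coef Gb r4.
exists (M1 * M2 + (M1 + M1) * M2 + 2 * (Ma * Mb)) => n z zr.
set t := cn z / r.
have t0 : 0 <= t by apply: divr_ge0; [exact: cn_ge0|exact: ltW].
have t1 : t <= 1 by rewrite ler_pdivrMr // mul1r.
have FM : cn (F z) <= M1.
  by have := H1 0%N z zr; rewrite /psum big_ord0 subr0 expr0 mulr1.
have GM : cn (G z) <= M2.
  by have := H2 0%N z zr; rewrite /psum big_ord0 subr0 expr0 mulr1.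
have M10 := le_trans (cn_ge0 _) FM; have M20 := le_trans (cn_ge0 _) GM.
set A := psum a n z; set B := psum b n z.
have FA : cn (F z - A) <= M1 * t ^+ n by exact: H1.
have GB : cn (G z - B) <= M2 * t ^+ n by exact: H2.
have tn1 : t ^+ n <= 1 by apply: exprn_ile1.
have AM : cn A <= M1 + M1.
  have -> : A = F z - (F z - A) by ring.
  rewrite (le_trans (cnB _ _)) // lerD // (le_trans FA) //.
  by rewrite ler_piMr.
(* As polynomials, the truncations have the Cauchy product as coefficients of their product in
   degrees below [n]. *)
pose pA := \poly_(k < n) a k; pose pB := \poly_(k < n) b k.
have AE : A = pA.[z] by rewrite horner_poly.
have BE : B = pB.[z] by rewrite horner_poly.
have ABE : A * B = \sum_(0 <= m < n + n) (pA * pB)`_m * z ^+ m.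
  rewrite AE BE -hornerM (horner_coef_wide (n := n + n)) ?big_mkord //.
  rewrite (leq_trans (size_polyMleq _ _)) // (leq_trans (leq_pred _)) //.
  by rewrite leq_add // size_poly.
have cE m : (m < n)%N -> (pA * pB)`_m = c m.
  move=> mn; rewrite coefM; apply: eq_bigr => -[j jm] _ /=.
  by rewrite !coef_poly (leq_ltn_trans _ mn) // (leq_ltn_trans (leq_subr _ _) mn).
have cM m : cn (pA * pB)`_m <= m.+1%:R * (Ma * Mb) / (4 * r) ^+ m.
  rewrite coefM (le_trans (cn_sum _ _ _)) //.
  have -> : m.+1%:R * (Ma * Mb) / (4 * r) ^+ m = \sum_(j < m.+1) (Ma * Mb) / (4 * r) ^+ m.
    by rewrite sumr_const card_ord -mulrA mulr_natl.
  apply: ler_sum => -[j jm] _ /=; rewrite cnM !coef_poly.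
  rewrite -(subnKC (_ : (j <= m)%N)) // exprD invfM mulrACA.
  rewrite (subnKC (_ : (j <= m)%N)) //.
  apply: ler_pM; rewrite ?cn_ge0 //; case: ifP => _ //; rewrite cn0; nneg;
    by apply: exprn_ge0; exact: ltW.
have -> : F z * G z - psum c n z = (F z - A) * G z + A * (G z - B) + (A * B - psum c n z) by ring.
have -> : A * B - psum c n z = \sum_(n <= m < n + n) (pA * pB)`_m * z ^+ m.
  rewrite ABE (big_cat_nat _ (leq_addr n n)) //= /psum big_mkord.
  rewrite [X in X + _ - _](_ : _ = \sum_(k < n) c k * z ^+ k).
    by rewrite addrAC subrr add0r.
  by apply: eq_bigr => m _; rewrite cE.
rewrite (le_trans (cnD _ _)) // [leRHS]mulrDl lerD //.
  rewrite (le_trans (cnD _ _)) // [leRHS]mulrDl lerD // cnM.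
    by rewrite mulrAC ler_pM ?cn_ge0.
  by rewrite -mulrA ler_pM ?cn_ge0.
rewrite (le_trans (cn_sum _ _ _)) //.
apply: (@le_trans _ _ (\sum_(n <= m < n + n) (Ma * Mb) * (t / 2) ^+ m)).
  apply: ler_sum => m _; rewrite cnM cnX (le_trans (ler_wpM2r _ (cM m))) //; first by nneg.
  have -> : m.+1%:R * (Ma * Mb) / (4 * r) ^+ m * cn z ^+ m =
     (Ma * Mb) * (m.+1%:R * (cn z / (4 * r)) ^+ m) by rewrite expr_div_n; ring.
  rewrite ler_wpM2l ?mulr_ge0 //.
  have -> : cn z / (4 * r) = (t / 2) / 2 by rewrite /t invfM; field; rewrite gt_eqF.
  rewrite [X in _ * X]expr_div_n mulrCA ler_piMr //; first by nneg.
  by rewrite ler_pdivrMr ?exprn_gt0 // mul1r -natrX ler_nat ltn_expl.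
rewrite -mulr_sumr.
have -> : 2 * (Ma * Mb) * t ^+ n = (Ma * Mb) * (2 * t ^+ n) by ring.
rewrite ler_wpM2l ?mulr_ge0 //.
rewrite (le_trans (half_geometric_sum _ (leq_addr _ _))) ?t0 //.
rewrite ler_wpM2l // expr_div_n ler_piMr //; first by nneg.
by rewrite invf_le1 ?exprn_gt0 // exprn_ege1 // ler1n.
Qed.

Lemma ent_deriv F a : ent F a -> exists G, ent G (fun n => n.+1%:R * a n.+1).
Proof.
move=> Fa; apply: ent_of_coef => r r0.
have r2 : 0 < 2 * r by rewrite mulr_gt0.
have [M M0 HM] := ent_coef Fa r2; exists (M / r).
  by apply: divr_ge0 => //; exact: ltW.
move=> n; rewrite cnM cn_nat (le_trans (ler_wpM2l _ (HM n.+1))) //.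
rewrite -[in leRHS]mulrA -invfM -exprS exprMn invfM mulrCA ler_wpM2l //.
rewrite mulrA ler_piMl ?invr_ge0 ?exprn_ge0 ?(ltW r0) //.
by rewrite ler_pdivrMr ?exprn_gt0 // mul1r -natrX ler_nat ltnW // ltn_expl.
Qed.

Lemma ent_deriv2 F a : ent F a -> exists G, ent G (fun n => 'C(n.+2, 2)%:R * a n.+2).
Proof.
move=> /ent_deriv[G1 /ent_deriv[G G1a]].
exists (fun z => G z / 2) => r r0; have [M HM] := G1a r r0.
exists (M / 2) => n z zr; rewrite mulrAC.
have -> : psum (fun n => 'C(n.+2, 2)%:R * a n.+2) n z =
    psum (fun n => n.+1%:R * (n.+2%:R * a n.+2)) n z / 2.
  rewrite /psum mulr_suml; apply: eq_bigr => k _.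
  have e : k.+1%:R * k.+2%:R = 2 * 'C(k.+2, 2)%:R :> C.
    by rewrite -!natrM; congr _%:R; rewrite -(mul_bin_diag k.+2 1) bin1 mulnC.
  by rewrite [_%:R * (_ * a _)]mulrA e; field.
by rewrite -mulrBl cnM cnV cn_nat ler_wpM2r // HM.
Qed.

Lemma ent_prim F a : ent F a -> exists G,
  ent G (fun n => if n is m.+1 then a m / m.+1%:R else 0).
Proof.
move=> Fa; apply: ent_of_coef => r r0.
have [M M0 HM] := ent_coef Fa r0; exists (M * r); first by nneg.
case=> [|n]; first by rewrite cn0; nneg.
rewrite cnM cnV cn_nat (le_trans (ler_wpM2r _ (HM n))) // ?invr_ge0 //.
have -> : M * r / r ^+ n.+1 = M / r ^+ n.
  by rewrite exprS invfM mulrA mulfK // gt_eqF.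
rewrite ler_piMr //; first by apply: divr_ge0 => //; apply: exprn_ge0; exact: ltW.
by rewrite invf_le1 ?ler1n // ltr0n.
Qed.

(** The bounds grow only like [(|z| + 1)^k], hence are summable against the coefficients of an
    entire series. The induction writes each remainder of [(z + h)^(k+1)] as [z] times the same
    remainder of [(z + h)^k] plus [h] times the previous one. *)
Lemma monomial_expansion z h k : cn h <= 1 ->
  [/\ cn ((z + h) ^+ k - z ^+ k) <= cn h * (cn z + 1) ^+ k,
      cn ((z + h) ^+ k - z ^+ k - k%:R * z ^+ k.-1 * h) <= cn h ^+ 2 * (cn z + 1) ^+ k &
      cn ((z + h) ^+ k - z ^+ k - k%:R * z ^+ k.-1 * h - 'C(k, 2)%:R * z ^+ k.-2 * h ^+ 2)
        <= cn h ^+ 3 * (cn z + 1) ^+ k].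
Proof.
move=> h1; have z0 := cn_ge0 z; have h0 := cn_ge0 h.
elim: k => [|k [IH1 IH2 IH3]].
  rewrite !expr0 subrr bin0n !mul0r !subr0 cn0.
  by split; nneg.
have pk : 0 <= (cn z + 1) ^+ k by apply: exprn_ge0; lra.
have zh : cn ((z + h) ^+ k) <= (cn z + 1) ^+ k.
  rewrite cnX; apply: lerXn2r; rewrite ?nnegrE ?addr_ge0 ?cn_ge0 //.
  by rewrite (le_trans (cnD _ _)) // lerD2l.
have e1 : (z + h) ^+ k.+1 - z ^+ k.+1 = z * ((z + h) ^+ k - z ^+ k) + h * (z + h) ^+ k.
  by rewrite !exprS; ring.
have e2 : (z + h) ^+ k.+1 - z ^+ k.+1 - k.+1%:R * z ^+ k * h =
   z * ((z + h) ^+ k - z ^+ k - k%:R * z ^+ k.-1 * h) + h * ((z + h) ^+ k - z ^+ k).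
  case: k {IH1 IH2 IH3 pk zh e1} => [|k]; first by rewrite !expr0 expr1; ring.
  by rewrite /= !exprS -!natr1; ring.
have e3 : (z + h) ^+ k.+1 - z ^+ k.+1 - k.+1%:R * z ^+ k * h - 'C(k.+1, 2)%:R * z ^+ k.-1 * h ^+ 2 =
   z * ((z + h) ^+ k - z ^+ k - k%:R * z ^+ k.-1 * h - 'C(k, 2)%:R * z ^+ k.-2 * h ^+ 2)
   + h * ((z + h) ^+ k - z ^+ k - k%:R * z ^+ k.-1 * h).
  rewrite e2 binS bin1 natrD; case: k {IH1 IH2 IH3 pk zh e1 e2} => [|[|k]] /=.
  - by rewrite !bin_small // !expr0; ring.
  - by rewrite !bin_small // !expr0 expr1; ring.
  - by rewrite !exprS; ring.
rewrite /= e3 e2 e1.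
have step (x y : C) n : cn x <= cn h ^+ n.+1 * (cn z + 1) ^+ k ->
    cn y <= cn h ^+ n * (cn z + 1) ^+ k ->
    cn (z * x + h * y) <= cn h ^+ n.+1 * (cn z + 1) ^+ k.+1.
  move=> xP yP; rewrite (le_trans (cnD _ _)) // !cnM.
  have h2 := ler_wpM2l z0 xP; have h3 := ler_wpM2l h0 yP.
  by rewrite [_ ^+ k.+1]exprS; rewrite !exprS in h2 h3 *; lra.
split.
- by have := step _ _ 0%N IH1 _; rewrite expr1; apply; rewrite expr0 mul1r.
- exact: (step _ _ 1%N).
- exact: (step _ _ 2%N).
Qed.

Lemma ent_expand F F1 F2 a : ent F a -> ent F1 (fun n => n.+1%:R * a n.+1) ->
  ent F2 (fun n => 'C(n.+2, 2)%:R * a n.+2) -> forall z, exists2 K : R, 0 <= K &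
  forall h, cn h <= 1 ->
    cn (F (z + h) - F z - F1 z * h - F2 z * h ^+ 2) <= K * cn h ^+ 3.
Proof.
move=> Fa F1a F2a z; pose rho := cn z + 1.
have rho0 : 0 < rho by rewrite ltr_wpDl ?cn_ge0.
have r2 : 0 < 2 * rho by rewrite mulr_gt0.
have [M M0 HM] := ent_coef Fa r2.
have [L0 L00 HF] := ent_half Fa rho0.
have [L1 L10 HF1] := ent_half F1a rho0.
have [L2 L20 HF2] := ent_half F2a rho0.
exists (2 * M); first by nneg.
move=> h h1; rewrite -subr_le0.
have h0 := cn_ge0 h.
have zr : cn z <= rho by rewrite lerDl.
have zhr : cn (z + h) <= rho by rewrite (le_trans (cnD _ _)) // lerD2l.
(* The truncation orders [n + 2], [n + 1] and [n] of [F], [F1] and [F2] match: the latter two are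
   then the first and half the second derivative of the same polynomial. *)
apply: (@le0_geometric _ (L0 + L0 + L1 + L2)) => n.
set d1 := fun n => n.+1%:R * a n.+1 in F1a HF1 *; set d2 := fun n => 'C(n.+2, 2)%:R * a n.+2 in F2a HF2 *.
have psE : psum a n.+2 (z + h) - psum a n.+2 z - psum d1 n.+1 z * h - psum d2 n z * h ^+ 2 =
  \sum_(k < n.+2) a k * ((z + h) ^+ k - z ^+ k - k%:R * z ^+ k.-1 * h - 'C(k, 2)%:R * z ^+ k.-2 * h ^+ 2).
  have -> : psum d1 n.+1 z * h = \sum_(k < n.+2) a k * (k%:R * z ^+ k.-1 * h).
    rewrite big_ord_recl /= !mul0r mulr0 add0r /psum mulr_suml; apply: eq_bigr => k _.
    by rewrite /d1 /bump /= add1n; ring.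
  have -> : psum d2 n z * h ^+ 2 = \sum_(k < n.+2) a k * ('C(k, 2)%:R * z ^+ k.-2 * h ^+ 2).
    rewrite !big_ord_recl /= !bin_small // !mul0r !mulr0 !add0r /psum mulr_suml.
    by apply: eq_bigr => k _; rewrite /d2 /bump /= !add1n; ring.
  rewrite /psum -!sumrB; apply: eq_bigr => k _; ring.
have psM : cn (\sum_(k < n.+2) a k * ((z + h) ^+ k - z ^+ k - k%:R * z ^+ k.-1 * h - 'C(k, 2)%:R * z ^+ k.-2 * h ^+ 2))
    <= 2 * M * cn h ^+ 3.
  rewrite (le_trans (cn_sum _ _ _)) //.
  apply: (@le_trans _ _ (\sum_(0 <= k < n.+2) (M * cn h ^+ 3) * (1 / 2) ^+ k)).
    rewrite big_mkord; apply: ler_sum => k _; rewrite cnM.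
    have [_ _ h3] := monomial_expansion z k h1.
    rewrite (le_trans (ler_pM _ _ (HM k) h3)) ?cn_ge0 // -/rho exprMn expr_div_n expr1n div1r.
    have rk : rho ^+ k != 0 by rewrite expf_neq0 // gt_eqF.
    have tk : 2 ^+ k != 0 :> R by rewrite expf_neq0.
    le_eq; move: (rho ^+ k) rk (2 ^+ k) tk (cn h ^+ 3) => A A0 B B0 D.
    by field; rewrite ?A0 ?B0.
  rewrite -mulr_sumr.
  have -> : 2 * M * cn h ^+ 3 = M * cn h ^+ 3 * 2 by ring.
  rewrite ler_wpM2l //; first by nneg.
  by rewrite (le_trans (half_geometric_sum _ _)) // ?ler01 ?lexx // expr0 mulr1.
have b1 := HF n.+2 (z + h) zhr; have b2 := HF n.+2 z zr.
have b3 := HF1 n.+1 z zr; have b4 := HF2 n z zr.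
rewrite -psE in psM.
have pn : 0 <= (1 / 2 : R) ^+ n by nneg.
have p2 : (1 / 2 : R) ^+ n.+2 <= (1 / 2) ^+ n.
  by rewrite !exprS; lra.
have p1 : (1 / 2 : R) ^+ n.+1 <= (1 / 2) ^+ n.
  by rewrite !exprS; lra.
have q2 := ler_wpM2l L00 p2; have q1 := ler_wpM2l L10 p1.
have -> : F (z + h) - F z - F1 z * h - F2 z * h ^+ 2 =
  (psum a n.+2 (z + h) - psum a n.+2 z - psum d1 n.+1 z * h - psum d2 n z * h ^+ 2)
  + ((F (z + h) - psum a n.+2 (z + h)) - (F z - psum a n.+2 z)
  - (F1 z - psum d1 n.+1 z) * h - (F2 z - psum d2 n z) * h ^+ 2) by ring.
set X := psum _ _ _ - _ - _ - _ in psM *.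
set Y1 := F (z + h) - _ in b1 *; set Y2 := F z - _ in b2 *.
set Y3 := F1 z - _ in b3 *; set Y4 := F2 z - _ in b4 *.
have c1 := cnD X (Y1 - Y2 - Y3 * h - Y4 * h ^+ 2).
have c2 := cnB (Y1 - Y2 - Y3 * h) (Y4 * h ^+ 2).
have c3 := cnB (Y1 - Y2) (Y3 * h).
have c4 := cnB Y1 Y2.
have c5 : cn (Y3 * h) <= cn Y3 by rewrite cnM ler_piMr ?cn_ge0.
have c6 : cn (Y4 * h ^+ 2) <= cn Y4.
  by rewrite cnM cnX ler_piMr ?cn_ge0 // exprn_ile1.
by lra.
Qed.

Lemma ent_cderiv F F1 a : ent F a -> ent F1 (fun n => n.+1%:R * a n.+1) ->
  forall z, cderiv F z (F1 z).
Proof.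
move=> Fa F1a z; have [F2 F2a] := ent_deriv2 Fa.
have [K K0 HK] := ent_expand Fa F1a F2a z.
exists (F2 z), (fun h => (F (z + h) - F z - F1 z * h - F2 z * h ^+ 2) / h ^+ 3); split.
  exists K, 1; split=> // h h1; have [->|h0] := eqVneq h 0.
    by rewrite [X in _ / X]expr0n invr0 mulr0 cn0.
  by rewrite cnM cnV cnX ler_pdivrMr ?exprn_gt0 ?cn_gt0 // HK.
exists 1 => // h h1; have [->|h0] := eqVneq h 0.
  by rewrite !expr0n /= !mulr0 mul0r !addr0.
by field.
Qed.

Lemma ent_pe2 F a : ent F a -> forall z, pe2 F z.
Proof.
move=> Fa z; have [F1 F1a] := ent_deriv Fa.
by exists (F1 z); exact: ent_cderiv Fa F1a z.
Qed.

Lemma ent_scale F a c : ent F a -> ent (fun z => F (c * z)) (fun n => a n * c ^+ n).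
Proof.
move=> Fa r r0; pose r' := (cn c + 1) * r.
have c1 : 0 < cn c + 1 by rewrite ltr_wpDl ?cn_ge0.
have r'0 : 0 < r' by rewrite mulr_gt0.
have [M HM] := Fa r' r'0.
have M0 : 0 <= M.
  have := HM 0%N 0; rewrite cn0 expr0 mulr1 => /(_ (ltW r'0)).
  by apply: le_trans; exact: cn_ge0.
exists M => n z zr.
have -> : psum (fun n => a n * c ^+ n) n z = psum a n (c * z).
  by apply: eq_bigr => k _; rewrite exprMn mulrA.
have cz : cn (c * z) <= (cn c + 1) * cn z.
  by rewrite cnM ler_wpM2r ?cn_ge0 // lerDl.
have czr : cn (c * z) <= r' by rewrite (le_trans cz) // ler_pM2l.
rewrite (le_trans (HM _ _ czr)) // ler_wpM2l //; apply: lerXn2r.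
- by rewrite nnegrE; apply: divr_ge0; [exact: cn_ge0|exact: ltW].
- by rewrite nnegrE; apply: divr_ge0; [exact: cn_ge0|exact: ltW].
rewrite ler_pdivrMr // /r' (le_trans cz) //.
by le_eq; field; rewrite gt_eqF.
Qed.

Lemma ent_div F a (al : C) : ent F a -> F al = 0 ->
  exists G b, ent G b /\ forall z, F z = (z - al) * G z.
Proof.
move=> Fa Fal.
(* Dividing by [X - al] formally gives minus a partial sum over [al^(n+1)]. Because [F al = 0] this
   is a remainder of the series at [al], and its smallness is what makes the quotient entire. *)
pose b n := if al == 0 then a n.+1 else - psum a n.+1 al / al ^+ n.+1.
have bM (r : R) : 0 < r -> exists2 M : R, 0 <= M & forall n, cn (b n) <= M / r ^+ n.
  move=> r0; rewrite /b; have [al0|al0] := eqVneq al 0.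
    have [M M0 HM] := ent_coef Fa r0; exists (M / r).
      by apply: divr_ge0 => //; exact: ltW.
    by move=> n; rewrite (le_trans (HM _)) // exprS invfM mulrA.
  pose r' := r + cn al.
  have r'0 : 0 < r' by rewrite ltr_wpDr ?cn_ge0.
  have [M HM] := Fa r' r'0.
  have alr : cn al <= r' by rewrite lerDr ltW.
  have M0 : 0 <= M by have := le_trans (cn_ge0 _) (HM 0%N al alr); rewrite expr0 mulr1.
  exists (M / r'); first by apply: divr_ge0 => //; exact: ltW.
  move=> n; have := HM n.+1 al alr; rewrite Fal sub0r cnM cnV cnX => h.
  rewrite ler_pdivrMr ?exprn_gt0 ?cn_gt0 // (le_trans h) //.
  have -> : M / r' / r ^+ n * cn al ^+ n.+1 = M * (cn al ^+ n.+1 / (r' * r ^+ n)).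
    by rewrite invfM; ring.
  rewrite ler_wpM2l // expr_div_n ler_wpM2l ?exprn_ge0 ?cn_ge0 //.
  rewrite lef_pV2 ?posrE ?exprn_gt0 ?mulr_gt0 ?exprn_gt0 // exprS ler_pM2l //.
  by apply: lerXn2r; [rewrite nnegrE ltW|rewrite nnegrE ltW|rewrite /r' lerDl cn_ge0].
have [G Gb] := ent_of_coef bM.
have a0 : al = 0 -> a 0%N = 0.
  move=> al0; have [M HM] := Fa 1 ltr01.
  have := HM 1%N 0; rewrite cn0 ler01 mul0r expr1 mulr0 -{1}al0 Fal /psum.
  rewrite big_ord1 expr0 mulr1 sub0r cnN => /(_ isT) h.
  by apply/eqP; rewrite -cn_eq0 eq_le h cn_ge0.
have rel n : al * b n = (if n is m.+1 then b m else 0) - a n.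
  rewrite /b; have [al0|al0] := eqVneq al 0.
    by case: n => [|n]; rewrite al0 mul0r ?subrr // a0 // subrr.
  case: n => [|n].
    by rewrite /psum big_ord1 expr0 expr1; field.
  rewrite {1}/psum big_ord_recr /= -/(psum a n.+1 al) ![al ^+ n.+2]exprS.
  have : al ^+ n.+1 != 0 by rewrite expf_neq0.
  by move: (al ^+ n.+1) (psum a n.+1 al) => w y w0; field; rewrite al0 w0.
have psE n z : (z - al) * psum b n z = psum a n z + (if n is m.+1 then b m * z ^+ n else 0).
  elim: n => [|n IH]; first by rewrite /psum !big_ord0 mulr0 addr0.
  rewrite /psum !big_ord_recr /= -/(psum b n z) -/(psum a n z) mulrDr IH.
  have -> : (z - al) * (b n * z ^+ n) = b n * z ^+ n.+1 - (al * b n) * z ^+ n.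
    by rewrite exprS; ring.
  by rewrite rel; case: n {IH} => [|n] /=; ring.
exists G, b; split=> // z; apply/eqP; rewrite -subr_eq0 -cn_eq0 eq_le cn_ge0 andbT.
have z1 : 0 < cn z + 1 by rewrite ltr_wpDl ?cn_ge0.
have zz : cn z <= cn z + 1 by rewrite lerDl.
have [M M0 HM] := ent_half Fa z1; have [M' M'0 HM'] := ent_half Gb z1.
have [L L0 HL] := bM _ (mulr_gt0 (ltr0n R 2) z1).
apply: (@le0_geometric _ (M + cn (z - al) * M' + L * (cn z + 1))) => n.
have -> : F z - (z - al) * G z = (F z - psum a n.+1 z) - (z - al) * (G z - psum b n.+1 z)
    - b n * z ^+ n.+1.
  by rewrite [(z - al) * (_ - _)]mulrBr psE; ring.
rewrite (le_trans (cnB _ _)) // [leRHS]mulrDl lerD //.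
  have p1 : (1 / 2 : R) ^+ n.+1 <= (1 / 2) ^+ n.
    have pn : 0 <= (1 / 2 : R) ^+ n by nneg.
    by rewrite exprS; lra.
  rewrite (le_trans (cnB _ _)) // [leRHS]mulrDl lerD // ?cnM -?mulrA.
    by rewrite (le_trans (HM n.+1 z zz)) // ler_wpM2l.
  by rewrite ler_wpM2l ?cn_ge0 // (le_trans (HM' n.+1 z zz)) // ler_wpM2l.
rewrite cnM cnX (le_trans (ler_wpM2r _ (HL n))) ?exprn_ge0 ?cn_ge0 //.
rewrite -!mulrA ler_wpM2l // exprS exprMn invfM expr_div_n expr1n mul1r mulrC.
rewrite -mulrA ler_pM ?cn_ge0 //; first by nneg.
rewrite mulrCA ler_piMr ?invr_ge0 ?exprn_ge0 //.
rewrite ler_pdivrMr ?exprn_gt0 // mul1r; apply: lerXn2r => //.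
  by rewrite nnegrE cn_ge0.
by rewrite nnegrE ltW.
Qed.

(** After removing the first [N + 1] terms, [F] is a polynomial plus [z^(N+1) G z] with
    [|G z| = O(1 / |z|)]. The maximum principle on squares of growing size then forces [G = 0]. *)
Lemma ent_liouville F a (K : R) N : ent F a -> 0 <= K ->
  (forall z, cn (F z) <= K * (1 + cn z) ^+ N) -> forall z, F z = psum a N.+1 z.
Proof.
move=> Fa K0 FK.
have [G Ga] : exists G, ent G (fun n => a (N.+1 + n)%N).
  apply: ent_of_coef => r r0; have [M M0 HM] := ent_coef Fa r0.
  exists (M / r ^+ N.+1); first by apply: divr_ge0 => //; apply: exprn_ge0; exact: ltW.
  by move=> n; rewrite (le_trans (HM _)) // exprD invfM mulrA.
have FE z : F z = psum a N.+1 z + z ^+ N.+1 * G z.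
  apply/eqP; rewrite -subr_eq0 -cn_eq0 eq_le cn_ge0 andbT.
  have z1 : 0 < cn z + 1 by rewrite ltr_wpDl ?cn_ge0.
  have zz : cn z <= cn z + 1 by rewrite lerDl.
  have [M M0 HM] := ent_half Fa z1; have [M' M'0 HM'] := ent_half Ga z1.
  apply: (@le0_geometric _ (M + cn z ^+ N.+1 * M')) => n.
  have -> : F z - (psum a N.+1 z + z ^+ N.+1 * G z) = (F z - psum a (N.+1 + n) z)
     - z ^+ N.+1 * (G z - psum (fun n => a (N.+1 + n)%N) n z).
    have -> : psum a (N.+1 + n) z = psum a N.+1 z + z ^+ N.+1 * psum (fun n => a (N.+1 + n)%N) n z.
      rewrite /psum big_split_ord /=; congr (_ + _); rewrite mulr_sumr.
      by apply: eq_bigr => k _; rewrite exprD; ring.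
    by ring.
  rewrite (le_trans (cnB _ _)) // [leRHS]mulrDl lerD //.
    rewrite (le_trans (HM _ _ zz)) // ler_wpM2l // exprD.
    by apply: ler_piMl; [nneg|apply: exprn_ile1; lra].
  by rewrite cnM cnX -mulrA ler_wpM2l ?HM' // exprn_ge0 ?cn_ge0.
pose S := \sum_(k < N.+1) cn (a k).
have S0 : 0 <= S by apply: sumr_ge0 => k _; exact: cn_ge0.
have GM z : 1 <= cn z -> cn (G z) <= (K * 2 ^+ N + S) / cn z.
  move=> z1; have z0 : 0 < cn z by exact: lt_le_trans z1.
  rewrite ler_pdivlMr // -(ler_pM2l (exprn_gt0 N z0)).
  have -> : cn z ^+ N * (cn (G z) * cn z) = cn (F z - psum a N.+1 z).
    by rewrite FE [psum _ _ _ + _]addrC addrK cnM cnX exprS; ring.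
  rewrite (le_trans (cnB _ _)) // [leRHS]mulrDr lerD //.
    rewrite (le_trans (FK z)) // mulrCA ler_wpM2l // -exprMn; apply: lerXn2r;
      rewrite ?nnegrE ?addr_ge0 ?mulr_ge0 ?cn_ge0 //; lra.
  rewrite (le_trans (cn_sum _ _ _)) // /S mulr_sumr ler_sum // => k _.
  rewrite cnM cnX mulrC ler_wpM2r ?cn_ge0 // ler_weXn2l //.
  by rewrite -ltnS.
have G0 z : G z = 0.
  apply/eqP; rewrite -cn_eq0 eq_le cn_ge0 andbT.
  pose K' := K * 2 ^+ N + S.
  have K'0 : 0 <= K' by rewrite /K'; nneg.
  apply: (@le0_geometric _ K') => n.
  pose r : R := cn z + 2 ^+ n.
  have r2 : 2 ^+ n <= r by rewrite /r lerDr cn_ge0.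
  have r1 : 1 <= r by rewrite (le_trans _ r2) // exprn_ege1 // ler1n.
  have r0 : 0 < r by exact: lt_le_trans r1.
  have big x y : - r <= x <= r -> - r <= y <= r ->
     [|| x == - r, x == r, y == - r | y == r] -> cn (G (Complex x y)) <= K' / r.
    move=> xr yr bd.
    have rz : r <= cn (Complex x y).
      have hx := Re_le_cn (Complex x y); have hy := Im_le_cn (Complex x y).
      rewrite -[X in X <= _](ger0_norm (ltW r0)).
      by case/or4P: bd => /eqP e; [apply: le_trans hx|apply: le_trans hx
        |apply: le_trans hy|apply: le_trans hy]; rewrite /= e ?normrN.
    rewrite (le_trans (GM _ _)) ?(le_trans r1) // ler_wpM2l //.
    by rewrite lef_pV2 ?posrE // (lt_le_trans r0).
  have zr x : `|x| <= cn z -> - r <= x <= r.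
    by rewrite -ler_norml => /le_trans; apply; rewrite lerDl exprn_ge0.
  have := maximum_principle (fun x y _ _ => ent_pe2 Ga (Complex x y)) big
     (zr _ (Re_le_cn z)) (zr _ (Im_le_cn z)).
  have -> : Complex (complex.Re z) (complex.Im z) = z by case: (z).
  move=> /le_trans; apply; rewrite ler_wpM2l // expr_div_n expr1n div1r.
  by rewrite lef_pV2 ?posrE ?exprn_gt0.
by move=> z; rewrite FE G0 mulr0 addr0.
Qed.
End PowerSeries.

(** * Logarithms, Borel-Caratheodory and factorisation of functions of order two *)

Section ZeroFree.
Variable R : realType.
Local Notation C := R[i].
Implicit Types (F G : C -> C) (a b : nat -> C) (z w h : C).

Lemma cderiv_bound F z (a : C) : cderiv F z a -> exists K d : R, [/\ 0 < d, 0 <= K &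
  forall h, cn h <= d -> cn (F (z + h) - F z - a * h) <= K * cn h ^+ 2].
Proof.
move=> [b [r [br [d d0 HF]]]].
have [K [c [c0 K0 Hs]]] : bounded_near0 (fun h => b + h * r h).
  by do ?[exact: br|exact: bounded_near0_cst|exact: bounded_near0_id
         |apply: bounded_near0M|apply: bounded_near0D].
exists K, (Num.min d c); split; rewrite ?lt_min ?d0 //.
move=> h; rewrite le_min => /andP[hd hc]; rewrite HF //.
have -> : F z + a * h + b * h ^+ 2 + h ^+ 3 * r h - F z - a * h = h ^+ 2 * (b + h * r h) by ring.
by rewrite cnM cnX mulrC ler_wpM2r ?Hs //; nneg.
Qed.

Lemma is_derive0_quadratic (f : R -> R) (t K d : R) : 0 < d -> 0 <= K ->
  (forall s, `|s| <= d -> `|f (t + s) - f t| <= K * s ^+ 2) -> is_derive t 1 f 0.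
Proof.
move=> d0 K0 H.
have cv : h^-1 *: ((f \o shift t) (h *: (1 : R)) - f t) @[h --> 0^'] --> (0 : R).
  apply/cvgrPdist_le => e e0; near=> h.
  have h0 : h != 0 by near: h; exact: nbhs_dnbhs_neq.
  have hd : `|h| <= d.
    near: h; apply: dnbhs0_le; exact: d0.
  have he : `|h| <= e / (K + 1).
    near: h; apply: dnbhs0_le; by rewrite divr_gt0 // ltr_wpDl.
  rewrite sub0r normrN /= /GRing.scale /= mulr1 [h + t]addrC normrM normfV.
  rewrite mulrC ler_pdivrMr ?normr_gt0 // (le_trans (H h hd)) //.
  rewrite -real_normK ?num_real // expr2 mulrA ler_wpM2r //.
  rewrite ler_pdivlMr ?ltr_wpDl // in he.
  by apply: le_trans he; rewrite mulrC ler_wpM2l // lerDl.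
apply: DeriveDef; first by apply/cvg_ex; exists 0.
by rewrite /derive; apply: cvg_lim.
Unshelve. all: by end_near.
Qed.

Lemma cderiv0_cst F : (forall z, cderiv F z 0) -> forall z, F z = F 0.
Proof.
move=> F0 z.
(* The cases [c = 1] and [c = -i] return the real and imaginary parts, so only real functions of one
   real variable are differentiated. *)
suff H (c : C) : complex.Re (c * F z) = complex.Re (c * F 0).
  apply: complex_eq; first by have := H 1; rewrite !mul1r.
  have := H (- 'i%C); case: (F z) (F 0) => [? ?] [? ?] /=.
  by rewrite !oppr0 !mul0r !mulN1r !sub0r !opprK.
pose f (t : R) := complex.Re (c * F (t%:C%C * z)).
have fd (t : R) : is_derive t 1 f 0.
  have [K [d [d0 K0 H]]] := cderiv_bound (F0 (t%:C%C * z)).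
  have z1 : 0 < cn z + 1 by rewrite ltr_wpDl ?cn_ge0.
  apply: (@is_derive0_quadratic f t (cn c * K * cn z ^+ 2) (d / (cn z + 1))).
  - by rewrite divr_gt0.
  - by nneg.
  move=> s sd; rewrite /f -ReN -ReD -mulrN -mulrDr (le_trans (Re_le_cn _)) // cnM.
  have -> : cn c * K * cn z ^+ 2 * s ^+ 2 = cn c * (K * (s ^+ 2 * cn z ^+ 2)) by ring.
  rewrite ler_wpM2l ?cn_ge0 // rmorphD mulrDl.
  have cs : cn (s%:C%C * z) = `|s| * cn z by rewrite cnM cn_real.
  have := H (s%:C%C * z); rewrite cs mul0r subr0 exprMn real_normK ?num_real //.
  apply.
  rewrite ler_pdivlMr // in sd; apply: le_trans sd.
  by rewrite ler_wpM2l // lerDl.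
have := @is_derive_0_is_cst R f 1 0 fd; rewrite /f mul0r.
by rewrite (_ : 1%:C%C = 1) ?mul1r //.
Qed.

Lemma ent_eq_coef F a b : a =1 b -> ent F a -> ent F b.
Proof. by move=> /funext ->. Qed.

Lemma ent_mulr_cst F a c : ent F a -> ent (fun z => F z * c) (fun n => a n * c).
Proof.
move=> Fa r r0; have [M HM] := Fa r r0.
exists (M * cn c) => n z zr.
have -> : psum (fun n => a n * c) n z = psum a n z * c.
  by rewrite /psum mulr_suml; apply: eq_bigr => k _; ring.
by rewrite -mulrBl cnM [leRHS]mulrAC ler_wpM2r ?cn_ge0 // HM.
Qed.

Lemma ent0 F a : ent F a -> F 0 = a 0%N.
Proof.
move=> Fa; have [M HM] := Fa 1 ltr01.
have := HM 1%N 0; rewrite cn0 ler01 mul0r expr1 mulr0 /psum big_ord1 expr0 mulr1.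
move=> /(_ isT) h; apply/eqP; rewrite -subr_eq0 -cn_eq0 eq_le h cn_ge0 //.
Qed.

(** The entire function [G] supplies the reciprocal of [F] up to the constant [c], so the
    logarithmic derivative is the entire function [F' G / c]; with [S] its primitive, [F e^(-S)] has
    derivative zero. *)
Lemma ent_logarithm F G a b (c : C) : ent F a -> ent G b -> c != 0 ->
  (forall z, F z * G z = c) ->
  exists S s, [/\ ent S s, S 0 = 0 & forall z, F z = F 0 * cexp (S z)].
Proof.
move=> Fa Gb c0 FG.
have [F1 F1a] := ent_deriv Fa.
have La := ent_mulr_cst c^-1 (ent_mul F1a Gb).
have [S Sa] := ent_prim La.
set s := fun n => _ in Sa.
have LS : ent (fun z => F1 z * G z / c) (fun n => n.+1%:R * s n.+1).
  apply: ent_eq_coef La => n; rewrite /s [RHS]mulrC divfK //.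
have S0 : S 0 = 0 by rewrite (ent0 Sa).
exists S, s; split=> // z.
pose Q u := F u * cexp (S u * -1).
have : Q z = Q 0.
  apply: cderiv0_cst => u.
  have dS := cderivM (ent_cderiv Sa LS u) (cderiv_cst (-1) u).
  have dE := cderiv_comp (F := @cexp R) (G := fun u => S u * -1) (cderiv_cexp (S u * -1)) dS.
  have dQ := cderivM (ent_cderiv Fa F1a u) dE.
  rewrite (_ : 0 = F u * (cexp (S u * -1) * (S u * 0 + F1 u * G u / c * -1)) +
    F1 u * cexp (S u * -1)) //.
  have -> : F u * (cexp (S u * -1) * (S u * 0 + F1 u * G u / c * -1)) + F1 u * cexp (S u * -1)
     = cexp (S u * -1) * F1 u * (1 - (F u * G u) / c) by field.
  by rewrite FG divff // subrr mulr0.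
rewrite /Q S0 mul0r cexp0 mulr1 => <-.
by rewrite -mulrA -cexpD (_ : S z * -1 + S z = 0) ?cexp0 ?mulr1 //; ring.
Qed.

Lemma max_square F (r M : R) : (forall z, `|complex.Re z| <= r -> `|complex.Im z| <= r -> pe2 F z) ->
  (forall z, `|complex.Re z| <= r -> `|complex.Im z| <= r -> r <= cn z -> cn (F z) <= M) ->
  forall z, cn z <= r -> cn (F z) <= M.
Proof.
move=> pF bF z zr.
have H x y : - r <= x <= r -> - r <= y <= r -> pe2 F (Complex x y).
  by move=> xr yr; apply: pF; rewrite ler_norml.
have G x y : - r <= x <= r -> - r <= y <= r ->
     [|| x == - r, x == r, y == - r | y == r] -> cn (F (Complex x y)) <= M.
  move=> xr yr bd; apply: bF; rewrite ?ler_norml //.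
  have r0 := le_trans (cn_ge0 z) zr.
  have hx := Re_le_cn (Complex x y); have hy := Im_le_cn (Complex x y).
  rewrite -[X in X <= _](ger0_norm r0).
  by case/or4P: bd => /eqP e; [apply: le_trans hx|apply: le_trans hx
    |apply: le_trans hy|apply: le_trans hy]; rewrite /= e ?normrN.
have -> : z = Complex (complex.Re z) (complex.Im z) by case: (z).
by apply: maximum_principle H G _ _ _ _; rewrite -ler_norml;
  [exact: le_trans (Re_le_cn z) zr|exact: le_trans (Im_le_cn z) zr].
Qed.

(* Borel-Caratheodory: [S / z] divided by [2 A - S] is at most [1 / r] on a square
   of half side [r] on which [Re S <= A]. *)
Lemma ent_Re_quadratic F a (K : R) : ent F a -> F 0 = 0 -> 0 <= K ->
  (forall z, complex.Re (F z) <= K * (1 + cn z ^+ 2)) ->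
  forall z, F z = a 1%N * z + a 2%N * z ^+ 2.
Proof.
move=> Fa F0 K0 ReF.
have [G [b [Gb FG']]] := ent_div Fa F0.
have {FG'} FG u : F u = u * G u by rewrite FG' subr0.
have bnd z : cn (F z) <= (18 * K + 2) * (1 + cn z) ^+ 2.
  pose r := 2 * (1 + cn z).
  have z0 := cn_ge0 z.
  have r0 : 0 < r by rewrite mulr_gt0 // ltr_wpDr.
  pose A := K * (1 + 2 * r ^+ 2) + 1.
  have A0 : 0 < A.
    by rewrite ltr_wpDl //; apply: mulr_ge0 => //; nneg.
  have ReA u : `|complex.Re u| <= r -> `|complex.Im u| <= r -> complex.Re (F u) <= A.
    move=> h1 h2; rewrite (le_trans (ReF u)) // /A.
    have : cn u ^+ 2 <= 2 * r ^+ 2.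
      rewrite cn_sq -(real_normK (num_real (complex.Re u))) -(real_normK (num_real (complex.Im u))).
      rewrite mulr2n mulrDl mul1r; apply: lerD; apply: lerXn2r;
        rewrite ?nnegrE ?(ltW r0) //.
    by move=> h; have := ler_wpM2l K0 h; lra.
  pose D u := (2 * A)%:C%C - F u.
  have ReD' u : `|complex.Re u| <= r -> `|complex.Im u| <= r -> A <= complex.Re (D u).
    by move=> h1 h2; rewrite /D ReD ReN /=; have := ReA u h1 h2; lra.
  have D0 u : `|complex.Re u| <= r -> `|complex.Im u| <= r -> D u != 0.
    move=> h1 h2; apply/eqP => Du; have := ReD' u h1 h2.
    by rewrite Du /= leNgt A0.
  have FD u : `|complex.Re u| <= r -> `|complex.Im u| <= r -> cn (F u) <= cn (D u).
    move=> h1 h2; rewrite -(ler_pXn2r (n := 2)) ?nnegrE ?cn_ge0 // !cn_sq /D !ReD !ImD !ReN !ImN /=.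
    by have := ReA u h1 h2; nra.
  have V u : cn u <= r -> cn (G u * (D u)^-1) <= r^-1.
    apply: (max_square (F := fun u => G u * (D u)^-1)) => {u} u h1 h2.
      apply: pe2M; first exact: ent_pe2 Gb u.
      apply: (pe2_comp (F := fun w => w^-1)); first by apply: pe2_inv; exact: D0.
      rewrite /D; under eq_fun do rewrite -mulN1r.
      by apply: pe2D; [exact: pe2_cst|apply: pe2M; [exact: pe2_cst|exact: ent_pe2 Fa u]].
    move=> ru; have u0 : 0 < cn u by exact: lt_le_trans ru.
    rewrite cnM cnV -(ler_pM2l u0) mulrA -cnM -FG.
    rewrite ler_pdivrMr ?cn_gt0 ?D0 // (le_trans (FD u h1 h2)) //.
    rewrite ler_peMl ?cn_ge0 //.
    by rewrite ler_pdivlMr // mul1r.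
  have zr : cn z <= r by rewrite /r; lra.
  have zRe := le_trans (Re_le_cn z) zr; have zIm := le_trans (Im_le_cn z) zr.
  have := V z zr; rewrite cnM cnV ler_pdivrMr ?cn_gt0 ?D0 // => h.
  have hF : cn (F z) <= cn z * (r^-1 * cn (D z)) by rewrite FG cnM ler_wpM2l ?cn_ge0.
  have zr2 : cn z / r <= 1 / 2 by rewrite ler_pdivrMr // /r; lra.
  have hD : cn (D z) <= 2 * A + cn (F z).
    by rewrite (le_trans (cnB _ _)) // cn_real ger0_norm // mulr_ge0 // ltW.
  (* The radius [r = 2 (1 + |z|)] makes [|z| / r <= 1/2], so [|F z|] on the right is absorbed on the
     left and [|F z| <= 2 A] follows. *)
  have : cn (F z) <= 1 / 2 * (2 * A + cn (F z)).
    rewrite (le_trans hF) // mulrA; apply: ler_pM => //; rewrite ?cn_ge0 //.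
    by apply: divr_ge0 => //; exact: ltW.
  have r2 : 1 + 2 * r ^+ 2 <= 9 * (1 + cn z) ^+ 2 by rewrite /r; nra.
  have := ler_wpM2l K0 r2; rewrite /A.
  have s1 : 1 <= (1 + cn z) ^+ 2 by nra.
  by lra.
have K1 : 0 <= 18 * K + 2 by nneg.
move=> z; rewrite (ent_liouville Fa K1 bnd) /psum !big_ord_recl big_ord0 /= /bump /=.
by rewrite -(ent0 Fa) F0 mul0r add0r addr0 expr1.
Qed.

Lemma pe2_horner (P : {poly C}) z : pe2 (horner P) z.
Proof.
elim/poly_ind: P => [|p e IHp].
  rewrite (_ : horner 0 = fun=> 0); last by apply/funext => u; rewrite horner0.
  exact: pe2_cst.
rewrite (_ : horner _ = fun u => p.[u] * u + e); last first.
  by apply/funext => u; rewrite hornerMXaddC.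
by apply: pe2D; [apply: pe2M; [exact: IHp|exact: pe2_id]|exact: pe2_cst].
Qed.

(** Each root of [Q] is a zero of [F] or of [G]; dividing it out of that factor lowers the degree of
    [Q]. When [Q] is a nonzero constant, [F] has a logarithm whose real part is at most quadratic,
    hence is a polynomial of degree at most two. *)
Lemma quotient_by_polynomial_exponential n : forall (Q : {poly C}) F G a b (K c : R),
  (size Q <= n)%N -> Q != 0 -> ent F a -> ent G b ->
  0 <= c -> (forall z, cn (F z) <= K * expR (c * cn z ^+ 2)) ->
  (forall z, F z * G z = Q.[z]) ->
  exists (P : {poly C}) (s1 s2 : C), P != 0 /\
    forall z, F z = P.[z] * cexp (s1 * z + s2 * z ^+ 2).
Proof.
elim: n => [|n IH] Q F G a b K c sQ Q0 Fa Gb c0 FK FG.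
  by move: sQ; rewrite leqn0 size_poly_eq0 (negPf Q0).
have [sQ1|sQ1] := eqVneq (size Q) 1%N.
  have [k k0 Qk] : exists2 k, k != 0 & Q = k%:P by apply/size_poly1P; rewrite sQ1.
  have FG' z : F z * G z = k by rewrite FG Qk hornerC.
  have [S [s [Sa S0 FS]]] := ent_logarithm Fa Gb k0 FG'.
  have F00 : F 0 != 0.
    by apply/eqP => F0; have := FG' 0; rewrite F0 mul0r => /esym/eqP; rewrite (negPf k0).
  have cF0 : 0 < cn (F 0) by rewrite cn_gt0.
  have K0 : 0 < K.
    by have := FK 0; rewrite cn0 expr0n mulr0 expR0 mulr1; exact: lt_le_trans.
  have ReS z : complex.Re (S z) <= (`|ln (K / cn (F 0))| + c) * (1 + cn z ^+ 2).
    have := FK z; rewrite FS cnM cn_cexp mulrC -ler_pdivlMr // => h.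
    have {h} : complex.Re (S z) <= ln (K / cn (F 0)) + c * cn z ^+ 2.
      rewrite -ler_expR (le_trans h) // expRD lnK ?posrE ?divr_gt0 //.
      by rewrite mulrAC.
    have := ler_norm (ln (K / cn (F 0))); have := normr_ge0 (ln (K / cn (F 0))).
    have : 0 <= cn z ^+ 2 by nneg.
    by nra.
  have Kc : 0 <= `|ln (K / cn (F 0))| + c by nneg.
  exists (F 0)%:P, (s 1%N), (s 2%N); split; first by rewrite polyC_eq0.
  by move=> z; rewrite hornerC FS (ent_Re_quadratic Sa S0 Kc ReS).
have /closed_rootP[al /factor_theorem[Q1 QE]] := sQ1.
have Q10 : Q1 != 0 by apply: contraNneq Q0 => Q1z; rewrite QE Q1z mul0r.
have sQ1' : (size Q1 <= n)%N.
  by move: sQ; rewrite QE size_Mmonic ?monicXsubC // size_XsubC addn2 /=.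
(* Away from [al] the factor [z - al] cancels; at [al] itself the equality follows by continuity. *)
have cancel (U V : C -> C) u v : ent U u -> ent V v ->
    (forall z, (z - al) * (U z * V z) = Q.[z]) -> forall z, U z * V z = Q1.[z].
  move=> Uu Vv UV z.
  have [->|zal] := eqVneq z al; last first.
    apply: (mulfI (_ : z - al != 0)); first by rewrite subr_eq0.
    by rewrite UV QE hornerM hornerXsubC mulrC.
  apply/eqP; rewrite -subr_eq0 -cn_eq0 eq_le cn_ge0 andbT.
  have pD : pe2 (fun z => U z * V z + (-1) * Q1.[z]) al.
    apply: pe2D; first by apply: pe2M; [exact: ent_pe2 Uu al|exact: ent_pe2 Vv al].
    apply: pe2M; first exact: pe2_cst.
    exact: pe2_horner.
  apply/ler_addgt0Pr => e e0; rewrite add0r; have [d d0 Hd] := pe2_continuous pD e0.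
  have dC : d%:C%C != 0 :> C by rewrite -cn_gt0 cn_real gtr0_norm.
  have := Hd d%:C%C; rewrite cn_real gtr0_norm // lexx => /(_ isT).
  have -> : U (al + d%:C%C) * V (al + d%:C%C) + -1 * Q1.[al + d%:C%C] = 0.
    apply: (mulfI dC); rewrite mulr0 mulrDr.
    have {1}-> : d%:C%C = (al + d%:C%C) - al by rewrite addrAC subrr add0r.
    by rewrite UV QE hornerM hornerXsubC addrAC subrr add0r; ring.
  by rewrite sub0r cnN mulN1r.
have [Fal|Fal] := eqVneq (F al) 0.
  have [F1 [a1 [F1a FE]]] := ent_div Fa Fal.
  have [M HM] := ent_bounded F1a (cn al + 1).
  (* Where [|z| <= |al| + 1] the quotient is bounded, and farther out [|z - al| >= 1], so dividing
     does not increase the modulus. *)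
  have F1K : forall z, cn (F1 z) <= (`|K| + `|M|) * expR (c * cn z ^+ 2).
    move=> z; have e1 : 1 <= expR (c * cn z ^+ 2) by rewrite -expR0 ler_expR; nneg.
    have e0 := expR_ge0 (c * cn z ^+ 2).
    have [zs|zb] := leP (cn z) (cn al + 1).
      have := HM z zs; have := ler_norm M; have := normr_ge0 K; have := normr_ge0 M.
      by nra.
    have h : 1 <= cn (z - al) by have := cnD (z - al) al; rewrite subrK; lra.
    have : cn (F1 z) <= cn (F z) by rewrite FE cnM ler_peMl ?cn_ge0.
    have := FK z; have := ler_norm K; have := normr_ge0 K; have := normr_ge0 M.
    by nra.
  have FG1 : forall z, F1 z * G z = Q1.[z].
    by apply: cancel F1a Gb _ => z; rewrite mulrA -FE; exact: FG.
  have [P1 [s1 [s2 [P10 F1E]]]] := IH Q1 F1 G a1 b _ c sQ1' Q10 F1a Gb c0 F1K FG1.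
  exists (('X - al%:P) * P1), s1, s2; split.
    by rewrite mulf_neq0 // polyXsubC_eq0.
  by move=> z; rewrite FE F1E hornerM hornerXsubC mulrA.
have Gal : G al = 0.
  have : F al * G al = 0 by rewrite FG QE hornerM hornerXsubC subrr mulr0.
  by move=> /eqP; rewrite mulf_eq0 (negPf Fal) => /eqP.
have [G1 [b1 [G1b GE]]] := ent_div Gb Gal.
apply: (IH Q1 F G1 a b1 K c sQ1' Q10 Fa G1b c0 FK).
by apply: cancel Fa G1b _ => z; rewrite mulrCA -GE; exact: FG.
Qed.
End ZeroFree.

(** * Functions forced to be a polynomial times one Gaussian *)

Section GaussianType.
Variable R : realType.
Local Notation C := R[i].
Implicit Types (F G : C -> C) (a b : nat -> C) (z w h : C).

Lemma pow_fact_le_expR (t : R) n : 0 <= t -> t ^+ n / n`!%:R <= expR t.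
Proof.
elim: n t => [|n IH] t t0.
  by rewrite expr0 fact0 divr1 -[leLHS]expR0 ler_expR.
pose f (s : R) := expR s - s ^+ n.+1 * (n.+1`!%:R)^-1.
have fd (s : R) : is_derive s 1 f (expR s - s ^+ n / n`!%:R).
  have d1 := is_derive_monomial ((n.+1`!%:R)^-1) s n.+1.
  apply: is_derive_eq; congr (_ - _); rewrite /= factS natrM invfM.
  have : n.+1%:R != 0 :> R by rewrite pnatr_eq0.
  by move: (n.+1%:R) (n`!%:R^-1) => u w u0; field.
have : f 0 <= f t by apply: (derive_ge0_le t0 fd) => x x0; rewrite subr_ge0 IH.
by rewrite /f expR0 expr0n mul0r subr0 => H; rewrite -subr_ge0 (le_trans _ H).
Qed.

Lemma ent_cexp : ent (@cexp R) (fun n => (n`!%:R)^-1).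
Proof.
move=> r r0; exists (expR (2 * r)) => n z zr.
have -> : cexp z - psum (fun n => (n`!%:R)^-1) n z = exp_tail n z.
  by rewrite /exp_tail /psum; congr (_ - _); apply: eq_bigr => k _; rewrite mulrC.
rewrite (le_trans (exp_tail_bound n z)) //.
have -> : cn z ^+ n / n`!%:R * expR (cn z) =
    (cn z / r) ^+ n * (r ^+ n / n`!%:R * expR (cn z)).
  rewrite expr_div_n; have : r ^+ n != 0 by rewrite expf_neq0 // gt_eqF.
  by move: (r ^+ n) (n`!%:R^-1) => u w u0; field.
rewrite mulrC ler_wpM2r //.
  by apply: exprn_ge0; apply: divr_ge0; [exact: cn_ge0|exact: ltW].
rewrite mulr2n mulrDl mul1r expRD ler_pM ?ler_expR ?pow_fact_le_expR ?(ltW r0) //.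
by apply: divr_ge0 => //; apply: exprn_ge0; exact: ltW.
Qed.

Definition gco (s : C) n : C := if odd n then 0 else s ^+ n./2 / (n./2)`!%:R.

Lemma ent_gauss (s : C) : ent (fun z => cexp (s * z ^+ 2)) (gco s).
Proof.
move=> r r0; exists (expR (2 * (cn s * r ^+ 2))) => n z zr.
(* Only even indices contribute, so [n] terms of the Gaussian series use [uphalf n] terms of the
   exponential; twice that number is at least [n]. *)
have -> : cexp (s * z ^+ 2) - psum (gco s) n z = exp_tail (uphalf n) (s * z ^+ 2).
  rewrite /exp_tail; congr (_ - _); elim: n => [|n IH]; first by rewrite /psum !big_ord0.
  rewrite /psum big_ord_recr /= -/(psum (gco s) n z) IH /gco uphalf_half.
  have [on|en] := boolP (odd n); first by rewrite mul0r addr0 /= add1n.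
  rewrite add0n big_ord_recr /=; congr (_ + _).
  have -> : z ^+ n = (z ^+ 2) ^+ n./2.
    by rewrite -exprM mul2n -[in LHS](odd_double_half n) (negPf en).
  by rewrite [in RHS]exprMn mulrAC.
rewrite (le_trans (exp_tail_bound _ _)) //; set m := uphalf n.
have sz : cn (s * z ^+ 2) = cn s * cn z ^+ 2 by rewrite cnM cnX.
have t0 : 0 <= cn z / r by apply: divr_ge0; [exact: cn_ge0|exact: ltW].
have t1 : cn z / r <= 1 by rewrite ler_pdivrMr // mul1r.
have szr : cn s * cn z ^+ 2 <= cn s * r ^+ 2.
  by rewrite ler_wpM2l ?cn_ge0 // lerXn2r ?nnegrE ?cn_ge0 // ltW.
have q0 : 0 <= cn s * r ^+ 2 by nneg.
have -> : cn (s * z ^+ 2) ^+ m / m`!%:R =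
   ((cn z / r) ^+ (2 * m)) * ((cn s * r ^+ 2) ^+ m / m`!%:R).
  have -> : cn (s * z ^+ 2) = (cn z / r) ^+ 2 * (cn s * r ^+ 2).
    by rewrite sz; field; rewrite gt_eqF.
  by rewrite [(_ * (cn s * _)) ^+ m]exprMn exprM mulrA.
have -> : forall x y w : R, x * y * w = x * (y * w) by move=> *; rewrite mulrA.
rewrite mulr2n mulrDl mul1r expRD mulrC.
apply: ler_pM; rewrite ?exprn_ge0 //.
- by apply: mulr_ge0; nneg.
- by rewrite ler_pM ?expR_ge0 ?pow_fact_le_expR ?ler_expR ?sz //; nneg.
apply: ler_wiXn2l => //.
by rewrite /m mul2n uphalf_half doubleD -{1}(odd_double_half n) leq_add2r; case: odd.
Qed.

Lemma poly_lower_bound (P : {poly C}) : P != 0 ->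
  exists c r0 : R, [/\ 0 < c, 0 < r0 & forall z, r0 <= cn z -> c <= cn P.[z]].
Proof.
elim/poly_ind: P => [|p e IH]; first by rewrite eqxx.
have [->|p0] := eqVneq p 0.
  rewrite mul0r add0r polyC_eq0 => e0.
  by exists (cn e), 1; split; rewrite ?cn_gt0 // => z _; rewrite hornerC.
move=> _; have [c [r0 [c0 r00 H]]] := IH p0.
have ce := cn_ge0 e.
exists c, (Num.max r0 ((cn e + c) / c)); split => //.
  by rewrite lt_max r00.
move=> z; rewrite ge_max => /andP[zr ze]; rewrite hornerMXaddC.
rewrite ler_pdivrMr // in ze.
have h1 := cnB (p.[z] * z + e) e; rewrite addrK cnM in h1.
have h2 := H z zr; have z0 := cn_ge0 z.
have : c * cn z <= cn p.[z] * cn z by rewrite ler_wpM2r.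
by lra.
Qed.

Lemma poly_upper_bound (P : {poly C}) : exists K : R, 0 <= K /\
  forall z, cn P.[z] <= K * (1 + cn z) ^+ size P.
Proof.
elim/poly_ind: P => [|p e [K [K0 IH]]].
  by exists 0; split=> // z; rewrite horner0 cn0 mul0r.
have [->|p0] := eqVneq p 0.
  exists (cn e); split; first exact: cn_ge0.
  move=> z; rewrite mul0r add0r hornerC ler_peMr ?cn_ge0 //.
  by apply: exprn_ege1; rewrite lerDl cn_ge0.
have -> : size (p * 'X + e%:P) = (size p).+1 by rewrite size_MXaddC (negPf p0).
exists (K + cn e); split; first by nneg.
move=> z; rewrite hornerMXaddC (le_trans (cnD _ _)) // mulrDl; have z0 := cn_ge0 z.
apply: lerD; last by rewrite ler_peMr ?cn_ge0 // exprn_ege1 // lerDl.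
rewrite cnM exprS [(1 + cn z) * _]mulrC mulrA; apply: ler_pM; rewrite ?cn_ge0 //.
by rewrite lerDr.
Qed.

(** Used as a contradiction along rays. The witness [t] comes from
    [(m t)^(N+1) / (N+1)! <= expR (m t)], which has one power more than the right-hand side. *)
Lemma expR_beats_poly (c m K q t0 : R) N : 0 < c -> 0 < m -> 0 <= K -> 0 <= q ->
  (forall t, t0 <= t -> c * expR (m * t) <= K * (1 + q * t) ^+ N) -> False.
Proof.
move=> c0 m0 K0 q0 H.
pose L := c * (m ^+ N.+1 / N.+1`!%:R).
have L0 : 0 < L by rewrite mulr_gt0 // divr_gt0 ?exprn_gt0 ?ltr0n ?fact_gt0.
pose t := `|t0| + 1 + K * (1 + q) ^+ N / L.
have X0 : 0 <= K * (1 + q) ^+ N / L.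
  by apply: divr_ge0; [nneg|exact: ltW].
have t1 : 1 <= t by rewrite /t; have := normr_ge0 t0; lra.
have tt0 : t0 <= t by rewrite /t; have := ler_norm t0; lra.
have tgt0 : 0 < t by lra.
have mt : 0 <= m * t by rewrite mulr_ge0 ?ltW.
have h1 := pow_fact_le_expR N.+1 mt.
have : L * t <= K * (1 + q) ^+ N.
  rewrite -(ler_pM2r (exprn_gt0 N tgt0)).
  apply: (@le_trans _ _ (c * expR (m * t))).
    rewrite /L -!mulrA ler_pM2l // (le_trans _ h1) // exprMn exprS.
    by le_eq; rewrite [in RHS]exprS; ring.
  rewrite (le_trans (H t tt0)) // -mulrA -exprMn ler_wpM2l // lerXn2r //;
    rewrite ?nnegrE; nra.
rewrite mulrC -ler_pdivlMr // leNgt => /negP; apply; rewrite /t.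
by have := normr_ge0 t0; lra.
Qed.

Lemma ent_conj F a : ent F a -> (forall n, complex.Im (a n) = 0) ->
  forall z, F (z^*)%C = ((F z)^*)%C.
Proof.
move=> Fa a0 z; apply/eqP; rewrite -subr_eq0 -cn_eq0 eq_le cn_ge0 andbT.
have z1 : 0 < cn z + 1 by rewrite ltr_wpDl ?cn_ge0.
have [M M0 HM] := ent_half Fa z1.
have zz : cn z <= cn z + 1 by rewrite lerDl.
have zz' : cn (z^*)%C <= cn z + 1 by rewrite cn_conj.
apply: (@le0_geometric _ _ (M + M)) => n; rewrite mulrDl.
have ps : psum a n (z^*)%C = ((psum a n z)^*)%C.
  rewrite /psum rmorph_sum; apply: eq_bigr => k _; rewrite rmorphM rmorphXn; congr (_ * _).
  by move: (a0 k); case: (a k) => x y /= ->; rewrite oppr0.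
have -> : F (z^*)%C - ((F z)^*)%C = (F (z^*)%C - psum a n (z^*)%C) - ((F z - psum a n z)^*)%C.
  by rewrite rmorphB ps; ring.
by rewrite (le_trans (cnB _ _)) // cn_conj lerD ?HM.
Qed.

(** With [m] the least index where [a], and hence [b], does not vanish, the coefficient of index
    [2m] reduces to [a m * b m]. Applied to [F z] and [F (i z)], it shows that their product is not
    the zero polynomial. *)
Lemma conv_neq0 a b : (exists n, a n != 0) -> (forall n, a n != 0 -> b n != 0) ->
  (forall n, a n = 0 -> b n = 0) ->
  exists n, \sum_(k < n.+1) a k * b (n - k)%N != 0.
Proof.
move=> exa ab ba; case: (ex_minnP exa) => m am minm.
exists (m + m)%N; rewrite (bigD1 (inord m)) //= big1 ?addr0.
  by rewrite inordK ?ltnS ?leq_addr // addnK mulf_neq0 // ab.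
move=> -[k km] /=; rewrite -val_eqE /= inordK ?ltnS ?leq_addr // => kn.
have [klt|kge] := ltnP k m.
  by case: (eqVneq (a k) 0) => [->|/minm]; rewrite ?mul0r // leqNgt klt.
have mk : (m + m - k < m)%N.
  by rewrite ltn_subLR ?ltn_add2r // ltn_neqAle eq_sym kn.
case: (eqVneq (a (m + m - k)%N) 0) => [/ba ->|/minm]; first by rewrite mulr0.
by rewrite leqNgt mk.
Qed.

(** The Taylor coefficients of [F(z) exp (s z^2)] when [a] are those of [F]. *)
Definition real_conv (a : nat -> C) (s : C) n := \sum_(k < n.+1) a k * gco s (n - k)%N.

(** [F] is the reference factor: [F(z) F(i z)] determines it as [P e^(s1 z + s2 z^2)], then [s1 = 0]
    and [s2] is real. Any [G] whose product with [F(i z)] obeys the same growth inherits the same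
    Gaussian, because dividing by the now explicit [F(i z)] leaves polynomial growth. *)
Theorem gaussian_type F a (K c : R) N : 0 <= K -> 0 <= c -> ent F a ->
  (forall n, complex.Im (a n) = 0) -> (exists n, a n != 0) ->
  (forall z, cn (F z) <= K * expR (c * cn z ^+ 2)) ->
  (forall x y, cn (F (Complex x y) * F ('i%C * Complex x y)) <=
    K * (1 + cn (Complex x y)) ^+ N * expR (c * Num.min (x ^+ 2) (y ^+ 2))) ->
  exists kappa : R, forall G b (K' : R), 0 <= K' -> ent G b ->
    (forall x y, cn (G (Complex x y) * F ('i%C * Complex x y)) <=
      K' * (1 + cn (Complex x y)) ^+ N * expR (c * Num.min (x ^+ 2) (y ^+ 2))) ->
    forall z, G z = psum (real_conv b (- kappa%:C%C)) N.+1 z * cexp (kappa%:C%C * z ^+ 2).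
Proof.
move=> K0 c0 Fa aR a0 FK WK.
have Fi := ent_scale 'i%C Fa.
have i0 : 'i%C != 0 :> C by rewrite -cn_gt0 cnE /= expr0n expr1n add0r sqrtr1.
have bound G b (K' : R) : 0 <= K' -> ent G b ->
    (forall x y, cn (G (Complex x y) * F ('i%C * Complex x y)) <=
      K' * (1 + cn (Complex x y)) ^+ N * expR (c * Num.min (x ^+ 2) (y ^+ 2))) ->
    exists2 L : R, 0 <= L & forall z, cn (G z * F ('i%C * z)) <= L * (1 + cn z) ^+ N.
  move=> K'0 Gb WG.
  by apply: phragmen_lindelof K'0 c0 (ent_pe2 (ent_mul Gb Fi)) WG.
have [L L0 WL] := bound F a K K0 Fa WK.
have Wa := ent_mul Fa Fi.
set w := fun n => \sum_(k < n.+1) _ in Wa.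
have WE := ent_liouville Wa L0 WL.
pose Q := \poly_(k < N.+1) w k.
have QE z : F z * F ('i%C * z) = Q.[z] by rewrite WE horner_poly.
have Q0 : Q != 0.
  apply/eqP => Qz.
  have ab n : a n != 0 -> a n * 'i%C ^+ n != 0.
    by move=> an; rewrite mulf_neq0 // expf_neq0.
  have ba n : a n = 0 -> a n * 'i%C ^+ n = 0 by move=> ->; rewrite mul0r.
  have [n /negP] := conv_neq0 (b := fun n => a n * 'i%C ^+ n) a0 ab ba.
  apply; apply/eqP; rewrite -/(w n); have zz : ent (fun=> 0 : C) (fun=> 0).
    by move=> r r0; exists 0 => m z _; rewrite mul0r /psum big1 ?subrr ?cn0 // => k _; rewrite mul0r.
  by apply: (ent_real_unique Wa zz) => x; rewrite QE Qz horner0.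
have [P [s1 [s2 [P0 FE]]]] :=
  quotient_by_polynomial_exponential (leqnn _) Q0 Fa Fi c0 FK QE.
have [cP [r0 [cP0 r00 HP]]] := poly_lower_bound P0.
have [KP [KP0 HKP]] := poly_upper_bound P.
(* Since [F(i z) = P(i z) e^(i s1 z - s2 z^2)] and [|P(i z)| >= cP] for large [|z|], the exponential
   factor times [G] is bounded by the product with [F(i z)]. *)
have quot G b (K' : R) e A : 0 <= K' -> ent G b ->
    (forall x y, cn (G (Complex x y) * F ('i%C * Complex x y)) <=
      K' * (1 + cn (Complex x y)) ^+ N * expR (c * Num.min (x ^+ 2) (y ^+ 2))) ->
    ent A e -> (forall z, A z = G z * cexp ('i%C * s1 * z - s2 * z ^+ 2)) ->
    exists2 K2 : R, 0 <= K2 & forall z, cn (A z) <= K2 * (1 + cn z) ^+ N.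
  move=> K'0 Gb WG Ae AE; have [L' L'0 WL'] := bound G b K' K'0 Gb WG.
  have [M HM] := ent_bounded Ae r0.
  exists (L' / cP + `|M|); first by nneg.
  move=> z; have z1 : 1 <= (1 + cn z) ^+ N by apply: exprn_ege1; rewrite lerDl cn_ge0.
  have Lc : 0 <= L' / cP by apply: divr_ge0 => //; exact: ltW.
  have [zr|/ltW zr] := leP (cn z) r0.
    by have := HM z zr; have := ler_norm M; have := normr_ge0 M; nra.
  have iz : r0 <= cn ('i%C * z).
    by rewrite cnM (_ : cn 'i%C = 1) ?mul1r // cnE /= expr0n expr1n add0r sqrtr1.
  have h := HP _ iz.
  have : cn (A z) * cP <= L' * (1 + cn z) ^+ N.
    apply: le_trans (WL' z); rewrite AE FE.
    have -> : s1 * ('i%C * z) + s2 * ('i%C * z) ^+ 2 = 'i%C * s1 * z - s2 * z ^+ 2.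
      rewrite exprMn sqr_i; ring.
    rewrite [X in _ <= cn X](_ : _ = G z * cexp ('i%C * s1 * z - s2 * z ^+ 2) * P.['i%C * z]); last by ring.
    by rewrite [in leRHS]cnM ler_wpM2l ?cn_ge0.
  rewrite -ler_pdivlMr // mulrDl mulrAC => /le_trans; apply.
  by rewrite lerDl; nneg; lra.
have cexp_s s : ent (fun z => cexp (s * z)) (fun n => (n`!%:R)^-1 * s ^+ n).
  exact: ent_scale ent_cexp.
have s10 : s1 = 0.
  have Ae := ent_mul (ent_mul Fa (cexp_s ('i%C * s1))) (ent_gauss (- s2)).
  have [|K2 K20 HA] := quot F a K _ _ K0 Fa WK Ae.
    by move=> z; rewrite -mulrA -cexpD mulNr.
  apply/eqP/negPn/negP => s1n.
  (* For [G = F] the function of polynomial growth is [P(z) e^((1 + i) s1 z)]; in the direction of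
     this conjugate the exponent is real and positive, so the growth would be exponential. *)
  pose v := ((1 + 'i%C) * s1)^*%C.
  have v0 : 0 < cn v.
    rewrite cn_gt0 conjc_eq0 mulf_neq0 //.
    by apply/eqP => -[/eqP]; rewrite addr0 oner_eq0.
  apply: (@expR_beats_poly cP (cn v ^+ 2) K2 (cn v) (r0 / cn v) N) => //.
  - by rewrite exprn_gt0.
  - exact: ltW.
  move=> t tr.
  have t0 : 0 <= t by apply: le_trans tr; apply: divr_ge0; exact: ltW.
  have cv : cn (t%:C%C * v) = cn v * t by rewrite cnM cn_real ger0_norm // mulrC.
  have rv : r0 <= cn (t%:C%C * v) by rewrite cv mulrC -ler_pdivrMr.
  have := HA (t%:C%C * v); rewrite cv => /(le_trans _); apply.
  rewrite FE -!mulrA -!cexpD cnM; apply: ler_pM => //; rewrite ?expR_ge0 ?(ltW cP0) ?HP //.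
  rewrite cn_cexp ler_expR le_eqVlt; apply/orP; left; apply/eqP.
  rewrite [X in complex.Re X](_ : _ = t%:C%C * (((1 + 'i%C) * s1) * v)); last by ring.
  rewrite ReZ mulrA -expr2 cn_sq mulrC; congr (_ * _); rewrite /v.
  by case: ((1 + 'i%C) * s1) => x y /=; ring.
have FE' z : F z = P.[z] * cexp (s2 * z ^+ 2) by rewrite FE s10 mul0r add0r.
have Fconj z : cn (F (z^*)%C) = cn (F z) by rewrite (ent_conj Fa aR) cn_conj.
(* On the diagonals [z = t (1 + i)] and [z = t (1 - i)] the real part of [s2 z^2] is [-2 t^2 Im s2]
   and [2 t^2 Im s2]. They are conjugate, and [F] has the same modulus at conjugate points since its
   coefficients are real, so exponential growth on one contradicts decay on the other. *)
have s2R : complex.Im s2 = 0.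
  have key z (m : R) : 0 < m -> (forall t : R, 1 <= t ->
      [/\ t <= cn (t%:C%C * z), cn (t%:C%C * z) <= 2 * t,
       complex.Re (s2 * (t%:C%C * z) ^+ 2) = m * t ^+ 2 &
       complex.Re (s2 * ((t%:C%C * z)^*)%C ^+ 2) = - (m * t ^+ 2)]) -> False.
    move=> m0 H; apply: (@expR_beats_poly cP m KP 2 (r0 + 1) (size P)) => // t tr.
    have t1 : 1 <= t by rewrite (le_trans _ tr) // lerDr ltW.
    have [h1 h2 h3 h4] := H t t1.
    have h5 : r0 <= cn (t%:C%C * z) by rewrite (le_trans _ h1) // (le_trans _ tr) // lerDl.
    have t2 : t <= t ^+ 2 by rewrite expr2 ler_peMl //; lra.
    apply: (@le_trans _ _ (cn (F (t%:C%C * z)))).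
      rewrite FE' cnM cn_cexp h3; apply: ler_pM; rewrite ?expR_ge0 ?(ltW cP0) ?HP //.
      by rewrite ler_expR ler_pM2l.
    rewrite -Fconj FE' cnM cn_cexp h4 -[leRHS]mulr1; apply: ler_pM; rewrite ?cn_ge0 ?expR_ge0 //.
      rewrite (le_trans (HKP _)) // ler_wpM2l // cn_conj lerXn2r // ?nnegrE; have := cn_ge0 (t%:C%C * z); lra.
    by rewrite -[leRHS]expR0 ler_expR oppr_le0; apply: mulr_ge0; [exact: ltW|nneg].
  have cz (t : R) e : e ^+ 2 = 1 -> 1 <= t ->
      t <= cn (t%:C%C * Complex 1 e) /\ cn (t%:C%C * Complex 1 e) <= 2 * t.
    move=> e2 t1; have t0 : 0 <= t by lra.
    have -> : cn (t%:C%C * Complex 1 e) = t * Num.sqrt 2.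
      by rewrite cnM cn_real ger0_norm // cnE /= e2 expr1n.
    have s1' : 1 <= Num.sqrt 2 :> R by rewrite -[X in X <= _]sqrtr1 ler_sqrt //; lra.
    have s2' : Num.sqrt 2 <= 2 :> R.
      by rewrite -[X in _ <= X]ger0_norm // -sqrtr_sqr ler_sqrt //; lra.
    by split; nra.
  have [m0|m0|//] := ltgtP (complex.Im s2) 0; exfalso.
  - apply: (key (Complex 1 1) (- 2 * complex.Im s2)); first by lra.
    move=> t t1; have [|h1 h2] := cz t 1 _ t1; first by rewrite expr1n.
    split=> //; case: (s2) => x y /=; ring.
  - apply: (key (Complex 1 (-1)) (2 * complex.Im s2)); first by lra.
    move=> t t1; have [|h1 h2] := cz t (-1) _ t1; first by rewrite sqrrN expr1n.
    split=> //; case: (s2) => x y /=; ring.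
pose kappa := complex.Re s2.
have s2E : s2 = kappa%:C%C by apply: complex_eq.
exists kappa => G b K' K'0 Gb WG z.
have Ae := ent_mul Gb (ent_gauss (- s2)).
have [|K2 K20 HA] := quot G b K' _ _ K'0 Gb WG Ae.
  by move=> u; rewrite s10 mulr0 mul0r sub0r mulNr.
rewrite -s2E /real_conv -(ent_liouville Ae K20 HA) -mulrA -cexpD mulNr addrC subrr.
by rewrite cexp0 mulr1.
Qed.
End GaussianType.

(** * Laplace transforms on the plane *)

Section RealIntegrals.
Context d (T : measurableType d) (R : realType) (mu : {measure set T -> \bar R}).
Implicit Types f g : T -> R.

Definition intg f := mu.-integrable [set: T] (EFin \o f).

Lemma intg_measurable f : intg f -> measurable_fun [set: T] f.
Proof. by move=> /integrableP[/measurable_EFinP]. Qed.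

Lemma intg_dom f g : measurable_fun [set: T] f -> intg g ->
  (forall x, `|f x| <= g x) -> intg f.
Proof.
move=> mf ig fg; apply: le_integrable ig => //; first exact/measurable_EFinP.
by move=> x _ /=; rewrite lee_fin (le_trans (fg x)) // ler_norm.
Qed.

Lemma intgD f g : intg f -> intg g -> intg (fun x => f x + g x).
Proof. by move=> fi gi; exact: (integrableD measurableT fi gi). Qed.

Lemma intgB f g : intg f -> intg g -> intg (fun x => f x - g x).
Proof. by move=> fi gi; exact: (integrableB measurableT fi gi). Qed.

Lemma intgZ c f : intg f -> intg (fun x => c * f x).
Proof. by move=> fi; exact: (integrableZl measurableT c fi). Qed.

Lemma intg_norm f : intg f -> intg (fun x => `|f x|).
Proof. exact: integrable_norm. Qed.

Lemma intg0 : intg (fun=> 0).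
Proof. exact: integrable0. Qed.

Lemma intg_sum (I : Type) (s : seq I) (h : I -> T -> R) :
  (forall i, intg (h i)) -> intg (fun x => \sum_(i <- s) h i x).
Proof.
move=> hi; elim: s => [|i s IH]; first by under eq_fun do rewrite big_nil; exact: intg0.
by under eq_fun do rewrite big_cons; exact: intgD.
Qed.

Lemma RintD f g : intg f -> intg g ->
  \int[mu]_x (f x + g x) = \int[mu]_x f x + \int[mu]_x g x.
Proof. by move=> fi gi; rewrite RintegralD. Qed.

Lemma RintB f g : intg f -> intg g ->
  \int[mu]_x (f x - g x) = \int[mu]_x f x - \int[mu]_x g x.
Proof. by move=> fi gi; rewrite RintegralB. Qed.

Lemma RintZ c f : intg f -> \int[mu]_x (c * f x) = c * \int[mu]_x f x.
Proof. by move=> fi; rewrite RintegralZl. Qed.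

Lemma Rint_sum (I : Type) (s : seq I) (h : I -> T -> R) :
  (forall i, intg (h i)) ->
  \int[mu]_x (\sum_(i <- s) h i x) = \sum_(i <- s) \int[mu]_x (h i x).
Proof.
move=> hi; elim: s => [|i s IH].
  rewrite big_nil; under eq_Rintegral do rewrite big_nil.
  by rewrite /Rintegral integral0.
rewrite big_cons -IH -RintD //; last exact: intg_sum.
by under eq_Rintegral do rewrite big_cons.
Qed.

Lemma Rint_le f g : intg f -> intg g -> (forall x, f x <= g x) ->
  \int[mu]_x f x <= \int[mu]_x g x.
Proof. by move=> fi gi fg; apply: le_Rintegral. Qed.

Lemma Rint_norm_le f g : measurable_fun [set: T] f -> intg g ->
  (forall x, `|f x| <= g x) -> `|\int[mu]_x f x| <= \int[mu]_x g x.
Proof.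
move=> mf gi fg; have fi := intg_dom mf gi fg.
rewrite (le_trans (le_normr_Rintegral _ _)) //.
by apply: Rint_le => //; exact: intg_norm.
Qed.

Lemma intg_fin f : intg f -> (\int[mu]_x (f x)%:E)%E = (\int[mu]_x f x)%:E.
Proof. by move=> fi; rewrite /Rintegral fineK //; exact: integrable_fin_num. Qed.

Lemma intg_ge0 f : measurable_fun [set: T] f -> (forall x, 0 <= f x) ->
  (\int[mu]_x (f x)%:E < +oo)%E -> intg f.
Proof.
move=> mf f0 fl; apply/integrableP; split; first exact/measurable_EFinP.
by under eq_integral do rewrite /= ger0_norm //.
Qed.

Lemma measurable_continuous_comp (phi : R -> R) f : continuous phi ->
  measurable_fun [set: T] f -> measurable_fun [set: T] (fun x => phi (f x)).
Proof.
move=> cphi mf; apply: (measurableT_comp (f := phi)) => //.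
exact: continuous_measurable_fun.
Qed.

Lemma measurable_expR_comp f : measurable_fun [set: T] f ->
  measurable_fun [set: T] (fun x => expR (f x)).
Proof. by apply: measurable_continuous_comp; exact: continuous_expR. Qed.

Lemma measurable_cos_comp f : measurable_fun [set: T] f ->
  measurable_fun [set: T] (fun x => cos (f x)).
Proof. by apply: measurable_continuous_comp; exact: continuous_cos. Qed.

Lemma measurable_sin_comp f : measurable_fun [set: T] f ->
  measurable_fun [set: T] (fun x => sin (f x)).
Proof. by apply: measurable_continuous_comp; exact: continuous_sin. Qed.

Lemma measurable_norm_comp f : measurable_fun [set: T] f ->
  measurable_fun [set: T] (fun x => `|f x|).
Proof. by apply: measurable_continuous_comp; exact: norm_continuous. Qed.

Lemma measurable_sqrt_comp f : measurable_fun [set: T] f ->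
  measurable_fun [set: T] (fun x => Num.sqrt (f x)).
Proof. by apply: measurable_continuous_comp; exact: sqrt_continuous. Qed.

Lemma measurable_exp_comp f n : measurable_fun [set: T] f ->
  measurable_fun [set: T] (fun x => f x ^+ n).
Proof. exact: (measurable_continuous_comp (phi := fun t => t ^+ n) (@exprn_continuous _ n)). Qed.

Lemma measurable_funN f : measurable_fun [set: T] f ->
  measurable_fun [set: T] (fun x => - f x).
Proof. by apply: measurable_continuous_comp; exact: opp_continuous. Qed.

End RealIntegrals.

Ltac msr := repeat (first
  [ match goal with
    | H : measurable_fun _ ?f |- measurable_fun _ ?f => exact H
    | |- measurable_fun _ (fun _ => ?c) => exact: measurable_cst
    | |- measurable_fun _ (fun x => @?f x) =>
        match f with
        | fun x => @GRing.mul _ (@?g x) (@?h x) => apply: measurable_funM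
        | fun x => @GRing.add _ (@?g x) (@GRing.opp _ (@?h x)) => apply: measurable_funB
        | fun x => @GRing.add _ (@?g x) (@?h x) => apply: measurable_funD
        | fun x => @GRing.opp _ (@?g x) => apply: measurable_funN
        | fun x => @GRing.exp _ (@?g x) _ => apply: measurable_exp_comp
        | fun x => expR (@?g x) => apply: measurable_expR_comp
        end
    end
  | assumption
  | exact: measurable_cst
  | exact: measurable_id
  | exact: measurable_fst
  | exact: measurable_snd
  | apply: measurable_expR_comp
  | apply: measurable_cos_comp
  | apply: measurable_sin_comp
  | apply: measurable_norm_comp
  | apply: measurable_sqrt_comp
  | apply: measurable_exp_comp
  | apply: measurable_funD
  | apply: measurable_funB
  | apply: measurable_funM
  | apply: measurable_funN
  ]).

Section LaplaceTransform.
Context d (T : measurableType d) (R : realType) (mu : {measure set T -> \bar R}).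
Variables (m xi : T -> R).
Hypothesis mm : measurable_fun [set: T] m.
Hypothesis mxi : measurable_fun [set: T] xi.
Hypothesis exp_moments : forall r : R, intg mu (fun x => `|m x| * expR (r * `|xi x|)).
Local Notation C := R[i].

Definition laplace (u : C) : C :=
  Complex (\int[mu]_x (m x * complex.Re (cexp (u * (xi x)%:C%C))))
          (\int[mu]_x (m x * complex.Im (cexp (u * (xi x)%:C%C)))).

Lemma measurable_Re_cexp (u : C) : measurable_fun [set: T] (fun x => complex.Re (cexp (u * (xi x)%:C%C))).
Proof. by case: u => a b /=; msr. Qed.

Lemma measurable_Im_cexp (u : C) : measurable_fun [set: T] (fun x => complex.Im (cexp (u * (xi x)%:C%C))).
Proof. by case: u => a b /=; msr. Qed.

Lemma moment_intg n : intg mu (fun x => m x * xi x ^+ n).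
Proof.
apply: (intg_dom _ (intgZ (n`!%:R) (exp_moments 1))); first by msr.
move=> x; rewrite normrM normrX mulrCA ler_wpM2l // mul1r mulrC.
by rewrite -ler_pdivrMr ?ltr0n ?fact_gt0 // pow_fact_le_expR.
Qed.

Lemma laplace_intg (u : C) : intg mu (fun x => `|m x| * cn (cexp (u * (xi x)%:C%C))).
Proof.
apply: (intg_dom _ (exp_moments (cn u))).
  apply: measurable_funM; first by msr.
  under eq_fun do rewrite cn_cexp; apply: measurable_expR_comp.
  by case: u => a b /=; msr.
move=> x; rewrite normrM normr_id ger0_norm ?cn_ge0 // ler_wpM2l // cn_cexp ler_expR.
by rewrite (le_trans (ler_norm _)) // (le_trans (Re_le_cn _)) // cnM cn_real.
Qed.

Lemma laplace_Re_intg (u : C) : intg mu (fun x => m x * complex.Re (cexp (u * (xi x)%:C%C))).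
Proof.
apply: (intg_dom _ (laplace_intg u)).
  by apply: measurable_funM => //; exact: measurable_Re_cexp.
by move=> x; rewrite normrM ler_wpM2l // Re_le_cn.
Qed.

Lemma laplace_Im_intg (u : C) : intg mu (fun x => m x * complex.Im (cexp (u * (xi x)%:C%C))).
Proof.
apply: (intg_dom _ (laplace_intg u)).
  by apply: measurable_funM => //; exact: measurable_Im_cexp.
by move=> x; rewrite normrM ler_wpM2l // Im_le_cn.
Qed.

Lemma laplace_le (u : C) :
  cn (laplace u) <= 2 * \int[mu]_x (`|m x| * cn (cexp (u * (xi x)%:C%C))).
Proof.
rewrite (le_trans (cn_le_ReIm _)) // mulr2n mulrDl mul1r.
apply: lerD; apply: Rint_norm_le (laplace_intg u) _.
- by apply: measurable_funM => //; exact: measurable_Re_cexp.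
- by move=> x; rewrite normrM ler_wpM2l // Re_le_cn.
- by apply: measurable_funM => //; exact: measurable_Im_cexp.
- by move=> x; rewrite normrM ler_wpM2l // Im_le_cn.
Qed.

(** The coefficients are the moments divided by factorials. Only a finite partial sum is integrated
    term by term; the remainder is the integral of [exp_tail n (z * xi)], where one factor
    [expR (r |xi|)] pays for the power and another for the exponential, whence the moment of order
    [2r]. *)
Lemma laplace_ent :
  ent laplace (fun n => ((\int[mu]_x (m x * xi x ^+ n)) / n`!%:R)%:C%C).
Proof.
move=> r r0; exists (2 * \int[mu]_x (`|m x| * expR (2 * r * `|xi x|))) => n z zr.
pose tl x := exp_tail n (z * (xi x)%:C%C).
have tlM x : cn (tl x) <= (cn z / r) ^+ n * expR (2 * r * `|xi x|).
  rewrite (le_trans (exp_tail_bound _ _)) // cnM cn_real.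
  have -> : (cn z * `|xi x|) ^+ n / n`!%:R = (cn z / r) ^+ n * ((r * `|xi x|) ^+ n / n`!%:R).
    rewrite mulrA -exprMn; congr (_ ^+ _ / _); field; by rewrite gt_eqF.
  rewrite -mulrA ler_wpM2l //.
    by apply: exprn_ge0; apply: divr_ge0; [exact: cn_ge0|exact: ltW].
  have rx : 0 <= r * `|xi x| by rewrite mulr_ge0 // ltW.
  have -> : 2 * r * `|xi x| = r * `|xi x| + r * `|xi x| by ring.
  rewrite expRD ler_pM ?expR_ge0 ?pow_fact_le_expR ?ler_expR ?ler_wpM2r //.
  by apply: divr_ge0 => //; exact: exprn_ge0.
(* Treats the real and the imaginary part at once, as additive functions that commute with real
   scalars and are bounded by the modulus. *)
have ps (phi : C -> R) (phiD : {morph phi : x y / x + y}) (phi0 : phi 0 = 0)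
    (phiN : forall x, phi (- x) = - phi x) (phiZ : forall (c : R) x, phi (c%:C%C * x) = c * phi x)
    (mphi : measurable_fun [set: T] (fun x => phi (cexp (z * (xi x)%:C%C))))
    (iphi : intg mu (fun x => m x * phi (cexp (z * (xi x)%:C%C)))) (phile : forall x, `|phi x| <= cn x) :
    `|\int[mu]_x (m x * phi (cexp (z * (xi x)%:C%C))) -
    phi (psum (fun n => ((\int[mu]_x (m x * xi x ^+ n)) / n`!%:R)%:C%C) n z)| <=
   \int[mu]_x (`|m x| * expR (2 * r * `|xi x|)) * (cn z / r) ^+ n.
  have phis (s : seq nat) (h : nat -> C) : phi (\sum_(k <- s) h k) = \sum_(k <- s) phi (h k).
    exact: (big_morph phi phiD phi0).
  have e1 : phi (psum (fun n => ((\int[mu]_x (m x * xi x ^+ n)) / n`!%:R)%:C%C) n z)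
     = \int[mu]_x (\sum_(k <- index_iota 0 n) (phi (z ^+ k) / k`!%:R) * (m x * xi x ^+ k)).
    rewrite Rint_sum; last by move=> k; apply: intgZ; exact: moment_intg.
    rewrite /psum -(big_mkord xpredT (fun k => ((\int[mu]_x (m x * xi x ^+ k)) / k`!%:R)%:C%C * z ^+ k)).
    rewrite phis; apply: eq_bigr => k _.
    by rewrite phiZ RintZ; [ring|exact: moment_intg].
  have i1 : intg mu (fun x => \sum_(k <- index_iota 0 n) (phi (z ^+ k) / k`!%:R) * (m x * xi x ^+ k)).
    by apply: intg_sum => k; apply: intgZ; exact: moment_intg.
  rewrite e1 -RintB //.
  have e2 x : m x * phi (cexp (z * (xi x)%:C%C)) -
     \sum_(k <- index_iota 0 n) (phi (z ^+ k) / k`!%:R) * (m x * xi x ^+ k) = m x * phi (tl x).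
    rewrite /tl /exp_tail phiD phiN mulrDr mulrN; congr (_ - _).
    rewrite -(big_mkord xpredT (fun k => (z * (xi x)%:C%C) ^+ k / k`!%:R)) phis mulr_sumr.
    apply: eq_bigr => k _.
    have -> : (z * (xi x)%:C%C) ^+ k / k`!%:R = ((xi x) ^+ k / k`!%:R)%:C%C * z ^+ k.
      by rewrite exprMn rmorphM fmorphV rmorph_nat rmorphXn /=; ring.
    by rewrite phiZ; ring.
  under eq_Rintegral do rewrite e2.
  rewrite mulrC -RintZ; last exact: exp_moments.
  apply: Rint_norm_le.
  - by under eq_fun do rewrite -e2; exact: intg_measurable (intgB iphi i1).
  - by apply: intgZ; exact: exp_moments.
  - move=> x; rewrite normrM mulrCA ler_wpM2l //.
    by rewrite (le_trans (phile _)) // tlM.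
rewrite (le_trans (cn_le_ReIm _)) // ReD ImD ReN ImN -[leRHS]mulrA [leRHS]mulrDl !mul1r.
apply: lerD.
  apply: (ps (@complex.Re R)) => //; first exact: ReD.
  - by move=> x; rewrite ReN.
  - by move=> c x; rewrite ReZ.
  - exact: measurable_Re_cexp.
  - exact: laplace_Re_intg.
  - exact: Re_le_cn.
apply: (ps (@complex.Im R)) => //; first exact: ImD.
- by move=> x; rewrite ImN.
- by move=> c x; rewrite ImZ.
- exact: measurable_Im_cexp.
- exact: laplace_Im_intg.
- exact: Im_le_cn.
Qed.
End LaplaceTransform.

(** * Fubini's theorem for real-valued integrands *)

Section ProductIntegrals.
Context d1 d2 (T1 : measurableType d1) (T2 : measurableType d2) (R : realType).
Variables (m1 : {sigma_finite_measure set T1 -> \bar R})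
  (m2 : {sigma_finite_measure set T2 -> \bar R}).

Lemma prod_intg (phi : T1 -> R) (psi : T2 -> R) : intg m1 phi -> intg m2 psi ->
  intg (m1 \x m2)%E (fun z => phi z.1 * psi z.2).
Proof.
move=> i1 i2.
have mp1 : measurable_fun [set: T1 * T2] (fun z => phi z.1).
  exact: (measurableT_comp (intg_measurable i1) measurable_fst).
have mp2 : measurable_fun [set: T1 * T2] (fun z => psi z.2).
  exact: (measurableT_comp (intg_measurable i2) measurable_snd).
apply/integrable12ltyP; first by apply/measurable_EFinP; exact: measurable_funM.
under eq_integral => x _.
  under eq_integral => y _ do rewrite /= normrM EFinM.
  rewrite integralZl //; last exact: (intg_norm i2).
  rewrite muleC (intg_fin (intg_norm i2)).
  over.
rewrite integralZl //; last exact: (intg_norm i1).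
by rewrite (intg_fin (intg_norm i1)) -EFinM ltry.
Qed.

Lemma Rint_iterated (h : T1 * T2 -> R) : intg (m1 \x m2)%E h ->
  (forall x, intg m2 (fun y => h (x, y))) ->
  intg m1 (fun x => \int[m2]_y h (x, y)) /\
  \int[m1]_x (\int[m2]_y h (x, y)) = \int[(m1 \x m2)%E]_z h z.
Proof.
move=> ih ih1; have e : (fun x => (\int[m2]_y h (x, y))%:E) = fubini_F m2 (EFin \o h).
  by apply/funext => x; rewrite -intg_fin.
split.
  by rewrite /intg -[EFin \o _]/(fun x => (\int[m2]_y h (x, y))%:E) e; exact: integrable_fubini_F.
by rewrite {1 3}/Rintegral -(integral12_prod_meas1 ih) -e.
Qed.

Lemma Rint_iterated_swap (h : T1 * T2 -> R) : intg (m1 \x m2)%E h ->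
  (forall y, intg m1 (fun x => h (x, y))) ->
  intg m2 (fun y => \int[m1]_x h (x, y)) /\
  \int[m2]_y (\int[m1]_x h (x, y)) = \int[(m1 \x m2)%E]_z h z.
Proof.
move=> ih ih1; have e : (fun y => (\int[m1]_x h (x, y))%:E) = fubini_G m1 (EFin \o h).
  by apply/funext => y; rewrite -intg_fin.
split.
  rewrite /intg -[EFin \o _]/(fun y => (\int[m1]_x h (x, y))%:E) e.
  have mh := measurable_int _ ih.
  have mG := @measurable_fun_fubini_tonelli_G _ _ _ _ _ m1 (abse \o (EFin \o h))
    (measurableT_comp (@abse_measurable _ setT) mh) (fun x => abse_ge0 _).
  apply/integrableP; split; first exact: (measurable_fubini_G ih).
  apply: le_lt_trans ((integrable21ltyP _ _ mh).1 ih).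
  apply: ge0_le_integral => //; first by apply: measurableT_comp => //; exact: (measurable_fubini_G ih).
  move=> y _; apply: le_abse_integral => //.
  exact: (measurable_int _ (ih1 y)).
by rewrite {1 3}/Rintegral -(integral21_prod_meas1 ih) -e.
Qed.

Lemma Rint_prod (phi : T1 -> R) (psi : T2 -> R) : intg m1 phi -> intg m2 psi ->
  \int[(m1 \x m2)%E]_z (phi z.1 * psi z.2) = (\int[m1]_x phi x) * (\int[m2]_y psi y).
Proof.
move=> i1 i2; have [|_ <-] := Rint_iterated (prod_intg i1 i2).
  by move=> x /=; exact: intgZ.
under eq_Rintegral do rewrite /= RintZ // mulrC.
by rewrite RintZ // mulrC.
Qed.

End ProductIntegrals.

Lemma ent_real_eq (R : realType) (F G : R[i] -> R[i]) a b : ent F a -> ent G b ->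
  (forall x : R, F x%:C%C = G x%:C%C) -> F =1 G.
Proof.
move=> Fa Gb FG; apply: (ent_ext Fa).
by apply: (ent_eq_coef _ Gb) => n; rewrite (ent_real_unique Fa Gb FG).
Qed.

Lemma laplace_real d (T : measurableType d) (R : realType) (mu : {measure set T -> \bar R})
    (m xi : T -> R) (x : R) :
  laplace mu m xi x%:C%C = (\int[mu]_t (m t * expR (x * xi t)))%:C%C.
Proof.
rewrite /laplace; congr Complex.
  by apply: eq_Rintegral => t _; rewrite -rmorphM cexp_real.
under eq_Rintegral do rewrite -rmorphM cexp_real mulr0.
by rewrite /Rintegral integral0.
Qed.

(** * Gaussian integrals on the line *)

Section GaussianIntegrals.
Variable R : realType.
Local Notation C := R[i].
Local Notation leb := (@lebesgue_measure R).

(** Completing the square makes the integrand a multiple of the normal density with mean [z / b^2]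
    and standard deviation [1 / b]. *)
Lemma gauss_shift_intg (b z : R) : 0 < b ->
  intg leb (fun w => expR (- (b * w) ^+ 2 / 2 + z * w)) /\
  \int[leb]_w expR (- (b * w) ^+ 2 / 2 + z * w) =
    Num.sqrt (2 * pi) / b * expR (z ^+ 2 / (2 * b ^+ 2)).
Proof.
move=> b0; have bn0 : b != 0 by rewrite gt_eqF.
have bV0 : b^-1 != 0 by rewrite invr_eq0.
set c := Num.sqrt (2 * pi) / b * expR (z ^+ 2 / (2 * b ^+ 2)).
have pi0 : 0 < 2 * pi :> R by rewrite mulr_gt0 // pi_gt0.
have e : (fun w => expR (- (b * w) ^+ 2 / 2 + z * w)) =
    (fun w => c * normal_pdf (z / b ^+ 2) b^-1 w).
  apply/funext => w; rewrite normal_pdfE // /normal_peak /normal_fun /c.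
  have -> : Num.sqrt (b^-1 ^+ 2 * pi *+ 2) = Num.sqrt (2 * pi) / b.
    rewrite -[_ *+ 2]mulr_natl mulrCA sqrtrM ?exprn_ge0 ?invr_ge0 ?ltW // sqrtr_sqr.
    by rewrite ger0_norm ?invr_ge0 ?ltW // mulrC.
  rewrite mulrACA mulfV ?mul1r; last first.
    by rewrite mulf_neq0 // gt_eqF // sqrtr_gt0.
  rewrite -expRD; congr expR; rewrite -[_ *+ 2]mulr_natl; field.
  by rewrite bn0.
have i1 : intg leb (normal_pdf (z / b ^+ 2) b^-1) by exact: integrable_normal_pdf.
rewrite e; split; first exact: intgZ.
by rewrite RintZ // /Rintegral integral_normal_pdf /= mulr1.
Qed.

Lemma measurable_gauss (b : R) :
  measurable_fun [set: measurableTypeR R] (fun w : measurableTypeR R => expR (- (b * w) ^+ 2 / 2)).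
Proof. by msr. Qed.

Lemma gauss_exp_moments (b r : R) : 0 < b ->
  intg leb (fun w => `|expR (- (b * w) ^+ 2 / 2)| * expR (r * `|w|)).
Proof.
move=> b0.
apply: (intg_dom _ (intgD (gauss_shift_intg r b0).1 (gauss_shift_intg (- r) b0).1)); first by msr.
move=> w; rewrite ger0_norm ?mulr_ge0 ?expR_ge0 // ger0_norm ?expR_ge0 // -expRD.
case: (leP 0 w) => w0.
  by rewrite (ger0_norm w0) lerDl expR_ge0.
by rewrite (ltr0_norm w0) mulrN -(mulNr r) lerDr expR_ge0.
Qed.

(** Both sides are entire and agree for real [z], so the Fourier transform of the Gaussian follows
    from the identity theorem without moving a contour. *)
Lemma gauss_laplace (b : R) (z : C) : 0 < b ->
  laplace leb (fun w => expR (- (b * w) ^+ 2 / 2)) id z =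
    (Num.sqrt (2 * pi) / b)%:C%C * cexp ((2 * b ^+ 2)^-1%:C%C * z ^+ 2).
Proof.
move=> b0; set c := _ / b; set s := _^-1%:C%C.
have L := laplace_ent (measurable_gauss b) (@measurable_id _ (measurableTypeR R) setT) (fun r => gauss_exp_moments r b0).
have G := ent_mulr_cst c%:C%C (ent_gauss s).
suff e x : laplace leb (fun w => expR (- (b * w) ^+ 2 / 2)) id x%:C%C = cexp (s * x%:C%C ^+ 2) * c%:C%C.
  by rewrite (ent_real_eq L G e) mulrC.
rewrite laplace_real /s -rmorphXn -rmorphM cexp_real -rmorphM /=; congr (_ %:C)%C.
under eq_Rintegral do rewrite -expRD.
have [_ ->] := gauss_shift_intg x b0.
by rewrite mulrC [_ / (2 * b ^+ 2)]mulrC.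
Qed.

End GaussianIntegrals.

(** * Quaternion norms and the Gaussian Fourier transform *)

Section QuaternionNorm.
Variable R : rcfType.
Implicit Types x y a : quat R.

Lemma qnorm_ge0 x : 0 <= qnorm x. Proof. exact: sqrtr_ge0. Qed.

Lemma qnorm_sq x : qnorm x ^+ 2 = q0 x ^+ 2 + q1 x ^+ 2 + q2 x ^+ 2 + q3 x ^+ 2.
Proof. by rewrite sqr_sqrtr // !addr_ge0 ?sqr_ge0. Qed.

Lemma qnorm_eq x c : 0 <= c -> c ^+ 2 = q0 x ^+ 2 + q1 x ^+ 2 + q2 x ^+ 2 + q3 x ^+ 2 ->
  qnorm x = c.
Proof. by move=> c0 e; rewrite /qnorm -e sqrtr_sqr ger0_norm. Qed.

Lemma qnormM x y : qnorm (x * y) = qnorm x * qnorm y.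
Proof.
apply: qnorm_eq; first by rewrite mulr_ge0 ?qnorm_ge0.
by rewrite exprMn !qnorm_sq; case: x y => [????] [????] /=; ring.
Qed.

Lemma le_qnorm x c : c ^+ 2 <= q0 x ^+ 2 + q1 x ^+ 2 + q2 x ^+ 2 + q3 x ^+ 2 ->
  `|c| <= qnorm x.
Proof. by rewrite -qnorm_sq => h; rewrite -ler_sqr ?nnegrE ?qnorm_ge0 // real_normK ?num_real. Qed.

Lemma q0_le x : `|q0 x| <= qnorm x.
Proof. by apply: le_qnorm; have := sqr_ge0 (q1 x); have := sqr_ge0 (q2 x); have := sqr_ge0 (q3 x); lra. Qed.
Lemma q1_le x : `|q1 x| <= qnorm x.
Proof. by apply: le_qnorm; have := sqr_ge0 (q0 x); have := sqr_ge0 (q2 x); have := sqr_ge0 (q3 x); lra. Qed.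
Lemma q2_le x : `|q2 x| <= qnorm x.
Proof. by apply: le_qnorm; have := sqr_ge0 (q0 x); have := sqr_ge0 (q1 x); have := sqr_ge0 (q3 x); lra. Qed.
Lemma q3_le x : `|q3 x| <= qnorm x.
Proof. by apply: le_qnorm; have := sqr_ge0 (q0 x); have := sqr_ge0 (q1 x); have := sqr_ge0 (q2 x); lra. Qed.

Lemma qnorm0 : qnorm (0 : quat R) = 0.
Proof. by apply: qnorm_eq => //=; ring. Qed.

Lemma qnorm_eq0 x : qnorm x = 0 -> x = 0.
Proof.
move=> h; have z (c : R) : `|c| <= qnorm x -> c = 0 by rewrite h normr_le0 => /eqP.
have [h0 h1 h2 h3] : [/\ q0 x = 0, q1 x = 0, q2 x = 0 & q3 x = 0].
  by split; apply: z; [exact: q0_le|exact: q1_le|exact: q2_le|exact: q3_le].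
by case: x h0 h1 h2 h3 {h z} => /= a b c d -> -> -> ->.
Qed.

Lemma q0M x y : q0 (x * y) = q0 x * q0 y - q1 x * q1 y - q2 x * q2 y - q3 x * q3 y.
Proof. by []. Qed.

Lemma q0_mulC x y : q0 (x * y) = q0 (y * x).
Proof. by case: x y => [????] [????] /=; ring. Qed.

Lemma inplane_qiM (z t : R[i]) : inplane qi (z * t) = inplane qi z * inplane qi t.
Proof. by case: z t => [? ?] [? ?]; congr Quat => /=; ring. Qed.

Lemma inplane_qjM (z t : R[i]) : inplane qj (z * t) = inplane qj z * inplane qj t.
Proof. by case: z t => [? ?] [? ?]; congr Quat => /=; ring. Qed.

Lemma qnorm_inplane_qi (z : R[i]) : qnorm (inplane qi z) = cn z.
Proof. by apply: qnorm_eq (cn_ge0 _) _; rewrite cn_sq; case: z => a b /=; ring. Qed.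

Lemma qnorm_inplane_qj (z : R[i]) : qnorm (inplane qj z) = cn z.
Proof. by apply: qnorm_eq (cn_ge0 _) _; rewrite cn_sq; case: z => a b /=; ring. Qed.

(** This removes noncommutativity from the integrals: by cyclicity of [q0] the factor on the right
    of [x] moves to the left of [a], and the sandwich becomes a real combination of four scalar
    functions [q0 (c * x)]. *)
Lemma q0_inplane2 (z t : R[i]) a x : q0 (a * (inplane qi z * x * inplane qj t)) =
  complex.Re z * complex.Re t * q0 (a * x) +
  complex.Im z * complex.Re t * q0 (a * qi * x) +
  complex.Re z * complex.Im t * q0 (qj * a * x) +
  complex.Im z * complex.Im t * q0 (qj * a * qi * x).
Proof. by case: z t a x => [? ?] [? ?] [????] [????] /=; ring. Qed.

End QuaternionNorm.

Section QuaternionIntegral.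
Variable R : realType.
Local Notation plane := (measurableTypeR R * measurableTypeR R)%type.
Local Notation L := (@leb2 R).
Implicit Types F : R * R -> quat R.

Lemma measurable_qnorm F : measurable_quat F -> measurable_fun [set: plane] (fun x => qnorm (F x)).
Proof. by case=> m0 m1 m2 m3; rewrite /qnorm; msr. Qed.

Lemma measurable_q0M F a : measurable_quat F -> measurable_fun [set: plane] (fun x => q0 (a * F x)).
Proof.
case=> m0 m1 m2 m3.
have -> : (fun x => q0 (a * F x)) =
   fun x => q0 a * q0 (F x) - q1 a * q1 (F x) - q2 a * q2 (F x) - q3 a * q3 (F x) by [].
by msr.
Qed.

Definition qintg F := measurable_quat F /\ intg L (fun x => qnorm (F x)).

Lemma qintg_comp F : qintg F -> [/\ intg L (fun x => q0 (F x)), intg L (fun x => q1 (F x)),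
   intg L (fun x => q2 (F x)) & intg L (fun x => q3 (F x))].
Proof.
case=> -[m0 m1 m2 m3] iF; split; apply: (intg_dom _ iF) => // x.
- exact: q0_le.
- exact: q1_le.
- exact: q2_le.
- exact: q3_le.
Qed.

Lemma q0_Rintegral F a : qintg F ->
  q0 (a * Rintegral_quat F) = \int[L]_x q0 (a * F x).
Proof.
move=> iF; have [i0 i1 i2 i3] := qintg_comp iF.
have z c (h : R * R -> R) : intg L h -> intg L (fun x => c * h x) by exact: intgZ.
rewrite /= (RintB (intgB (intgB (z _ _ i0) (z _ _ i1)) (z _ _ i2)) (z _ _ i3)).
rewrite (RintB (intgB (z _ _ i0) (z _ _ i1)) (z _ _ i2)) (RintB (z _ _ i0) (z _ _ i1)).
by rewrite (RintZ _ i0) (RintZ _ i1) (RintZ _ i2) (RintZ _ i3).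
Qed.

Lemma qintg_mul (A B : R * R -> quat R) F (cA cB : R) : measurable_quat (fun x => A x * F x * B x) ->
  (forall x, qnorm (A x) <= cA) -> (forall x, qnorm (B x) <= cB) -> qintg F ->
  qintg (fun x => A x * F x * B x).
Proof.
move=> mAB hA hB [mF iF]; split => //.
apply: (intg_dom _ (intgZ (cA * cB) iF)); first exact: measurable_qnorm.
move=> x; rewrite ger0_norm ?qnorm_ge0 // !qnormM.
by rewrite mulrAC ler_wpM2r ?qnorm_ge0 // ler_pM ?qnorm_ge0.
Qed.

End QuaternionIntegral.

Section ComplexIntegral.
Context d (T : measurableType d) (R : realType) (mu : {measure set T -> \bar R}).
Implicit Types F : T -> R[i].

Definition cintg F := intg mu (fun x => complex.Re (F x)) /\ intg mu (fun x => complex.Im (F x)).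

Definition cint F : R[i] := Complex (\int[mu]_x complex.Re (F x)) (\int[mu]_x complex.Im (F x)).

Lemma cint_mulc F (c : R[i]) : cintg F -> cint (fun x => c * F x) = c * cint F.
Proof.
case: c => a b [iR iI]; rewrite /cint; apply: complex_eq => /=.
  by under eq_Rintegral do rewrite Re_mul /=; rewrite RintB ?RintZ //; exact: intgZ.
by under eq_Rintegral do rewrite Im_mul /=; rewrite RintD ?RintZ //; exact: intgZ.
Qed.

Definition cmeas F := measurable_fun [set: T] (fun x => complex.Re (F x)) /\
  measurable_fun [set: T] (fun x => complex.Im (F x)).

Lemma cmeas_real (f : T -> R) : measurable_fun [set: T] f -> cmeas (fun x => (f x)%:C%C).
Proof. by move=> mf; split => //=; exact: measurable_cst. Qed.

Lemma cmeas_cst (c : R[i]) : cmeas (fun=> c).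
Proof. by split; exact: measurable_cst. Qed.

Lemma cmeasD F G : cmeas F -> cmeas G -> cmeas (fun x => F x + G x).
Proof.
move=> [? ?] [? ?]; split.
  by under eq_fun do rewrite ReD; exact: measurable_funD.
by under eq_fun do rewrite ImD; exact: measurable_funD.
Qed.

Lemma cmeasM F G : cmeas F -> cmeas G -> cmeas (fun x => F x * G x).
Proof.
move=> [? ?] [? ?]; split.
  by under eq_fun do rewrite Re_mul; msr.
by under eq_fun do rewrite Im_mul; msr.
Qed.

Lemma cmeasN F : cmeas F -> cmeas (fun x => - F x).
Proof.
move=> [? ?]; split.
  by under eq_fun do rewrite ReN; msr.
by under eq_fun do rewrite ImN; msr.
Qed.

Lemma cmeas_cexp F : cmeas F -> cmeas (fun x => cexp (F x)).
Proof. by move=> [? ?]; split; rewrite /cexp /=; msr. Qed.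

Lemma cintg_dom F g : cmeas F ->
  intg mu g -> (forall x, cn (F x) <= g x) -> cintg F.
Proof.
move=> [mR mI] ig h; split; apply: (intg_dom _ ig) => // x.
  exact: le_trans (Re_le_cn _) _.
exact: le_trans (Im_le_cn _) _.
Qed.

End ComplexIntegral.

Lemma eq_intg d (T : measurableType d) (R : realType) (mu : {measure set T -> \bar R})
  (f g : T -> R) : f =1 g -> intg mu f -> intg mu g.
Proof. by move=> /funext ->. Qed.

Section GaussianFourier.
Variable R : realType.
Local Notation C := R[i].
Local Notation leb := (@lebesgue_measure R).
Implicit Types (s b w x : R) (v : C).

Definition gk s x v : C := cexp (v * x%:C%C - (x ^+ 2 / (2 * s ^+ 2))%:C%C).

(** Up to a constant, the Fourier transform of [gk s _ v] in the variable [b w]; the square is that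
    of the complex number [b w - i v]. *)
Definition gh s b w v : C :=
  cexp (- (s ^+ 2 / 2)%:C%C * ((b * w)%:C%C - 'i%C * v) ^+ 2).

Definition osc b x w : C := cexp (Complex 0 (- (b * x * w))).

Lemma cn_osc b x w : cn (osc b x w) = 1.
Proof. by rewrite cn_cexp expR0. Qed.

Lemma cn_gh s b w v : cn (gh s b w v) =
  expR (s ^+ 2 / 2 * (complex.Re v ^+ 2 - (b * w + complex.Im v) ^+ 2)).
Proof. by rewrite cn_cexp; congr expR; case: v => p q /=; field. Qed.

Lemma gh_split s b w v x : gh s b w v * osc b x w =
  cexp ((s ^+ 2 / 2)%:C%C * v ^+ 2) *
  ((expR (- (s * b * w) ^+ 2 / 2))%:C%C *
    cexp ((Complex 0 1) * ((s ^+ 2)%:C%C * b%:C%C * v - (x * b)%:C%C) * w%:C%C)).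
Proof.
rewrite /gh /osc -cexp_real -!cexpD; congr cexp.
by case: v => p q; apply: complex_eq => /=; field.
Qed.

Lemma gh_intg s b v : 0 < s -> b != 0 -> intg leb (fun w => cn (gh s b w v)).
Proof.
move=> s0 b0; have sb : 0 < s * `|b| by rewrite mulr_gt0 // normr_gt0.
apply: eq_intg (intgZ (expR (s ^+ 2 / 2 * (complex.Re v ^+ 2 - complex.Im v ^+ 2)))
  (gauss_shift_intg (- (s ^+ 2 * b * complex.Im v)) sb).1) => w; rewrite cn_gh -expRD; congr expR.
have -> : (s * `|b| * w) ^+ 2 = (s * b * w) ^+ 2.
  by rewrite !exprMn real_normK // num_real.
by field.
Qed.

Lemma cmeas_gh s b v :
  cmeas (fun w : measurableTypeR R => gh s b w v).
Proof.
apply: cmeas_cexp; apply: cmeasM; first exact: cmeas_cst.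
have h : cmeas (fun w : measurableTypeR R => (b * w)%:C%C - 'i%C * v).
  by apply: cmeasD; [apply: cmeas_real; msr|exact: cmeas_cst].
exact: (cmeasM h h).
Qed.

Lemma cmeas_osc d (T : measurableType d) b (x w : T -> R) :
  measurable_fun [set: T] x -> measurable_fun [set: T] w ->
  cmeas (fun t => osc b (x t) (w t)).
Proof. by move=> mx mw; apply: cmeas_cexp; split => /=; msr. Qed.

Lemma gh_osc_cintg s b v x : 0 < s -> b != 0 ->
  cintg leb (fun w => gh s b w v * osc b x w).
Proof.
move=> s0 b0; apply: (cintg_dom _ (gh_intg v s0 b0)).
  by apply: cmeasM; [exact: cmeas_gh|apply: cmeas_osc; msr].
by move=> w; rewrite cnM cn_osc mulr1.
Qed.

Lemma gk_fourier s b x v : 0 < s -> b != 0 ->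
  gk s x v = (s * `|b| / Num.sqrt (2 * pi))%:C%C * cint leb (fun w => gh s b w v * osc b x w).
Proof.
move=> s0 b0; have sb : 0 < s * `|b| by rewrite mulr_gt0 // normr_gt0.
have nb : `|b| ^+ 2 = b ^+ 2 by rewrite real_normK // num_real.
pose z := Complex 0 1 * ((s ^+ 2)%:C%C * b%:C%C * v - (x * b)%:C%C).
have e w : (s * `|b| * w) ^+ 2 = (s * b * w) ^+ 2 by rewrite !exprMn nb.
pose F w := (expR (- (s * `|b| * w) ^+ 2 / 2))%:C%C * cexp (z * w%:C%C).
have cF : cint leb F = (Num.sqrt (2 * pi) / (s * `|b|))%:C%C * cexp ((2 * (s * `|b|) ^+ 2)^-1%:C%C * z ^+ 2).
  rewrite -gauss_laplace //; congr Complex; apply: eq_Rintegral => w _ /=.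
    by rewrite mul0r subr0.
  by rewrite mul0r addr0.
have -> : (fun w => gh s b w v * osc b x w) = (fun w => cexp ((s ^+ 2 / 2)%:C%C * v ^+ 2) * F w).
  by apply/funext => w; rewrite gh_split /F e.
rewrite cint_mulc; last first.
  have mm := gauss_exp_moments _ sb.
  split.
    apply: eq_intg (laplace_Re_intg (measurable_gauss (s * `|b|)) (@measurable_id _ (measurableTypeR R) setT) mm z).
    by move=> w; rewrite /F ReZ.
  apply: eq_intg (laplace_Im_intg (measurable_gauss (s * `|b|)) (@measurable_id _ (measurableTypeR R) setT) mm z).
  by move=> w; rewrite /F ImZ.
rewrite cF mulrCA [X in _ * X]mulrA -rmorphM.
have -> : s * `|b| / Num.sqrt (2 * pi) * (Num.sqrt (2 * pi) / (s * `|b|)) = 1.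
  have := sb; have : 0 < Num.sqrt (2 * pi) :> R by rewrite sqrtr_gt0 mulr_gt0 // pi_gt0.
  by move: (s * _) (Num.sqrt _) => u t t0 u0; field; rewrite !gt_eqF.
rewrite mul1r -cexpD; congr cexp; rewrite /z exprMn nb.
have s1 : s != 0 by rewrite gt_eqF.
have -> : x ^+ 2 / (2 * s ^+ 2) = (2 * (s ^+ 2 * b ^+ 2))^-1 * (x * b) ^+ 2 by field; rewrite s1 b0.
have -> : s ^+ 2 / 2 = (2 * (s ^+ 2 * b ^+ 2))^-1 * (s ^+ 2 * b) ^+ 2 by field; rewrite s1 b0.
have hx : x = (2 * (s ^+ 2 * b ^+ 2))^-1 * (2 * (s ^+ 2 * b) * (x * b)) by field; rewrite s1 b0.
rewrite {1}hx; move: (2 * (s ^+ 2 * b ^+ 2))^-1 => t; move: (s ^+ 2) => s2.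
by clear; case: v => p q; apply: complex_eq => /=; ring.
Qed.

End GaussianFourier.

(** * The dual inequality *)

Lemma qnorm_sandwich (R : realType) (z t : R[i]) (a x : quat R) :
  qnorm (a * (inplane qi z * x * inplane qj t)) = qnorm a * (cn z * qnorm x * cn t).
Proof. by rewrite !qnormM qnorm_inplane_qi qnorm_inplane_qj. Qed.

Lemma q0_cycle (R : realType) (a x y z t u : quat R) :
  q0 (a * (x * y * z * (t * u))) = q0 (u * a * x * (y * z * t)).
Proof.
have -> : u * a * x * (y * z * t) = u * (a * x * y * z * t) by rewrite !mulrA.
by rewrite [RHS]q0_mulC !mulrA.
Qed.

Lemma q0_inplane2_scale (R : realType) (c d : R) (z t : R[i]) (a x : quat R) :
  q0 (a * (inplane qi (c%:C%C * z) * x * inplane qj (d%:C%C * t))) =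
  c * d * q0 (a * (inplane qi z * x * inplane qj t)).
Proof. by rewrite !q0_inplane2 !ReZ !ImZ; ring. Qed.

Lemma ae_imp d (T : measurableType d) (R : realType) (mu : {measure set T -> \bar R})
    (P Q : T -> Prop) : (forall x, P x -> Q x) ->
  {ae mu, forall x, P x} -> {ae mu, forall x, Q x}.
Proof. exact: filterS. Qed.

Lemma ae_imp2 d (T : measurableType d) (R : realType) (mu : {measure set T -> \bar R})
    (P1 P2 Q : T -> Prop) : (forall x, P1 x -> P2 x -> Q x) ->
  {ae mu, forall x, P1 x} -> {ae mu, forall x, P2 x} -> {ae mu, forall x, Q x}.
Proof. exact: filterS2. Qed.

Section DominatedFubini.
Context d1 d2 (T1 : measurableType d1) (T2 : measurableType d2) (R : realType).
Variables (m1 : {sigma_finite_measure set T1 -> \bar R})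
  (m2 : {sigma_finite_measure set T2 -> \bar R}).

Lemma dominated_fubini (h : T1 * T2 -> R) (phi : T1 -> R) (psi : T2 -> R) :
  measurable_fun [set: T1 * T2] h -> intg m1 phi -> intg m2 psi ->
  (forall x w, `|h (x, w)| <= phi x * psi w) ->
  [/\ intg m1 (fun x => \int[m2]_w h (x, w)), intg m2 (fun w => \int[m1]_x h (x, w)) &
  \int[m1]_x (\int[m2]_w h (x, w)) = \int[m2]_w (\int[m1]_x h (x, w))].
Proof.
move=> mh ip iq hle.
have ih : intg (m1 \x m2)%E h.
  by apply: (intg_dom mh (prod_intg ip iq)) => -[x w]; exact: hle.
have i1 x : intg m2 (fun w => h (x, w)).
  apply: (intg_dom _ (intgZ (phi x) iq)) => [|w]; last exact: hle.
  by apply: (measurableT_comp mh); exact: measurable_pair1.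
have i2 w : intg m1 (fun x => h (x, w)).
  apply: (intg_dom _ (intgZ (psi w) ip)) => [|x]; last by rewrite mulrC hle.
  by apply: (measurableT_comp mh); exact: measurable_pair2.
have [j1 e1] := Rint_iterated ih i1; have [j2 e2] := Rint_iterated_swap ih i2.
by split; [exact: j1|exact: j2|rewrite [LHS]e1 [RHS]e2].
Qed.

End DominatedFubini.

Section SigmaFinite.
Context d (T : measurableType d) (R : realType) (mu : {measure set T -> \bar R}).
Hypothesis mu_sf : sigma_finite [set: T] mu.
(** The same function as [mu], with the proof of sigma-finiteness recorded in its type: [leb2] is
    declared as a plain measure, while the Fubini statements take sigma-finite ones. *)
Definition sf_measure of sigma_finite [set: T] mu : set T -> \bar R := mu.
HB.instance Definition _ := isMeasure.Build _ _ _ (sf_measure mu_sf)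
  (measure0 mu) (measure_ge0 mu) (@measure_semi_sigma_additive _ _ _ mu).
HB.instance Definition _ := Measure_isSigmaFinite.Build _ _ _ (sf_measure mu_sf) mu_sf.
Definition sfm : {sigma_finite_measure set T -> \bar R} := sf_measure mu_sf.
End SigmaFinite.

Section PlaneFubini.
Variable R : realType.
Local Notation plane := (measurableTypeR R * measurableTypeR R)%type.
Local Notation leb := (@lebesgue_measure R).
Local Notation L := (@leb2 R).

Lemma leb2_prod_intg (phi psi : R -> R) : intg leb phi -> intg leb psi ->
  intg L (fun z => phi z.1 * psi z.2).
Proof. exact: prod_intg. Qed.

Lemma leb2_Rint_prod (phi psi : R -> R) : intg leb phi -> intg leb psi ->
  \int[L]_z (phi z.1 * psi z.2) = (\int[leb]_x phi x) * (\int[leb]_y psi y).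
Proof. exact: Rint_prod. Qed.

Lemma leb2_sigma_finite : sigma_finite setT (leb2 R).
Proof.
have /sigma_finiteP[F [TF ndF Foo]] := sigma_finiteT (@lebesgue_measure R).
exists (fun n => F n `*` F n).
  rewrite -setXTT TF predeqE => -[x y]; split.
    move=> [[n _ Fnx] [k _ Fky]]; exists (maxn n k) => //=; split.
      by move: (ndF _ _ (leq_maxl n k)) => /subsetPset; apply.
    by move: (ndF _ _ (leq_maxr n k)) => /subsetPset; apply.
  by move=> [n _ [??]]; split; exists n.
move=> k; have [mFk Fkoo] := Foo k; split; first exact: measurableX.
rewrite [ltLHS](_ : _ = (lebesgue_measure (F k) * lebesgue_measure (F k))%E).
  by rewrite lte_mul_pinfty// ge0_fin_numE.
exact: product_measure1E.
Qed.

Lemma leb2_fubini (h : plane * plane -> R) (phi psi : plane -> R) :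
  measurable_fun [set: plane * plane] h -> intg L phi -> intg L psi ->
  (forall x w, `|h (x, w)| <= phi x * psi w) ->
  [/\ intg L (fun x => \int[L]_w h (x, w)), intg L (fun w => \int[L]_x h (x, w)) &
  \int[L]_x (\int[L]_w h (x, w)) = \int[L]_w (\int[L]_x h (x, w))].
Proof.
exact: (dominated_fubini (m1 := sfm leb2_sigma_finite) (m2 := sfm leb2_sigma_finite)).
Qed.

Lemma Rint_norm_le_ae d (T : measurableType d) (mu : {measure set T -> \bar R}) (f g : T -> R) :
  intg mu f -> intg mu g -> {ae mu, forall x, `|f x| <= g x} ->
  `|\int[mu]_x f x| <= \int[mu]_x g x.
Proof.
move=> fi gi fg; rewrite (le_trans (le_normr_Rintegral _ fi)) //.
rewrite -lee_fin -!intg_fin //; last exact: intg_norm.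
(* [g] is known to be nonnegative only almost everywhere, so it is replaced by its positive part for
   the comparison of nonnegative integrals. *)
have mg : measurable_fun [set: T] (fun x => (Num.max (g x) 0)%:E).
  apply/measurable_EFinP.
  by apply: (measurable_maxr (g := fun=> 0)); [exact: (intg_measurable gi)|exact: measurable_cst].
apply: (@le_trans _ _ (\int[mu]_x (Num.max (g x) 0)%:E)%E).
  apply: ae_ge0_le_integral => //.
  - exact: (measurable_int _ (intg_norm fi)).
  - by move=> x _ /=; rewrite lee_fin le_max lexx orbT.
  - by apply: filterS fg => x h _ /=; rewrite lee_fin le_max h.
rewrite le_eqVlt; apply/orP; left; apply/eqP.
apply: ae_eq_integral => //.
- exact: (measurable_int _ gi).
by apply: filterS fg => x h _; rewrite max_l // (le_trans _ h).
Qed.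

End PlaneFubini.

Section GaussianDuality.
Variable R : realType.
Local Notation C := R[i].
Local Notation plane := (measurableTypeR R * measurableTypeR R)%type.
Local Notation leb := (@lebesgue_measure R).
Local Notation L := (@leb2 R).
Variables (b1 b2 : R) (g : R * R -> quat R).
Hypotheses (b1_neq0 : b1 != 0) (b2_neq0 : b2 != 0) (ig : qintg g).

Definition qwave (x w : R * R) : quat R :=
  inplane qi (osc b1 x.1 w.1) * g x * inplane qj (osc b2 x.2 w.2).

Definition qft (w : R * R) : quat R := Rintegral_quat (qwave^~ w).

Lemma measurable_inplane2 d (T : measurableType d) (A B : T -> C) (G : T -> quat R) a :
  cmeas A -> cmeas B -> (forall c, measurable_fun [set: T] (fun t => q0 (c * G t))) ->
  measurable_fun [set: T] (fun t => q0 (a * (inplane qi (A t) * G t * inplane qj (B t)))).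
Proof.
move=> [? ?] [? ?] mG; under eq_fun do rewrite q0_inplane2.
have := (mG a, mG (a * qi), mG (qj * a), mG (qj * a * qi)) => -[[[? ?] ?] ?].
by apply: measurable_funD; first apply: measurable_funD; first apply: measurable_funD;
  (apply: measurable_funM; first apply: measurable_funM).
Qed.

Lemma measurable_quat_q0M (F : R * R -> quat R) :
  (forall c, measurable_fun [set: plane] (fun t => q0 (c * F t))) -> measurable_quat F.
Proof.
move=> h.
have e0 : (fun t => q0 (F t)) = (fun t => q0 (Quat 1 0 0 0 * F t)).
  by apply/funext => t; case: (F t) => ? ? ? ? /=; ring.
have e1 : (fun t => q1 (F t)) = (fun t => q0 (Quat 0 (-1) 0 0 * F t)).
  by apply/funext => t; case: (F t) => ? ? ? ? /=; ring.
have e2 : (fun t => q2 (F t)) = (fun t => q0 (Quat 0 0 (-1) 0 * F t)).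
  by apply/funext => t; case: (F t) => ? ? ? ? /=; ring.
have e3 : (fun t => q3 (F t)) = (fun t => q0 (Quat 0 0 0 (-1) * F t)).
  by apply/funext => t; case: (F t) => ? ? ? ? /=; ring.
by split; [rewrite e0|rewrite e1|rewrite e2|rewrite e3]; exact: h.
Qed.

Lemma qwave_intg w : qintg (qwave^~ w).
Proof.
have [mg _] := ig; apply: (qintg_mul (cA := 1) (cB := 1)) => //.
- apply: measurable_quat_q0M => c; apply: measurable_inplane2.
  + by apply: cmeas_osc; msr.
  + by apply: cmeas_osc; msr.
  + by move=> c'; exact: measurable_q0M.
- by move=> x; rewrite qnorm_inplane_qi cn_osc.
- by move=> x; rewrite qnorm_inplane_qj cn_osc.
Qed.

Variables (s : R) (v1 v2 : C) (a : quat R).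
Hypothesis s_gt0 : 0 < s.

Let G1 (w : R * R) := gh s b1 w.1 v1.
Let G2 (w : R * R) := gh s b2 w.2 v2.
Let h (z : plane * plane) : R :=
  q0 (a * (inplane qi (G1 z.2 * osc b1 z.1.1 z.2.1) * g z.1 *
           inplane qj (G2 z.2 * osc b2 z.1.2 z.2.2))).

Lemma gh2_intg : intg L (fun w => cn (G1 w) * cn (G2 w)).
Proof. by apply: (leb2_prod_intg (phi := fun t => cn (gh s b1 t v1)) (psi := fun t => cn (gh s b2 t v2))); exact: gh_intg. Qed.

Let measurable_h : measurable_fun [set: plane * plane] h.
Proof.
have [mg _] := ig; rewrite /h; apply: measurable_inplane2.
- apply: cmeasM; last by apply: cmeas_osc; apply: measurableT_comp; msr.
  have [? ?] := cmeas_gh s b1 v1.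
  by split; apply: (measurableT_comp (f := fun t => _ (gh s b1 t v1))) => //; apply: measurableT_comp; msr.
- apply: cmeasM; last by apply: cmeas_osc; apply: measurableT_comp; msr.
  have [? ?] := cmeas_gh s b2 v2.
  by split; apply: (measurableT_comp (f := fun t => _ (gh s b2 t v2))) => //; apply: measurableT_comp; msr.
- move=> c; apply: (measurableT_comp (f := fun t => q0 (c * g t))); first exact: measurable_q0M.
  exact: measurable_fst.
Qed.

Let h_le x w : `|h (x, w)| <= (qnorm a * qnorm (g x)) * (cn (G1 w) * cn (G2 w)).
Proof.
have -> : qnorm a * qnorm (g x) * (cn (G1 w) * cn (G2 w)) =
    qnorm a * (cn (G1 w) * 1 * qnorm (g x) * (cn (G2 w) * 1)) by ring.
rewrite /h; apply: le_trans (q0_le _) _.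
by rewrite qnorm_sandwich 2!cnM 2!cn_osc lexx.
Qed.

Let int_h_x w : \int[L]_x h (x, w) =
  q0 (inplane qj (G2 w) * a * inplane qi (G1 w) * qft w).
Proof.
rewrite q0_Rintegral; last exact: qwave_intg.
apply: eq_Rintegral => x _; rewrite /h /qwave inplane_qiM (mulrC (G2 _)) inplane_qjM.
exact: q0_cycle.
Qed.

Let A1 (x : R * R) (t : R) := gh s b1 t v1 * osc b1 x.1 t.
Let A2 (x : R * R) (t : R) := gh s b2 t v2 * osc b2 x.2 t.

Let int_h_w x : \int[L]_w h (x, w) =
  q0 (a * (inplane qi (cint leb (A1 x)) * g x * inplane qj (cint leb (A2 x)))).
Proof.
have [r1 i1] := gh_osc_cintg v1 x.1 s_gt0 b1_neq0.
have [r2 i2] := gh_osc_cintg v2 x.2 s_gt0 b2_neq0.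
rewrite q0_inplane2 -!leb2_Rint_prod //.
have p (c : R) (phi psi : R -> R) : intg leb phi -> intg leb psi ->
  intg L (fun w => phi w.1 * psi w.2 * c) /\
  \int[L]_w (phi w.1 * psi w.2 * c) = \int[L]_w (phi w.1 * psi w.2) * c.
  move=> iphi ipsi; have ip := leb2_prod_intg iphi ipsi; split.
    by apply: eq_intg (intgZ c ip) => w; rewrite mulrC.
  by rewrite mulrC -RintZ //; apply: eq_Rintegral => w _; rewrite mulrC.
have [j1 <-] := p (q0 (a * g x)) _ _ r1 r2.
have [j2 <-] := p (q0 (a * qi * g x)) _ _ i1 r2.
have [j3 <-] := p (q0 (qj * a * g x)) _ _ r1 i2.
have [j4 <-] := p (q0 (qj * a * qi * g x)) _ _ i1 i2.
rewrite -(RintD j1 j2) -(RintD (intgD j1 j2) j3) -(RintD (intgD (intgD j1 j2) j3) j4).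
by apply: eq_Rintegral => w _; exact: q0_inplane2.
Qed.

(** The double integral of [h] is computed in both orders. Integrating over [w] first rebuilds the
    Gaussians [gk] by [gk_fourier]; integrating over [x] first produces the transform [qft], placed
    between the factors [gh], whose norm is at most [H]. *)
Lemma gaussian_duality (H : R * R -> R) :
  {ae L, forall w, qnorm (qft w) <= H w} -> intg L (fun w => cn (G1 w) * cn (G2 w) * H w) ->
  `|\int[L]_x q0 (a * (inplane qi (gk s x.1 v1) * g x * inplane qj (gk s x.2 v2)))| <=
  (s * `|b1| / Num.sqrt (2 * pi)) * (s * `|b2| / Num.sqrt (2 * pi)) * qnorm a *
    \int[L]_w (cn (G1 w) * cn (G2 w) * H w).
Proof.
move=> qH iH; set c1 := s * `|b1| / _; set c2 := s * `|b2| / _.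
have c1_ge0 : 0 <= c1 by rewrite /c1 mulr_ge0 ?invr_ge0 ?sqrtr_ge0 // mulr_ge0 // ltW.
have c2_ge0 : 0 <= c2 by rewrite /c2 mulr_ge0 ?invr_ge0 ?sqrtr_ge0 // mulr_ge0 // ltW.
have [ihx ihw e] := leb2_fubini measurable_h (intgZ (qnorm a) ig.2) gh2_intg h_le.
have -> : \int[L]_x q0 (a * (inplane qi (gk s x.1 v1) * g x * inplane qj (gk s x.2 v2))) =
    (c1 * c2) * \int[L]_w \int[L]_x h (x, w).
  rewrite -e -(RintZ _ ihx); congr (Rintegral _ _ _); apply/funext => x.
  rewrite int_h_w (gk_fourier _ _ s_gt0 b1_neq0) (gk_fourier _ _ s_gt0 b2_neq0) -/c1 -/c2.
  exact: q0_inplane2_scale.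
have : `|\int[L]_w \int[L]_x h (x, w)| <= qnorm a * \int[L]_w (cn (G1 w) * cn (G2 w) * H w).
  rewrite -(RintZ _ iH); apply: Rint_norm_le_ae ihw (intgZ _ iH) _.
  apply: (ae_imp _ qH) => w qw; rewrite int_h_x; apply: le_trans (q0_le _) _.
  have -> : qnorm a * (cn (G1 w) * cn (G2 w) * H w) = cn (G2 w) * qnorm a * cn (G1 w) * H w by ring.
  rewrite !qnormM qnorm_inplane_qi qnorm_inplane_qj.
  apply: ler_wpM2l qw; apply: mulr_ge0 (cn_ge0 _).
  exact: mulr_ge0 (cn_ge0 _) (qnorm_ge0 _).
move: (\int[L]_w _) (\int[L]_w _) => J K JK.
rewrite normrM (ger0_norm (mulr_ge0 c1_ge0 c2_ge0)) -[leRHS]mulrA.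
exact: ler_wpM2l (mulr_ge0 c1_ge0 c2_ge0) _ _ JK.
Qed.

End GaussianDuality.

Lemma Rint_dominated d (T : measurableType d) (R : realType) (mu : {measure set T -> \bar R})
    (h_ : nat -> T -> R) (h k : T -> R) :
  (forall n, measurable_fun [set: T] (h_ n)) -> measurable_fun [set: T] h -> intg mu k ->
  (forall n x, `|h_ n x| <= k x) -> {ae mu, forall x, h_ n x @[n --> \oo] --> h x} ->
  (\int[mu]_x h_ n x) @[n --> \oo] --> \int[mu]_x h x.
Proof.
move=> mh_ mh ik hk hcvg.
have hc : {ae mu, forall x, [set: T] x -> (h_ n x)%:E @[n --> \oo] --> (h x)%:E}.
  by apply: (ae_imp _ hcvg) => x hx _; apply: cvg_EFin; [exact: nearW|exact: hx].
have [ih _ c] := @dominated_convergence _ _ _ mu setT measurableT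
  (fun n x => (h_ n x)%:E) (EFin \o h) (EFin \o k)
  (fun n => (measurable_EFinP _ _).2 (mh_ n)) ((measurable_EFinP _ _).2 mh)
  hc ik
  (aeW _ (fun x n _ => hk n x)).
have ih_ n : intg mu (h_ n) by apply: (intg_dom (mh_ n) ik).
apply: fine_cvg; move: c; rewrite (intg_fin ih) /=.
by under eq_fun do rewrite /= (intg_fin (ih_ _)).
Qed.

(** * Square integrable functions and their approximation by integrable ones *)

Section SquareIntegrable.
Variable R : realType.
Local Notation plane := (measurableTypeR R * measurableTypeR R)%type.
Local Notation L := (@leb2 R).
Implicit Types F G : R * R -> quat R.

Lemma Lnorm2E d (T : measurableType d) (mu : {measure set T -> \bar R}) (h : T -> R) :
  (forall x, 0 <= h x) ->
  Lnorm mu 2%:E (fun x => (h x)%:E) = ((\int[mu]_x (h x ^+ 2)%:E) `^ 2^-1)%E.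
Proof.
move=> h0; rewrite unlock; congr (_ `^ _)%E; apply: eq_integral => x _ /=.
by rewrite ger0_norm // powR_mulrn.
Qed.

Lemma LpH1P F : LpH 1%E F <-> qintg F.
Proof.
rewrite /LpH /qintg /=; split => -[mF iF]; split => //.
  exact/Lfun1_integrable.
exact/Lfun1_integrable.
Qed.

Definition sq_intg F := measurable_quat F /\ intg L (fun x => qnorm (F x) ^+ 2).

Lemma LpH2P F : LpH 2%:E F <-> sq_intg F.
Proof.
rewrite /LpH /=; split => -[mF iF]; split => //.
  exact: (Lfun2_integrable_sqr iF).
rewrite inE; apply/andP; split; rewrite inE /=; first exact: measurable_qnorm.
rewrite /finite_norm Lnorm2E; last by move=> x; exact: qnorm_ge0.
by rewrite intg_fin // poweR_lty // ltry.
Qed.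

Lemma L2dist_intg F G : intg L (fun x => qnorm (F x - G x) ^+ 2) ->
  L2dist F G = (Num.sqrt (\int[L]_x qnorm (F x - G x) ^+ 2))%:E.
Proof.
move=> iFG; rewrite /L2dist Lnorm2E; last by move=> x; exact: qnorm_ge0.
rewrite intg_fin // poweR_EFin powR12_sqrt //.
by apply: Rintegral_ge0 => x _; exact: sqr_ge0.
Qed.

Lemma L2dist_ltP F G (e : R) : 0 < e -> measurable_quat (fun x => F x - G x) ->
  (L2dist F G < e%:E)%E <->
  intg L (fun x => qnorm (F x - G x) ^+ 2) /\ \int[L]_x qnorm (F x - G x) ^+ 2 < e ^+ 2.
Proof.
move=> e0 mFG; have I0 : 0 <= \int[L]_x qnorm (F x - G x) ^+ 2.
  by apply: Rintegral_ge0 => x _; exact: sqr_ge0.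
have e1 : (Num.sqrt (\int[L]_x qnorm (F x - G x) ^+ 2) < e) =
    (\int[L]_x qnorm (F x - G x) ^+ 2 < e ^+ 2).
  by rewrite -[RHS]ltr_sqrt ?exprn_gt0 // sqrtr_sqr gtr0_norm.
split=> [h|[iFG]]; last by rewrite L2dist_intg // lte_fin e1.
have iFG : intg L (fun x => qnorm (F x - G x) ^+ 2).
  apply: intg_ge0; first by apply: measurable_exp_comp; exact: measurable_qnorm.
    by move=> x; exact: sqr_ge0.
  move: (lt_trans h (ltry e)); rewrite /L2dist Lnorm2E; last by move=> x; exact: qnorm_ge0.
  by apply: lty_poweRy.
by split => //; move: h; rewrite L2dist_intg // lte_fin e1.
Qed.

Lemma AMGM (x y : R) : x * y <= x ^+ 2 + y ^+ 2.
Proof. by have := sqr_ge0 (x - y); have := sqr_ge0 x; have := sqr_ge0 y; nra. Qed.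

End SquareIntegrable.

Section Truncation.
Variable R : realType.
Local Notation plane := (measurableTypeR R * measurableTypeR R)%type.
Local Notation leb := (@lebesgue_measure R).
Local Notation L := (@leb2 R).
Implicit Types F G : R * R -> quat R.

Lemma gauss2_intg (e : R) : 0 < e -> intg L (fun x => expR (- (e * x.1) ^+ 2 / 2) * expR (- (e * x.2) ^+ 2 / 2)).
Proof.
move=> e0; have [i _] := gauss_shift_intg 0 e0.
have i' : intg leb (fun w => expR (- (e * w) ^+ 2 / 2)).
  by apply: eq_intg i => w; rewrite mul0r addr0.
exact: (leb2_prod_intg i' i').
Qed.

Lemma enorm_sq (x : R * R) : enorm x ^+ 2 = x.1 ^+ 2 + x.2 ^+ 2.
Proof. by rewrite sqr_sqrtr // addr_ge0 ?sqr_ge0. Qed.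

Lemma enorm_ge0 (x : R * R) : 0 <= enorm x. Proof. exact: sqrtr_ge0. Qed.

Lemma gauss_enorm_intg (e : R) : 0 < e -> intg L (fun x => expR (- (e * enorm x ^+ 2))).
Proof.
move=> e0; have s0 : 0 < Num.sqrt (2 * e) by rewrite sqrtr_gt0 mulr_gt0.
apply: eq_intg (gauss2_intg s0) => x; rewrite -expRD enorm_sq; congr expR.
by rewrite !exprMn sqr_sqrtr ?mulr_ge0 ?ltW //; field.
Qed.

Lemma measurable_enorm : measurable_fun [set: plane] (fun x : plane => enorm x).
Proof. by rewrite /enorm; msr. Qed.

Lemma measurable_quatZ (c : R * R -> R) F : measurable_fun [set: plane] c -> measurable_quat F ->
  measurable_quat (fun x => c x *: F x).
Proof. by move=> mc [m0 m1 m2 m3]; split => /=; exact: measurable_funM. Qed.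

Lemma qnormZ (c : R) q : qnorm (c *: q) = `|c| * qnorm q.
Proof.
apply: qnorm_eq; first by rewrite mulr_ge0 ?qnorm_ge0.
by rewrite exprMn qnorm_sq real_normK ?num_real //=; ring.
Qed.

(** Multiplying by [exp (- |x|^2 / (n + 1))] makes a square integrable function integrable, as a
    product of two square integrable ones, and the products converge to [F] in the square norm by
    dominated convergence. *)
Lemma approx_L1 F (e : R) : 0 < e -> sq_intg F ->
  exists G, [/\ qintg G, sq_intg G & (L2dist G F < e%:E)%E].
Proof.
move=> e0 [mF iF].
pose c (n : nat) (x : R * R) : R := expR (- (n.+1%:R^-1 * enorm x ^+ 2)).
have mc n : measurable_fun [set: plane] (c n) by have := measurable_enorm => me; rewrite /c; msr.
have c1 n x : 0 <= c n x <= 1.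
  by rewrite expR_ge0 -[leRHS]expR0 ler_expR oppr_le0 mulr_ge0 ?invr_ge0 ?sqr_ge0.
pose G n x := c n x *: F x.
have mG n : measurable_quat (G n) by exact: measurable_quatZ.
have nG n x : qnorm (G n x) = c n x * qnorm (F x).
  by rewrite qnormZ ger0_norm //; case/andP: (c1 n x).
have iG n : qintg (G n).
  split=> //; apply: (intg_dom _ (intgD (gauss_enorm_intg (e := 2 * n.+1%:R^-1) _) iF)) => [||x].
  - exact: measurable_qnorm.
  - by rewrite mulr_gt0 // invr_gt0.
  - rewrite ger0_norm ?qnorm_ge0 // nG.
    have -> : expR (- (2 * n.+1%:R^-1 * enorm x ^+ 2)) = c n x ^+ 2.
      by rewrite [RHS]expr2 -expRD; congr expR; ring.
    exact: AMGM.
have sG n : sq_intg (G n).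
  split=> //; apply: (intg_dom _ iF) => [|x].
    by apply: measurable_exp_comp; exact: measurable_qnorm.
  rewrite ger0_norm ?sqr_ge0 // nG exprMn ler_piMl ?sqr_ge0 //.
  by have /andP[? ?] := c1 n x; rewrite expr_le1.
have eGF n x : qnorm (G n x - F x) ^+ 2 = (1 - c n x) ^+ 2 * qnorm (F x) ^+ 2.
  have -> : G n x - F x = (c n x - 1) *: F x by rewrite scalerBl scale1r.
  by rewrite qnormZ exprMn real_normK ?num_real // -sqrrN opprB.
have mD n : measurable_quat (fun x => G n x - F x).
  have -> : (fun x => G n x - F x) = (fun x => (c n x - 1) *: F x).
    by apply/funext => x; rewrite scalerBl scale1r.
  by apply: measurable_quatZ => //; apply: measurable_funB; msr.
have iD n : intg L (fun x => qnorm (G n x - F x) ^+ 2).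
  apply: (intg_dom _ iF) => [|x]; first by apply: measurable_exp_comp; exact: measurable_qnorm.
  rewrite ger0_norm ?sqr_ge0 // eGF ler_piMl ?sqr_ge0 //.
  by have /andP[] := c1 n x; move: (c n x) => t t0 t1; nra.
have m2 n : measurable_fun [set: plane] (fun x => qnorm (G n x - F x) ^+ 2).
  by apply: measurable_exp_comp; exact: measurable_qnorm.
have d2 n x : `|qnorm (G n x - F x) ^+ 2| <= qnorm (F x) ^+ 2.
  rewrite ger0_norm ?sqr_ge0 // eGF ler_piMl ?sqr_ge0 //.
  by have /andP[] := c1 n x; move: (c n x) => t t0 t1; nra.
have c2 : {ae L, forall x, (qnorm (G n x - F x) ^+ 2) @[n --> \oo] --> (0 : R)}.
  apply: aeW => x.
  have cc : c n x @[n --> \oo] --> (1 : R).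
    rewrite -expR0 /c; apply: continuous_cvg; first exact: continuous_expR.
    rewrite -[X in _ --> X]oppr0; apply: cvgN.
    rewrite -[X in _ --> X](mul0r (enorm x ^+ 2)); apply: cvgMl.
    exact: cvg_harmonic.
  rewrite (_ : (fun n => qnorm (G n x - F x) ^+ 2) =
    (fun n => (1 - c n x) ^+ 2 * qnorm (F x) ^+ 2)); last by apply/funext.
  rewrite -[X in _ --> X](mul0r (qnorm (F x) ^+ 2)); apply: cvgMl.
  rewrite -[X in _ --> X](expr0n _ 2) -[X in X ^+ 2](subrr 1).
  have cc1 : (1 - c n x) @[n --> \oo] --> (1 - 1 : R) by exact: cvgB (cvg_cst _) cc.
  exact: (cvgM cc1 cc1).
have m0 : measurable_fun [set: plane] (fun=> 0 : R) by exact: measurable_cst.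
have := Rint_dominated m2 m0 iF d2 c2.
rewrite (_ : \int[L]_x 0 = 0); last by rewrite /Rintegral integral0.
move=> /cvgr0Pnorm_lt /(_ (e ^+ 2) (exprn_gt0 _ e0)) [n _ /(_ n (leqnn n)) /=].
rewrite ger0_norm; last by apply: Rintegral_ge0 => x _; exact: sqr_ge0.
by move=> h; exists (G n); split => //; apply/L2dist_ltP.
Qed.

End Truncation.

Lemma q0_inj (R : realType) (x y : quat R) : (forall a, q0 (a * x) = q0 (a * y)) -> x = y.
Proof.
case: x y => [x0 x1 x2 x3] [y0 y1 y2 y3] h.
have := h (Quat 1 0 0 0); have := h (Quat 0 1 0 0); have := h (Quat 0 0 1 0); have := h (Quat 0 0 0 1).
by rewrite /= => h3 h2 h1 h0; congr Quat; lra.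
Qed.

Lemma qnormD (R : rcfType) (x y : quat R) : qnorm (x + y) <= qnorm x + qnorm y.
Proof.
rewrite -ler_sqr ?nnegrE ?addr_ge0 ?qnorm_ge0 // sqrrD !qnorm_sq.
pose y' := Quat (q0 y) (- q1 y) (- q2 y) (- q3 y).
have -> : qnorm y = qnorm y' by rewrite /qnorm /= !sqrrN.
have := le_trans (ler_norm _) (q0_le (x * y')); rewrite qnormM.
move: (qnorm x * qnorm y') => q; rewrite q0M /=; lra.
Qed.

(** * Gaussian duality for the transform on square integrable functions *)

Section L2Duality.
Variable R : realType.
Local Notation C := R[i].
Local Notation plane := (measurableTypeR R * measurableTypeR R)%type.
Local Notation leb := (@lebesgue_measure R).
Local Notation L := (@leb2 R).
Variables (mu1 mu2 : qpft_param R).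
Hypotheses (hb1 : pb mu1 != 0) (hb2 : pb mu2 != 0).
Local Notation b1 := (pb mu1).
Local Notation b2 := (pb mu2).
Implicit Types (F : R * R -> quat R) (x w : R * R) (a : quat R).

Definition chirp (mu : qpft_param R) (t : R) : C :=
  cexp (Complex 0 (- (pa mu * t ^+ 2 + pd mu * t))).

Definition demod F x : quat R :=
  inplane qi (chirp mu1 x.1) * F x * inplane qj (chirp mu2 x.2).

Lemma cn_chirp (mu : qpft_param R) (t : R) : cn (chirp mu t) = 1.
Proof. by rewrite cn_cexp expR0. Qed.

Lemma cmeas_chirp d (T : measurableType d) mu (t : T -> R) : measurable_fun [set: T] t ->
  cmeas (fun y => chirp mu (t y)).
Proof. by move=> mt; apply: cmeas_cexp; split => /=; msr. Qed.

Lemma qnorm_demod F x : qnorm (demod F x) = qnorm (F x).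
Proof. by rewrite !qnormM qnorm_inplane_qi qnorm_inplane_qj !cn_chirp mul1r mulr1. Qed.

Lemma measurable_demod F : measurable_quat F -> measurable_quat (demod F).
Proof.
move=> mF; apply: measurable_quat_q0M => c; apply: measurable_inplane2.
- by apply: cmeas_chirp; msr.
- by apply: cmeas_chirp; msr.
- by move=> c'; exact: measurable_q0M.
Qed.

Lemma demod_qintg F : qintg F -> qintg (demod F).
Proof.
move=> [mF iF]; split; first exact: measurable_demod.
by apply: eq_intg iF => x; rewrite qnorm_demod.
Qed.

Lemma demod_sq_intg F : sq_intg F -> sq_intg (demod F).
Proof.
move=> [mF iF]; split; first exact: measurable_demod.
by apply: eq_intg iF => x; rewrite qnorm_demod.
Qed.

Lemma demodB F G x : demod (fun x => F x - G x) x = demod F x - demod G x.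
Proof. by rewrite /demod mulrBr mulrBl. Qed.

Definition amp (mu : qpft_param R) (w : R) : C :=
  sqrtc (Complex 0 (pb mu / (2 * pi))) * cexp (Complex 0 (- (pc mu * w ^+ 2 + pe mu * w))).

(** The quadratic phase separates into a part in [w] of constant modulus, the oscillation [b x w]
    and a chirp in [x]. All moduli below therefore see only the Fourier kernel at frequency
    [b w]. *)
Lemma kernel_split (mu : qpft_param R) (x w : R) :
  sqrtc (Complex 0 (pb mu / (2 * pi))) * cexp (Complex 0 (- qphase mu x w)) =
  amp mu w * (osc (pb mu) x w * chirp mu x).
Proof.
rewrite /amp /osc /chirp -!mulrA -!cexpD; congr (_ * cexp _).
by apply: complex_eq => /=; rewrite /qphase; ring.
Qed.

Lemma Rintegral_quat_mul F (x y : quat R) : qintg F -> qintg (fun t => x * F t * y) ->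
  Rintegral_quat (fun t => x * F t * y) = x * Rintegral_quat F * y.
Proof.
move=> iF ixFy; apply: q0_inj => a; rewrite q0_Rintegral //.
have e t : q0 (a * (x * t * y)) = q0 (y * a * x * t).
  by rewrite -!(mulrA y) [RHS]q0_mulC !mulrA.
by rewrite e q0_Rintegral //; apply: eq_Rintegral => t _; exact: e.
Qed.

Lemma inplane_expu_qi (z : C) (t : R) : inplane qi z * expu qi t = inplane qi (z * cexp (Complex 0 t)).
Proof. by rewrite inplane_qiM; congr (_ * inplane _ _); rewrite /cexp /= expR0 !mul1r. Qed.

Lemma inplane_expu_qj (z : C) (t : R) : inplane qj z * expu qj t = inplane qj (z * cexp (Complex 0 t)).
Proof. by rewrite inplane_qjM; congr (_ * inplane _ _); rewrite /cexp /= expR0 !mul1r. Qed.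

Lemma qnorm_QQPFT F w : qintg F ->
  qnorm (QQPFT mu1 mu2 F w) = cn (amp mu1 w.1) * qnorm (qft b1 b2 (demod F) w) * cn (amp mu2 w.2).
Proof.
move=> iF; have iw := qwave_intg b1 b2 (demod_qintg iF) w.
have e x : qpft_kernel qi mu1 x.1 w.1 * F x * qpft_kernel qj mu2 x.2 w.2 =
    inplane qi (amp mu1 w.1) * qwave b1 b2 (demod F) x w * inplane qj (amp mu2 w.2).
  rewrite /qpft_kernel inplane_expu_qi inplane_expu_qj !kernel_split /qwave /demod.
  rewrite (mulrC (amp mu2 _)) (mulrC (osc _ _ w.2)) !inplane_qiM !inplane_qjM.
  by rewrite !mulrA.
have i2 : qintg (fun x => inplane qi (amp mu1 w.1) * qwave b1 b2 (demod F) x w * inplane qj (amp mu2 w.2)).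
  apply: (qintg_mul (A := fun=> _) (B := fun=> _) (cA := cn (amp mu1 w.1)) (cB := cn (amp mu2 w.2))) => //.
  - apply: measurable_quat_q0M => c; apply: (measurable_inplane2 (A := fun=> _) (B := fun=> _)).
    + exact: cmeas_cst.
    + exact: cmeas_cst.
    + by move=> c'; apply: measurable_q0M; exact: iw.1.
  - by move=> x; rewrite qnorm_inplane_qi.
  - by move=> x; rewrite qnorm_inplane_qj.
rewrite /QQPFT (_ : (fun x => _) = (fun x => inplane qi (amp mu1 w.1) *
   qwave b1 b2 (demod F) x w * inplane qj (amp mu2 w.2))); last exact/funext.
by rewrite Rintegral_quat_mul // !qnormM qnorm_inplane_qi qnorm_inplane_qj.
Qed.

Lemma cn_amp (mu : qpft_param R) (w : R) : pb mu != 0 -> cn (amp mu w) = cn (amp mu 0) /\ 0 < cn (amp mu 0).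
Proof.
have c1 (t : R) : cn (cexp (Complex 0 t)) = 1 by rewrite cn_cexp expR0.
move=> b0; rewrite /amp !cnM !c1 mulr1; split => //.
rewrite cn_gt0 sqrtc_eq0; apply/eqP => -[/eqP].
by apply/negP; rewrite mulf_neq0 // invr_eq0 mulf_neq0 // gt_eqF // pi_gt0.
Qed.

Variable T : (R * R -> quat R) -> (R * R -> quat R).
Hypothesis hT : is_QQPFT_L2 mu1 mu2 T.

Lemma T_sq_intg F : sq_intg F -> sq_intg (T F).
Proof. by move=> /LpH2P hF; apply/LpH2P; case: hT => h _ _; exact: h. Qed.

Definition amp_cst : R := (cn (amp mu1 0) * cn (amp mu2 0))^-1.

Lemma amp_cst_ge0 : 0 <= amp_cst.
Proof. by rewrite invr_ge0 mulr_ge0 ?cn_ge0. Qed.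

Lemma qft_T F : qintg F -> sq_intg F ->
  {ae L, forall w, qnorm (qft b1 b2 (demod F) w) <= amp_cst * qnorm (T F w)}.
Proof.
move=> i1 i2; case: hT => _ _ /(_ F ((LpH1P F).2 i1) ((LpH2P F).2 i2)).
apply: ae_imp => w ->; rewrite qnorm_QQPFT // /amp_cst.
have [-> h1] := cn_amp w.1 hb1; have [-> h2] := cn_amp w.2 hb2.
by le_eq; move: (qnorm _) h1 h2 => q h1 h2; field; rewrite !gt_eqF.
Qed.

Variables (s : R) (v1 v2 : C).
Hypothesis s_gt0 : 0 < s.

Definition gk2 x : R := cn (gk s x.1 v1) * cn (gk s x.2 v2).
Definition gh2 w : R := cn (gh s b1 w.1 v1) * cn (gh s b2 w.2 v2).

Lemma cn_gk (t : R) v : cn (gk s t v) = expR (complex.Re v * t - t ^+ 2 / (2 * s ^+ 2)).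
Proof. by rewrite cn_cexp; congr expR; case: v => p q /=; ring. Qed.

Lemma gk2_sq_intg : intg L (fun x => gk2 x ^+ 2).
Proof.
have s1 : s != 0 by rewrite gt_eqF.
have i (v : C) : intg leb (fun t => cn (gk s t v) ^+ 2).
  have b0 : 0 < Num.sqrt 2 / s by rewrite divr_gt0 // sqrtr_gt0.
  apply: eq_intg (gauss_shift_intg (2 * complex.Re v) b0).1 => t.
  rewrite cn_gk [RHS]expr2 -expRD; congr expR.
  by rewrite !exprMn sqr_sqrtr // exprVn; field.
by apply: eq_intg (leb2_prod_intg (i v1) (i v2)) => x; rewrite exprMn.
Qed.

Lemma gh2_sq_intg : intg L (fun w => gh2 w ^+ 2).
Proof.
have s2 : 0 < Num.sqrt 2 * s by rewrite mulr_gt0 // sqrtr_gt0.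
have i b v : b != 0 -> intg leb (fun t => cn (gh s b t v) ^+ 2).
  move=> b0; apply: eq_intg (gh_intg v s2 b0) => t.
  rewrite !cn_gh [RHS]expr2 -expRD; congr expR.
  by rewrite exprMn sqr_sqrtr //; field.
by apply: eq_intg (leb2_prod_intg (i _ v1 hb1) (i _ v2 hb2)) => x; rewrite exprMn.
Qed.

Lemma measurable_gk2 : measurable_fun [set: plane] gk2.
Proof.
rewrite /gk2; under eq_fun do rewrite !cn_gk.
by msr.
Qed.

Lemma measurable_gh2 : measurable_fun [set: plane] gh2.
Proof.
rewrite /gh2; under eq_fun do rewrite !cn_gh.
by msr.
Qed.

Lemma gk2_ge0 x : 0 <= gk2 x. Proof. by rewrite mulr_ge0 ?cn_ge0. Qed.
Lemma gh2_ge0 x : 0 <= gh2 x. Proof. by rewrite mulr_ge0 ?cn_ge0. Qed.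

(** The Cauchy-Schwarz inequality in additive form. The weight [e] stays free because the lemma is
    applied with a second integral of size [e^2], which then contributes only a multiple of [e]. *)
Lemma weighted_intg (k h : plane -> R) (e : R) : 0 < e ->
  measurable_fun [set: plane] k -> measurable_fun [set: plane] h ->
  (forall x, 0 <= k x) -> (forall x, 0 <= h x) ->
  intg L (fun x => k x ^+ 2) -> intg L (fun x => h x ^+ 2) ->
  intg L (fun x => k x * h x) /\
  \int[L]_x (k x * h x) <= e * \int[L]_x (k x ^+ 2) + e^-1 * \int[L]_x (h x ^+ 2).
Proof.
move=> e0 mk mh k0 h0 ik ih.
have le x : k x * h x <= e * k x ^+ 2 + e^-1 * h x ^+ 2.
  have := AMGM (Num.sqrt e * k x) (Num.sqrt e^-1 * h x).
  have e1 : 0 <= e by exact: ltW.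
  have eV : 0 <= e^-1 by rewrite invr_ge0.
  rewrite (exprMn _ (Num.sqrt e)) (exprMn _ (Num.sqrt e^-1)) !sqr_sqrtr //.
  by rewrite mulrACA -sqrtrM // mulfV ?gt_eqF // sqrtr1 mul1r.
have i2 := intgD (intgZ e ik) (intgZ e^-1 ih).
have i1 : intg L (fun x => k x * h x).
  apply: (intg_dom _ i2) => [|x]; first by msr.
  by rewrite ger0_norm ?mulr_ge0.
split => //; rewrite -(RintZ _ ik) -(RintZ _ ih) -RintD; [|exact: intgZ|exact: intgZ].
exact: Rint_le.
Qed.

Definition gsand F a x : R := q0 (a * (inplane qi (gk s x.1 v1) * F x * inplane qj (gk s x.2 v2))).

Lemma gsand_le F a x : `|gsand F a x| <= qnorm a * (gk2 x * qnorm (F x)).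
Proof.
apply: le_trans (q0_le _) _; rewrite qnorm_sandwich /gk2.
by le_eq; ring.
Qed.

Lemma measurable_gsand F a : measurable_quat F -> measurable_fun [set: plane] (gsand F a).
Proof.
move=> mF; apply: measurable_inplane2.
- apply: cmeas_cexp; apply: cmeasD; last by apply: cmeasN; apply: cmeas_real; msr.
  by apply: cmeasM; [exact: cmeas_cst|apply: cmeas_real; msr].
- apply: cmeas_cexp; apply: cmeasD; last by apply: cmeasN; apply: cmeas_real; msr.
  by apply: cmeasM; [exact: cmeas_cst|apply: cmeas_real; msr].
- by move=> c; exact: measurable_q0M.
Qed.

Lemma gsand_intg F a : sq_intg F -> intg L (gsand F a).
Proof.
move=> [mF iF]; apply: (intg_dom (measurable_gsand a mF) _ (gsand_le F a)).
apply: intgZ.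
by have [] := weighted_intg ltr01 measurable_gk2 (measurable_qnorm mF) gk2_ge0
  (fun x => qnorm_ge0 _) gk2_sq_intg iF.
Qed.

Definition dual_cst : R := (s * `|b1| / Num.sqrt (2 * pi)) * (s * `|b2| / Num.sqrt (2 * pi)) * amp_cst.

Lemma dual_cst_ge0 : 0 <= dual_cst.
Proof.
have h (b : R) : 0 <= s * `|b| / Num.sqrt (2 * pi).
  by apply: divr_ge0 (sqrtr_ge0 _); apply: mulr_ge0 => //; exact: ltW.
exact: mulr_ge0 (mulr_ge0 (h _) (h _)) amp_cst_ge0.
Qed.

Lemma gh2_T_intg F : sq_intg F -> intg L (fun w => gh2 w * qnorm (T F w)).
Proof.
move=> iF; have [mT iT] := T_sq_intg iF.
by have [] := weighted_intg ltr01 measurable_gh2 (measurable_qnorm mT) gh2_ge0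
  (fun x => qnorm_ge0 _) gh2_sq_intg iT.
Qed.

Lemma duality_L1L2 F a : qintg F -> sq_intg F ->
  `|\int[L]_x gsand (demod F) a x| <= dual_cst * qnorm a * \int[L]_w (gh2 w * qnorm (T F w)).
Proof.
move=> i1 i2; have iT := gh2_T_intg i2.
have iT' : intg L (fun w => cn (gh s b1 w.1 v1) * cn (gh s b2 w.2 v2) * (amp_cst * qnorm (T F w))).
  by apply: eq_intg (intgZ amp_cst iT) => w; rewrite mulrCA.
have := gaussian_duality hb1 hb2 (demod_qintg i1) a s_gt0 (qft_T i1 i2) iT'.
have -> : \int[L]_w (cn (gh s b1 w.1 v1) * cn (gh s b2 w.2 v2) * (amp_cst * qnorm (T F w))) =
   amp_cst * \int[L]_w (gh2 w * qnorm (T F w)).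
  by rewrite -(RintZ _ iT); apply: eq_Rintegral => w _; rewrite mulrCA.
move/le_trans; apply; rewrite /dual_cst.
by move: (\int[L]_w _) (_ / _) (_ / _) => I c1 c2; le_eq; ring.
Qed.

(** Both sides are continuous for the square norm, the right one through the continuity of [T]. The
    approximant is taken close enough for itself and its transform to be within [e], and the
    resulting error is linear in [e]. *)
Lemma duality_L2 F a : sq_intg F ->
  `|\int[L]_x gsand (demod F) a x| <= dual_cst * qnorm a * \int[L]_w (gh2 w * qnorm (T F w)).
Proof.
move=> iF; have iTF := gh2_T_intg iF.
set I := \int[L]_w (gh2 w * _).
pose K1 := \int[L]_x (gk2 x ^+ 2); pose K2 := \int[L]_x (gh2 x ^+ 2).
have K10 : 0 <= K1 by apply: Rintegral_ge0 => x _; exact: sqr_ge0.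
have K20 : 0 <= K2 by apply: Rintegral_ge0 => x _; exact: sqr_ge0.
have qa := qnorm_ge0 a; have dc := dual_cst_ge0.
have key e : 0 < e -> `|\int[L]_x gsand (demod F) a x| <=
    dual_cst * qnorm a * I + e * (dual_cst * qnorm a * (K2 + 1) + qnorm a * (K1 + 1)).
  move=> e0; case: (hT) => _ /(_ F ((LpH2P F).2 iF) e e0) [dl dl0 hdl] _.
  have [|G [i1 i2 GF]] := approx_L1 (e := Num.min dl e) _ iF; first by rewrite lt_min dl0.
  have GFd : (L2dist G F < dl%:E)%E by apply: lt_le_trans GF _; rewrite lee_fin ge_min lexx.
  have GFe : (L2dist G F < e%:E)%E by apply: lt_le_trans GF _; rewrite lee_fin ge_min lexx orbT.
  have mB (X Y : R * R -> quat R) : measurable_quat X -> measurable_quat Y -> measurable_quat (fun x => X x - Y x).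
    by move=> [????] [????]; split => /=; apply: measurable_funB.
  have TGF := hdl G ((LpH2P G).2 i2) GFd.
  have mGF := mB _ _ i2.1 iF.1; have mTGF := mB _ _ (T_sq_intg i2).1 (T_sq_intg iF).1.
  have [jGF leGF] := (L2dist_ltP e0 mGF).1 GFe; have [jT leT] := (L2dist_ltP e0 mTGF).1 TGF.
  have [w1 w1le] := weighted_intg e0 measurable_gk2 (measurable_qnorm mGF) gk2_ge0
    (fun x => qnorm_ge0 _) gk2_sq_intg jGF.
  have [w2 w2le] := weighted_intg e0 measurable_gh2 (measurable_qnorm mTGF) gh2_ge0
    (fun x => qnorm_ge0 _) gh2_sq_intg jT.
  (* The bound of [weighted_intg] for a distance below [e], whose square integral [y] is below
     [e^2]. *)
  have small (y z : R) : y < e ^+ 2 -> e * z + e^-1 * y <= e * (z + 1).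
    move=> ye; rewrite mulrDr lerD2l mulr1 mulrC ler_pdivrMr // -expr2; exact: ltW.
  have h1 := duality_L1L2 a i1 i2.
  have iTG := gh2_T_intg i2.
  have h2 : \int[L]_w (gh2 w * qnorm (T G w)) <= I + e * (K2 + 1).
    apply: (@le_trans _ _ (I + \int[L]_w (gh2 w * qnorm (T G w - T F w)))).
      rewrite -(RintD iTF w2); apply: Rint_le => //; first exact: intgD.
      move=> w; rewrite -mulrDr ler_wpM2l ?gh2_ge0 //.
      by have := qnormD (T F w) (T G w - T F w); rewrite [X in qnorm X <= _]addrC subrK.
    by rewrite lerD2l (le_trans w2le) // small.
  have h3 : `|\int[L]_x gsand (demod F) a x| <= `|\int[L]_x gsand (demod G) a x| +
      qnorm a * (e * (K1 + 1)).
    have iGs := gsand_intg a (demod_sq_intg i2); have iFs := gsand_intg a (demod_sq_intg iF).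
    have -> : \int[L]_x gsand (demod F) a x =
       \int[L]_x gsand (demod G) a x - \int[L]_x (gsand (demod G) a x - gsand (demod F) a x).
      by rewrite (RintB iGs iFs); ring.
    apply: le_trans (ler_normB _ _) _; rewrite lerD2l.
    apply: (@le_trans _ _ (\int[L]_x (qnorm a * (gk2 x * qnorm (G x - F x))))).
      apply: Rint_norm_le; first by apply: measurable_funB; apply: measurable_gsand; apply: measurable_demod; [exact: i2.1|exact: iF.1].
        exact: intgZ.
      move=> x; have -> : gsand (demod G) a x - gsand (demod F) a x =
          gsand (demod (fun x => G x - F x)) a x.
        by rewrite /gsand demodB mulrBr mulrBl mulrBr.
      by apply: le_trans (gsand_le _ _ _) _; rewrite qnorm_demod.
    by rewrite (RintZ _ w1) ler_wpM2l // (le_trans w1le) // small.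
  apply: le_trans h3 _.
  have : `|\int[L]_x gsand (demod G) a x| <= dual_cst * qnorm a * (I + e * (K2 + 1)).
    exact: le_trans h1 (ler_wpM2l (mulr_ge0 dc qa) h2).
  move: (`|\int[L]_x gsand (demod G) a x|) => X hX.
  apply: (le_trans (lerD hX (lexx _))).
  by move: dual_cst => D; le_eq; ring.
apply/ler_addgt0Pr => e e0.
set M := dual_cst * qnorm a * (K2 + 1) + qnorm a * (K1 + 1) in key.
have M0 : 0 <= M.
  exact: addr_ge0 (mulr_ge0 (mulr_ge0 dc qa) (addr_ge0 K20 ler01)) (mulr_ge0 qa (addr_ge0 K10 ler01)).
have M1 : 0 < M + 1 by rewrite ltr_wpDl.
apply: le_trans (key (e / (M + 1)) (divr_gt0 e0 M1)) _.
rewrite lerD2l mulrAC ler_pdivrMr // ler_pM2l //.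
by rewrite lerDl.
Qed.

End L2Duality.

(** * Consequences of a finite iterated integral *)

Section IteratedIntegrals.
Variable R : realType.
Local Notation plane := (measurableTypeR R * measurableTypeR R)%type.
Local Notation L := (@leb2 R).
Local Notation M := (sfm (@leb2_sigma_finite R)).
Variable Phi : plane * plane -> R.
Hypotheses (mPhi : measurable_fun [set: plane * plane] Phi) (Phi0 : forall z, 0 <= Phi z).
Hypothesis hint : (\int[L]_w \int[L]_x (Phi (x, w))%:E < +oo)%E.

Lemma iterated_intg : intg (M \x M)%E Phi.
Proof.
apply/integrable21ltyP; first exact/measurable_EFinP.
apply: le_lt_trans hint; le_eq; apply: eq_integral => w _; apply: eq_integral => x _ /=.
by rewrite ger0_norm.
Qed.

Lemma iterated_ae_l : {ae L, forall x, intg L (fun w => Phi (x, w))}.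
Proof. exact: (ae_integrable1 iterated_intg). Qed.

Lemma iterated_ae_r : {ae L, forall w, intg L (fun x => Phi (x, w))}.
Proof. exact: (ae_integrable2 iterated_intg). Qed.

(** The hypothesis integrates over [x] inside and over [w] outside; Tonelli exchanges the two, so a
    pointwise lower bound for the [w]-integral is integrable in [x]. This is how the degree bound
    uses the hypothesis. *)
Lemma iterated_lower (H : plane -> R) : measurable_fun [set: plane] H -> (forall x, 0 <= H x) ->
  (forall x, ((H x)%:E <= \int[L]_w (Phi (x, w))%:E)%E) -> intg L H.
Proof.
move=> mH H0 hH; apply: intg_ge0 => //.
have e := fubini_tonelli (m1 := M) (m2 := M) (fun z => (Phi z)%:E)
  ((measurable_EFinP _ _).2 mPhi) (fun z => Phi0 z).
apply: le_lt_trans hint; rewrite -[leRHS]e.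
apply: ge0_le_integral => //.
- by move=> x _; rewrite lee_fin.
- exact/measurable_EFinP.
- exact: (measurable_fun_fubini_tonelli_F (m2 := M) (fun z => (Phi z)%:E)
  ((measurable_EFinP _ _).2 mPhi) (fun z => Phi0 z)).
Qed.

Lemma iterated_product (phi psi : plane -> R) (c : R) : 0 <= c -> intg L phi -> intg L psi ->
  (forall x, 0 <= phi x) -> (forall w, 0 <= psi w) ->
  (forall x w, phi x * psi w <= c * Phi (x, w)) ->
  (\int[L]_x phi x) * (\int[L]_w psi w) <= c * \int[(M \x M)%E]_z Phi z.
Proof.
move=> c0 ip iq p0 q0 h; have iPhi := iterated_intg.
have -> : (\int[L]_x phi x) * (\int[L]_w psi w) = \int[(M \x M)%E]_z (phi z.1 * psi z.2).
  by rewrite (Rint_prod (m1 := M) (m2 := M)).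
rewrite -(RintZ _ iPhi); apply: Rint_le.
- exact: (prod_intg (m1 := M) (m2 := M)).
- exact: intgZ.
- by move=> [x w]; exact: h.
Qed.

End IteratedIntegrals.

Section ElementaryBounds.
Variable R : realType.
Implicit Types (t X y s r : R).

(** From [(1 + y)^N <= N! e^(1 + y)]; the constant [3/2] is the maximum of [1 + y - y^2 / 2],
    attained at [y = 1]. *)
Lemma polynomial_gauss_bound (N : nat) y : 0 <= y ->
  (1 + y) ^+ N * expR (- y ^+ 2 / 2) <= N`!%:R * expR (3 / 2).
Proof.
move=> y0; have h := pow_fact_le_expR N (addr_ge0 ler01 y0).
have f0 : 0 < N`!%:R :> R by rewrite ltr0n fact_gt0.
have h2 : (1 + y) ^+ N <= N`!%:R * expR (1 + y) by rewrite -ler_pdivrMl // mulrC.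
apply: (@le_trans _ _ (N`!%:R * expR (1 + y) * expR (- y ^+ 2 / 2))).
  by rewrite ler_wpM2r ?expR_ge0.
rewrite -mulrA -expRD ler_pM2l // ler_expR.
by have := sqr_ge0 (y - 1); lra.
Qed.

(** The inequality [1 + t <= (1 + X) (1 + |t - X|)] separates the centre from the offset, and the
    Gaussian absorbs the offset. *)
Lemma shifted_gauss_bound (N : nat) (d t X : R) : 0 <= d -> d <= N%:R -> 0 <= t -> 0 <= X ->
  (1 + t) `^ d * expR (- (t - X) ^+ 2 / 2) <= N`!%:R * expR (3 / 2) * (1 + X) ^+ N.
Proof.
move=> d0 dN t0 X0.
have h1 : (1 + t) `^ d <= (1 + t) ^+ N.
  by rewrite -powR_mulrn ?addr_ge0 // ler_powR // lerDl.
have h2 : (1 + t) ^+ N <= (1 + X) ^+ N * (1 + `|t - X|) ^+ N.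
  rewrite -exprMn; apply: lerXn2r; rewrite ?nnegrE ?mulr_ge0 ?addr_ge0 //.
  have := ler_norm (t - X); have := normr_ge0 (t - X); nra.
have h3 := polynomial_gauss_bound N (normr_ge0 (t - X)).
rewrite real_normK ?num_real // in h3.
apply: (@le_trans _ _ ((1 + X) ^+ N * (1 + `|t - X|) ^+ N * expR (- (t - X) ^+ 2 / 2))).
  by rewrite ler_wpM2r ?expR_ge0 // (le_trans h1).
by rewrite -mulrA [leRHS]mulrC ler_wpM2l // exprn_ge0 // addr_ge0.
Qed.

End ElementaryBounds.

(** * The transforms of the demodulated function *)

Section Bounds.
Variable R : realType.
Local Notation C := R[i].

Lemma norm_le_sq (t c : R) : 0 <= c -> t ^+ 2 <= c ^+ 2 -> `|t| <= c.
Proof. by move=> c0 h; rewrite -ler_sqr ?nnegrE // real_normK ?num_real. Qed.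

Lemma enorm_dot_le (x y : R * R) : `|x.1 * y.1 + x.2 * y.2| <= enorm x * enorm y.
Proof.
apply: norm_le_sq; first by rewrite mulr_ge0 ?enorm_ge0.
rewrite exprMn !enorm_sq; have := sqr_ge0 (x.1 * y.2 - x.2 * y.1); nra.
Qed.

Definition Gw (X t : R) : R := expR (- t ^+ 2 / 2 + X * t).

Lemma Gw_le X t : Gw X t <= expR (X ^+ 2) * expR (- t ^+ 2 / 4).
Proof. by rewrite -expRD ler_expR; have := sqr_ge0 (X - t / 2); lra. Qed.

(** The identity that fits the hypothesis: with [s = |x|] and [r = |bw|] the product of the two
    weights contains [e^(s r)], and the leftover Gaussian is centred where [s + r = X], so it turns
    the denominator in [1 + s + r] into a power of [1 + X]. *)
Lemma Gw_mul X s r : Gw X s * Gw X r =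
  expR (- (s + r - X) ^+ 2 / 2) * (expR (X ^+ 2 / 2) * expR (s * r)).
Proof. by rewrite -!expRD; congr expR; field. Qed.

Lemma rint_avg4 d (Ts : measurableType d) (mu : {measure set Ts -> \bar R})
    (h F1 F2 F3 F4 : Ts -> R) (s2 s3 s4 M : R) :
  [/\ intg mu F1, intg mu F2, intg mu F3 & intg mu F4] ->
  [/\ `|s2| = 1, `|s3| = 1 & `|s4| = 1] ->
  [/\ `|\int[mu]_x F1 x| <= M, `|\int[mu]_x F2 x| <= M, `|\int[mu]_x F3 x| <= M &
      `|\int[mu]_x F4 x| <= M] ->
  (forall x, h x = 4^-1 * (F1 x + s2 * F2 x + s3 * F3 x + s4 * F4 x)) ->
  intg mu h /\ `|\int[mu]_x h x| <= M.
Proof.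
move=> [i1 i2 i3 i4] [e2 e3 e4] [l1 l2 l3 l4] /funext ->.
have j2 := intgD i1 (intgZ s2 i2); have j3 := intgD j2 (intgZ s3 i3).
have j4 := intgD j3 (intgZ s4 i4); split; first exact: intgZ.
rewrite RintZ // (RintD j3 (intgZ s4 i4)) (RintD j2 (intgZ s3 i3)) (RintD i1 (intgZ s2 i2)).
rewrite (RintZ _ i2) (RintZ _ i3) (RintZ _ i4) normrM (ger0_norm (x := 4^-1)) // ler_pdivrMl //.
have := ler_normD (\int[mu]_x F1 x + s2 * \int[mu]_x F2 x + s3 * \int[mu]_x F3 x) (s4 * \int[mu]_x F4 x).
have := ler_normD (\int[mu]_x F1 x + s2 * \int[mu]_x F2 x) (s3 * \int[mu]_x F3 x).
have := ler_normD (\int[mu]_x F1 x) (s2 * \int[mu]_x F2 x).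
by rewrite !normrM e2 e3 e4 !mul1r; lra.
Qed.

Lemma cexp_conj (z : C) : cexp (z^*)%C = ((cexp z)^*)%C.
Proof. by case: z => a b; apply: complex_eq => /=; rewrite ?cosN ?sinN ?mulrN. Qed.

Lemma gk_conj (s t : R) (v : C) : gk s t (v^*)%C = ((gk s t v)^*)%C.
Proof.
rewrite /gk -cexp_conj; congr cexp.
by case: v => a b; apply: complex_eq => /=; ring.
Qed.

(** Conjugating [z] flips the sign of its imaginary part, so a suitable choice of the three signs
    keeps exactly one of the four products of real and imaginary parts. *)
Lemma sandwich_average (a y : quat R) (z t : C) (s2 s3 s4 : R) :
  let S z t := q0 (a * (inplane qi z * y * inplane qj t)) in
  4^-1 * (S z t + s2 * S (z^*)%C t + s3 * S z (t^*)%C + s4 * S (z^*)%C (t^*)%C) =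
  4^-1 * (complex.Re z * complex.Re t * (1 + s2 + s3 + s4) * q0 (a * y) +
   complex.Im z * complex.Re t * (1 - s2 + s3 - s4) * q0 (a * qi * y) +
   complex.Re z * complex.Im t * (1 + s2 - s3 - s4) * q0 (qj * a * y) +
   complex.Im z * complex.Im t * (1 - s2 - s3 + s4) * q0 (qj * a * qi * y)).
Proof.
move=> S; rewrite /S !q0_inplane2.
move: (q0 (a * y)) (q0 (a * qi * y)) (q0 (qj * a * y)) (q0 (qj * a * qi * y)) => A B D E.
by case: z t {S} => [z1 z2] [t1 t2] /=; ring.
Qed.

End Bounds.

Section Transforms.
Variable R : realType.
Local Notation C := R[i].
Local Notation plane := (measurableTypeR R * measurableTypeR R)%type.
Local Notation leb := (@lebesgue_measure R).
Local Notation L := (@leb2 R).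
Variables (mu1 mu2 : qpft_param R).
Hypotheses (hb1 : pb mu1 != 0) (hb2 : pb mu2 != 0).
Local Notation b1 := (pb mu1).
Local Notation b2 := (pb mu2).
Variable T : (R * R -> quat R) -> (R * R -> quat R).
Hypothesis hT : is_QQPFT_L2 mu1 mu2 T.
Variable f : R * R -> quat R.
Hypothesis hf : sq_intg f.
Let nb (w : R * R) : R := enorm (b1 * w.1, b2 * w.2).
Implicit Types (a : quat R) (p x w : R * R) (u : C) (X : R).

Definition gf x : quat R := demod mu1 mu2 f x.

Definition ml a x : R := expR (- enorm x ^+ 2 / 2) * q0 (a * gf x).

Definition dotp p x : R := p.1 * x.1 + p.2 * x.2.

Definition Bt a p u : C := laplace L (ml a) (dotp p) u.

Definition DF X : R := \int[L]_x (Gw X (enorm x) * qnorm (f x)).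
Definition DT X : R := \int[L]_w (Gw X (nb w) * qnorm (T f w)).

Lemma measurable_nb : measurable_fun [set: plane] (nb : plane -> R).
Proof. by rewrite /nb /enorm; msr. Qed.

Lemma nb_ge0 w : 0 <= nb w. Proof. exact: enorm_ge0. Qed.

(** Half of the Gaussian exponent is kept for integrability; the other half pays for [e^(X t)] in
    [Gw_le]. *)
Lemma quarter_F_intg : intg L (fun x => expR (- enorm x ^+ 2 / 4) * qnorm (f x)).
Proof.
have me := @measurable_enorm R.
have i2 : intg L (fun x => expR (- enorm x ^+ 2 / 4) ^+ 2).
  have h : 0 < 2^-1 :> R by [].
  apply: eq_intg (gauss_enorm_intg h) => x; rewrite [RHS]expr2 -expRD; congr expR.
  by field.
by have [] := weighted_intg ltr01 (k := fun x => expR (- enorm x ^+ 2 / 4)) _ (measurable_qnorm hf.1)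
  (fun x => expR_ge0 _) (fun x => qnorm_ge0 _) i2 hf.2; msr.
Qed.

Lemma quarter_T_intg : intg L (fun w => expR (- nb w ^+ 2 / 4) * qnorm (T f w)).
Proof.
have me := measurable_nb; have [mT iT] := T_sq_intg hT hf.
have i2 : intg L (fun w => expR (- nb w ^+ 2 / 4) ^+ 2).
  have h (b : R) : b != 0 -> intg leb (fun t => expR (- (`|b| * t) ^+ 2 / 2)).
    rewrite -normr_gt0 => b0; apply: eq_intg (gauss_shift_intg 0 b0).1 => t.
    by rewrite mul0r addr0.
  apply: eq_intg (leb2_prod_intg (h _ hb1) (h _ hb2)) => w.
  rewrite [RHS]expr2 -!expRD /nb enorm_sq /= !exprMn !real_normK ?num_real //; congr expR.
  by field.
by have [] := weighted_intg ltr01 (k := fun w => expR (- nb w ^+ 2 / 4)) _ (measurable_qnorm mT)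
  (fun x => expR_ge0 _) (fun x => qnorm_ge0 _) i2 iT; msr.
Qed.

Lemma DF_intg X : intg L (fun x => Gw X (enorm x) * qnorm (f x)).
Proof.
have me := @measurable_enorm R; have mf := measurable_qnorm hf.1.
apply: (intg_dom _ (intgZ (expR (X ^+ 2)) quarter_F_intg)); first by rewrite /Gw; msr.
move=> x; rewrite ger0_norm ?mulr_ge0 ?expR_ge0 ?qnorm_ge0 // [leRHS]mulrA.
by rewrite ler_wpM2r ?qnorm_ge0 // Gw_le.
Qed.

Lemma DT_intg X : intg L (fun w => Gw X (nb w) * qnorm (T f w)).
Proof.
have me := measurable_nb; have [mT _] := T_sq_intg hT hf; have mT' := measurable_qnorm mT.
apply: (intg_dom _ (intgZ (expR (X ^+ 2)) quarter_T_intg)); first by rewrite /Gw; msr.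
move=> x; rewrite ger0_norm ?mulr_ge0 ?expR_ge0 ?qnorm_ge0 // [leRHS]mulrA.
by rewrite ler_wpM2r ?qnorm_ge0 // Gw_le.
Qed.

Lemma DF_ge0 X : 0 <= DF X.
Proof. by apply: Rintegral_ge0 => x _; rewrite mulr_ge0 ?expR_ge0 ?qnorm_ge0. Qed.

Lemma DT_ge0 X : 0 <= DT X.
Proof. by apply: Rintegral_ge0 => x _; rewrite mulr_ge0 ?expR_ge0 ?qnorm_ge0. Qed.

Lemma DF_order : exists2 K : R, 0 <= K & forall X, DF X <= K * expR (X ^+ 2).
Proof.
exists (\int[L]_x (expR (- enorm x ^+ 2 / 4) * qnorm (f x))) => [|X].
  by apply: Rintegral_ge0 => x _; rewrite mulr_ge0 ?expR_ge0 ?qnorm_ge0.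
rewrite mulrC -(RintZ _ quarter_F_intg); apply: Rint_le => //; first exact: DF_intg.
  exact: intgZ quarter_F_intg.
move=> x; rewrite [leRHS]mulrA.
by rewrite ler_wpM2r ?qnorm_ge0 // Gw_le.
Qed.

Lemma measurable_ml a : measurable_fun [set: plane] (ml a).
Proof.
have me := @measurable_enorm R; apply: measurable_funM; first by msr.
by apply: measurable_q0M; apply: measurable_demod; exact: hf.1.
Qed.

Lemma measurable_dotp p : measurable_fun [set: plane] (dotp p).
Proof. by rewrite /dotp; msr. Qed.

Lemma ml_le a x : `|ml a x| <= qnorm a * (expR (- enorm x ^+ 2 / 2) * qnorm (f x)).
Proof.
rewrite normrM (ger0_norm (expR_ge0 _)) mulrCA ler_wpM2l ?expR_ge0 //.
by apply: le_trans (q0_le _) _; rewrite qnormM qnorm_demod.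
Qed.

Section Direction.
Variable p : R * R.
Hypothesis p1 : enorm p = 1.

Lemma dotp_le x : `|dotp p x| <= enorm x.
Proof. by have := enorm_dot_le p x; rewrite p1 mul1r. Qed.

Lemma ml_exp_moments a (r : R) : intg L (fun x => `|ml a x| * expR (r * `|dotp p x|)).
Proof.
have mm := measurable_ml a; have md := measurable_dotp p.
apply: (intg_dom _ (intgZ (qnorm a) (DF_intg `|r|))); first by msr.
move=> x; rewrite ger0_norm ?mulr_ge0 ?expR_ge0 //.
apply: (@le_trans _ _ (qnorm a * (expR (- enorm x ^+ 2 / 2) * qnorm (f x)) * expR (`|r| * enorm x))).
  apply: ler_pM; [exact: normr_ge0|exact: expR_ge0|exact: ml_le|].
  rewrite ler_expR (le_trans (ler_norm _)) // normrM normr_id ler_wpM2l //; exact: dotp_le.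
by rewrite /Gw expRD; le_eq; ring.
Qed.

Definition bco a n : C := ((\int[L]_x (ml a x * dotp p x ^+ n)) / n`!%:R)%:C%C.

Lemma Bt_ent a : ent (Bt a p) (bco a).
Proof. exact: laplace_ent (measurable_ml a) (measurable_dotp p) (ml_exp_moments a). Qed.

Lemma Bt_direct a u : cn (Bt a p u) <= 2 * qnorm a * DF `|complex.Re u|.
Proof.
apply: le_trans (laplace_le (measurable_ml a) (measurable_dotp p) (ml_exp_moments a) u) _.
rewrite -mulrA ler_pM2l // -(RintZ _ (DF_intg _)); apply: Rint_le.
- exact: laplace_intg (measurable_ml a) (measurable_dotp p) (ml_exp_moments a) u.
- exact: intgZ (DF_intg _).
move=> x.
apply: (@le_trans _ _ (qnorm a * (expR (- enorm x ^+ 2 / 2) * qnorm (f x)) *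
    expR (`|complex.Re u| * enorm x))).
  apply: ler_pM; [exact: normr_ge0|exact: cn_ge0|exact: ml_le|].
  rewrite cn_cexp ler_expR; case: u => a' b' /=.
  rewrite mulr0 subr0 (le_trans (ler_norm _)) // normrM ler_wpM2l //; exact: dotp_le.
by rewrite /Gw expRD; le_eq; ring.
Qed.

(** The vector [(Im v1, Im v2)] has norm [|Im u|], and Cauchy-Schwarz bounds its product with [bw],
    leaving a radial weight. *)
Lemma gh2_le u (v1 v2 : C) w :
  complex.Re v1 ^+ 2 + complex.Re v2 ^+ 2 = complex.Re u ^+ 2 ->
  complex.Im v1 ^+ 2 + complex.Im v2 ^+ 2 = complex.Im u ^+ 2 ->
  gh2 mu1 mu2 1 v1 v2 w <= expR ((complex.Re u ^+ 2 - complex.Im u ^+ 2) / 2) *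
    Gw `|complex.Im u| (nb w).
Proof.
move=> hR hI; rewrite /gh2 !cn_gh /Gw -!expRD ler_expR -hR.
have e : enorm (complex.Im v1, complex.Im v2) = `|complex.Im u|.
  by rewrite /enorm /= hI sqrtr_sqr.
have := enorm_dot_le (complex.Im v1, complex.Im v2) (b1 * w.1, b2 * w.2).
rewrite e -/(nb w) /= ler_norml => /andP[h _].
have n2 : nb w ^+ 2 = (b1 * w.1) ^+ 2 + (b2 * w.2) ^+ 2 by rewrite enorm_sq.
rewrite n2 -hI expr1n; move: h; move: (nb w) (complex.Re v1) (complex.Re v2) => q r1 r2 h.
lra.
Qed.

(** In [B_a(p u)] the factors [k1] and [k2] multiply as complex numbers, whereas duality controls
    them on opposite sides of a quaternion, in the planes of [i] and [j]. The product [k1 k2] is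
    expanded into four products of real and imaginary parts; [sandwich_average] bounds each of them
    by duality at [v1], [v2] and their conjugates, and the four terms give the factor [4]. *)
Lemma Bt_dual a u : cn (Bt a p u) <= 4 * dual_cst mu1 mu2 1 * qnorm a *
  expR ((complex.Re u ^+ 2 - complex.Im u ^+ 2) / 2) * DT `|complex.Im u|.
Proof.
set E := expR _; set M := dual_cst mu1 mu2 1 * qnorm a * (E * DT `|complex.Im u|).
have -> : 4 * dual_cst mu1 mu2 1 * qnorm a * E * DT `|complex.Im u| = (M + M) + (M + M).
  by rewrite /M; ring.
have pp : p.1 ^+ 2 + p.2 ^+ 2 = 1 by rewrite -enorm_sq p1 expr1n.
pose v1 := u * p.1%:C%C; pose v2 := u * p.2%:C%C.
have S (w1 w2 : C) a' : complex.Re w1 = complex.Re v1 -> complex.Re w2 = complex.Re v2 ->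
    complex.Im w1 ^+ 2 = complex.Im v1 ^+ 2 -> complex.Im w2 ^+ 2 = complex.Im v2 ^+ 2 ->
    qnorm a' = qnorm a ->
    intg L (gsand 1 w1 w2 gf a') /\ `|\int[L]_x gsand 1 w1 w2 gf a' x| <= M.
  move=> r1 r2 i1 i2 qa; split; first by apply: gsand_intg => //; exact: demod_sq_intg.
  apply: le_trans (duality_L2 hb1 hb2 hT w1 w2 ltr01 a' hf) _; rewrite qa.
  apply: ler_wpM2l; first by rewrite mulr_ge0 ?qnorm_ge0 // dual_cst_ge0.
  rewrite /DT -(RintZ _ (DT_intg _)); apply: Rint_le.
  - exact: gh2_T_intg.
  - exact: intgZ (DT_intg _).
  move=> w; rewrite [leRHS]mulrA ler_wpM2r ?qnorm_ge0 //; apply: gh2_le.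
    by rewrite r1 r2 /v1 /v2; case: (u) => x y /=; rewrite !mulr0 !subr0 !exprMn -mulrDr pp mulr1.
  by rewrite i1 i2 /v1 /v2; case: (u) => x y /=; rewrite !mulr0 !add0r !exprMn -mulrDr pp mulr1.
have flip (c : C) : complex.Re (c^*)%C = complex.Re c /\ complex.Im (c^*)%C ^+ 2 = complex.Im c ^+ 2.
  by case: c => x y /=; rewrite sqrrN.
have [f1 g1] := flip v1; have [f2 g2] := flip v2.
have S4 a' : qnorm a' = qnorm a ->
    [/\ intg L (gsand 1 v1 v2 gf a'), intg L (gsand 1 (v1^*)%C v2 gf a'),
        intg L (gsand 1 v1 (v2^*)%C gf a') & intg L (gsand 1 (v1^*)%C (v2^*)%C gf a')] /\
    [/\ `|\int[L]_x gsand 1 v1 v2 gf a' x| <= M, `|\int[L]_x gsand 1 (v1^*)%C v2 gf a' x| <= M,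
        `|\int[L]_x gsand 1 v1 (v2^*)%C gf a' x| <= M &
        `|\int[L]_x gsand 1 (v1^*)%C (v2^*)%C gf a' x| <= M].
  move=> qa; have [? ?] := S v1 v2 a' erefl erefl erefl erefl qa.
  have [? ?] := S _ v2 a' f1 erefl g1 erefl qa.
  have [? ?] := S v1 _ a' erefl f2 erefl g2 qa.
  by have [? ?] := S _ _ a' f1 f2 g1 g2 qa.
have n1 : `|1 : R| = 1 by rewrite normr1.
have nN : `|-1 : R| = 1 by rewrite normrN1.
have qqi : qnorm (qi : quat R) = 1 by apply: qnorm_eq => //=; ring.
have qqj : qnorm (qj : quat R) = 1 by apply: qnorm_eq => //=; ring.
have qN (y : quat R) : qnorm (- y) = qnorm y by apply: qnorm_eq; [exact: qnorm_ge0|rewrite qnorm_sq /= !sqrrN].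
have gE (w1 w2 : C) a' x : gsand 1 w1 w2 gf a' x =
   q0 (a' * (inplane qi (gk 1 x.1 w1) * gf x * inplane qj (gk 1 x.2 w2))) by [].
(* Each of the other three products appears with [a] multiplied by [qi], [qj] or both, so duality is
   applied to the unit multiple of [a] that restores [q0 (a * gf x)]. *)
have [] := S4 a erefl => jRR lRR.
have [|] := S4 (qj * a * qi); first by rewrite !qnormM qqi qqj mul1r mulr1.
move=> jII lII.
have [|] := S4 (- (a * qi)); first by rewrite qN qnormM qqi mulr1.
move=> jIR lIR.
have [|] := S4 (- (qj * a)); first by rewrite qN qnormM qqj mul1r.
move=> jRI lRI.
pose k1 x := gk 1 x.1 v1; pose k2 x := gk 1 x.2 v2.
have [|iRR hRR] := rint_avg4 (mu := L)
    (h := fun x : plane => complex.Re (k1 x) * complex.Re (k2 x) * q0 (a * gf x)) jRR (And3 n1 n1 n1) lRR.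
  by move=> x; rewrite !gE !gk_conj sandwich_average; field.
have ajj : qj * (qj * a * qi) * qi = a.
  by rewrite !mulrA qjqj -!mulrA qiqi mulrN1 mulN1r opprK.
have aii : - (a * qi) * qi = a by rewrite mulNr -mulrA qiqi mulrN1 opprK.
have aij : qj * - (qj * a) = a by rewrite mulrN mulrA qjqj mulN1r opprK.
have [|iII hII] := rint_avg4 (mu := L)
    (h := fun x : plane => complex.Im (k1 x) * complex.Im (k2 x) * q0 (a * gf x)) jII (And3 nN nN n1) lII.
  by move=> x; rewrite !gE !gk_conj sandwich_average ajj; field.
have [|iIR hIR] := rint_avg4 (mu := L)
    (h := fun x : plane => complex.Im (k1 x) * complex.Re (k2 x) * q0 (a * gf x)) jIR (And3 nN n1 nN) lIR.
  by move=> x; rewrite !gE !gk_conj sandwich_average aii; field.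
have [|iRI hRI] := rint_avg4 (mu := L)
    (h := fun x : plane => complex.Re (k1 x) * complex.Im (k2 x) * q0 (a * gf x)) jRI (And3 n1 nN nN) lRI.
  by move=> x; rewrite !gE !gk_conj sandwich_average aij; field.
have kk x : (expR (- enorm x ^+ 2 / 2))%:C%C * cexp (u * (dotp p x)%:C%C) = k1 x * k2 x.
  rewrite /k1 /k2 /gk -cexp_real -!cexpD; congr cexp.
  by rewrite enorm_sq /v1 /v2 /dotp; case: (u) => x' y'; apply: complex_eq => /=; field.
apply: le_trans (cn_le_ReIm _) _; apply: lerD.
- have -> : complex.Re (Bt a p u) = \int[L]_x (complex.Re (k1 x) * complex.Re (k2 x) * q0 (a * gf x)) -
     \int[L]_x (complex.Im (k1 x) * complex.Im (k2 x) * q0 (a * gf x)).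
    rewrite -(RintB iRR iII); apply: eq_Rintegral => x _.
    by rewrite -mulrBl -Re_mul -kk ReZ /ml; ring.
  exact: le_trans (ler_normB _ _) (lerD hRR hII).
- have -> : complex.Im (Bt a p u) = \int[L]_x (complex.Im (k1 x) * complex.Re (k2 x) * q0 (a * gf x)) +
     \int[L]_x (complex.Re (k1 x) * complex.Im (k2 x) * q0 (a * gf x)).
    rewrite -(RintD iIR iRI); apply: eq_Rintegral => x _.
    by rewrite -mulrDl [X in _ = X * _]addrC -Im_mul -kk ImZ /ml; ring.
  exact: le_trans (ler_normD _ _) (lerD hIR hRI).
Qed.

End Direction.

End Transforms.

Section MoreBounds.
Variable R : realType.
Local Notation plane := (measurableTypeR R * measurableTypeR R)%type.
Local Notation L := (@leb2 R).

Lemma ae_enorm_neq0 : {ae L, forall x : R * R, enorm x != 0}.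
Proof.
pose A : set (measurableTypeR R) := [set (0 : R)]; have mA : measurable A by exact: measurable_set1.
exists (A `*` A); split.
- exact: measurableX.
- rewrite [LHS](_ : _ = (lebesgue_measure A * lebesgue_measure A)%E).
    by rewrite lebesgue_measure_set1 mule0.
  exact: product_measure1E.
- move=> [x y] /=; apply: contra_notP => h; apply/eqP => e; apply: h.
  have := enorm_sq (x, y); rewrite e expr0n /= => /esym/eqP.
  by rewrite paddr_eq0 ?sqr_ge0 // !sqrf_eq0 => /andP[/eqP -> /eqP ->].
Qed.

(** Half of the exponent [r s] absorbs the power of [1 + s + r], so a point where the other function
    does not vanish still yields the exponential moment of order [r / 2]. The constants come from
    [t^N <= N! e^t] with [t = r (1 + s + r) / 2]. *)
Lemma moment_weight (d s r : R) (N : nat) : 0 <= d -> d <= N%:R -> 0 < r -> 0 <= s ->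
  (1 + s + r) `^ d * expR (r / 2 * s) <=
  ((2 / r) ^+ N * N`!%:R * expR (r / 2 * (1 + r))) * expR (s * r).
Proof.
move=> d0 dN r0 s0; set t := r / 2 * (1 + s + r).
have t0 : 0 <= t by rewrite /t; nneg.
have f0 : 0 < N`!%:R :> R by rewrite ltr0n fact_gt0.
have h1 : (1 + s + r) `^ d <= (1 + s + r) ^+ N.
  by rewrite -powR_mulrn ?ler_powR //; lra.
have h2 : (1 + s + r) ^+ N = (2 / r) ^+ N * t ^+ N.
  by rewrite -exprMn; congr (_ ^+ _); rewrite /t; field; rewrite gt_eqF.
have h3 : t ^+ N <= N`!%:R * expR t by rewrite -ler_pdivrMl // mulrC pow_fact_le_expR.
have h4 : (1 + s + r) `^ d <= (2 / r) ^+ N * (N`!%:R * expR t).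
  by apply: le_trans h1 _; rewrite h2 ler_wpM2l // exprn_ge0 // divr_ge0 // ltW.
apply: le_trans (ler_wpM2r (expR_ge0 _) h4) _.
have -> : expR (s * r) = expR (r / 2 * s) * expR (r / 2 * s) by rewrite -expRD; congr expR; field.
have -> : expR t = expR (r / 2 * (1 + r)) * expR (r / 2 * s) by rewrite -expRD; congr expR; rewrite /t; field.
by le_eq; ring.
Qed.

End MoreBounds.

(** * Growth of the product of two slices, and exponential moments *)

Section GaussianShape.
Variable R : realType.
Local Notation C := R[i].
Local Notation plane := (measurableTypeR R * measurableTypeR R)%type.
Local Notation leb := (@lebesgue_measure R).
Local Notation L := (@leb2 R).
Local Notation M := (sfm (@leb2_sigma_finite R)).
Variables (mu1 mu2 : qpft_param R).
Hypotheses (hb1 : pb mu1 != 0) (hb2 : pb mu2 != 0).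
Local Notation b1 := (pb mu1).
Local Notation b2 := (pb mu2).
Variable T : (R * R -> quat R) -> (R * R -> quat R).
Hypothesis hT : is_QQPFT_L2 mu1 mu2 T.
Variable f : R * R -> quat R.
Hypothesis hf : sq_intg f.
Variable d : R.
Hypothesis hd : 0 <= d.
Let nb (w : R * R) : R := enorm (b1 * w.1, b2 * w.2).
Definition hintF (z : plane * plane) : R :=
  qnorm (f z.1) * qnorm (T f z.2) / (1 + enorm z.1 + nb z.2) `^ d * expR (enorm z.1 * nb z.2).
Hypothesis hint : (\int[L]_w \int[L]_x (hintF (x, w))%:E < +oo)%E.
Local Notation Bt := (Bt mu1 mu2 f).
Local Notation DF := (DF f).
Local Notation DT := (DT mu1 mu2 T f).
Local Notation bco := (bco mu1 mu2 f).

Lemma hintF_ge0 z : 0 <= hintF z.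
Proof.
apply: mulr_ge0 (expR_ge0 _); apply: divr_ge0 (powR_ge0 _ _).
by apply: mulr_ge0; exact: qnorm_ge0.
Qed.

Lemma measurable_hintF : measurable_fun [set: plane * plane] hintF.
Proof.
have mf := measurable_qnorm hf.1; have mT := measurable_qnorm (T_sq_intg hT hf).1.
have me := @measurable_enorm R; have mn := measurable_nb mu1 mu2.
have m1 := measurableT_comp mf (@measurable_fst _ _ plane plane).
have m2 := measurableT_comp mT (@measurable_snd _ _ plane plane).
have m3 := measurableT_comp me (@measurable_fst _ _ plane plane).
have m4 := measurableT_comp mn (@measurable_snd _ _ plane plane).
apply: measurable_funM; last by apply: measurable_expR_comp; exact: measurable_funM.
apply: measurable_funM; first exact: measurable_funM.
(* The base is positive, so the real power is the exponential of a logarithm and its measurability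
   that of [ln]. *)
have -> : (fun z : plane * plane => ((1 + enorm z.1 + nb z.2) `^ d)^-1) =
    (fun z => expR (- (d * ln (1 + enorm z.1 + nb z.2)))).
  apply/funext => z; rewrite /powR gt_eqF ?expRN //.
  by have := enorm_ge0 z.1; have := nb_ge0 mu1 mu2 z.2; rewrite -/(nb z.2); lra.
apply: measurable_expR_comp; apply: measurable_funN; apply: measurable_funM; first exact: measurable_cst.
apply: (measurableT_comp (f := @ln R)); first exact: measurable_ln.
by apply: measurable_funD => //; apply: measurable_funD.
Qed.

Definition hintJ : R := \int[(M \x M)%E]_z hintF z.

Lemma hintJ_ge0 : 0 <= hintJ.
Proof. by apply: Rintegral_ge0 => z _; exact: hintF_ge0. Qed.

Lemma DF_DT_le (N : nat) X : d <= N%:R -> 0 <= X ->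
  DF X * DT X <= N`!%:R * expR (3 / 2) * (1 + X) ^+ N * expR (X ^+ 2 / 2) * hintJ.
Proof.
move=> dN X0; set c := _ * expR (X ^+ 2 / 2).
have c0 : 0 <= c by rewrite /c; nneg.
apply: (iterated_product measurable_hintF hintF_ge0 hint c0 (DF_intg hf X) (DT_intg hb1 hb2 hT hf X)).
- by move=> x; apply: mulr_ge0; [exact: expR_ge0|exact: qnorm_ge0].
- by move=> x; apply: mulr_ge0; [exact: expR_ge0|exact: qnorm_ge0].
move=> x w; rewrite -/(nb w) /hintF /=.
set s := enorm x; set r := nb w; have s0 : 0 <= s by exact: enorm_ge0.
have r0 : 0 <= r by exact: nb_ge0.
have P0 : 0 < (1 + s + r) `^ d by rewrite powR_gt0 //; lra.
have h := shifted_gauss_bound hd dN (addr_ge0 s0 r0) X0; rewrite addrA in h.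
rewrite mulrACA Gw_mul /c; move: P0 h.
move: (qnorm_ge0 (f x)) (qnorm_ge0 (T f w)) (expR_ge0 (X ^+ 2 / 2)) (expR_ge0 (s * r)).
move: (qnorm (f x)) (qnorm (T f w)) (expR (X ^+ 2 / 2)) (expR (s * r)) (expR (- _ / 2)) => p q E S G.
move: ((1 + s + r) `^ d) (N`!%:R * _) => P K p0 q0 E0 S0 P0 h.
have -> : K * (1 + X) ^+ N * E * (p * q / P * S) = (K * (1 + X) ^+ N / P) * (E * S * (p * q)).
  by field; rewrite gt_eqF.
have -> : G * (E * S) * (p * q) = G * (E * S * (p * q)) by ring.
apply: ler_wpM2r; first exact: mulr_ge0 (mulr_ge0 E0 S0) (mulr_ge0 p0 q0).
by rewrite ler_pdivlMr // mulrC.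
Qed.

(** Multiplication by [i] exchanges the roles of [x] and [y]. The direct bound of one factor and the
    dual bound of the other then involve [DF] and [DT] at the same argument, where [DF_DT_le]
    applies. The two possible pairings give the exponents [y^2 / 2] and [x^2 / 2], and the smaller
    one is kept. *)
Lemma Bt_product (N : nat) a a' p q (x y : R) : d <= N%:R -> enorm p = 1 -> enorm q = 1 ->
  cn (Bt a p (Complex x y) * Bt a' q ('i%C * Complex x y)) <=
  (2 * (4 * dual_cst mu1 mu2 1) * (N`!%:R * expR (3 / 2)) * hintJ * (qnorm a * qnorm a')) *
  (1 + cn (Complex x y)) ^+ N * expR (2^-1 * Num.min (x ^+ 2) (y ^+ 2)).
Proof.
move=> dN p1 q1; rewrite cnM.
have iu : 'i%C * Complex x y = Complex (- y) x by apply: complex_eq => /=; ring.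
rewrite iu; set B := Bt a p _; set B' := Bt a' q _.
have D1 : cn B <= 2 * qnorm a * DF `|x| := Bt_direct mu1 mu2 hf p1 a (Complex x y).
have D2 : cn B' <= 2 * qnorm a' * DF `|- y| := Bt_direct mu1 mu2 hf q1 a' (Complex (- y) x).
have E1 : cn B <= 4 * dual_cst mu1 mu2 1 * qnorm a * expR ((x ^+ 2 - y ^+ 2) / 2) * DT `|y| :=
  Bt_dual hb1 hb2 hT hf p1 a (Complex x y).
have E2 : cn B' <= 4 * dual_cst mu1 mu2 1 * qnorm a' * expR (((- y) ^+ 2 - x ^+ 2) / 2) * DT `|x| :=
  Bt_dual hb1 hb2 hT hf q1 a' (Complex (- y) x).
rewrite normrN in D2; rewrite sqrrN in E2; move: D1 D2 E1 E2.
set c := 4 * dual_cst mu1 mu2 1; have c0 : 0 <= c by rewrite mulr_ge0 // dual_cst_ge0.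
set K := N`!%:R * _; have K0 : 0 <= K by rewrite mulr_ge0 // expR_ge0.
have J0 := hintJ_ge0; move: (qnorm_ge0 a) (qnorm_ge0 a') => A0 A'0.
have cA : 0 <= 2 * c * (qnorm a * qnorm a').
  exact: mulr_ge0 (mulr_ge0 (ler0n _ 2) c0) (mulr_ge0 A0 A'0).
have key (X Y t : R) : `|X| <= t -> DF `|X| * (expR ((Y ^+ 2 - X ^+ 2) / 2) * DT `|X|) <=
    K * hintJ * (1 + t) ^+ N * expR (2^-1 * Y ^+ 2).
  move=> Xt; have h := DF_DT_le dN (normr_ge0 X); rewrite real_normK ?num_real // in h.
  rewrite mulrCA; apply: le_trans (ler_wpM2l (expR_ge0 _) h) _.
  have -> : expR ((Y ^+ 2 - X ^+ 2) / 2) * (N`!%:R * expR (3 / 2) * (1 + `|X|) ^+ N * expR (X ^+ 2 / 2) * hintJ) =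
      K * hintJ * (1 + `|X|) ^+ N * expR (2^-1 * Y ^+ 2).
    have -> : 2^-1 * Y ^+ 2 = (Y ^+ 2 - X ^+ 2) / 2 + X ^+ 2 / 2 by field.
    by rewrite expRD /K; ring.
  apply: (ler_wpM2r (expR_ge0 _)); apply: (ler_wpM2l (mulr_ge0 K0 J0)).
  by apply: lerXn2r; rewrite ?nnegrE ?addr_ge0 // ?lerD2l // (le_trans (normr_ge0 _) Xt).
have xt : `|x| <= cn (Complex x y) by exact: (Re_le_cn (Complex x y)).
have yt : `|y| <= cn (Complex x y) by exact: (Im_le_cn (Complex x y)).
have kx := key x y _ xt; have ky := key y x _ yt.
move: (DF_ge0 f `|x|) (DF_ge0 f `|y|) (DT_ge0 mu1 mu2 T f `|x|) (DT_ge0 mu1 mu2 T f `|y|) kx ky.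
move: (cn (Complex x y)) => t; move: ((1 + t) ^+ N) => V.
move: (expR_ge0 ((y ^+ 2 - x ^+ 2) / 2)) (expR_ge0 ((x ^+ 2 - y ^+ 2) / 2)).
move: (expR ((y ^+ 2 - x ^+ 2) / 2)) (expR ((x ^+ 2 - y ^+ 2) / 2)) => e1 e2 e10 e20.
move: (DF `|x|) (DF `|y|) (DT `|x|) (DT `|y|) => fx fy tx ty fx0 fy0 tx0 ty0 kx ky D1 D2 E1 E2.
case: (leP (x ^+ 2) (y ^+ 2)) => _.
- have := ler_pM (cn_ge0 _) (cn_ge0 _) E1 D2; move/le_trans; apply.
  have -> : c * qnorm a * e2 * ty * (2 * qnorm a' * fy) =
    2 * c * (qnorm a * qnorm a') * (fy * (e2 * ty)) by ring.
  apply: le_trans (ler_wpM2l cA ky) _.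
  by le_eq; ring.
- have := ler_pM (cn_ge0 _) (cn_ge0 _) D1 E2; move/le_trans; apply.
  have -> : 2 * qnorm a * fx * (c * qnorm a' * e1 * tx) =
    2 * c * (qnorm a * qnorm a') * (fx * (e1 * tx)) by ring.
  apply: le_trans (ler_wpM2l cA kx) _.
  by le_eq; ring.
Qed.

Lemma Bt_gaussian a0 p0 n0 : enorm p0 = 1 -> bco p0 a0 n0 != 0 ->
  exists (kappa : R) (N : nat), forall a p, enorm p = 1 -> forall z,
    Bt a p z = psum (real_conv (bco p a) (- kappa%:C%C)) N z * cexp (kappa%:C%C * z ^+ 2).
Proof.
move=> p01 n0P; pose N := (Num.bound d).
have dN : d <= N%:R := ltW (archi_boundP hd).
have [KF KF0 HKF] := DF_order hf.
pose Kp a a' := 2 * (4 * dual_cst mu1 mu2 1) * (N`!%:R * expR (3 / 2)) * hintJ * (qnorm a * qnorm a').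
have Kp0 a a' : 0 <= Kp a a'.
  rewrite /Kp; apply: mulr_ge0 (mulr_ge0 (qnorm_ge0 _) (qnorm_ge0 _)); apply: mulr_ge0 hintJ_ge0.
  apply: mulr_ge0; last by apply: mulr_ge0 (expR_ge0 _); exact: ler0n.
  by apply: mulr_ge0 => //; apply: mulr_ge0 => //; exact: dual_cst_ge0.
pose K := Kp a0 a0 + 2 * qnorm a0 * KF.
have K0 : 0 <= K by rewrite addr_ge0 // mulr_ge0 // mulr_ge0 ?qnorm_ge0.
(* Relaxing [1/2] to [1] lets a single constant serve both for the product and for the order-two
   bound that comes from [DF_order]. *)
have half (x y : R) : expR (2^-1 * Num.min (x ^+ 2) (y ^+ 2)) <= expR (1 * Num.min (x ^+ 2) (y ^+ 2)).
  by rewrite ler_expR ler_wpM2r ?le_min ?sqr_ge0 //; lra.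
have W a p K' : enorm p = 1 -> Kp a a0 <= K' -> forall x y,
   cn (Bt a p (Complex x y) * Bt a0 p0 ('i%C * Complex x y)) <=
   K' * (1 + cn (Complex x y)) ^+ N * expR (1 * Num.min (x ^+ 2) (y ^+ 2)).
  move=> p1 KK x y; apply: le_trans (Bt_product a a0 x y dN p1 p01) _.
  rewrite -/(Kp a a0); have V0 : 0 <= (1 + cn (Complex x y)) ^+ N by rewrite exprn_ge0 // addr_ge0 // cn_ge0.
  apply: ler_pM (half x y); [|exact: expR_ge0|exact: ler_wpM2r].
  exact: mulr_ge0.
have h1 n : complex.Im (bco p0 a0 n) = 0 by [].
have h2 : exists n, bco p0 a0 n != 0 by exists n0.
have h3 z : cn (Bt a0 p0 z) <= K * expR (1 * cn z ^+ 2).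
  apply: le_trans (Bt_direct mu1 mu2 hf p01 a0 z) _.
  apply: (@le_trans _ _ (2 * qnorm a0 * (KF * expR (1 * cn z ^+ 2)))).
    apply: ler_wpM2l; first by rewrite mulr_ge0 ?qnorm_ge0.
    apply: le_trans (HKF _) _; apply: ler_wpM2l => //; rewrite ler_expR mul1r.
    by apply: lerXn2r; rewrite ?nnegrE ?normr_ge0 ?cn_ge0 // Re_le_cn.
  rewrite mulrA; apply: (ler_wpM2r (expR_ge0 _)).
  by rewrite /K lerDr.
have KK : Kp a0 a0 <= K by rewrite /K lerDl mulr_ge0 // mulr_ge0 ?qnorm_ge0.
have [kappa H] := gaussian_type K0 ler01 (Bt_ent mu1 mu2 hf p01 a0) h1 h2 h3 (W a0 p0 K p01 KK).
exists kappa, N.+1 => a p p1 z.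
apply: (H (Bt a p) (bco p a) (Kp a a0) (Kp0 a a0) (Bt_ent mu1 mu2 hf p1 a)).
exact: W.
Qed.

(** By Fubini almost every slice of the hypothesis is integrable. A single slice at some [x0 != 0]
    with [f x0 != 0] carries [e^(|x0| r)] against the transform, of which half the exponent survives
    the denominator. *)
Lemma T_exp_moment : ~ {ae L, forall x, f x = 0} ->
  exists2 c : R, 0 < c & intg L (fun w => expR (c * nb w) * qnorm (T f w)).
Proof.
move=> nf; have mT := measurable_qnorm (T_sq_intg hT hf).1.
have [x0 [fx0 ex0 ix0]] : exists x, [/\ qnorm (f x) != 0, enorm x != 0 & intg L (fun w => hintF (x, w))].
  apply: contrapT => h; apply: nf.
  apply: (ae_imp2 _ (iterated_ae_l measurable_hintF hintF_ge0 hint) (@ae_enorm_neq0 R)) => x ix ex.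
  apply: qnorm_eq0; apply: contrapT => /eqP fx; apply: h; by exists x.
have r0 : 0 < enorm x0 by rewrite lt_def ex0 enorm_ge0.
have q0 : 0 < qnorm (f x0) by rewrite lt_def fx0 qnorm_ge0.
exists (enorm x0 / 2); first by rewrite divr_gt0.
pose N := Num.bound d.
have dN : d <= N%:R := ltW (archi_boundP hd).
set r := enorm x0 in r0 *.
pose K := (2 / r) ^+ N * N`!%:R * expR (r / 2 * (1 + r)).
have mn := measurable_nb mu1 mu2.
apply: (intg_dom _ (intgZ (K / qnorm (f x0)) ix0)); first by msr.
move=> w; rewrite ger0_norm; last by apply: mulr_ge0; [exact: expR_ge0|exact: qnorm_ge0].
have := moment_weight hd dN r0 (nb_ge0 mu1 mu2 w); rewrite -/(nb w) -/K /hintF /= -/r.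
have P0 : 0 < (1 + nb w + r) `^ d by rewrite powR_gt0 //; have := nb_ge0 mu1 mu2 w; rewrite -/(nb w); lra.
rewrite (_ : 1 + r + nb w = 1 + nb w + r); last by ring.
rewrite (mulrC r (nb w)); move: q0 (qnorm_ge0 (T f w)) P0.
move: (qnorm (f x0)) (qnorm (T f w)) (expR (nb w * r)) (expR (r / 2 * nb w)) (_ `^ d) => p q S E P p0 q0 P0 h.
have -> : K / p * (p * q / P * S) = (K * S / P) * q by field; rewrite !gt_eqF.
by apply: ler_wpM2r => //; rewrite ler_pdivlMr // mulrC.
Qed.

Lemma f_exp_moment : ~ {ae L, forall w, T f w = 0} ->
  exists2 c : R, 0 < c & intg L (fun x => expR (c * enorm x) * qnorm (f x)).
Proof.
move=> nT; have mf := measurable_qnorm hf.1; have me := @measurable_enorm R.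
have nb_neq0 w : enorm w != 0 -> nb w != 0.
  apply: contra => /eqP e; have := enorm_sq (b1 * w.1, b2 * w.2).
  rewrite -/(nb w) e expr0n /= => /esym/eqP; rewrite paddr_eq0 ?sqr_ge0 // !sqrf_eq0 !mulf_eq0.
  rewrite (negbTE hb1) (negbTE hb2) /= => /andP[/eqP e1 /eqP e2].
  by rewrite -sqrf_eq0 enorm_sq e1 e2 expr0n /= addr0.
have [w0 [fw0 ew0 iw0]] : exists w, [/\ qnorm (T f w) != 0, nb w != 0 & intg L (fun x => hintF (x, w))].
  apply: contrapT => h; apply: nT.
  apply: (ae_imp2 _ (iterated_ae_r measurable_hintF hintF_ge0 hint) (@ae_enorm_neq0 R)) => w iw ew.
  apply: qnorm_eq0; apply: contrapT => /eqP fx; apply: h; exists w; split => //; exact: nb_neq0.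
have r0 : 0 < nb w0 by rewrite lt_def ew0 nb_ge0.
have q0 : 0 < qnorm (T f w0) by rewrite lt_def fw0 qnorm_ge0.
exists (nb w0 / 2); first by rewrite divr_gt0.
pose N := Num.bound d.
have dN : d <= N%:R := ltW (archi_boundP hd).
set r := nb w0 in r0 *.
pose K := (2 / r) ^+ N * N`!%:R * expR (r / 2 * (1 + r)).
apply: (intg_dom _ (intgZ (K / qnorm (T f w0)) iw0)); first by msr.
move=> x; rewrite ger0_norm; last by apply: mulr_ge0; [exact: expR_ge0|exact: qnorm_ge0].
have := moment_weight hd dN r0 (enorm_ge0 x); rewrite -/K /hintF /= -/r.
have P0 : 0 < (1 + enorm x + r) `^ d by rewrite powR_gt0 //; have := enorm_ge0 x; lra.
move: q0 (qnorm_ge0 (f x)) P0.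
move: (qnorm (T f w0)) (qnorm (f x)) (expR (enorm x * r)) (expR (r / 2 * enorm x)) (_ `^ d) => p q S E P p0 q0 P0 h.
have -> : K / p * (q * p / P * S) = (K * S / P) * q by field; rewrite !gt_eqF.
by apply: ler_wpM2r => //; rewrite ler_pdivlMr // mulrC.
Qed.

End GaussianShape.

(** * Inversion of polynomial Gaussians *)

Section TypeRange.
Variable R : realType.
Local Notation C := R[i].
Implicit Types (P : {poly C}) (kappa c K : R).

(** An exponential moment of [f] bounds the slice at real [t] by [e^((t - c)^2 / 2)], which is
    smaller than [e^(t^2 / 2)] by a factor of order [e^(-c t)]. For [kappa >= 1/2] the left side
    would stay above a multiple of [e^(t^2 / 2)]. *)
Lemma type_lt_half P kappa c K : P != 0 -> 0 < c -> 0 <= K ->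
  (forall t : R, 0 <= t -> cn (P.[t%:C%C] * cexp (kappa%:C%C * t%:C%C ^+ 2)) <=
    K * expR ((t - c) ^+ 2 / 2)) -> kappa < 1 / 2.
Proof.
move=> P0 c0 K0 H; rewrite ltNge; apply/negP => k2.
have [c1 [r0 [c10 r00 HP]]] := poly_lower_bound P0.
apply: (@expR_beats_poly _ c1 c (K * expR (c ^+ 2 / 2)) 0 r0 0%N) => //.
  by rewrite mulr_ge0 ?expR_ge0.
move=> t tr; have t0 : 0 <= t by lra.
have := H t t0; rewrite cnM cn_cexp -rmorphXn -rmorphM /= expr0 mulr1 => h.
have h1 : c1 <= cn P.[t%:C%C] by apply: HP; rewrite cn_real ger0_norm.
have h2 : expR (t ^+ 2 / 2) <= expR (kappa * t ^+ 2).
  by rewrite ler_expR; have := sqr_ge0 t; nra.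
have h3 := le_trans (ler_pM (ltW c10) (expR_ge0 _) h1 h2) h.
have e1 : expR ((t - c) ^+ 2 / 2) = expR (t ^+ 2 / 2) * (expR (c ^+ 2 / 2) * expR (- (c * t))).
  by rewrite -!expRD; congr expR; field.
rewrite e1 mulrC [leRHS]mulrCA in h3; rewrite ler_pM2l ?expR_gt0 // in h3.
have e2 : expR (c * t) * expR (- (c * t)) = 1 by rewrite expRxMexpNx_1.
rewrite -(ler_pM2r (expR_gt0 (- (c * t)))) -mulrA e2 mulr1.
by apply: le_trans h3 _; rewrite mulrA.
Qed.

(** On the imaginary axis an exponential moment of the transform leaves a bound of order [e^(-c t)],
    while for [kappa <= 0] the left side stays bounded below. *)
Lemma type_gt0 P kappa c K : P != 0 -> 0 < c -> 0 <= K ->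
  (forall t : R, 0 <= t -> cn (P.[Complex 0 t] * cexp (kappa%:C%C * Complex 0 t ^+ 2)) <=
    K * (expR (- t ^+ 2 / 2) * expR ((t - c) ^+ 2 / 2))) -> 0 < kappa.
Proof.
move=> P0 c0 K0 H; rewrite ltNge; apply/negP => k2.
have [c1 [r0 [c10 r00 HP]]] := poly_lower_bound P0.
apply: (@expR_beats_poly _ c1 c (K * expR (c ^+ 2 / 2)) 0 r0 0%N) => //.
  by rewrite mulr_ge0 ?expR_ge0.
move=> t tr; have t0 : 0 <= t by lra.
have := H t t0; rewrite cnM cn_cexp expr0 mulr1 => h.
have h1 : c1 <= cn P.[Complex 0 t].
  by apply: HP; rewrite cnE /= expr0n add0r sqrtr_sqr ger0_norm.
have h2 : 1 <= expR (complex.Re (kappa%:C%C * Complex 0 t ^+ 2)).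
  by rewrite -[leLHS]expR0 ler_expR /=; have := sqr_ge0 t; nra.
have h3 := le_trans (ler_pM (ltW c10) ler01 h1 h2) h.
have e1 : expR (- t ^+ 2 / 2) * expR ((t - c) ^+ 2 / 2) = expR (c ^+ 2 / 2) * expR (- (c * t)).
  by rewrite -!expRD; congr expR; field.
rewrite mulr1 e1 mulrA in h3.
have e2 : expR (c * t) * expR (- (c * t)) = 1 by rewrite expRxMexpNx_1.
by rewrite -(ler_pM2r (expR_gt0 (- (c * t)))) -mulrA e2 mulr1.
Qed.

Lemma Gw_shift (X t c : R) : Gw X t <= expR ((X - c) ^+ 2 / 2) * expR (c * t).
Proof. by rewrite -expRD ler_expR; have := sqr_ge0 (t - (X - c)); lra. Qed.

End TypeRange.

(** * Homogeneous forms in the direction *)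

Section HomogeneousForms.
Variable R : realType.

(** Homogeneous polynomials as functions, presented by generators: an inverse transform has then to
    be built for monomials only and added up. *)
Inductive hom : nat -> (R * R -> R) -> Prop :=
| hom_mon i j c : hom (i + j) (fun p => c * (p.1 ^+ i * p.2 ^+ j))
| hom_add l phi psi : hom l phi -> hom l psi -> hom l (fun p => phi p + psi p).

Lemma hom_eq l phi psi : phi =1 psi -> hom l phi -> hom l psi.
Proof. by move=> /funext ->. Qed.

Lemma hom0 l : hom l (fun=> 0).
Proof. by have := hom_mon l 0 0; rewrite addn0; apply: hom_eq => p; rewrite mul0r. Qed.

Lemma hom_sum l (n : nat) (F : 'I_n -> R * R -> R) : (forall i, hom l (F i)) ->
  hom l (fun p => \sum_(i < n) F i p).
Proof.
elim: n F => [|n IH] F hF; first by apply: hom_eq (hom0 l) => p; rewrite big_ord0.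
apply: hom_eq (hom_add (IH (fun i => F (widen_ord (leqnSn n) i)) (fun i => hF _)) (hF ord_max)) => p.
by rewrite big_ord_recr.
Qed.

Lemma hom_mul k l phi psi : hom k phi -> hom l psi -> hom (k + l) (fun p => phi p * psi p).
Proof.
move=> hk; elim: hk l psi => {k phi} [i j c l psi hl|k phi phi' _ IH _ IH' l psi hl].
  elim: hl => {l psi} [i' j' c'|l psi psi' _ IH _ IH'].
    rewrite addnACA; apply: hom_eq (hom_mon (i + i') (j + j') (c * c')) => p.
    by rewrite !exprD; ring.
  by apply: hom_eq (hom_add IH IH') => p; ring.
by apply: hom_eq (hom_add (IH l psi hl) (IH' l psi hl)) => p; ring.
Qed.

Lemma hom_norm_pow r : hom (r + r) (fun p => (p.1 ^+ 2 + p.2 ^+ 2) ^+ r).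
Proof.
elim: r => [|r IH].
  by apply: hom_eq (hom_mon 0 0 1) => p; rewrite !expr0 !mulr1.
have h : hom 2 (fun p => p.1 ^+ 2 + p.2 ^+ 2).
  apply: hom_eq (hom_add (hom_mon 2 0 1) (hom_mon 0 2 1)) => p; by rewrite !expr0; ring.
rewrite addSn addnS -addn2 -[X in hom X _]addnC.
by apply: hom_eq (hom_mul h IH) => p; rewrite [RHS]exprS.
Qed.

End HomogeneousForms.

Section GaussianInverse.
Variable R : realType.
Local Notation C := R[i].
Local Notation line := (measurableTypeR R).
Local Notation plane := (line * line)%type.
Local Notation leb := (@lebesgue_measure R).
Local Notation L := (@leb2 R).
Variable b : R.
Hypothesis b0 : 0 < b.
Let m0 (w : R) : R := expR (- (b * w) ^+ 2 / 2).
Let s : R := (2 * b ^+ 2)^-1.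
Implicit Types h : {poly R}.

Let s0 : 0 < s. Proof. by rewrite invr_gt0 mulr_gt0 // exprn_gt0. Qed.

Definition gpow (n : nat) : R := if odd n then 0 else s ^+ n./2 / (n./2)`!%:R.

(** The Taylor coefficient of index [k] of [u^n e^(s u^2)], with [s = 1 / (2 b^2)]. *)
Definition gcoef (n k : nat) : R := if (k < n)%N then 0 else gpow (k - n).

Lemma poly_le_exp h : exists2 K : R, 0 <= K & forall w, `|h.[w]| <= K * expR `|w|.
Proof.
elim/poly_ind: h => [|h c [K K0 IH]].
  by exists 0 => // w; rewrite horner0 normr0 mul0r.
have [Kx Kx0 Hx] : exists2 K' : R, 0 <= K' & forall w, `|h.[w] * w| <= K' * expR `|w|.
  have pw (n : nat) w : `|w| ^+ n <= n`!%:R * expR `|w| :> R.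
    have f0 : 0 < n`!%:R :> R by rewrite ltr0n fact_gt0.
    by rewrite -ler_pdivrMl // mulrC pow_fact_le_expR.
  exists (\sum_(i < size h) `|h`_i| * i.+1`!%:R) => [|w].
    by apply: sumr_ge0 => i _; rewrite mulr_ge0.
  rewrite horner_coef !mulr_suml; apply: le_trans (ler_norm_sum _ _ _) _.
  apply: ler_sum => i _; rewrite -mulrA -exprSr normrM normrX -mulrA.
  by apply: ler_wpM2l.
exists (Kx + `|c|) => [|w]; first by rewrite addr_ge0.
rewrite hornerMXaddC mulrDl; apply: le_trans (ler_normD _ _) _; apply: lerD => //.
by rewrite ler_peMr // -[leLHS]expR0 ler_expR.
Qed.

Lemma measurable_horner h : measurable_fun [set: line] (fun w : line => h.[w]).
Proof. by apply: continuous_measurable_fun; exact: continuous_horner. Qed.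

Let hm h (w : R) : R := m0 w * h.[w].

Let measurable_hm h : measurable_fun [set: line] (hm h : line -> R).
Proof. by apply: measurable_funM; [exact: measurable_gauss|exact: measurable_horner]. Qed.

Let hm_exp_moments h (r : R) : intg leb (fun w => `|hm h w| * expR (r * `|w|)).
Proof.
have [K K0 HK] := poly_le_exp h.
apply: (intg_dom _ (intgZ K (gauss_exp_moments (r + 1) b0))).
  have := measurable_hm h => mh; have mi := @measurable_id _ line setT.
  by msr.
move=> w; rewrite ger0_norm ?mulr_ge0 ?expR_ge0 // normrM.
have -> : expR ((r + 1) * `|w|) = expR (r * `|w|) * expR `|w| by rewrite -expRD; congr expR; ring.
have -> : K * (`|expR (- (b * w) ^+ 2 / 2)| * (expR (r * `|w|) * expR `|w|)) =
  `|m0 w| * (K * expR `|w|) * expR (r * `|w|) by rewrite /m0; ring.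
by rewrite ler_wpM2r ?expR_ge0 // ler_wpM2l.
Qed.

Let mom h k := \int[leb]_w (hm h w * w ^+ k).

Let hm_mom_intg h k : intg leb (fun w => hm h w * w ^+ k).
Proof. exact: (moment_intg (measurable_hm h) (@measurable_id _ line setT) (hm_exp_moments h)). Qed.

Lemma gpow_rec j : j.+2%:R * gpow j.+2 = 2 * s * gpow j.
Proof.
rewrite /gpow /= negbK; case: ifP => [_|oj]; first by rewrite !mulr0.
rewrite factS natrM exprS; have -> : j.+2%:R = 2 * (j./2.+1)%:R :> R.
  rewrite -natrM mul2n doubleS; congr (_.+2%:R).
  by rewrite -[LHS]odd_double_half oj add0n.
have f0 : (j./2)`!%:R != 0 :> R by rewrite pnatr_eq0 -lt0n fact_gt0.
have f1 : (j./2.+1)%:R != 0 :> R by rewrite pnatr_eq0.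
by move: f0 f1; move: (_ `!%:R) (_.+1%:R) (s ^+ j./2) => A B D A0 B0; field; rewrite A0 B0.
Qed.

Lemma gco_real k : gco s%:C%C k = (gpow k)%:C%C.
Proof.
rewrite /gco /gpow; case: ifP => // _; symmetry.
apply: etrans (rmorphM (real_complex R) _ _) _; congr (_ * _).
  exact: (rmorphXn (real_complex R)).
by apply: etrans (fmorphV (real_complex R) _) _; congr (_^-1); exact: (rmorph_nat (real_complex R)).
Qed.

(** The coefficient form of the derivative of [u^n e^(s u^2)], which is [n u^(n-1) e^(s u^2) + 2 s
    u^(n+1) e^(s u^2)]. *)
Lemma gcoef_rec n k : k.+1%:R * gcoef n k.+1 - n%:R * gcoef n.-1 k = 2 * s * gcoef n.+1 k.
Proof.
rewrite /gcoef; case: n => [|n] /=.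
  rewrite mul0r subr0 subn0; case: k => [|k] /=; first by rewrite /gpow /= !mulr0.
  by rewrite subn1 gpow_rec.
rewrite ltnS subSS; case: (ltnP k n) => [kn|nk].
  by rewrite (leq_trans kn (leqW (leqnSn n))) !mulr0 subrr.
rewrite -mulrBl -natrB ?ltnS // subSS.
case: ifP => [kn2|/negbT]; last rewrite -ltnNge => nk2.
  have [->|->] : (k - n = 0 \/ k - n = 1)%N.
    by have : (k - n <= 1)%N; [rewrite leq_subLR addn1|case: (k - n)%N => [|[|]]; auto].
    by rewrite mul0r mulr0.
  by rewrite /gpow /= !mulr0.
have -> : (k - n = (k - n.+2).+2)%N by rewrite -!subSn ?subSS // ltnW.
exact: gpow_rec.
Qed.

(** Multiplying a density by [w] differentiates its Laplace transform, so [gcoef_rec] translates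
    into [h_(n+1) = (w h_n - n h_(n-1)) / (2 s)]: these are Hermite polynomials up to scaling. *)
Lemma inverse_moments n : exists h, (size h <= n.+1)%N /\
  forall k, mom h k = k`!%:R * gcoef n k.
Proof.
pose c := Num.sqrt (2 * pi) / b.
have c0 : c != 0 by rewrite gt_eqF // divr_gt0 // sqrtr_gt0 mulr_gt0 // pi_gt0.
have base : exists h, (size h <= 1)%N /\ forall k, mom h k = k`!%:R * gcoef 0 k.
  exists (c^-1)%:P; split => [|k]; first exact: size_polyC_leq1.
  have Le := laplace_ent (measurable_gauss b) (@measurable_id _ line setT) (fun r => gauss_exp_moments r b0).
  have Ge := ent_mulr_cst c%:C%C (ent_gauss s%:C%C).
  have FG (x : R) : laplace leb (fun w => expR (- (b * w) ^+ 2 / 2)) id x%:C%C = cexp (s%:C%C * x%:C%C ^+ 2) * c%:C%C.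
    by rewrite gauss_laplace // mulrC.
  have := ent_real_unique Le Ge FG k => /(congr1 (@complex.Re R)).
  rewrite gco_real -rmorphM /= => e; have k0 : k`!%:R != 0 :> R by rewrite pnatr_eq0 -lt0n fact_gt0.
  have mi : intg leb (fun w => expR (- (b * w) ^+ 2 / 2) * w ^+ k).
    exact: (moment_intg (measurable_gauss b) (@measurable_id _ line setT) (fun r => gauss_exp_moments r b0)).
  rewrite /mom; have -> : (fun w => hm (c^-1)%:P w * w ^+ k) =
      (fun w => c^-1 * (expR (- (b * w) ^+ 2 / 2) * w ^+ k)).
    by apply/funext => w; rewrite /hm hornerC /m0; ring.
  rewrite (RintZ _ mi) /gcoef ltn0 subn0.
  move: e; move: (\int[leb]_w _) (gpow k) => I g e.
  have -> : I = g * c * k`!%:R by rewrite -e; field.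
  by field; rewrite c0.
elim/ltn_ind: n => -[|n] IH; first exact: base.
have [h [sh hh]] := IH n (ltnSn n).
(* Keeping the factor [n] in the equation covers [n = 0], where there is no preceding polynomial and
   [g = 0] will do. *)
have [g [sg hg]] : exists g : {poly R}, (size g <= n.+1)%N /\ forall k, n%:R * mom g k = k`!%:R * (n%:R * gcoef n.-1 k).
  case: n IH {h sh hh} => [|n] IH; first by exists 0; rewrite size_poly0; split => // k; rewrite !mul0r mulr0.
  have [g [sg hg]] := IH n (ltnW (ltnSn n.+1)); exists g; split; first exact: leqW.
  by move=> k; rewrite hg; ring.
exists ((2 * s)^-1 *: (h * 'X - n%:R *: g)); split => [|k].
  apply: leq_trans (size_scale_leq _ _) _; apply: leq_trans (size_polyD _ _) _.
  rewrite geq_max size_polyN; apply/andP; split.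
    by apply: leq_trans (size_polyMleq _ _) _; rewrite size_polyX addn2.
  by apply: leq_trans (size_scale_leq _ _) _; exact: leqW.
have e : (fun w => hm ((2 * s)^-1 *: (h * 'X - n%:R *: g)) w * w ^+ k) =
    (fun w => (2 * s)^-1 * (hm h w * w ^+ k.+1 - n%:R * (hm g w * w ^+ k))).
  by apply/funext => w; rewrite /hm hornerZ hornerD hornerN hornerZ hornerMX exprS; ring.
rewrite /mom e (RintZ _ (intgB (hm_mom_intg h k.+1) (intgZ _ (hm_mom_intg g k)))).
rewrite (RintB (hm_mom_intg h k.+1) (intgZ _ (hm_mom_intg g k))) (RintZ _ (hm_mom_intg g k)).
rewrite -/(mom h k.+1) -/(mom g k) hh hg factS natrM.
have := gcoef_rec n k; move: (gcoef n k.+1) (gcoef n.-1 k) (gcoef n.+1 k) => A B D e2.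
have -> : (k.+1)%:R * k`!%:R * A - k`!%:R * (n%:R * B) = k`!%:R * (k.+1%:R * A - n%:R * B) by ring.
by rewrite e2; field; rewrite gt_eqF.
Qed.

Lemma ent_mulX (F : C -> C) a : ent F a -> ent (fun z => z * F z) (fun k => if k is k'.+1 then a k' else 0).
Proof.
move=> Fa r r0; have [M HM] := Fa r r0; exists (M * r) => -[|n] z zr.
  rewrite /psum big_ord0 subr0 cnM expr0 mulr1 mulrC.
  have := HM 0%N z zr; rewrite /psum big_ord0 subr0 expr0 mulr1 => h.
  by apply: ler_pM => //; exact: cn_ge0.
have -> : psum (fun k => if k is k'.+1 then a k' else 0) n.+1 z = z * psum a n z.
  rewrite /psum big_ord_recl mul0r add0r mulr_sumr; apply: eq_bigr => i _.
  by rewrite /= exprS; ring.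
rewrite -mulrBr cnM; have := HM n z zr => h.
have -> : M * r * (cn z / r) ^+ n.+1 = cn z * (M * (cn z / r) ^+ n).
  by rewrite exprS; move: (_ ^+ n) => V; field; rewrite gt_eqF.
by apply: ler_wpM2l => //; exact: cn_ge0.
Qed.

Lemma inverse_laplace n : exists h, (size h <= n.+1)%N /\
  forall u : C, laplace leb (hm h) id u = u ^+ n * cexp (s%:C%C * u ^+ 2).
Proof.
have [h [sh hh]] := inverse_moments n; exists h; split => //.
have E : ent (fun u => u ^+ n * cexp (s%:C%C * u ^+ 2)) (fun k => (gcoef n k)%:C%C).
  elim: n {h sh hh} => [|n IH].
    have -> : (fun u => u ^+ 0 * cexp (s%:C%C * u ^+ 2)) = (fun u => cexp (s%:C%C * u ^+ 2)).
      by apply/funext => u; rewrite expr0 mul1r.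
    apply: (ent_eq_coef _ (ent_gauss _)) => k; by rewrite /gcoef ltn0 subn0 gco_real.
  have -> : (fun u => u ^+ n.+1 * cexp (s%:C%C * u ^+ 2)) = (fun u => u * (u ^+ n * cexp (s%:C%C * u ^+ 2))).
    by apply/funext => u; rewrite exprS mulrA.
  by apply: (ent_eq_coef _ (ent_mulX IH)) => -[|k]; rewrite /gcoef ?ltnS ?subSS.
have Le := laplace_ent (measurable_hm h) (@measurable_id _ line setT) (hm_exp_moments h).
apply: (ent_ext Le); apply: (ent_eq_coef _ E) => k; congr (_%:C)%C.
have k0 : k`!%:R != 0 :> R by rewrite pnatr_eq0 -lt0n fact_gt0.
by rewrite -/(mom h k) hh; field.
Qed.

Definition pol2 (D : nat) (c : nat -> nat -> R) (x : R * R) : R :=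
  \sum_(i < D.+1) \sum_(j < D.+1) c i j * (x.1 ^+ i * x.2 ^+ j).

Definition pdeg (D : nat) (c : nat -> nat -> R) := forall i j, c i j != 0 -> (i + j <= D)%N.

Let W (x : R * R) : R := m0 x.1 * m0 x.2.

Lemma measurable_pol2 D c : measurable_fun [set: plane] (pol2 D c : plane -> R).
Proof.
have f1 : measurable_fun [set: plane] (fun z : plane => z.1 : R) by exact: measurable_fst.
have f2 : measurable_fun [set: plane] (fun z : plane => z.2 : R) by exact: measurable_snd.
rewrite /pol2; apply: measurable_sum => i; apply: measurable_sum => j.
by apply: measurable_funM; [exact: measurable_cst|apply: measurable_funM; exact: measurable_exp_comp].
Qed.

Lemma measurable_polW D c : measurable_fun [set: plane] (fun x : plane => pol2 D c x * W x).
Proof.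
have f1 : measurable_fun [set: plane] (fun z : plane => z.1 : R) by exact: measurable_fst.
have f2 : measurable_fun [set: plane] (fun z : plane => z.2 : R) by exact: measurable_snd.
apply: measurable_funM; first exact: measurable_pol2.
by apply: measurable_funM; [exact: (measurableT_comp (measurable_gauss b) f1)|
  exact: (measurableT_comp (measurable_gauss b) f2)].
Qed.

Lemma pol2_le_exp D c : exists2 K : R, 0 <= K & forall x, `|pol2 D c x| <= K * (expR `|x.1| * expR `|x.2|).
Proof.
have pw (n : nat) (w : R) : `|w| ^+ n <= n`!%:R * expR `|w| :> R.
  have f0 : 0 < n`!%:R :> R by rewrite ltr0n fact_gt0.
  by rewrite -ler_pdivrMl // mulrC pow_fact_le_expR.
exists (\sum_(i < D.+1) \sum_(j < D.+1) `|c i j| * (i`!%:R * j`!%:R)) => [|x].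
  by apply: sumr_ge0 => i _; apply: sumr_ge0 => j _; rewrite mulr_ge0.
rewrite mulr_suml; apply: le_trans (ler_norm_sum _ _ _) _; apply: ler_sum => i _.
rewrite mulr_suml; apply: le_trans (ler_norm_sum _ _ _) _; apply: ler_sum => j _.
rewrite !normrM !normrX -mulrA; apply: ler_wpM2l => //; rewrite mulrACA.
by apply: ler_pM => //; exact: exprn_ge0.
Qed.

Lemma polW_exp_moments D c p (r : R) : enorm p = 1 ->
  intg L (fun x => `|pol2 D c x * W x| * expR (r * `|dotp p x|)).
Proof.
move=> p1; have [K K0 HK] := pol2_le_exp D c.
have e1 := gauss_exp_moments (`|r| + 1) b0.
apply: (intg_dom _ (intgZ K (leb2_prod_intg e1 e1))).
  have mp := measurable_polW D c; have md := measurable_dotp p.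
  by apply: measurable_funM; [exact: measurable_norm_comp|
    apply: measurable_expR_comp; apply: measurable_funM; [exact: measurable_cst|exact: measurable_norm_comp]].
have pp : p.1 ^+ 2 + p.2 ^+ 2 = 1 by rewrite -enorm_sq p1 expr1n.
have h1 : `|p.1| <= 1 by apply: norm_le_sq => //; have := sqr_ge0 p.2; lra.
have h2 : `|p.2| <= 1 by apply: norm_le_sq => //; have := sqr_ge0 p.1; lra.
move=> x; rewrite (ger0_norm (mulr_ge0 (normr_ge0 _) (expR_ge0 _))) normrM.
have dx : `|dotp p x| <= `|x.1| + `|x.2|.
  apply: le_trans (ler_normD _ _) _; rewrite !normrM.
  by apply: lerD; apply: ler_piMl.
have hr : expR (r * `|dotp p x|) <= expR (`|r| * `|x.1|) * expR (`|r| * `|x.2|).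
  rewrite -expRD ler_expR -mulrDr; apply: (@le_trans _ _ (`|r| * `|dotp p x|)).
    by apply: ler_wpM2r => //; exact: ler_norm.
  exact: ler_wpM2l.
have W0 : `|W x| = m0 x.1 * m0 x.2 by rewrite ger0_norm // mulr_ge0 // expR_ge0.
rewrite W0 !(ger0_norm (expR_ge0 _)) -/(m0 x.1) -/(m0 x.2).
have E (y : R) : expR ((`|r| + 1) * `|y|) = expR (`|r| * `|y|) * expR `|y| by rewrite -expRD; congr expR; ring.
rewrite !E.
have m1 : 0 <= m0 x.1 * m0 x.2 by rewrite mulr_ge0 // expR_ge0.
apply: le_trans (ler_pM (mulr_ge0 (normr_ge0 _) m1) (expR_ge0 _) (ler_wpM2r m1 (HK x)) hr) _.
by le_eq; ring.
Qed.

Lemma laplace_add (m1 m2 : R * R -> R) p (u : C) :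
  intg L (fun x => m1 x * complex.Re (cexp (u * (dotp p x)%:C%C))) ->
  intg L (fun x => m1 x * complex.Im (cexp (u * (dotp p x)%:C%C))) ->
  intg L (fun x => m2 x * complex.Re (cexp (u * (dotp p x)%:C%C))) ->
  intg L (fun x => m2 x * complex.Im (cexp (u * (dotp p x)%:C%C))) ->
  laplace L (fun x => m1 x + m2 x) (dotp p) u = laplace L m1 (dotp p) u + laplace L m2 (dotp p) u.
Proof.
move=> r1 i1 r2 i2; apply: complex_eq.
  rewrite ReD; rewrite [LHS]/= [X in X + _]/= [X in _ + X]/= -(RintD r1 r2).
  by apply: eq_Rintegral => x _; rewrite mulrDl.
rewrite ImD; rewrite [LHS]/= [X in X + _]/= [X in _ + X]/= -(RintD i1 i2).
by apply: eq_Rintegral => x _; rewrite mulrDl.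
Qed.

Lemma laplace_prod h g p (u : C) :
  laplace L (fun x => hm h x.1 * hm g x.2) (dotp p) u =
  laplace leb (hm h) id (u * p.1%:C%C) * laplace leb (hm g) id (u * p.2%:C%C).
Proof.
have ri h' v := laplace_Re_intg (measurable_hm h') (@measurable_id _ line setT) (hm_exp_moments h') v.
have ii h' v := laplace_Im_intg (measurable_hm h') (@measurable_id _ line setT) (hm_exp_moments h') v.
have [r1 r2 i1 i2] := And4 (ri h (u * p.1%:C%C)) (ri g (u * p.2%:C%C)) (ii h (u * p.1%:C%C)) (ii g (u * p.2%:C%C)).
have E (x : R * R) : cexp (u * (dotp p x)%:C%C) = cexp (u * p.1%:C%C * (x.1)%:C%C) * cexp (u * p.2%:C%C * (x.2)%:C%C).
  by rewrite -cexpD; congr cexp; rewrite /dotp; case: (u) => a c; apply: complex_eq => /=; ring.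
apply: complex_eq.
  rewrite Re_mul [LHS]/= [in RHS]/= -(leb2_Rint_prod r1 r2) -(leb2_Rint_prod i1 i2).
  rewrite -(RintB (leb2_prod_intg r1 r2) (leb2_prod_intg i1 i2)); apply: eq_Rintegral => x _.
  by rewrite -/(cexp _) (_ : _ * cos _ = complex.Re (cexp (u * (dotp p x)%:C%C))) // E Re_mul; ring.
rewrite Im_mul [LHS]/= [in RHS]/= -(leb2_Rint_prod r1 i2) -(leb2_Rint_prod i1 r2).
rewrite -(RintD (leb2_prod_intg r1 i2) (leb2_prod_intg i1 r2)); apply: eq_Rintegral => x _.
by rewrite (_ : _ * sin _ = complex.Im (cexp (u * (dotp p x)%:C%C))) // E Im_mul; ring.
Qed.

Lemma pol2_add D c c' x : pol2 D (fun i j => c i j + c' i j) x = pol2 D c x + pol2 D c' x.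
Proof.
rewrite /pol2 -big_split; apply: eq_bigr => i _; rewrite -big_split; apply: eq_bigr => j _.
by rewrite /= mulrDl.
Qed.

(** A polynomial times the Gaussian whose transform on each unit direction is
    [phi p * u^l * e^(s u^2)]. The degree bound [D] is shared by all [l], so arrays of coefficients
    can be added. *)
Definition realizes (D l : nat) (phi : R * R -> R) := exists2 c : nat -> nat -> R, pdeg D c &
  forall p, enorm p = 1 -> forall u : C, laplace L (fun x => pol2 D c x * W x) (dotp p) u =
    (phi p)%:C%C * u ^+ l * cexp (s%:C%C * u ^+ 2).

Lemma laplace_polW_add D c c' p u : enorm p = 1 ->
  laplace L (fun x => pol2 D (fun i j => c i j + c' i j) x * W x) (dotp p) u =
  laplace L (fun x => pol2 D c x * W x) (dotp p) u + laplace L (fun x => pol2 D c' x * W x) (dotp p) u.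
Proof.
move=> p1; have -> : (fun x => pol2 D (fun i j => c i j + c' i j) x * W x) =
    (fun x => pol2 D c x * W x + pol2 D c' x * W x).
  by apply/funext => x; rewrite pol2_add mulrDl.
have md := measurable_dotp p.
apply: laplace_add.
- exact: (laplace_Re_intg (measurable_polW D c) md (fun r => polW_exp_moments D c r p1) u).
- exact: (laplace_Im_intg (measurable_polW D c) md (fun r => polW_exp_moments D c r p1) u).
- exact: (laplace_Re_intg (measurable_polW D c') md (fun r => polW_exp_moments D c' r p1) u).
- exact: (laplace_Im_intg (measurable_polW D c') md (fun r => polW_exp_moments D c' r p1) u).
Qed.

Lemma pdeg_add D c c' : pdeg D c -> pdeg D c' -> pdeg D (fun i j => c i j + c' i j).
Proof.
move=> hc hc' i j; have [e|/hc //] := eqVneq (c i j) 0.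
by rewrite e add0r => /hc'.
Qed.

(** For a monomial [p1^i p2^j] the inverse is the product of two one-variable inverses: since
    [|p| = 1], the Gaussian [e^(s u^2)] splits as [e^(s (u p1)^2) e^(s (u p2)^2)]. *)
Lemma hom_realizes D l phi : (l <= D)%N -> hom l phi -> realizes D l phi.
Proof.
move=> lD hl; elim: hl lD => {l phi} [i j c lD|l phi psi _ IH _ IH' lD]; last first.
  have [c1 d1 e1] := IH lD; have [c2 d2 e2] := IH' lD.
  exists (fun i j => c1 i j + c2 i j); first exact: pdeg_add.
  by move=> p p1 u; rewrite laplace_polW_add // e1 // e2 // rmorphD /=; ring.
have [h [sh hh]] := inverse_laplace i; have [g [sg hg]] := inverse_laplace j.
pose h' := c *: h; have sh' : (size h' <= i.+1)%N by exact: leq_trans (size_scale_leq _ _) sh.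
exists (fun a e => h'`_a * g`_e).
  move=> a e; rewrite mulf_eq0 negb_or => /andP[ha ge].
  have la : (a <= i)%N by rewrite -ltnS; apply: leq_trans sh'; rewrite ltnNge; apply: contra ha => /(nth_default 0) ->.
  have le_ : (e <= j)%N by rewrite -ltnS; apply: leq_trans sg; rewrite ltnNge; apply: contra ge => /(nth_default 0) ->.
  exact: leq_trans (leq_add la le_) lD.
move=> p p1 u.
have iD : (i < D.+1)%N by rewrite ltnS (leq_trans (leq_addr j i) lD).
have jD : (j < D.+1)%N by rewrite ltnS (leq_trans (leq_addl i j) lD).
have -> : (fun x => pol2 D (fun a e => h'`_a * g`_e) x * W x) = (fun x => hm h' x.1 * hm g x.2).
  apply/funext => x; have -> : pol2 D (fun a e => h'`_a * g`_e) x = h'.[x.1] * g.[x.2].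
    rewrite (horner_coef_wide _ (leq_trans sh' iD)) (horner_coef_wide _ (leq_trans sg jD)) mulr_suml.
    apply: eq_bigr => a _; rewrite mulr_sumr; apply: eq_bigr => e _; ring.
  by rewrite /W /hm; ring.
rewrite laplace_prod hg.
have -> : laplace leb (hm h') id (u * p.1%:C%C) = c%:C%C * laplace leb (hm h) id (u * p.1%:C%C).
  have r1 := laplace_Re_intg (measurable_hm h) (@measurable_id _ line setT) (hm_exp_moments h) (u * p.1%:C%C).
  have i1 := laplace_Im_intg (measurable_hm h) (@measurable_id _ line setT) (hm_exp_moments h) (u * p.1%:C%C).
  apply: complex_eq.
    rewrite ReZ [LHS]/= [in RHS]/= -(RintZ _ r1); apply: eq_Rintegral => w _.
    by rewrite /hm hornerZ /=; ring.
  rewrite ImZ [LHS]/= [in RHS]/= -(RintZ _ i1); apply: eq_Rintegral => w _.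
  by rewrite /hm hornerZ /=; ring.
rewrite hh.
have pp : p.1%:C%C ^+ 2 + p.2%:C%C ^+ 2 = 1 :> C.
  by rewrite -!rmorphXn -rmorphD -enorm_sq p1 expr1n.
have -> : cexp (s%:C%C * u ^+ 2) = cexp (s%:C%C * (u * p.1%:C%C) ^+ 2) * cexp (s%:C%C * (u * p.2%:C%C) ^+ 2).
  rewrite -cexpD -mulrDr !exprMn -mulrDr pp mulr1 //.
rewrite !exprMn exprD !rmorphM !rmorphXn /=; ring.
Qed.

End GaussianInverse.

(** * Uniqueness of Fourier transforms *)

Section GaussianApproximation.
Variable R : realType.
Local Notation leb := (@lebesgue_measure R).
Local Notation line := (measurableTypeR R).
Implicit Types n t a A B : R.

Definition gs n t a : R := n / Num.sqrt (2 * pi) * expR (- (n * (a - t)) ^+ 2 / 2).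

Lemma norm_unit_mul_le (s g : R) : 0 <= s <= 1 -> 0 <= g -> `|s * g| <= g.
Proof. by move=> /andP[s0 s1] g0; rewrite normrM (ger0_norm s0) (ger0_norm g0) ler_piMl. Qed.

Lemma sqrt2pi_gt0 : 0 < Num.sqrt (2 * pi) :> R.
Proof. by rewrite sqrtr_gt0 mulr_gt0 // pi_gt0. Qed.

Lemma gs_ge0 n t a : 0 < n -> 0 <= gs n t a.
Proof. by move=> n0; rewrite /gs mulr_ge0 ?expR_ge0 // divr_ge0 ?sqrtr_ge0 // ltW. Qed.

Lemma gs_le n t a : 0 < n -> gs n t a <= n / Num.sqrt (2 * pi).
Proof.
move=> n0; apply: ler_piMr; first by apply: divr_ge0 (sqrtr_ge0 _); exact: ltW.
by rewrite -[leRHS]expR0 ler_expR; have := sqr_ge0 (n * (a - t)); lra.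
Qed.

Lemma gs_intg n t : 0 < n -> intg leb (gs n t) /\ \int[leb]_a gs n t a = 1.
Proof.
move=> n0; have [i e] := gauss_shift_intg (n ^+ 2 * t) n0.
pose c := n / Num.sqrt (2 * pi) * expR (- (n * t) ^+ 2 / 2).
have E : gs n t = (fun a => c * expR (- (n * a) ^+ 2 / 2 + n ^+ 2 * t * a)).
  by apply/funext => a; rewrite /gs /c -[RHS]mulrA -expRD; congr (_ * expR _); field.
rewrite E; split; first exact: intgZ.
rewrite RintZ // e /c.
have -> : (n ^+ 2 * t) ^+ 2 / (2 * n ^+ 2) = (n * t) ^+ 2 / 2 by field; rewrite gt_eqF.
have := expRxMexpNx_1 ((n * t) ^+ 2 / 2); rewrite mulNr.
have := sqrt2pi_gt0; move: (Num.sqrt _) (expR ((n * t) ^+ 2 / 2)) (expR (- _)) => s E1 E2 s0 e12.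
have -> : n / s * E2 * (s / n * E1) = E1 * E2 by field; rewrite !gt_eqF.
exact: e12.
Qed.

Lemma measurable_gs_comp d (T : measurableType d) n (t a : T -> R) :
  measurable_fun [set: T] t -> measurable_fun [set: T] a ->
  measurable_fun [set: T] (fun z => gs n (t z) (a z)).
Proof.
move=> mt ma; rewrite /gs; apply: measurable_funM; first exact: measurable_cst.
apply: measurable_expR_comp; apply: measurable_funM; last exact: measurable_cst.
apply: measurable_funN; apply: measurable_exp_comp; apply: measurable_funM; first exact: measurable_cst.
exact: measurable_funB.
Qed.

Lemma measurable_gs n t : measurable_fun [set: line] (gs n t : line -> R).
Proof. by rewrite /gs; msr. Qed.

(** Half of the exponent is spent on decay: [gs n] is [sqrt 2] times the wider density
    [gs (n / sqrt 2)] times [e^(-z)] with [z = (n (a - t))^2 / 4], and [e^(-z) <= 1 / z] is at most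
    [4 / (n^2 dl^2)] off the interval of radius [dl]. *)
Lemma gs_tail (S : R -> R) n t (dl : R) : 0 < n -> 0 < dl -> measurable_fun [set: line] (S : line -> R) ->
  (forall a, 0 <= S a <= 1) -> (forall a, S a != 0 -> dl <= `|a - t|) ->
  intg leb (fun a => S a * gs n t a) /\
  0 <= \int[leb]_a (S a * gs n t a) <= Num.sqrt 2 * 4 / (n ^+ 2 * dl ^+ 2).
Proof.
move=> n0 d0 mS S01 Sd; have [i1 _] := gs_intg t n0.
have s20 : 0 < Num.sqrt 2 :> R by rewrite sqrtr_gt0.
have m0 : 0 < n / Num.sqrt 2 by rewrite divr_gt0.
have [i2 e2] := gs_intg t m0.
have mg := measurable_gs n t.
have i : intg leb (fun a => S a * gs n t a).
  apply: (intg_dom _ i1); first exact: measurable_funM.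
  by move=> a; exact: norm_unit_mul_le (S01 a) (gs_ge0 t a n0).
split => //; apply/andP; split.
  by apply: Rintegral_ge0 => a _; have /andP[S0 _] := S01 a; rewrite mulr_ge0 // gs_ge0.
set K := _ / (_ * _); have K0 : 0 <= K by rewrite /K; nneg.
rewrite -[leRHS]mulr1 -e2 -(RintZ _ i2); apply: Rint_le => //; first exact: intgZ.
move=> a; have /andP[S0 S1] := S01 a; have g0 := gs_ge0 t a n0; have g1 := gs_ge0 t a m0.
have [->|/Sd da] := eqVneq (S a) 0; first by rewrite mul0r mulr_ge0.
apply: (@le_trans _ _ (gs n t a)); first by rewrite ler_piMl.
pose z := (n * (a - t)) ^+ 2 / 4.
have y2 : dl ^+ 2 <= (a - t) ^+ 2.
  by rewrite -[leRHS](real_normK (num_real _)) lerXn2r // ?nnegrE ltW.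
have y20 : 0 < (a - t) ^+ 2 by apply: lt_le_trans y2; rewrite exprn_gt0.
have n20 : 0 < n ^+ 2 by rewrite exprn_gt0.
have z0 : 0 < z by rewrite /z exprMn divr_gt0 // mulr_gt0.
have ez : expR (- z) <= 4 / (n ^+ 2 * dl ^+ 2).
  apply: (@le_trans _ _ z^-1).
    by rewrite expRN lef_pV2 ?posrE ?expR_gt0 //; have := expR_ge1Dx z; lra.
  rewrite /z exprMn invf_div; apply: ler_wpM2l => //.
  have d20 : 0 < dl ^+ 2 by rewrite exprn_gt0.
  by rewrite lef_pV2 ?posrE ?(mulr_gt0 n20 y20) ?(mulr_gt0 n20 d20) // ler_pM2l.
have -> : gs n t a = Num.sqrt 2 * gs (n / Num.sqrt 2) t a * expR (- z).
  have e : (n / Num.sqrt 2 * (a - t)) ^+ 2 = (n * (a - t)) ^+ 2 / 2.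
    by rewrite !exprMn exprVn sqr_sqrtr //; ring.
  rewrite /gs e.
  have -> : expR (- (n * (a - t)) ^+ 2 / 2) = expR (- ((n * (a - t)) ^+ 2 / 2) / 2) * expR (- z).
    by rewrite -expRD; congr expR; rewrite /z; field.
  move: (expR (- z)) (expR _) sqrt2pi_gt0 => E E' h; field.
  by rewrite !gt_eqF.
have -> : K * gs (n / Num.sqrt 2) t a = Num.sqrt 2 * gs (n / Num.sqrt 2) t a * (4 / (n ^+ 2 * dl ^+ 2)).
  by rewrite /K; ring.
by apply: ler_wpM2l => //; rewrite mulr_ge0 // ltW.
Qed.

(** The interval is open on the left and closed on the right, as are the generators of the Borel
    sets in [line_dynkin]. *)
Definition ind A B (t : R) : R := \1_(`]A, B]%classic : set line) t.

Lemma ind01 A B t : 0 <= ind A B t <= 1.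
Proof. by rewrite /ind indicE; case: (_ \in _); rewrite ?lexx ?ler01. Qed.

Lemma indE A B t : ind A B t = ((A < t) && (t <= B))%:R.
Proof. by rewrite /ind indicE mem_setE in_itv. Qed.

Lemma measurable_ind A B : measurable_fun [set: line] (ind A B : line -> R).
Proof. by apply: measurable_indic; exact: measurable_itv. Qed.

Lemma ind_intg A B : intg leb (ind A B).
Proof.
apply: intg_ge0; first exact: measurable_ind.
  by move=> t; case/andP: (ind01 A B t).
rewrite /ind integral_indic //.
rewrite setIT; have h := @lebesgue_measure_itv R `]A, B].
by rewrite [X in (X < _)%E]h /=; case: ifP => _; rewrite ?ltry // -EFinD ltry.
Qed.

Definition psi A B n t : R := \int[leb]_a (ind A B a * gs n t a).

Lemma psi_intg A B n t : 0 < n -> intg leb (fun a => ind A B a * gs n t a).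
Proof.
move=> n0; have [i _] := gs_intg t n0; apply: (intg_dom _ i).
  by apply: measurable_funM; [exact: measurable_ind|exact: measurable_gs].
by move=> a; exact: norm_unit_mul_le (ind01 A B a) (gs_ge0 t a n0).
Qed.

Lemma psi01 A B n t : 0 < n -> 0 <= psi A B n t <= 1.
Proof.
move=> n0; have [i e] := gs_intg t n0; apply/andP; split.
  by apply: Rintegral_ge0 => a _; have /andP[? ?] := ind01 A B a; rewrite mulr_ge0 // gs_ge0.
rewrite -e; apply: Rint_le (psi_intg A B t n0) i _ => a.
by have /andP[? ?] := ind01 A B a; rewrite ler_piMl // gs_ge0.
Qed.

Lemma psi_error A B t : t != A -> t != B -> exists2 K : R, 0 <= K &
  forall n, 0 < n -> `|psi A B n t - ind A B t| <= K / n ^+ 2.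
Proof.
move=> tA tB; pose dl := Num.min `|t - A| `|t - B|.
have dl0 : 0 < dl by rewrite lt_min !normr_gt0 !subr_eq0 tA tB.
exists (Num.sqrt 2 * 4 / dl ^+ 2) => [|n n0]; first by nneg.
have -> : Num.sqrt 2 * 4 / dl ^+ 2 / n ^+ 2 = Num.sqrt 2 * 4 / (n ^+ 2 * dl ^+ 2).
  by field; rewrite !gt_eqF.
have dA : dl <= `|t - A| by rewrite ge_min lexx.
have dB : dl <= `|t - B| by rewrite ge_min lexx orbT.
have [i e] := gs_intg t n0.
case Et : ((A < t) && (t <= B)); rewrite indE Et.
  have/andP[At tB'] := Et.
  have m1 : measurable_fun [set: line] ((fun a => 1 - ind A B a) : line -> R).
    by apply: measurable_funB; [exact: measurable_cst|exact: measurable_ind].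
  have h01 a : 0 <= 1 - ind A B a <= 1.
    by have /andP[? ?] := ind01 A B a; rewrite subr_ge0 lerBlDr lerDl; apply/andP.
  have hd a : 1 - ind A B a != 0 -> dl <= `|a - t|.
    rewrite indE; case Ea: (_ && _); rewrite ?subrr ?eqxx // => _.
    move/negbT: Ea; rewrite negb_and -leNgt -ltNge => /orP[aA|Ba].
      by rewrite distrC (le_trans dA) // !ger0_norm; lra.
    by rewrite (le_trans dB) // ler0_norm ?ger0_norm; lra.
  have [j /andP[j0 j1]] := gs_tail n0 dl0 m1 h01 hd.
  have -> : psi A B n t - true%:R = - \int[leb]_a ((1 - ind A B a) * gs n t a).
    rewrite -[X in _ - X]e -opprB; congr (- _); rewrite -(RintB i (psi_intg A B t n0)).
    by apply: eq_Rintegral => a _; ring.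
  by rewrite normrN ger0_norm.
have hd a : ind A B a != 0 -> dl <= `|a - t|.
  rewrite indE; case Ea: (_ && _); rewrite ?eqxx // => _; case/andP: Ea => Aa aB.
  move/negbT: Et; rewrite negb_and -leNgt -ltNge => /orP[tA'|Bt].
    by rewrite (le_trans dA) // ler0_norm ?ger0_norm; lra.
  by rewrite distrC (le_trans dB) // !ger0_norm; lra.
have [j /andP[j0 j1]] := gs_tail n0 dl0 (measurable_ind A B) (ind01 A B) hd.
by rewrite subr0 ger0_norm.
Qed.

Lemma psi_cvg A B t : t != A -> t != B -> psi A B k.+1%:R t @[k --> \oo] --> ind A B t.
Proof.
move=> tA tB; have [K K0 HK] := psi_error tA tB.
apply/cvgrPdist_le => e e0.
have [k _ Hk] : \forall k \near \oo, K * k.+1%:R^-1 <= e.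
  have : K * harmonic k @[k --> \oo] --> (K * 0 : R) by apply: cvgMr; exact: cvg_harmonic.
  rewrite mulr0 => /cvgr0Pnorm_le /(_ e e0); apply: filterS => k.
  by apply: le_trans; rewrite ler_norm.
exists k => // j /= kj; rewrite distrC; apply: le_trans (HK _ _) _; first by [].
apply: le_trans (Hk j kj); apply: ler_wpM2l => //.
rewrite lef_pV2 ?posrE ?exprn_gt0 // -natrX ler_nat.
by rewrite expnS expn1 leq_pmulr.
Qed.

(** The weight [e^(-t^2 / 2)] makes the integrand dominated by a product of integrable functions, so
    Fubini gives measurability in the parameter [t]; the weight is then divided out. *)
Lemma measurable_psi A B n : 0 < n -> measurable_fun [set: line] (psi A B n : line -> R).
Proof.
move=> n0; have [[i1 _] [i2 _]] := (gs_intg 0 n0, gs_intg 0 (n := 1) ltr01).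
have m : measurable_fun [set: line * line] (fun z : line * line => ind A B z.2 * gs n z.1 z.2 * expR (- z.1 ^+ 2 / 2)).
  have mi := measurableT_comp (measurable_ind A B) (@measurable_snd _ _ line line).
  have f1 : measurable_fun [set: line * line] (fun z : line * line => z.1 : R) by exact: measurable_fst.
  have f2 : measurable_fun [set: line * line] (fun z : line * line => z.2 : R) by exact: measurable_snd.
  apply: measurable_funM; last first.
    apply: measurable_expR_comp; apply: measurable_funM; last exact: measurable_cst.
    by apply: measurable_funN; exact: measurable_exp_comp.
  by apply: measurable_funM => //; exact: measurable_gs_comp.
have hb t a : `|ind A B a * gs n t a * expR (- t ^+ 2 / 2)| <=
    expR (- t ^+ 2 / 2) * (n / Num.sqrt (2 * pi) * ind A B a).
  have /andP[I0 I1] := ind01 A B a; have g0 := gs_ge0 t a n0.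
  rewrite ger0_norm ?(mulr_ge0 (mulr_ge0 I0 g0) (expR_ge0 _)) // mulrC.
  by apply: (ler_wpM2l (expR_ge0 _)); rewrite mulrC; apply: (ler_wpM2r I0); exact: gs_le.
have j : intg leb (fun t : R => expR (- t ^+ 2 / 2)).
  apply: eq_intg (gauss_shift_intg 0 (@ltr01 R)).1 => t; by rewrite mul1r mul0r addr0.
have [k _ _] := dominated_fubini (m1 := leb) (m2 := leb)
  (phi := fun t : R => expR (- t ^+ 2 / 2)) (psi := fun a => n / Num.sqrt (2 * pi) * ind A B a)
  m j (intgZ _ (ind_intg A B)) hb.
have me : measurable_fun [set: line] (fun t : line => expR (t ^+ 2 / 2)).
  by apply: measurable_expR_comp; apply: measurable_funM; [exact: measurable_exp_comp|exact: measurable_cst].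
have -> : psi A B n = (fun t => (\int[leb]_a (ind A B a * gs n t a * expR (- t ^+ 2 / 2))) * expR (t ^+ 2 / 2)).
  apply/funext => t; under eq_Rintegral do rewrite mulrC.
  have z : - t ^+ 2 / 2 + t ^+ 2 / 2 = 0 by field.
  by rewrite (RintZ _ (psi_intg A B t n0)) mulrAC -expRD z expR0 mul1r.
exact: (measurable_funM (intg_measurable k) me).
Qed.

End GaussianApproximation.

Section PlaneLines.
Variable R : realType.
Local Notation L := (@leb2 R).

Lemma ae_fst_neq (A : R) : {ae L, forall x : R * R, x.1 != A}.
Proof.
pose S : set (measurableTypeR R) := [set A]; have mS : measurable S by exact: measurable_set1.
exists (S `*` [set: measurableTypeR R]); split.
- exact: measurableX.
- rewrite [LHS](_ : _ = (lebesgue_measure S * lebesgue_measure [set: measurableTypeR R])%E).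
    by rewrite lebesgue_measure_set1 mul0e.
  exact: product_measure1E.
- by move=> [x y] /= h; split => //; apply: contrapT => xA; apply: h; exact/eqP.
Qed.

Lemma ae_snd_neq (A : R) : {ae L, forall x : R * R, x.2 != A}.
Proof.
pose S : set (measurableTypeR R) := [set A]; have mS : measurable S by exact: measurable_set1.
exists ([set: measurableTypeR R] `*` S); split.
- exact: measurableX.
- rewrite [LHS](_ : _ = (lebesgue_measure [set: measurableTypeR R] * lebesgue_measure S)%E).
    by rewrite lebesgue_measure_set1 mule0.
  exact: product_measure1E.
- by move=> [x y] /= h; split => //; apply: contrapT => xA; apply: h; exact/eqP.
Qed.

End PlaneLines.

Section FourierUniqueness.
Variable R : realType.
Local Notation C := R[i].
Local Notation plane := (measurableTypeR R * measurableTypeR R)%type.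
Local Notation leb := (@lebesgue_measure R).
Local Notation L := (@leb2 R).
Variable m : R * R -> R.
Hypothesis im : intg L m.
Hypothesis mcos : forall w : R * R, \int[L]_x (m x * cos (x.1 * w.1 + x.2 * w.2)) = 0.
Hypothesis msin : forall w : R * R, \int[L]_x (m x * sin (x.1 * w.1 + x.2 * w.2)) = 0.

Let g (x : R * R) : quat R := Quat (m x) 0 0 0.

Let ig : qintg g.
Proof.
have mm := intg_measurable im; split.
  by split => //=; exact: measurable_cst.
apply: eq_intg (intg_norm im) => x; rewrite (qnorm_eq (c := `|m x|)) //=.
by rewrite real_normK ?num_real // expr0n !addr0.
Qed.

Let trig_intg (h : R -> R) (w : R * R) : measurable_fun [set: plane] (fun x : plane => h (x.1 * w.1 + x.2 * w.2)) ->
  (forall t, `|h t| <= 1) -> intg L (fun x => m x * h (x.1 * w.1 + x.2 * w.2)).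
Proof.
move=> mh h1; apply: (intg_dom _ (intg_norm im)) => [|x].
  by apply: measurable_funM => //; exact: intg_measurable im.
by rewrite normrM ler_piMr.
Qed.

(** Product-to-sum formulas express the four coordinates of the two-sided kernel by cosines and
    sines of [x1 w1 + x2 w2] and [x1 w1 - x2 w2]; the second is the frequency [w']. *)
Let qft0 w : qft 1 1 g w = 0.
Proof.
have mc (v : R * R) : measurable_fun [set: plane] (fun x : plane => cos (x.1 * v.1 + x.2 * v.2)) by msr.
have ms (v : R * R) : measurable_fun [set: plane] (fun x : plane => sin (x.1 * v.1 + x.2 * v.2)) by msr.
have c1 t : `|cos t : R| <= 1 by rewrite ler_norml cos_geN1 cos_le1.
have s1 t : `|sin t : R| <= 1 by rewrite ler_norml sin_geN1 sin_le1.
pose w' := (w.1, - w.2).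
have ic := trig_intg (mc w) c1; have ic' := trig_intg (mc w') c1.
have is_ := trig_intg (ms w) s1; have is' := trig_intg (ms w') s1.
have comb (F : R * R -> R) (h h' : R -> R) (a b : R) :
  intg L (fun x => m x * h (x.1 * w.1 + x.2 * w.2)) -> intg L (fun x => m x * h' (x.1 * w'.1 + x.2 * w'.2)) ->
  \int[L]_x (m x * h (x.1 * w.1 + x.2 * w.2)) = 0 ->
  \int[L]_x (m x * h' (x.1 * w'.1 + x.2 * w'.2)) = 0 ->
  (forall x, F x = a * (m x * h (x.1 * w.1 + x.2 * w.2)) + b * (m x * h' (x.1 * w'.1 + x.2 * w'.2))) ->
  \int[L]_x F x = 0.
  move=> ih ih' e e' /funext ->.
  by rewrite (RintD (intgZ a ih) (intgZ b ih')) !RintZ // e e' !mulr0 addr0.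
have e : qwave 1 1 g ^~ w = (fun x => Quat (m x * (cos (x.1 * w.1) * cos (x.2 * w.2)))
    (- (m x * (sin (x.1 * w.1) * cos (x.2 * w.2)))) (- (m x * (cos (x.1 * w.1) * sin (x.2 * w.2))))
    (m x * (sin (x.1 * w.1) * sin (x.2 * w.2)))).
  apply/funext => x; rewrite /qwave /osc /g /cexp /= expR0 !mul1r !cosN !sinN.
  by congr Quat => /=; ring.
rewrite /qft e.
congr Quat => /=.
- by apply: (comb _ cos cos (1/2) (1/2)) => // x; rewrite /= !mulrN cosD cosB; field.
- by apply: (comb _ sin sin (- 1/2) (- 1/2)) => // x; rewrite /= !mulrN sinD sinB; field.
- by apply: (comb _ sin sin (- 1/2) (1/2)) => // x; rewrite /= !mulrN sinD sinB; field.
- by apply: (comb _ cos cos (- 1/2) (1/2)) => // x; rewrite /= !mulrN cosD cosB; field.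
Qed.

Lemma m_gs_intg (n : R) (a : R * R) : 0 < n ->
  intg L (fun x => m x * (gs n x.1 a.1 * gs n x.2 a.2)).
Proof.
move=> n0.
  apply: (intg_dom _ (intgZ ((n / Num.sqrt (2 * pi)) ^+ 2) (intg_norm im))).
    apply: measurable_funM; first exact: intg_measurable im.
    by apply: measurable_funM; apply: measurable_gs_comp; msr.
  move=> x; rewrite normrM mulrC; apply: ler_wpM2r => //.
  rewrite normrM !ger0_norm ?gs_ge0 // expr2.
  by apply: ler_pM; rewrite ?gs_ge0 ?gs_le.
Qed.

(** The real function [m] is viewed as quaternion-valued. Its two-sided transform vanishes, so
    Gaussian duality with [H = 0] kills every Gaussian average. *)
Lemma gauss_smoothing0 (n : R) (a : R * R) : 0 < n ->
  \int[L]_x (m x * (gs n x.1 a.1 * gs n x.2 a.2)) = 0.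
Proof.
move=> n0; have nV0 : 0 < n^-1 by rewrite invr_gt0.
(* With width [1 / n] this shift turns [gk] into a constant multiple of the density centred at
   [t]. *)
pose v (t : R) : C := (n ^+ 2 * t)%:C%C.
have h0 : {ae L, forall w, qnorm (qft 1 1 g w) <= 0 :> R}.
  by apply: aeW => w; rewrite qft0 qnorm0.
have i0 : intg L (fun w => cn (gh n^-1 1 w.1 (v a.1)) * cn (gh n^-1 1 w.2 (v a.2)) * 0).
  by apply: eq_intg (intg0 _) => w; rewrite mulr0.
have n1 : (1 : R) != 0 by exact: oner_neq0.
have := gaussian_duality n1 n1 ig 1 nV0 h0 i0.
under [X in _ <= _ * X]eq_Rintegral do rewrite mulr0.
rewrite [X in _ <= _ * X](_ : _ = 0); last by rewrite /Rintegral integral0.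
rewrite mulr0 normr_le0 => /eqP.
have gkE t b : gk n^-1 t (v b) = (expR (n ^+ 2 * b * t - (n * t) ^+ 2 / 2))%:C%C.
  rewrite /gk /v -cexp_real; congr cexp; rewrite exprVn.
  by apply: complex_eq => /=; [field; rewrite gt_eqF|ring].
have E t b : gs n t b = (n / Num.sqrt (2 * pi) * expR (- (n * b) ^+ 2 / 2)) * expR (n ^+ 2 * b * t - (n * t) ^+ 2 / 2).
  by rewrite /gs -[RHS]mulrA -expRD; congr (_ * expR _); field.
pose c b := n / Num.sqrt (2 * pi) * expR (- (n * b) ^+ 2 / 2).
have c0 b : 0 < c b by rewrite /c mulr_gt0 ?expR_gt0 // divr_gt0 // sqrt2pi_gt0.
have ims := m_gs_intg a n0.
set I := \int[L]_x _.
have -> : I = (c a.1 * c a.2)^-1 * \int[L]_x (m x * (gs n x.1 a.1 * gs n x.2 a.2)).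
  rewrite /I -(RintZ _ ims); apply: eq_Rintegral => x _.
  have h (y z t : R) : q0 (1 * (inplane qi y%:C%C * Quat z 0 0 0 * inplane qj t%:C%C)) = y * z * t.
    by rewrite /=; ring.
  rewrite !gkE h !E -/(c a.1) -/(c a.2).
  by move: (c0 a.1) (c0 a.2) => ca cb; field; rewrite !gt_eqF.
by move=> /eqP; rewrite mulf_eq0 invr_eq0 (gt_eqF (mulr_gt0 (c0 _) (c0 _))) => /eqP.
Qed.

Lemma rect_psi0 (A B A' B' n : R) : 0 < n ->
  \int[L]_x (m x * (psi A B n x.1 * psi A' B' n x.2)) = 0.
Proof.
move=> n0; pose k := n / Num.sqrt (2 * pi).
have k0 : 0 <= k by apply: divr_ge0 (sqrtr_ge0 _); exact: ltW.
pose h (z : plane * plane) : R := m z.1 * (ind A B z.2.1 * gs n z.1.1 z.2.1 * (ind A' B' z.2.2 * gs n z.1.2 z.2.2)).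
have mh : measurable_fun [set: plane * plane] h.
  have mm := measurableT_comp (intg_measurable im) (@measurable_fst _ _ plane plane).
  have f1 : measurable_fun [set: plane * plane] (fun z : plane * plane => z.1.1 : R).
    exact: (measurableT_comp (@measurable_fst _ _ _ _) (@measurable_fst _ _ plane plane)).
  have f2 : measurable_fun [set: plane * plane] (fun z : plane * plane => z.1.2 : R).
    exact: (measurableT_comp (@measurable_snd _ _ _ _) (@measurable_fst _ _ plane plane)).
  have f3 : measurable_fun [set: plane * plane] (fun z : plane * plane => z.2.1 : R).
    exact: (measurableT_comp (@measurable_fst _ _ _ _) (@measurable_snd _ _ plane plane)).
  have f4 : measurable_fun [set: plane * plane] (fun z : plane * plane => z.2.2 : R).
    exact: (measurableT_comp (@measurable_snd _ _ _ _) (@measurable_snd _ _ plane plane)).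
  have mi1 := measurableT_comp (measurable_ind A B) f3.
  have mi2 := measurableT_comp (measurable_ind A' B') f4.
  apply: measurable_funM; first exact: mm.
  by apply: measurable_funM; apply: measurable_funM => //; exact: measurable_gs_comp.
have [ij1 ij2] := (intgZ k (ind_intg A B), intgZ k (ind_intg A' B')).
have hb x a : `|h (x, a)| <= `|m x| * (k * ind A B a.1 * (k * ind A' B' a.2)).
  rewrite /h /= normrM; apply: ler_wpM2l => //.
  have q (A1 B1 t b : R) : `|ind A1 B1 b * gs n t b| <= k * ind A1 B1 b.
    have /andP[I0 _] := ind01 A1 B1 b.
    by rewrite normrM (ger0_norm I0) (ger0_norm (gs_ge0 t b n0)) mulrC; apply: (ler_wpM2r I0); exact: gs_le.
  by rewrite normrM; apply: ler_pM => //; exact: q.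
have [_ _ e] := leb2_fubini mh (intg_norm im) (leb2_prod_intg ij1 ij2) hb.
have -> : \int[L]_x (m x * (psi A B n x.1 * psi A' B' n x.2)) = \int[L]_x \int[L]_a h (x, a).
  apply: eq_Rintegral => x _.
  have [p1 p2] := (psi_intg A B x.1 n0, psi_intg A' B' x.2 n0).
  rewrite -(leb2_Rint_prod p1 p2).
  exact: esym (RintZ (m x) (leb2_prod_intg p1 p2)).
rewrite e; apply: etrans (_ : \int[L]_(a in setT) 0 = 0); last by rewrite /Rintegral integral0.
apply: eq_Rintegral => a _; rewrite /h /=.
have -> : (fun x : R * R => m x * (ind A B a.1 * gs n x.1 a.1 * (ind A' B' a.2 * gs n x.2 a.2))) =
    (fun x => (ind A B a.1 * ind A' B' a.2) * (m x * (gs n x.1 a.1 * gs n x.2 a.2))).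
  by apply/funext => x; ring.
by rewrite (RintZ _ (m_gs_intg a n0)) (gauss_smoothing0 a n0) mulr0.
Qed.

(** The mollified indicators are bounded by [1] and converge off the four lines carrying the edges,
    which form a null set. *)
Lemma rect0 (A B A' B' : R) : \int[L]_x (m x * (ind A B x.1 * ind A' B' x.2)) = 0.
Proof.
have n0 (k : nat) : 0 < k.+1%:R :> R by [].
have mm := intg_measurable im.
have f1 : measurable_fun [set: plane] (fun z : plane => z.1 : R) by exact: measurable_fst.
have f2 : measurable_fun [set: plane] (fun z : plane => z.2 : R) by exact: measurable_snd.
have m1 (k : nat) : measurable_fun [set: plane] (fun x : plane => m x * (psi A B k.+1%:R x.1 * psi A' B' k.+1%:R x.2)).
  have p1 := measurableT_comp (measurable_psi A B (n0 k)) f1.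
  have p2 := measurableT_comp (measurable_psi A' B' (n0 k)) f2.
  exact: (measurable_funM mm (measurable_funM p1 p2)).
have m2 : measurable_fun [set: plane] (fun x : plane => m x * (ind A B x.1 * ind A' B' x.2)).
  have p1 := measurableT_comp (measurable_ind A B) f1.
  have p2 := measurableT_comp (measurable_ind A' B') f2.
  exact: (measurable_funM mm (measurable_funM p1 p2)).
have b k x : `|m x * (psi A B k.+1%:R x.1 * psi A' B' k.+1%:R x.2)| <= `|m x|.
  have /andP[a0 a1] := psi01 A B x.1 (n0 k); have /andP[b0 b1] := psi01 A' B' x.2 (n0 k).
  rewrite normrM (ger0_norm (mulr_ge0 a0 b0)).
  exact: (ler_piMr (normr_ge0 _) (mulr_ile1 a0 b0 a1 b1)).
have cv : {ae L, forall x, (m x * (psi A B k.+1%:R x.1 * psi A' B' k.+1%:R x.2)) @[k --> \oo] -->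
    m x * (ind A B x.1 * ind A' B' x.2)}.
  have h := ae_imp2 (fun x p q => conj p q) (ae_imp2 (fun x p q => conj p q) (ae_fst_neq A) (ae_fst_neq B))
    (ae_imp2 (fun x p q => conj p q) (ae_snd_neq A') (ae_snd_neq B')).
  apply: (ae_imp _ h) => x [[xA xB] [xA' xB']].
  by apply: cvgMr; apply: cvgM; exact: psi_cvg.
have := Rint_dominated m1 m2 (intg_norm im) b cv.
under eq_fun do rewrite rect_psi0 //.
by move/(cvg_lim (@Rhausdorff R)) => <-; rewrite lim_cst.
Qed.

End FourierUniqueness.

(** * From rectangles to Borel sets *)

Section Dynkin.
Context d d' (T : measurableType d) (T' : measurableType d') (R : realType).
Variables (mu : {measure set T -> \bar R}) (m : T -> R) (phi : T -> T').
Hypotheses (im : intg mu m) (mphi : measurable_fun [set: T] phi).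

Lemma indic_intg (D : set T) : measurable D -> intg mu (fun x => m x * \1_D x).
Proof.
move=> mD; apply: (intg_dom _ (intg_norm im)) => [|x].
  by apply: measurable_funM; [exact: intg_measurable im|exact: measurable_indic].
by rewrite normrM indicE; case: (_ \in _); rewrite ?normr1 ?normr0 ?mulr1 ?mulr0.
Qed.

Lemma Rint_restrict (D : set T) : measurable D ->
  (\int[mu]_(x in D) (m x)%:E = (\int[mu]_x (m x * \1_D x))%:E)%E.
Proof.
move=> mD; rewrite integral_mkcond -(intg_fin (indic_intg mD)); apply: eq_integral => x _.
by rewrite /patch indicE; case: ifP; rewrite ?mulr1 ?mulr0.
Qed.

Lemma preimage_measurable S : measurable S -> measurable (phi @^-1` S).
Proof. by move=> mS; rewrite -[X in measurable X]setTI; exact: mphi. Qed.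

(** Stated for preimages under a map [phi], so that one lemma handles the two coordinate projections
    and the identity of the plane. *)
Lemma dynkin_integral (G : set_system T') : @measurable _ T' = <<s G >> -> setI_closed G ->
  \int[mu]_x m x = 0 -> (forall S, G S -> \int[mu]_x (m x * \1_(phi @^-1` S) x) = 0) ->
  forall S, measurable S -> \int[mu]_x (m x * \1_(phi @^-1` S) x) = 0.
Proof.
move=> GE GI m0 mG S mS.
apply: (dynkin_induction (P := fun S => \int[mu]_x (m x * \1_(phi @^-1` S) x) = 0) GE GI) => //.
- rewrite -[RHS]m0; apply: eq_Rintegral => x _.
  by rewrite preimage_setT indicE in_setT mulr1.
- move=> A mA A0.
  have -> : (fun x => m x * \1_(phi @^-1` (~` A)) x) = (fun x => m x - m x * \1_(phi @^-1` A) x).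
    apply/funext => x; rewrite preimage_setC !indicE in_setC.
    by case: (_ \in _); rewrite /= ?mulr1 ?mulr0 ?subrr ?subr0.
  by rewrite (RintB im (indic_intg (preimage_measurable mA))) A0 m0 subrr.
- move=> F mF tF F0.
  have mU : measurable (phi @^-1` (\bigcup_k F k)).
    by apply: preimage_measurable; exact: bigcup_measurable.
  have mpF k : measurable (phi @^-1` F k) by exact: preimage_measurable.
  apply: EFin_inj; rewrite -(Rint_restrict mU) preimage_bigcup.
  rewrite integral_bigcup //.
  - by rewrite eseries0 // => k _ _ /=; rewrite Rint_restrict // F0.
  - by move=> i j _ _ [x [xi xj]]; apply: tF => //; exists (phi x).
  - by apply: (integrableS measurableT) im => //; exact: bigcup_measurable.
- by rewrite -GE.
Qed.

End Dynkin.

Section LaplaceUniqueness.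
Variable R : realType.
Local Notation C := R[i].
Local Notation line := (measurableTypeR R).
Local Notation plane := (line * line)%type.
Local Notation L := (@leb2 R).

(** Half-open intervals are closed under intersection; the vanishing of the total integral, which
    starts the Dynkin argument, is the limit over the intervals []-k, k]]. *)
Lemma line_dynkin (m : R * R -> R) (phi : plane -> line) : intg L m ->
  measurable_fun [set: plane] phi ->
  (forall A B, \int[L]_x (m x * ind A B (phi x)) = 0) ->
  forall S : set line, measurable S -> \int[L]_x (m x * \1_(phi @^-1` S) x) = 0.
Proof.
move=> im mphi h; have mm := intg_measurable im.
apply: (dynkin_integral im mphi (G := @ocitv R)) => //.
- exact: ocitvI.
- have mk (k : nat) : measurable_fun [set: plane] (fun x : plane => m x * ind (- k%:R) k%:R (phi x)).
    by apply: measurable_funM => //; exact: (measurableT_comp (measurable_ind _ _) mphi).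
  have b (k : nat) x : `|m x * ind (- k%:R) k%:R (phi x)| <= `|m x|.
    have /andP[i0 i1] := ind01 (- k%:R) k%:R (phi x).
    by rewrite normrM (ger0_norm i0) ler_piMr.
  have cv : {ae L, forall x, (m x * ind (- k%:R) k%:R (phi x)) @[k --> \oo] --> m x}.
    apply: aeW => x; apply: cvg_near_cst.
    exists (Num.bound `|(phi x : R)|).+1 => // k /= kb.
    rewrite indE; have t : `|(phi x : R)| < k%:R.
      apply: lt_le_trans (archi_boundP (normr_ge0 _)) _.
      by rewrite ler_nat ltnW.
    by move: t; rewrite ltr_norml => /andP[-> /ltW ->]; rewrite mulr1.
  have := Rint_dominated mk mm (intg_norm im) b cv.
  under eq_fun do rewrite h.
  by move/(cvg_lim (@Rhausdorff R)) => <-; rewrite lim_cst.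
- move=> S [[A B] _ <-]; rewrite -[RHS](h A B); apply: eq_Rintegral => x _.
  by congr (_ * _); rewrite /ind !indicE.
Qed.

(** Passage from intervals to Borel sets is made in the first coordinate and then in the second,
    with [m] weighted by an indicator in the variable held fixed. Measurable rectangles then
    generate the plane, and a function whose integral over every measurable set is zero vanishes
    almost everywhere. *)
Lemma fourier_unique (m : R * R -> R) : intg L m ->
  (forall w : R * R, \int[L]_x (m x * cos (x.1 * w.1 + x.2 * w.2)) = 0) ->
  (forall w : R * R, \int[L]_x (m x * sin (x.1 * w.1 + x.2 * w.2)) = 0) ->
  {ae L, forall x, m x = 0}.
Proof.
move=> im mc ms.
have f1 : measurable_fun [set: plane] (fst : plane -> line) by exact: measurable_fst.
have f2 : measurable_fun [set: plane] (snd : plane -> line) by exact: measurable_snd.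
have s1 (A B : R) (S : set line) : measurable S ->
    \int[L]_x (m x * ind A B x.2 * \1_(fst @^-1` S) x) = 0.
  apply: (line_dynkin (m := fun x => m x * ind A B x.2) (phi := fst)) => //.
    apply: (intg_dom _ (intg_norm im)) => [|x].
      apply: measurable_funM; first exact: intg_measurable im.
      exact: (measurableT_comp (measurable_ind _ _) f2).
    by have /andP[i0 i1] := ind01 A B x.2; rewrite normrM (ger0_norm i0) ler_piMr.
  move=> A' B'; rewrite -[RHS](rect0 im mc ms A' B' A B).
  by apply: eq_Rintegral => x _; rewrite -mulrA (mulrC (ind A B _)).
have s2 (S S' : set line) : measurable S -> measurable S' ->
    \int[L]_x (m x * \1_(fst @^-1` S) x * \1_(snd @^-1` S') x) = 0.
  move=> mS mS'; apply: (line_dynkin (m := fun x => m x * \1_(fst @^-1` S) x) (phi := snd)) => //.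
    have q := preimage_measurable f1 mS.
    exact: (indic_intg im q).
  move=> A B; rewrite -[RHS](s1 A B S mS).
  by apply: eq_Rintegral => x _; rewrite mulrAC.
have m0 : \int[L]_x m x = 0.
  rewrite -[RHS](s2 setT setT measurableT measurableT); apply: eq_Rintegral => x _.
  by rewrite !preimage_setT !indicE !in_setT !mulr1.
have s3 : forall S : set plane, measurable S -> \int[L]_x (m x * \1_S x) = 0.
  move=> S mS; apply: (@dynkin_integral _ _ plane plane R L m id im (@measurable_id _ plane setT) _
    (measurable_prod_measurableType line line) _ m0 _ S mS).
  - move=> _ _ [A mA [B mB <-]] [A' mA' [B' mB' <-]]; exists (A `&` A'); first exact: measurableI.
    by exists (B `&` B'); [exact: measurableI|rewrite setXI].
  - move=> _ [A mA [B mB <-]]; rewrite -[RHS](s2 A B mA mB); apply: eq_Rintegral => x _.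
    rewrite -mulrA; congr (_ * _); rewrite !indicE -natrM mulnb; congr (_%:R); congr nat_of_bool.
    by rewrite -in_setI; congr (_ \in _).
have ae0 : ae_eq L setT (EFin \o m) (cst 0%E).
  apply: integral_ae_eq => //.
  move=> E _ mE; rewrite integral0.
  by have := @Rint_restrict _ _ _ L m im E mE; rewrite s3.
by apply: (ae_imp _ ae0) => x /(_ I) /= [].
Qed.

Lemma laplace_unique (m : R * R -> R) : intg L m ->
  (forall p t, enorm p = 1 -> laplace L m (dotp p) (Complex 0 t) = 0) ->
  {ae L, forall x, m x = 0}.
Proof.
move=> im h.
have key (w : R * R) : exists p t, enorm p = 1 /\ forall x : R * R, t * dotp p x = x.1 * w.1 + x.2 * w.2.
  have [w0|w0] := eqVneq (enorm w) 0.
    exists (1, 0), 0; split; first by rewrite /enorm /= expr1n expr0n addr0 sqrtr1.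
    move=> x; have := enorm_sq w; rewrite w0 expr0n /= => /esym/eqP.
    rewrite paddr_eq0 ?sqr_ge0 // !sqrf_eq0 => /andP[/eqP -> /eqP ->].
    by rewrite /dotp; ring.
  have wp : 0 < enorm w by rewrite lt_def w0 enorm_ge0.
  exists (w.1 / enorm w, w.2 / enorm w), (enorm w); split.
    rewrite {1}/enorm /= !exprMn -mulrDl -enorm_sq exprVn divff ?sqrtr1 //.
    by rewrite expf_neq0.
  by move=> x; rewrite /dotp /=; field; rewrite gt_eqF.
apply: fourier_unique => // w; have [p [t [p1 e]]] := key w; have := h p t p1.
  move/(congr1 (@complex.Re R)) => /= <-; apply: eq_Rintegral => x _.
  by rewrite !mul0r mulr0 subrr expR0 mul1r add0r e.
move/(congr1 (@complex.Im R)) => /= <-; apply: eq_Rintegral => x _.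
by rewrite !mul0r mulr0 subrr expR0 mul1r add0r e.
Qed.

End LaplaceUniqueness.

(** * The degree bound *)

Section PolynomialGrowth.
Variable R : realType.
Local Notation line := (measurableTypeR R).
Local Notation plane := (line * line)%type.
Local Notation leb := (@lebesgue_measure R).
Local Notation L := (@leb2 R).

Lemma poly_growth (P : {poly R[i]}) : P != 0 ->
  exists c r0 : R, [/\ 0 < c, 0 < r0 & forall z, r0 <= cn z -> c * cn z ^+ (size P).-1 <= cn P.[z]].
Proof.
elim/poly_ind: P => [|p e IH]; first by rewrite eqxx.
have [->|p0] := eqVneq p 0.
  rewrite mul0r add0r polyC_eq0 => e0; exists (cn e), 1; split; rewrite ?cn_gt0 // => z _.
  by rewrite hornerC size_polyC e0 /= expr0 mulr1.
move=> _; have [c [r0 [c0 r00 H]]] := IH p0.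
have n0 : (0 < size p)%N by rewrite size_poly_gt0.
have e0 := cn_ge0 e.
have q0 : 0 <= 2 * cn e / c by rewrite divr_ge0 ?mulr_ge0 // ltW.
exists (c / 2), (r0 + 1 + 2 * cn e / c); split; [by rewrite divr_gt0|lra|].
move=> z zr; have zr0 : r0 <= cn z by lra.
have z1 : 1 <= cn z by lra.
rewrite size_MXaddC (negbTE p0) /= hornerMXaddC.
have -> : size p = (size p).-1.+1 by rewrite prednK.
have h := H z zr0; set V := cn z ^+ (size p).-1 in h.
have V1 : 1 <= V by rewrite /V exprn_ege1.
rewrite exprSr -/V.
have h1 : cn (p.[z] * z + e) >= cn (p.[z] * z) - cn e.
  have := cnB (p.[z] * z + e) e; rewrite addrK; lra.
rewrite cnM in h1; apply: le_trans h1.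
have h2 : c * V * cn z <= cn p.[z] * cn z by rewrite ler_wpM2r // cn_ge0.
have h3 : 2 * cn e <= c * (V * cn z).
  have : 2 * cn e / c <= V * cn z.
    by apply: (@le_trans _ _ (cn z)); [lra|rewrite ler_peMl // cn_ge0].
  by rewrite ler_pdivrMr // [X in _ <= X]mulrC.
lra.
Qed.

Lemma poly_nonroot (Q : {poly R}) : Q != 0 -> exists n : nat, Q.[n%:R] != 0.
Proof.
move=> Q0; apply: contrapT => h.
have := @max_poly_roots _ Q (map (fun n : nat => n%:R) (iota 0 (size Q))) Q0.
rewrite size_map size_iota ltnn => H; suff : false by []; apply: H.
  apply/allP => _ /mapP[n _ ->]; apply: contrapT => /negP nr; apply: h.
  by exists n; move: nr; rewrite /root.
by rewrite map_inj_uniq ?iota_uniq // => m n /eqP; rewrite eqr_nat => /eqP.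
Qed.

Lemma poly_nonvanishing (Q : {poly R}) : Q != 0 -> exists (a : nat) (eta c : R),
  [/\ 0 < eta, 0 < c & forall t, `|t - a%:R| <= eta -> c <= `|Q.[t]|].
Proof.
move=> /poly_nonroot[a Qa]; have c0 : 0 < `|Q.[a%:R]| / 2 by rewrite divr_gt0 // normr_gt0.
have cQ : continuous (fun t : R => Q.[t]) by exact: continuous_horner.
move: (cQ a%:R) => /cvgrPdist_le /(_ _ c0) /nbhs_ballP[e /= e0 He].
exists a, (e / 2), (`|Q.[a%:R]| / 2); split => //; first by rewrite divr_gt0.
move=> t ta; have := He t; rewrite /ball /= distrC => /(_ _) h.
have {}h : `|Q.[a%:R] - Q.[t]| <= `|Q.[a%:R]| / 2.
  by apply: h; apply: le_lt_trans ta _; rewrite ltr_pdivrMr // ltr_pMr // ltr1n.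
by have := ler_normB (Q.[a%:R] - Q.[t]) (- Q.[t]); rewrite opprK subrK normrN; lra.
Qed.

(** The top form is [x2^n Q(x1 / x2)] with [Q] its dehomogenisation. A natural number [a] with
    [Q(a) != 0] gives a cone around the slope [a] on which [Q] is bounded below, and inside it the
    terms of lower degree lose a factor [y]. *)
Lemma pol2_lower (D : nat) (c : nat -> nat -> R) (n i0 j0 : nat) :
  pdeg n c -> (n <= D)%N -> (i0 + j0)%N = n -> c i0 j0 != 0 ->
  exists (a : nat) (e k Y : R), [/\ 0 < e <= 1, 0 < k, 1 <= Y & forall y x, Y <= y ->
    a%:R * y <= x.1 <= (a%:R + e) * y -> y <= x.2 <= (1 + e) * y ->
    k * y ^+ n <= `|pol2 D c x|].
Proof.
move=> dc nD ij cij.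
pose Q : {poly R} := \poly_(i < n.+1) c i (n - i)%N.
have Q0 : Q != 0.
  apply/eqP => /(congr1 (fun q : {poly R} => q`_i0)); rewrite coef_poly coef0 ltnS -ij leq_addr.
  by rewrite addKn => /eqP; rewrite (negbTE cij).
have [a [eta [c0 [eta0 c00 HQ]]]] := poly_nonvanishing Q0.
(* On the box the ratio [x1 / x2] differs from [a] by at most [e (1 + a)]. *)
pose e := Num.min 1 (eta / (1 + a%:R)).
have a1 : 0 < 1 + a%:R :> R by rewrite ltr_pwDl.
have e0 : 0 < e by rewrite lt_min ltr01 divr_gt0.
have e1 : e <= 1 by rewrite ge_min lexx.
have ea : e * (1 + a%:R) <= eta by rewrite -ler_pdivlMr // ge_min lexx orbT.
pose B : R := a%:R + 2; have B1 : 1 <= B by rewrite /B; have := ler0n R a; lra.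
pose M := \sum_(i < D.+1) \sum_(j < D.+1) `|c i j| * B ^+ (i + j).
have M0 : 0 <= M by apply: sumr_ge0 => i _; apply: sumr_ge0 => j _; rewrite mulr_ge0 // exprn_ge0 //; lra.
exists a, e, (c0 / 2), (1 + 2 * M / c0); split.
- by rewrite e0.
- by rewrite divr_gt0.
- by rewrite lerDl divr_ge0 ?mulr_ge0 // ltW.
move=> y x yY /andP[x1l x1u] /andP[x2l x2u].
have y1 : 1 <= y by apply: le_trans yY; rewrite lerDl divr_ge0 ?mulr_ge0 // ltW.
have y0 : 0 < y by lra.
have x20 : 0 < x.2 by lra.
have x10 : 0 <= x.1 by apply: le_trans x1l; rewrite mulr_ge0 // ltW.
have x1B : `|x.1| <= B * y.
  rewrite ger0_norm //; apply: le_trans x1u _; apply: (ler_wpM2r (ltW y0)); rewrite /B; lra.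
have x2B : `|x.2| <= B * y.
  rewrite gtr0_norm //; apply: le_trans x2u _; apply: (ler_wpM2r (ltW y0)).
  by rewrite /B; have := ler0n R a; lra.
pose top := \sum_(i < D.+1) \sum_(j < D.+1) (if (i + j)%N == n then c i j * (x.1 ^+ i * x.2 ^+ j) else 0).
pose low := \sum_(i < D.+1) \sum_(j < D.+1) (if (i + j)%N == n then 0 else c i j * (x.1 ^+ i * x.2 ^+ j)).
have -> : pol2 D c x = top + low.
  rewrite /pol2 /top /low -big_split; apply: eq_bigr => i _; rewrite -big_split; apply: eq_bigr => j _ /=.
  by case: ifP => _; rewrite ?addr0 ?add0r.
have By : 0 <= B * y := mulr_ge0 (le_trans ler01 B1) (ltW y0).
have lowE : `|low| * y <= M * y ^+ n.
  rewrite /low /M !mulr_suml; apply: le_trans (ler_wpM2r (ltW y0) (ler_norm_sum _ _ _)) _.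
  rewrite mulr_suml; apply: ler_sum => i _.
  apply: le_trans (ler_wpM2r (ltW y0) (ler_norm_sum _ _ _)) _.
  rewrite !mulr_suml; apply: ler_sum => j _.
  have R0 : 0 <= `|c i j| * B ^+ (i + j) * y ^+ n.
    by rewrite mulr_ge0 ?exprn_ge0 ?mulr_ge0 ?exprn_ge0 //; lra.
  case: ifP => [_|ijn]; first by rewrite normr0 mul0r.
  have [c0'|/dc lij'] := eqVneq (c i j) 0; first by rewrite c0' !(mul0r, normr0).
  have lij : (i + j < n)%N by rewrite ltn_neqAle ijn.
  rewrite !normrM !normrX -!mulrA; apply: ler_wpM2l => //.
  have h1 : `|x.1| ^+ i <= (B * y) ^+ i by apply: lerXn2r; rewrite ?nnegrE.
  have h2 : `|x.2| ^+ j <= (B * y) ^+ j by apply: lerXn2r; rewrite ?nnegrE.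
  apply: (@le_trans _ _ ((B * y) ^+ i * ((B * y) ^+ j * y))).
    have n1 : 0 <= `|x.1| ^+ i by rewrite exprn_ge0.
    have n2 : 0 <= `|x.2| ^+ j by rewrite exprn_ge0.
    apply: ler_pM => //; first by rewrite mulr_ge0 // ltW.
    by apply: (ler_wpM2r (ltW y0)).
  rewrite mulrA -exprD exprMn -mulrA -exprSr; apply: ler_wpM2l; first by rewrite exprn_ge0 //; lra.
  by apply: ler_weXn2l.
have topE : top = x.2 ^+ n * Q.[x.1 / x.2].
  rewrite /Q horner_poly mulr_sumr /top.
  have nD1 : (n.+1 <= D.+1)%N by [].
  rewrite (big_ord_widen _ (fun i => x.2 ^+ n * (c i (n - i)%N * (x.1 / x.2) ^+ i)) nD1).
  rewrite [RHS]big_mkcond; apply: eq_bigr => i _ /=; case: ifP => [|/negbT] iN.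
    have jD : (n - i < D.+1)%N by rewrite ltnS (leq_trans (leq_subr _ _) nD).
    rewrite (bigD1 (Ordinal jD)) //= big1 ?addr0.
      rewrite subnKC // eqxx; have -> : x.2 ^+ n = x.2 ^+ i * x.2 ^+ (n - i) by rewrite -exprD subnKC.
      rewrite exprMn exprVn; have xi : x.2 ^+ i != 0 by rewrite expf_neq0 // gt_eqF.
      by move: (x.2 ^+ i) xi (x.2 ^+ (n - i)) (x.1 ^+ i) => A A0 B' D'; field.
    move=> j jn; rewrite ifF //; apply/negbTE; apply: contra jn => /eqP e'.
    by rewrite -val_eqE /= -e' addKn.
  rewrite big1 // => j _; rewrite ifF //; apply/negbTE; rewrite neq_ltn; apply/orP; right.
  by rewrite -leqNgt in iN; exact: leq_trans iN (leq_addr _ _).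
have tq : `|x.1 / x.2 - a%:R| <= eta.
  have a0 : 0 <= a%:R :> R by exact: ler0n.
  have ey : 0 <= e * y by rewrite mulr_ge0 // ltW.
  have aey : 0 <= e * a%:R * y by rewrite !mulr_ge0 // ltW.
  have h1 := ler_wpM2l a0 x2u.
  have h2 := ler_wpM2l (ltW e0) x2l.
  have h3 := ler_wpM2l (mulr_ge0 (ltW e0) a0) x2l.
  have h4 := ler_wpM2l a0 x2l.
  apply: le_trans ea; rewrite ler_norml; apply/andP; split.
    by rewrite lerBrDr ler_pdivlMr //; lra.
  by rewrite lerBlDr ler_pdivrMr //; lra.
have topl : c0 * y ^+ n <= `|top|.
  have yx : y ^+ n <= x.2 ^+ n by apply: lerXn2r; rewrite ?nnegrE ?(ltW y0) ?(ltW x20).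
  have yn : 0 <= y ^+ n by rewrite exprn_ge0 // ltW.
  rewrite topE normrM mulrC normrX (gtr0_norm x20) [leRHS]mulrC.
  by rewrite mulrC; apply: (ler_pM (ltW c00) yn (HQ _ tq) yx).
have low2 : `|low| <= c0 / 2 * y ^+ n.
  have yn : 0 <= y ^+ n by rewrite exprn_ge0 // ltW.
  rewrite -(ler_pM2r y0); apply: le_trans lowE _.
  have : M <= c0 / 2 * y.
    have : 2 * M / c0 <= y by lra.
    by rewrite ler_pdivrMr //; lra.
  by move/(ler_wpM2r yn) => h; apply: le_trans h _; le_eq; ring.
by have := ler_normB (top + low) low; rewrite addrK; lra.
Qed.

Lemma box_enorm (a : nat) (e y : R) (x : R * R) : 0 < e -> e <= 1 -> 1 <= y ->
  a%:R * y <= x.1 <= (a%:R + e) * y -> y <= x.2 <= (1 + e) * y ->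
  y <= enorm x /\ 1 + enorm x <= (a%:R + 4) * y.
Proof.
move=> e0 e1 y1 /andP[x1l x1u] /andP[x2l x2u]; have y0 : 0 < y by lra.
have x10 : 0 <= x.1 by apply: le_trans x1l; rewrite mulr_ge0 // ltW.
have x20 : 0 < x.2 by lra.
split.
  apply: (le_trans x2l); rewrite -[leLHS](gtr0_norm x20); apply: norm_le_sq; first exact: enorm_ge0.
  by rewrite enorm_sq lerDr sqr_ge0.
have x12 : 0 <= x.1 * x.2 by rewrite mulr_ge0 // ltW.
have : enorm x <= x.1 + x.2.
  rewrite -[leLHS](ger0_norm (enorm_ge0 x)); apply: norm_le_sq; first by lra.
  by rewrite enorm_sq; lra.
have ey : e * y <= y by rewrite ler_piMl // ltW.
by lra.
Qed.

(** A box of scale [y] has area [e^2 y^2], and on it [H] is at least of order [y^(n + N - d)]. If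
    [n + N >= d - 2], the integral over the box stays above a positive constant, whereas the boxes
    escape to infinity and dominated convergence sends these integrals to zero. *)
Lemma pol2_growth (D : nat) (c : nat -> nat -> R) (n i0 j0 N : nat) (d c1 r0 : R) (H : plane -> R) :
  pdeg n c -> (n <= D)%N -> (i0 + j0)%N = n -> c i0 j0 != 0 -> 0 <= d -> 0 < c1 ->
  intg L H -> (forall x, 0 <= H x) ->
  {ae L, forall x, r0 <= enorm x ->
    c1 * (`|pol2 D c x| * (enorm x ^+ N / (1 + enorm x) `^ d)) <= H x} ->
  (n + N)%:R < d - 2.
Proof.
move=> dc nD ij cij d0 c10 iH H0 hH; rewrite ltNge; apply/negP => dn.
have [a [e [k [Y [/andP[e0 e1] k0 Y1 low]]]]] := pol2_lower dc nD ij cij.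
pose y (m : nat) : R := m.+1%:R.
pose bx m (x : R * R) : R := ind (a%:R * y m) ((a%:R + e) * y m) x.1 * ind (y m) ((1 + e) * y m) x.2.
have f1 : measurable_fun [set: plane] (fun z : plane => z.1 : R) by exact: measurable_fst.
have f2 : measurable_fun [set: plane] (fun z : plane => z.2 : R) by exact: measurable_snd.
have mb m : measurable_fun [set: plane] (bx m : plane -> R).
  by apply: measurable_funM; [exact: (measurableT_comp (measurable_ind _ _) f1)|
    exact: (measurableT_comp (measurable_ind _ _) f2)].
have b01 m x : 0 <= bx m x <= 1.
  have /andP[p0 p1] := ind01 (a%:R * y m) ((a%:R + e) * y m) x.1.
  have /andP[q0 q1] := ind01 (y m) ((1 + e) * y m) x.2.
  by rewrite /bx mulr_ge0 //= mulr_ile1.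
have mH := intg_measurable iH.
have mHb m : measurable_fun [set: plane] (fun x => H x * bx m x) by exact: measurable_funM.
have Hb m x : `|H x * bx m x| <= H x.
  by rewrite mulrC; exact: norm_unit_mul_le.
have cv : {ae L, forall x, H x * bx m x @[m --> \oo] --> (0 : R)}.
  apply: aeW => x; apply: cvg_near_cst; exists (Num.bound `|x.2|) => // m /= mx.
  rewrite /bx !indE; have : x.2 <= y m.
    apply: le_trans (ler_norm _) _; apply: ltW; apply: lt_le_trans (archi_boundP (normr_ge0 _)) _.
    by rewrite ler_nat leqW.
  by rewrite leNgt => /negbTE ->; rewrite /= !mulr0.
have m0 : measurable_fun [set: plane] (fun=> 0 : R) by exact: measurable_cst.
have := Rint_dominated mHb m0 iH Hb cv.
rewrite (_ : \int[L]_x 0 = 0); last by rewrite /Rintegral integral0.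
pose B : R := a%:R + 4; have B1 : 1 <= B by rewrite /B; have := ler0n R a; lra.
have B0 : 0 < B by lra.
have Bd : 0 < B `^ d by rewrite powR_gt0.
pose K := c1 * k / B `^ d; have K0 : 0 < K by rewrite divr_gt0 // mulr_gt0.
move=> /cvgr0Pnorm_lt /(_ (K * e ^+ 2)); rewrite mulr_gt0 ?exprn_gt0 // => /(_ isT) [m1 _ hm].
pose m := (m1 + Num.bound (Y + `|r0|))%N.
have := hm m (leq_addr _ _); apply/negP; rewrite -leNgt.
have Yy : Y + `|r0| <= y m.
  apply: ltW; apply: lt_le_trans (archi_boundP (addr_ge0 _ (normr_ge0 _))) _; first lra.
  by rewrite ler_nat /m leqW // leq_addl.
have r0' := normr_ge0 r0; have y1 : 1 <= y m by lra.
have y0 : 0 < y m by lra.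
have ib : intg L (bx m) by apply: leb2_prod_intg; exact: ind_intg.
have lenI (A B' : R) : A <= B' -> \int[leb]_t ind A B' t = B' - A.
  move=> AB; rewrite /Rintegral /ind integral_indic // setIT.
  have h := @lebesgue_measure_itv R `]A, B']; rewrite [X in fine X]h /=.
  case: ifP => [_|/negbT]; first by rewrite -EFinB.
  by rewrite lte_fin -leNgt => BA; rewrite (le_anti (introT andP (conj AB BA))) subrr.
have eb : \int[L]_x bx m x = e ^+ 2 * y m ^+ 2.
  rewrite (leb2_Rint_prod (ind_intg _ _) (ind_intg _ _)) !lenI; first by ring.
    by rewrite ler_peMl ?ltW //; lra.
  by rewrite ler_wpM2r ?ltW //; lra.
have -> : K * e ^+ 2 = \int[L]_x (K / y m ^+ 2 * bx m x).
  by rewrite (RintZ _ ib) eb; field; rewrite gt_eqF.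
apply: le_trans (ler_norm _) _.
apply: le_trans (ler_norm _).
apply: Rint_norm_le_ae; first exact: intgZ.
  exact: (intg_dom (mHb m) iH (Hb m)).
apply: (ae_imp _ hH) => x hx.
have /andP[bb0 bb1] := b01 m x.
rewrite ger0_norm; last by rewrite mulr_ge0 // divr_ge0 ?exprn_ge0 // ltW.
rewrite /bx !indE; case E1: (_ && _) => /=; last by rewrite !mul0r !mulr0.
case E2: (_ && _) => /=; last by rewrite !mulr0.
rewrite !mulr1; move: E1 E2 => /andP[x1l x1u] /andP[x2l x2u].
have x1b : a%:R * y m <= x.1 <= (a%:R + e) * y m by rewrite (ltW x1l) x1u.
have x2b : y m <= x.2 <= (1 + e) * y m by rewrite (ltW x2l) x2u.
have [sy sB] := box_enorm e0 e1 y1 x1b x2b.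
have s0 : 0 < enorm x := lt_le_trans y0 sy.
have s2 : 0 < 1 + enorm x := addr_gt0 ltr01 s0.
have s1 : 0 <= 1 + enorm x := ltW s2.
have h1 : k * y m ^+ n <= `|pol2 D c x|.
  by apply: low => //; apply: le_trans Yy; rewrite lerDl.
have yd : 0 < y m `^ d by rewrite powR_gt0.
have h2 : y m ^+ N / (B `^ d * y m `^ d) <= enorm x ^+ N / (1 + enorm x) `^ d.
  have p0 : 0 < (1 + enorm x) `^ d by rewrite powR_gt0.
  have p1 : (1 + enorm x) `^ d <= B `^ d * y m `^ d.
    by rewrite -powRM ?(ltW B0) ?(ltW y0) //; apply: ge0_ler_powR => //; rewrite nnegrE //; apply: mulr_ge0; exact: ltW.
  apply: ler_pM; rewrite ?exprn_ge0 ?invr_ge0 ?(ltW y0) ?(ltW (mulr_gt0 Bd yd)) //.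
    by apply: lerXn2r; rewrite ?nnegrE ?(ltW y0) ?(ltW s0).
  by rewrite lef_pV2 ?posrE // mulr_gt0.
have h3 : r0 <= enorm x.
  apply: le_trans sy; apply: le_trans Yy; apply: (le_trans (ler_norm r0)).
  by rewrite lerDr (le_trans ler01).
apply: le_trans (hx h3).
have yn0 : 0 <= k * y m ^+ n by rewrite mulr_ge0 ?exprn_ge0 ?ltW.
have yN0 : 0 <= y m ^+ N / (B `^ d * y m `^ d).
  by apply: divr_ge0; [rewrite exprn_ge0 // ltW|exact: ltW (mulr_gt0 Bd yd)].
apply: le_trans (ler_wpM2l (ltW c10) (ler_pM yn0 yN0 h1 h2)).
have h4 : y m `^ d <= y m ^+ (n + N) * y m ^+ 2.
  rewrite -exprD -powR_mulrn ?(ltW y0) //; apply: ler_powR => //.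
  by rewrite natrD -lerBlDr.
have y20 : 0 < y m ^+ 2 by rewrite exprn_gt0.
have -> : c1 * (k * y m ^+ n * (y m ^+ N / (B `^ d * y m `^ d))) = K * (y m ^+ (n + N) / y m `^ d).
  rewrite /K exprD; move: (y m `^ d) (B `^ d) yd Bd => A B' A0 B0'; field; by rewrite !gt_eqF.
apply: ler_wpM2l; first exact: ltW.
by rewrite ler_pdivlMr // mulrC ler_pdivrMr.
Qed.

End PolynomialGrowth.

(** * Coordinates of the demodulated function as polynomial Gaussians *)

Section Components.
Variable R : realType.
Local Notation C := R[i].
Local Notation plane := (measurableTypeR R * measurableTypeR R)%type.
Local Notation L := (@leb2 R).

Definition gaussr (t : R) (n : nat) : R := if odd n then 0 else t ^+ n./2 / (n./2)`!%:R.

Lemma gco_gaussr (t : R) n : gco t%:C%C n = (gaussr t n)%:C%C.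
Proof.
rewrite /gco /gaussr; case: ifP => // _; symmetry.
apply: etrans (rmorphM (real_complex R) _ _) _; congr (_ * _).
  exact: (rmorphXn (real_complex R)).
by apply: etrans (fmorphV (real_complex R) _) _; congr (_^-1); exact: (rmorph_nat (real_complex R)).
Qed.

Variables (mu1 mu2 : qpft_param R) (f : R * R -> quat R).
Hypothesis hf : sq_intg f.
Local Notation ml := (ml mu1 mu2 f).
Local Notation bco := (bco mu1 mu2 f).
Local Notation Bt := (Bt mu1 mu2 f).
Local Notation gf := (gf mu1 mu2 f).

Lemma ml_monomial_intg a i j : intg L (fun x => ml a x * (x.1 ^+ i * x.2 ^+ j)).
Proof.
have p1 : enorm ((1, 0) : R * R) = 1 by rewrite /enorm /= expr1n expr0n addr0 sqrtr1.
have p2 : enorm ((0, 1) : R * R) = 1 by rewrite /enorm /= expr1n expr0n add0r sqrtr1.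
have e1 := ml_exp_moments mu1 mu2 hf p1 a 2.
have e2 := ml_exp_moments mu1 mu2 hf p2 a 2.
have f1 : measurable_fun [set: plane] (fun z : plane => z.1 : R) by exact: measurable_fst.
have f2 : measurable_fun [set: plane] (fun z : plane => z.2 : R) by exact: measurable_snd.
have mm := measurable_ml mu1 mu2 hf a.
apply: (intg_dom _ (intgZ (i`!%:R * j`!%:R) (intgD e1 e2))).
  apply: measurable_funM => //; apply: measurable_funM.
    exact: (measurableT_comp (exprn_measurable i) f1).
  exact: (measurableT_comp (exprn_measurable j) f2).
move=> x; rewrite /dotp /= !mul1r !mul0r addr0 add0r !normrM !normrX.
have hi : `|x.1| ^+ i <= i`!%:R * expR `|x.1|.
  by rewrite mulrC -ler_pdivrMr ?ltr0n ?fact_gt0 // pow_fact_le_expR.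
have hj : `|x.2| ^+ j <= j`!%:R * expR `|x.2|.
  by rewrite mulrC -ler_pdivrMr ?ltr0n ?fact_gt0 // pow_fact_le_expR.
have h := ler_pM (exprn_ge0 i (normr_ge0 x.1)) (exprn_ge0 j (normr_ge0 x.2)) hi hj.
rewrite -!normrM -mulrDr; move: (normr_ge0 (expR (- enorm x ^+ 2 / 2) * q0 (a * gf x))).
move: `|expR (- enorm x ^+ 2 / 2) * q0 (a * gf x)| => Z Z0.
rewrite [leRHS]mulrCA; apply: (ler_wpM2l Z0); apply: le_trans h _.
rewrite mulrACA; apply: ler_wpM2l; first by rewrite mulr_ge0.
have e2t (t : R) : expR (2 * t) = expR t * expR t by rewrite -expRD; congr expR; ring.
rewrite !e2t; move: Z0 => _.
have := expR_ge0 `|x.1|; have := expR_ge0 `|x.2|.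
move: (expR `|x.1|) (expR `|x.2|) => A B; nra.
Qed.

Lemma hom_bco a k : exists phi, hom k phi /\ forall p, bco p a k = (phi p)%:C%C.
Proof.
pose m i j := \int[L]_x (ml a x * (x.1 ^+ i * x.2 ^+ j)).
exists (fun p => \sum_(i < k.+1) ('C(k, i)%:R * m (k - i)%N i / k`!%:R) * (p.1 ^+ (k - i) * p.2 ^+ i)); split.
  apply: hom_sum => i; have ik : (i <= k)%N by rewrite -ltnS.
  by have := hom_mon (k - i) i ('C(k, i)%:R * m (k - i)%N i / k`!%:R); rewrite subnK.
move=> p; rewrite /bco; congr (_ %:C)%C.
pose h (i : 'I_k.+1) (x : R * R) : R := ('C(k, i)%:R * (p.1 ^+ (k - i) * p.2 ^+ i)) * (ml a x * (x.1 ^+ (k - i) * x.2 ^+ i)).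
have hi i : intg L (h i) by apply: intgZ; exact: ml_monomial_intg.
have -> : \int[L]_x (ml a x * dotp p x ^+ k) = \int[L]_x (\sum_(i <- index_enum 'I_k.+1) h i x).
  apply: eq_Rintegral => x _; rewrite /dotp exprDn mulr_sumr; apply: eq_bigr => i _.
  by rewrite /h !exprMn -mulr_natl; ring.
rewrite Rint_sum // mulr_suml; apply: eq_bigr => i _.
by rewrite /h RintZ ?ml_monomial_intg // -/(m (k - i)%N i); ring.
Qed.

(** The coefficient of [u^l] mixes forms of degree [k <= l] with [l - k] even, the Gaussian series
    having only even terms. A power of [p1^2 + p2^2], which is [1] on unit vectors, raises each of
    them to degree [l]. *)
Lemma hom_conv (kappa : R) a l : exists phi, hom l phi /\
  forall p, enorm p = 1 -> real_conv (bco p a) (- kappa%:C%C) l = (phi p)%:C%C.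
Proof.
have /choice[phi Hphi] := hom_bco a.
exists (fun p => \sum_(k < l.+1) phi k p * (gaussr (- kappa) (l - k) * (p.1 ^+ 2 + p.2 ^+ 2) ^+ (l - k)./2)); split.
  apply: hom_sum => k; have kl : (k <= l)%N by rewrite -ltnS.
  suff h : hom (l - k) (fun p => gaussr (- kappa) (l - k) * (p.1 ^+ 2 + p.2 ^+ 2) ^+ (l - k)./2).
    by have := hom_mul (Hphi k).1 h; rewrite subnKC.
  have [od|/negbTE od] := boolP (odd (l - k)).
    by apply: hom_eq (hom0 _ _) => p; rewrite /gaussr od mul0r.
  have h0 := hom_mon 0 0 (gaussr (- kappa) (l - k)).
  have := hom_mul h0 (hom_norm_pow R (l - k)./2); rewrite add0n add0n addnn.
  have := odd_double_half (l - k); rewrite od add0n => ->.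
  by apply: hom_eq => p; rewrite !expr0 !mulr1.
move=> p p1; rewrite /real_conv rmorph_sum; apply: eq_bigr => k _.
have -> : - kappa%:C%C = (- kappa)%:C%C :> C by rewrite rmorphN.
by rewrite (Hphi k).2 gco_gaussr -enorm_sq p1 !expr1n mulr1 rmorphM.
Qed.

Lemma hom_sum_realizes (b : R) (D n : nat) (phi : nat -> R * R -> R) : 0 < b -> (n <= D.+1)%N ->
  (forall l, hom l (phi l)) -> exists2 c : nat -> nat -> R, pdeg D c &
    forall p, enorm p = 1 -> forall u : C,
    laplace L (fun x => pol2 D c x * (expR (- (b * x.1) ^+ 2 / 2) * expR (- (b * x.2) ^+ 2 / 2))) (dotp p) u =
    psum (fun l => (phi l p)%:C%C) n u * cexp ((2 * b ^+ 2)^-1%:C%C * u ^+ 2).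
Proof.
move=> b0 + hphi; elim: n => [_|n IH nD].
  have [c dc hc] := hom_realizes b0 (leq0n D) (hom0 R 0).
  by exists c => // p p1 u; rewrite hc // /psum big_ord0 !mul0r.
have [c dc hc] := IH (ltnW nD).
have [c' dc' hc'] := hom_realizes b0 (nD : (n <= D)%N) (hphi n).
exists (fun i j => c i j + c' i j); first exact: pdeg_add.
move=> p p1 u; rewrite (laplace_polW_add b0) // hc // hc' // /psum big_ord_recr /=.
by rewrite -mulrDl.
Qed.

(** The width [b^2 = 1 / (2 kappa)] gives the inverse the factor [e^(kappa u^2)], and uniqueness
    identifies it with [ml a]. Removing [e^(-|x|^2 / 2)] from [e^(-b^2 |x|^2 / 2)] leaves the
    exponent [1 / (4 kappa) - 1/2]. *)
Lemma gaussian_components (kappa : R) (N : nat) a : 0 < kappa ->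
  (forall p, enorm p = 1 -> forall z,
    Bt a p z = psum (real_conv (bco p a) (- kappa%:C%C)) N z * cexp (kappa%:C%C * z ^+ 2)) ->
  exists2 c : nat -> nat -> R, pdeg N.-1 c &
    {ae L, forall x, q0 (a * gf x) = pol2 N.-1 c x * expR (- ((4 * kappa)^-1 - 2^-1) * enorm x ^+ 2)}.
Proof.
move=> k0 HB; have /choice[phi Hphi] := hom_conv kappa a.
pose b := Num.sqrt (2 * kappa)^-1.
have b2 : b ^+ 2 = (2 * kappa)^-1 by rewrite sqr_sqrtr // invr_ge0 mulr_ge0 // ltW.
have b0 : 0 < b by rewrite sqrtr_gt0 invr_gt0 mulr_gt0.
have [c dc hc] := hom_sum_realizes b0 (leqSpred N) (fun l => (Hphi l).1).
exists c => //.
pose W (x : R * R) : R := expR (- (b * x.1) ^+ 2 / 2) * expR (- (b * x.2) ^+ 2 / 2).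
have mm := measurable_ml mu1 mu2 hf a.
have p1 : enorm ((1, 0) : R * R) = 1 by rewrite /enorm /= expr1n expr0n addr0 sqrtr1.
have i1 : intg L (ml a).
  by have := ml_monomial_intg a 0 0; apply: eq_intg => x; rewrite !expr0 !mulr1.
have i2 : intg L (fun x => pol2 N.-1 c x * W x).
  have mW : measurable_fun [set: plane] (fun x : plane => pol2 N.-1 c x * W x) := measurable_polW b N.-1 c.
  have eW := polW_exp_moments b0 N.-1 c 0 p1.
  by apply: (intg_dom mW eW) => x; rewrite mul0r expR0 mulr1.
have : {ae L, forall x, ml a x - pol2 N.-1 c x * W x = 0}.
  apply: (laplace_unique (intgB i1 i2)) => p t pp.
  have md := measurable_dotp p.
  have r1 := laplace_Re_intg mm md (fun r => ml_exp_moments mu1 mu2 hf pp a r) (Complex 0 t).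
  have j1 := laplace_Im_intg mm md (fun r => ml_exp_moments mu1 mu2 hf pp a r) (Complex 0 t).
  have r2 := laplace_Re_intg (measurable_polW b N.-1 c) md (fun r => polW_exp_moments b0 N.-1 c r pp) (Complex 0 t).
  have j2 := laplace_Im_intg (measurable_polW b N.-1 c) md (fun r => polW_exp_moments b0 N.-1 c r pp) (Complex 0 t).
  have e : laplace L (ml a) (dotp p) (Complex 0 t) =
      laplace L (fun x => ml a x - pol2 N.-1 c x * W x) (dotp p) (Complex 0 t) +
      laplace L (fun x => pol2 N.-1 c x * W x) (dotp p) (Complex 0 t).
    rewrite -(laplace_add _ _ r2 j2); first by congr laplace; apply/funext => x; rewrite subrK.
      by apply: eq_intg (intgB r1 r2) => x; rewrite mulrBl.
    by apply: eq_intg (intgB j1 j2) => x; rewrite mulrBl.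
  move/(canRL (addrK _)): (esym e) => ->; rewrite hc //.
  rewrite -[laplace L (ml a) _ _]/(Bt a p _) HB // b2.
  have -> : (2 * (2 * kappa)^-1)^-1 = kappa by field; rewrite gt_eqF.
  apply/eqP; rewrite subr_eq0; apply/eqP; congr (_ * _); apply: eq_bigr => l _.
  by rewrite (Hphi l).2.
apply: ae_imp => x; rewrite /ml => /(canRL (subrK _)); rewrite add0r => e.
have -> : q0 (a * gf x) = expR (enorm x ^+ 2 / 2) * (expR (- enorm x ^+ 2 / 2) * q0 (a * gf x)).
  by rewrite mulrA -expRD -mulrDl subrr mul0r expR0 mul1r.
rewrite e mulrCA; congr (_ * _); rewrite /W -!expRD; congr expR.
rewrite enorm_sq !exprMn b2; field; by rewrite gt_eqF.
Qed.

End Components.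

Section Structure.
Variable R : realType.
Local Notation C := R[i].
Local Notation plane := (measurableTypeR R * measurableTypeR R)%type.
Local Notation L := (@leb2 R).

Lemma ae_all d (T : measurableType d) (mu : {measure set T -> \bar R}) (P : nat -> T -> Prop) :
  (forall n, {ae mu, forall x, P n x}) -> {ae mu, forall x, forall n, P n x}.
Proof. exact: ae_foralln. Qed.

(* [q0 (axis m * g)] is the m-th real coordinate of [g]. *)
Definition axis (m : nat) : quat R :=
  match m with 0%N => 1 | 1%N => - qi | 2%N => - qj | _ => - qk end.

Lemma quat_axis (g : quat R) : g = Quat (q0 (axis 0 * g)) (q0 (axis 1 * g)) (q0 (axis 2 * g)) (q0 (axis 3 * g)).
Proof. by case: g => a b c e; congr Quat => /=; ring. Qed.

Lemma axis_eq0 (g : quat R) : (forall m, q0 (axis m * g) = 0) -> g = 0.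
Proof. by move=> h; rewrite (quat_axis g) !h. Qed.

Lemma qnorm_axis m : qnorm (axis m) = 1.
Proof. by case: m => [|[|[|m]]]; apply: qnorm_eq => //=; ring. Qed.

Variables (mu1 mu2 : qpft_param R).
Hypotheses (hb1 : pb mu1 != 0) (hb2 : pb mu2 != 0).
Local Notation b1 := (pb mu1).
Local Notation b2 := (pb mu2).
Variable T : (R * R -> quat R) -> (R * R -> quat R).
Hypothesis hT : is_QQPFT_L2 mu1 mu2 T.
Variable f : R * R -> quat R.
Hypothesis hf : sq_intg f.
Let nb (w : R * R) : R := enorm (b1 * w.1, b2 * w.2).
Local Notation Bt := (Bt mu1 mu2 f).
Local Notation DF := (DF f).
Local Notation DT := (DT mu1 mu2 T f).
Local Notation bco := (bco mu1 mu2 f).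
Local Notation gf := (gf mu1 mu2 f).
Local Notation ml := (ml mu1 mu2 f).

Lemma gf_axis_ae0 : {ae L, forall x, forall m, q0 (axis m * gf x) = 0} -> {ae L, forall x, f x = 0}.
Proof.
apply: ae_imp => x h; apply: qnorm_eq0; rewrite -(qnorm_demod mu1 mu2) -/(gf x).
by rewrite (axis_eq0 h) qnorm0.
Qed.

Lemma Bt_eq0 : (forall a p u, enorm p = 1 -> Bt a p u = 0) -> {ae L, forall x, f x = 0}.
Proof.
move=> h; apply: gf_axis_ae0; apply: ae_all => m.
have im : intg L (ml (axis m)).
  by have := ml_monomial_intg mu1 mu2 hf (axis m) 0 0; apply: eq_intg => x; rewrite !expr0 !mulr1.
have := laplace_unique im (fun p t p1 => h (axis m) p (Complex 0 t) p1).
apply: ae_imp => x; rewrite /ml => /eqP; rewrite mulf_eq0 gt_eqF ?expR_gt0 //= => /eqP.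
by [].
Qed.

Lemma moment_shift (t : plane -> R) (g : plane -> R) (c X : R) : (forall x, 0 <= g x) ->
  intg L (fun x => expR (c * t x) * g x) -> intg L (fun x => Gw X (t x) * g x) ->
  \int[L]_x (Gw X (t x) * g x) <= expR ((X - c) ^+ 2 / 2) * \int[L]_x (expR (c * t x) * g x).
Proof.
move=> g0 i1 i2; rewrite -RintZ //; apply: Rint_le => //; first exact: intgZ.
by move=> x; rewrite mulrA; apply: (ler_wpM2r (g0 x)); exact: Gw_shift.
Qed.

Variable d : R.
Hypothesis hd : 0 <= d.
Hypothesis hint : (\int[L]_w \int[L]_x (hintF mu1 mu2 T f d (x, w))%:E < +oo)%E.
Hypothesis nf : ~ {ae L, forall x, f x = 0}.

(** A vanishing transform would make [DT] zero, and the dual bound would then kill every slice of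
    [f]. *)
Lemma T_not_ae0 : ~ {ae L, forall w, T f w = 0}.
Proof.
move=> h; apply: nf; apply: Bt_eq0 => a p u p1.
have D0 X : DT X = 0.
  have e : {ae L, forall w, `|Gw X (nb w) * qnorm (T f w)| <= 0}.
    by apply: (ae_imp _ h) => w ->; rewrite qnorm0 mulr0 normr0.
  have i0 := @intg0 _ plane R L.
  have := Rint_norm_le_ae (DT_intg hb1 hb2 hT hf X) i0 e.
  by rewrite [X in _ <= X]/Rintegral integral0 /= normr_le0 => /eqP.
have := Bt_dual hb1 hb2 hT hf p1 a u; rewrite D0 mulr0 => h0.
by apply/eqP; rewrite -cn_eq0; apply/eqP/le_anti; rewrite h0 cn_ge0.
Qed.

Lemma gaussian_form : exists (kappa : R) (N : nat) (a : quat R) (p : R * R) (P : {poly C}),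
  [/\ 0 < kappa < 1 / 2, enorm p = 1, size P = N.+1,
    forall z, Bt a p z = P.[z] * cexp (kappa%:C%C * z ^+ 2) &
    forall m, exists2 c : nat -> nat -> R, pdeg N c &
    {ae L, forall x, q0 (axis m * gf x) = pol2 N c x * expR (- ((4 * kappa)^-1 - 2^-1) * enorm x ^+ 2)}].
Proof.
have [a0 [p0 [n0 [p01 b0]]]] : exists a0 p0 n0, enorm p0 = 1 /\ bco p0 a0 n0 != 0.
  apply: contrapT => h; apply: nf; apply: Bt_eq0 => a p u p1.
  have e0 : ent (fun=> 0 : C) (bco p a).
    move=> r r0; exists 0 => n z _; rewrite /psum big1 ?subrr ?cn0 ?mul0r // => k _.
    have [->|nz] := eqVneq (bco p a k) 0; first by rewrite mul0r.
    by exfalso; apply: h; exists a, p, k.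
  exact: ent_ext (Bt_ent mu1 mu2 hf p1 a) e0 u.
have [kappa [N0 H0]] := Bt_gaussian hb1 hb2 hT hf hd hint p01 b0.
pose Q n := forall a p, enorm p = 1 -> forall z,
    Bt a p z = psum (real_conv (bco p a) (- kappa%:C%C)) n z * cexp (kappa%:C%C * z ^+ 2).
have ex : exists n, `[< Q n >] by exists N0; apply/asboolP.
(* The least number of terms valid for all slices at once: it bounds the degree of every coordinate
   by [N], and by minimality some slice has degree exactly [N], which the lower bound for the inner
   integral uses. *)
case: (ex_minnP ex) => -[|N] /asboolP QN minN.
  by exfalso; apply: nf; apply: Bt_eq0 => a p u p1; rewrite QN // /psum big_ord0 mul0r.
have [a [p [p1 cN]]] : exists a p, enorm p = 1 /\ real_conv (bco p a) (- kappa%:C%C) N != 0.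
  apply: contrapT => h; suff /asboolP/minN : Q N by rewrite ltnn.
  move=> a p p1 z; rewrite QN // /psum big_ord_recr /=.
  have [->|nz] := eqVneq (real_conv (bco p a) (- kappa%:C%C) N) 0; first by rewrite mul0r addr0.
  by exfalso; apply: h; exists a, p.
pose P : {poly C} := \poly_(k < N.+1) real_conv (bco p a) (- kappa%:C%C) k.
have sP : size P = N.+1 by apply: size_poly_eq.
have P0 : P != 0 by rewrite -size_poly_gt0 sP.
have HP z : Bt a p z = P.[z] * cexp (kappa%:C%C * z ^+ 2) by rewrite QN // /P horner_poly.
have [c c0 ic] := f_exp_moment hb1 hb2 hT hf hd hint T_not_ae0.
have [c' c'0 ic'] := T_exp_moment hT hf hd hint nf.
have k1 : kappa < 1 / 2.
  apply: (@type_lt_half _ P kappa c (2 * qnorm a * \int[L]_x (expR (c * enorm x) * qnorm (f x)))) => //.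
    apply: mulr_ge0; first by apply: mulr_ge0 (qnorm_ge0 _).
    by apply: Rintegral_ge0 => x _; apply: mulr_ge0 (expR_ge0 _) (qnorm_ge0 _).
  move=> t t0; rewrite -HP; apply: le_trans (Bt_direct mu1 mu2 hf p1 a _) _ => /=.
  rewrite (ger0_norm t0).
  have h := moment_shift (fun x => qnorm_ge0 (f x)) ic (DF_intg hf t).
  have K0 : 0 <= 2 * qnorm a by apply: mulr_ge0 (qnorm_ge0 _).
  by apply: le_trans (ler_wpM2l K0 h) _; le_eq; rewrite [RHS]mulrAC -mulrA.
have k0 : 0 < kappa.
  apply: (@type_gt0 _ P kappa c' (4 * dual_cst mu1 mu2 1 * qnorm a * \int[L]_w (expR (c' * nb w) * qnorm (T f w)))) => //.
    apply: mulr_ge0; first by apply: mulr_ge0 (qnorm_ge0 _); apply: mulr_ge0 => //; exact: dual_cst_ge0.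
    by apply: Rintegral_ge0 => x _; apply: mulr_ge0 (expR_ge0 _) (qnorm_ge0 _).
  move=> t t0; rewrite -HP; apply: le_trans (Bt_dual hb1 hb2 hT hf p1 a _) _.
  rewrite [complex.Re _]/= [complex.Im _]/= (ger0_norm t0) expr0n /= sub0r.
  have h := moment_shift (fun x => qnorm_ge0 (T f x)) ic' (DT_intg hb1 hb2 hT hf t).
  have K0 : 0 <= 4 * dual_cst mu1 mu2 1 * qnorm a * expR (- t ^+ 2 / 2).
    apply: mulr_ge0 (expR_ge0 _); apply: mulr_ge0 (qnorm_ge0 _); apply: mulr_ge0 => //; exact: dual_cst_ge0.
  apply: le_trans (ler_wpM2l K0 h) _.
  by le_eq; move: (4 * dual_cst mu1 mu2 1 * qnorm a) (expR (- t ^+ 2 / 2)) => A B; ring.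
exists kappa, N, a, p, P; split => //; first by rewrite k0 k1.
by move=> m; exact: (@gaussian_components R mu1 mu2 f hf kappa N.+1 (axis m) k0 (QN (axis m))).
Qed.

End Structure.

(** * Lower bound for the inner integral and the degree *)

Section Degree.
Variable R : realType.
Local Notation C := R[i].
Local Notation plane := (measurableTypeR R * measurableTypeR R)%type.
Local Notation L := (@leb2 R).

(* With [t = (1 + 2k) s] and [2 kappa (1 + 2k) = 1] the exponents combine to
   [s r - k s^2 - (2 k s - r)^2 / 2]. *)
Lemma weight_transfer (k d s r : R) (N : nat) : 0 < k -> 0 <= d -> d <= N%:R -> 0 <= s -> 0 <= r ->
  expR (((1 + 2 * k) * s) ^+ 2 / (2 * (1 + 2 * k)) - ((1 + 2 * k) * s) ^+ 2 / 2) * Gw ((1 + 2 * k) * s) r <=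
  (1 + 2 * k) `^ d * (N`!%:R * expR (3 / 2)) * ((1 + s) `^ d * expR (- k * s ^+ 2)) *
  (expR (s * r) / (1 + s + r) `^ d).
Proof.
move=> k0 d0 dN s0 r0; rewrite /Gw -expRD.
pose y := `|r - 2 * k * s|; have y0 : 0 <= y by exact: normr_ge0.
have -> : ((1 + 2 * k) * s) ^+ 2 / (2 * (1 + 2 * k)) - ((1 + 2 * k) * s) ^+ 2 / 2 +
    (- r ^+ 2 / 2 + (1 + 2 * k) * s * r) = - k * s ^+ 2 + s * r + - y ^+ 2 / 2.
  rewrite /y real_normK ?num_real //; field; rewrite gt_eqF //; lra.
rewrite 2!expRD.
have P0 : 0 < (1 + s + r) `^ d by rewrite powR_gt0 //; lra.
have ks : 0 <= k * s by rewrite mulr_ge0 // ltW.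
(* From [r <= 2 k s + y]: the denominator splits into a factor in [s] and a factor in the offset
   [y], which the Gaussian absorbs. *)
have h1 : 1 + s + r <= (1 + 2 * k) * ((1 + s) * (1 + y)).
  have h := ler_norm (r - 2 * k * s); rewrite -/y in h.
  have h2 : 0 <= s * y by rewrite mulr_ge0.
  have h3 : 0 <= k * y by rewrite mulr_ge0 // ltW.
  have h4 : 0 <= k * s * y by rewrite mulr_ge0.
  by lra.
have h2 : (1 + s + r) `^ d <= (1 + 2 * k) `^ d * ((1 + s) `^ d * (1 + y) `^ d).
  have n1 : 0 <= 1 + 2 * k by lra.
  have n2 : 0 <= 1 + s by lra.
  have n3 : 0 <= 1 + y by lra.
  have n4 : 0 <= 1 + s + r by lra.
  have n5 := mulr_ge0 n2 n3; have n6 := mulr_ge0 n1 n5.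
  by rewrite -(powRM _ n2 n3) -(powRM _ n1 n5); apply: ge0_ler_powR.
have h3 : (1 + y) `^ d <= (1 + y) ^+ N by rewrite -powR_mulrn ?addr_ge0 // ler_powR // lerDl.
have h4 := polynomial_gauss_bound N y0.
have h5 : (1 + s + r) `^ d * expR (- y ^+ 2 / 2) <= (1 + 2 * k) `^ d * (1 + s) `^ d * (N`!%:R * expR (3 / 2)).
  apply: le_trans (ler_wpM2r (expR_ge0 _) h2) _; rewrite -!mulrA.
  apply: (ler_wpM2l (powR_ge0 _ _)); apply: (ler_wpM2l (powR_ge0 _ _)).
  by apply: le_trans h4; exact: (ler_wpM2r (expR_ge0 _) h3).
rewrite [leRHS]mulrA ler_pdivlMr //.
have E0 : 0 <= expR (- k * s ^+ 2) * expR (s * r) by rewrite mulr_ge0 // expR_ge0.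
have := ler_wpM2l E0 h5.
move: (expR (- k * s ^+ 2)) (expR (s * r)) (expR (- y ^+ 2 / 2)) ((1 + s + r) `^ d) ((1 + 2 * k) `^ d) ((1 + s) `^ d) (N`!%:R * expR (3 / 2)).
by move=> A B F P' Q S W h; apply: le_trans (le_trans _ h) _; le_eq; ring.
Qed.

Variables (mu1 mu2 : qpft_param R).
Hypotheses (hb1 : pb mu1 != 0) (hb2 : pb mu2 != 0).
Local Notation b1 := (pb mu1).
Local Notation b2 := (pb mu2).
Variable T : (R * R -> quat R) -> (R * R -> quat R).
Hypothesis hT : is_QQPFT_L2 mu1 mu2 T.
Variable f : R * R -> quat R.
Hypothesis hf : sq_intg f.
Let nb (w : R * R) : R := enorm (b1 * w.1, b2 * w.2).
Local Notation Bt := (Bt mu1 mu2 f).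
Local Notation DT := (DT mu1 mu2 T f).
Local Notation gf := (gf mu1 mu2 f).
Variable d : R.
Hypothesis hd : 0 <= d.
Local Notation hintF := (hintF mu1 mu2 T f d).
Hypothesis hint : (\int[L]_w \int[L]_x (hintF (x, w))%:E < +oo)%E.

Variables (k kappa : R) (N : nat) (a : quat R) (p : R * R) (P : {poly C}).
Hypotheses (k0 : 0 < k) (kk : 2 * (1 + 2 * k) * kappa = 1) (p1 : enorm p = 1) (sP : size P = N.+1).
Hypothesis HP : forall z, Bt a p z = P.[z] * cexp (kappa%:C%C * z ^+ 2).

(** The candidate lower bound for the inner integral, cut off where the growth estimate for [P] need
    not hold; the power of [1 + |x|] is written with [ln] for measurability. *)
Definition minorant (c1 r0 : R) (x : plane) : R :=
  if r0 <= enorm x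
  then c1 * (qnorm (f x) * expR (k * enorm x ^+ 2) * (enorm x ^+ N * expR (- (d * ln (1 + enorm x)))))
  else 0.

Lemma minorant_intg : exists c1 r0 : R, 0 < c1 /\ intg L (minorant c1 r0) /\ forall x, 0 <= minorant c1 r0 x.
Proof.
have P0 : P != 0 by rewrite -size_poly_gt0 sP.
have [cP [r0 [cP0 r00 HG]]] := poly_growth P0; rewrite sP /= in HG.
pose M := Num.bound d; have dM : d <= M%:R := ltW (archi_boundP hd).
pose A := 4 * dual_cst mu1 mu2 1 * qnorm a.
have A0 : 0 <= A by apply: mulr_ge0 (qnorm_ge0 _); apply: mulr_ge0 => //; exact: dual_cst_ge0.
pose K := (1 + 2 * k) `^ d * (M`!%:R * expR (3 / 2)).
have K0 : 0 <= K by apply: (mulr_ge0 (powR_ge0 _ _)); exact: (mulr_ge0 (ler0n _ _) (expR_ge0 _)).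
have AK : 0 < 1 + A * K by rewrite ltr_pwDl // mulr_ge0.
pose c1 := cP / (1 + A * K); have c10 : 0 < c1 by rewrite divr_gt0.
have H0 x : 0 <= minorant c1 r0 x.
  rewrite /minorant; case: ifP => // _; apply: mulr_ge0; first exact: ltW.
  apply: mulr_ge0; first by apply: mulr_ge0 (qnorm_ge0 _) (expR_ge0 _).
  by apply: mulr_ge0 (expR_ge0 _); rewrite exprn_ge0 // enorm_ge0.
have me := @measurable_enorm R; have mf := measurable_qnorm hf.1.
have mH : measurable_fun [set: plane] (minorant c1 r0).
  apply: measurable_fun_ifT; [| |exact: measurable_cst].
    by apply: measurable_fun_ler => //; exact: measurable_cst.
  apply: measurable_funM; first exact: measurable_cst.
  apply: measurable_funM; first by msr.
  apply: measurable_funM; first by msr.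
  apply: measurable_expR_comp; apply: measurable_funN; apply: measurable_funM; first exact: measurable_cst.
  apply: (measurableT_comp (f := @ln R)); first exact: measurable_ln.
  by apply: measurable_funD => //; exact: measurable_cst.
exists c1, r0; split => //; split => //.
have mh := measurable_hintF hT hf d.
apply: (iterated_lower mh (@hintF_ge0 _ _ _ _ _ _) hint mH H0) => x.
have mx : measurable_fun [set: plane] (fun w => hintF (x, w)).
  exact: (measurableT_comp mh (measurable_pair1 (x : plane))).
(* The inner integral may be infinite at particular points, where the inequality is trivial in the
   extended reals. *)
have [fin|/negP] := pselect ((\int[L]_w (hintF (x, w))%:E < +oo)%E); last first.
  by rewrite -leNgt leye_eq => /eqP ->; rewrite leey.
have ix := intg_ge0 mx (fun w => hintF_ge0 _ _ _ _ _ _) fin.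
rewrite (intg_fin ix) lee_fin /minorant; case: ifP => [sr|_]; last first.
  by apply: Rintegral_ge0 => w _; exact: hintF_ge0.
set s := enorm x in sr *; have s0 : 0 <= s by exact: enorm_ge0.
(* Up to polynomial factors, [e^(-kappa t^2) <= A e^(-t^2 / 2) DT t] and
   [t r - r^2 / 2 <= s r + (t - s)^2 / 2] bound the inner integral below by
   [|f x| e^(t s - kappa t^2 - s^2 / 2)]. The exponent is largest at
   [t = s / (2 kappa) = (1 + 2k) s], where it equals [k s^2]. *)
pose t := (1 + 2 * k) * s.
have ks : 0 <= k * s by rewrite mulr_ge0 // ltW.
have st : s <= t by rewrite /t; lra.
have t0 : 0 <= t by lra.
have cit : cn (Complex 0 t) = t by rewrite cnE /= expr0n /= add0r sqrtr_sqr ger0_norm.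
have g1 : cP * s ^+ N <= cn P.[Complex 0 t].
  have := HG (Complex 0 t); rewrite cit => /(_ (le_trans sr st)); apply: le_trans.
  by apply: (ler_wpM2l (ltW cP0)); apply: lerXn2r; rewrite ?nnegrE.
pose E := expR (t ^+ 2 / (2 * (1 + 2 * k)) - t ^+ 2 / 2).
have g2 : cn P.[Complex 0 t] <= A * (E * DT t).
  have h := Bt_dual hb1 hb2 hT hf p1 a (Complex 0 t); rewrite HP cnM cn_cexp in h.
  have e1 : complex.Re (kappa%:C%C * Complex 0 t ^+ 2) = - (t ^+ 2 / (2 * (1 + 2 * k))).
    have k2 : 2 * (1 + 2 * k) != 0 by rewrite gt_eqF // mulr_gt0 // addr_gt0 // mulr_gt0.
    have -> : kappa = (2 * (1 + 2 * k))^-1 by apply: (mulfI k2); rewrite kk divff.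
    by rewrite expr2 /=; ring.
  rewrite e1 [complex.Re _]/= [complex.Im _]/= (ger0_norm t0) expr0n /= sub0r in h.
  have := ler_wpM2r (expR_ge0 (t ^+ 2 / (2 * (1 + 2 * k)))) h.
  rewrite -[X in X <= _ -> _]mulrA -expRD addNr expR0 mulr1 => {}h; apply: le_trans h _.
  have eE : E = expR (t ^+ 2 / (2 * (1 + 2 * k))) * expR (- t ^+ 2 / 2) by rewrite -expRD mulNr.
  by rewrite eE /A; le_eq; ring.
have q0 : 0 <= qnorm (f x) by exact: qnorm_ge0.
have p0 : 0 < (1 + s) `^ d by rewrite powR_gt0 //; lra.
pose Z := (1 + s) `^ d * expR (- k * s ^+ 2).
have Z0 : 0 < Z by rewrite mulr_gt0 // expR_gt0.
have g3 : qnorm (f x) * (E * DT t) <= K * Z * \int[L]_w hintF (x, w).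
  have eD : DT t = \int[L]_w (Gw t (nb w) * qnorm (T f w)) by [].
  have iD := DT_intg hb1 hb2 hT hf t.
  rewrite mulrA eD -(RintZ (qnorm (f x) * E) iD) -(RintZ (K * Z) ix).
  apply: Rint_le; [exact: (intgZ (qnorm (f x) * E) iD)|exact: (intgZ (K * Z) ix)|].
  move=> w; have h := weight_transfer k0 hd dM s0 (nb_ge0 mu1 mu2 w).
  have T0 := mulr_ge0 q0 (qnorm_ge0 (T f w)).
  have := ler_wpM2l T0 h; rewrite -/t -/E -/K -/Z /hintF -/s -/(nb w).
  move: (Gw t (nb w)) (qnorm (f x)) (qnorm (T f w)) (expR (s * nb w)) ((1 + s + nb w) `^ d)^-1 => G' q q' e' i' h'.
  by apply: le_trans (le_trans _ h') _; le_eq; ring.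
set J := \int[L]_w hintF (x, w) in g3 *.
have J0 : 0 <= J by apply: Rintegral_ge0 => w _; exact: hintF_ge0.
have e1 : expR (k * s ^+ 2) * expR (- (d * ln (1 + s))) = Z^-1.
  by rewrite /Z /powR gt_eqF ?ltr_pwDl // -!expRD -expRN; congr expR; ring.
have -> : c1 * (qnorm (f x) * expR (k * s ^+ 2) * (s ^+ N * expR (- (d * ln (1 + s))))) =
   (qnorm (f x) * (cP * s ^+ N)) * Z^-1 / (1 + A * K) by rewrite -e1 /c1; ring.
rewrite ler_pdivrMr // ler_pdivrMr //.
apply: le_trans (ler_wpM2l q0 (le_trans g1 g2)) _; rewrite mulrCA.
apply: le_trans (ler_wpM2l A0 g3) _.
have ZJ : 0 <= J * Z by rewrite mulr_ge0 // ltW.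
by move: ZJ; move: (A) (K) (Z) (J) => A' K' Z' J' h; lra.
Qed.

Lemma degree_bound m (c : nat -> nat -> R) n i0 j0 :
  {ae L, forall x, q0 (axis R m * gf x) = pol2 N c x * expR (- k * enorm x ^+ 2)} ->
  pdeg n c -> (n <= N)%N -> (i0 + j0)%N = n -> c i0 j0 != 0 -> (n + N)%:R < d - 2.
Proof.
move=> hae dc nN ij cij; have [c1 [r0 [c10 [iH H0]]]] := minorant_intg.
apply: (@pol2_growth R N c n i0 j0 N d c1 r0 (minorant c1 r0)) => //.
apply: (ae_imp _ hae) => x e sr; rewrite /minorant sr; apply: (ler_wpM2l (ltW c10)).
have s0 := enorm_ge0 x.
have -> : expR (- (d * ln (1 + enorm x))) = ((1 + enorm x) `^ d)^-1.
  by rewrite /powR gt_eqF ?ltr_pwDl // expRN.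
apply: ler_wpM2r; first by apply: mulr_ge0; [exact: exprn_ge0|rewrite invr_ge0 powR_ge0].
have -> : pol2 N c x = q0 (axis R m * gf x) * expR (k * enorm x ^+ 2).
  by rewrite e -mulrA -expRD mulNr addNr expR0 mulr1.
rewrite normrM (ger0_norm (expR_ge0 _)); apply: (ler_wpM2r (expR_ge0 _)).
apply: le_trans (q0_le _) _; rewrite qnormM qnorm_axis mul1r.
by rewrite -[gf x]/(demod mu1 mu2 f x) qnorm_demod.
Qed.

End Degree.

(** * Reassembling quaternion polynomials *)

Section QuaternionPolynomials.
Variable R : realType.
Implicit Types (e : nat -> nat -> quat R) (x : R * R).

Definition poly2 (D : nat) e : {poly {poly (quat R)}} := \poly_(j < D.+1) \poly_(i < D.+1) e i j.

Lemma coef_poly2 D e n m : (poly2 D e)`_n`_m != 0 -> e m n != 0.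
Proof.
rewrite /poly2 coef_poly; case: ifP => _; last by rewrite coef0 eqxx.
by rewrite coef_poly; case: ifP => // _; rewrite eqxx.
Qed.

Lemma eval2_poly2 D e x :
  eval2 (poly2 D e) x = \sum_(i < D.+1) \sum_(j < D.+1) (x.1 ^+ i * x.2 ^+ j) *: e i j.
Proof.
rewrite /eval2 /poly2 horner_poly horner_sum exchange_big /=; apply: eq_bigr => j _.
rewrite -rmorphXn /= hornerM_comm; last first.
  by rewrite /comm_poly hornerC exprZn expr1n mulr_algl mulr_algr.
rewrite hornerC horner_poly mulr_suml; apply: eq_bigr => i _.
by rewrite !exprZn !expr1n !mulr_algr scalerA mulrC.
Qed.

Lemma coord_eval2 (q : quat R -> R) D e x : {morph q : y z / y + z} -> q 0 = 0 ->
  (forall a y, q (a *: y) = a * q y) ->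
  q (eval2 (poly2 D e) x) = pol2 D (fun i j => q (e i j)) x.
Proof.
move=> qD q00 qZ; rewrite eval2_poly2 (big_morph q qD q00); apply: eq_bigr => i _.
by rewrite (big_morph q qD q00); apply: eq_bigr => j _; rewrite qZ mulrC.
Qed.

Lemma inplane1 (u : quat R) : inplane u 1 = 1.
Proof. by rewrite /inplane /= scale0r addr0 scale1r. Qed.

Lemma eval2_sandwich (z t : R[i]) D e x : z != 0 -> t != 0 ->
  inplane qi z^-1 * eval2 (poly2 D (fun i j => inplane qi z * e i j * inplane qj t)) x * inplane qj t^-1 =
  eval2 (poly2 D e) x.
Proof.
move=> z0 t0; rewrite !eval2_poly2 mulr_sumr mulr_suml; apply: eq_bigr => i _.
rewrite mulr_sumr mulr_suml; apply: eq_bigr => j _.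
rewrite -scalerAr -scalerAl; congr (_ *: _).
by rewrite !mulrA -inplane_qiM mulVf // inplane1 mul1r -mulrA -inplane_qjM divff // inplane1 mulr1.
Qed.

Lemma demodK (mu1 mu2 : qpft_param R) (F : R * R -> quat R) x :
  F x = expu qi (pa mu1 * x.1 ^+ 2 + pd mu1 * x.1) * demod mu1 mu2 F x *
    expu qj (pa mu2 * x.2 ^+ 2 + pd mu2 * x.2).
Proof.
have ei t : expu qi t = inplane qi (cexp (Complex 0 t)) :> quat R.
  by have := inplane_expu_qi 1 t; rewrite inplane1 !mul1r.
rewrite /demod /chirp; move: (pa mu1 * _ + _) (pa mu2 * _ + _) => t1 t2.
rewrite -!mulrA inplane_expu_qj ei !mulrA -inplane_qiM -!cexpD.
have e1 (s : R) : Complex 0 s + Complex 0 (- s) = 0 :> R[i] by congr Complex => /=; ring.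
have e2 (s : R) : Complex 0 (- s) + Complex 0 s = 0 :> R[i] by congr Complex => /=; ring.
by rewrite e1 e2 cexp0 !inplane1 mul1r mulr1.
Qed.

Lemma sqrtc_imaginary_neq0 (b : R) : b != 0 -> sqrtc (Complex 0 b) != 0.
Proof.
move=> b0; apply/eqP => h; have := sqr_sqrtc (Complex 0 b); rewrite h expr0n /=.
by move/(congr1 (@complex.Im R)) => /= /esym/eqP; rewrite (negbTE b0).
Qed.

End QuaternionPolynomials.

Theorem theorem4p5 (R : realType) (mu1 mu2 : qpft_param R)
  (hb1 : pb mu1 != 0) (hb2 : pb mu2 != 0)
  (QQPFT2 : (R * R -> quat R) -> (R * R -> quat R))
  (hQ : is_QQPFT_L2 mu1 mu2 QQPFT2)
  (f : R * R -> quat R) (hf : LpH 2%:E f)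
  (d : R) (hd : 0 <= d)
  (hint : (\int[@leb2 R]_w \int[@leb2 R]_x
     (qnorm (f x) * qnorm (QQPFT2 f w)
      / (1 + enorm x + enorm (pb mu1 * w.1, pb mu2 * w.2)) `^ d
      * expR (enorm x * enorm (pb mu1 * w.1, pb mu2 * w.2)))%:E < +oo)%E) :
  (exists (k : R) (P P' : {poly {poly (quat R)}}),
     [/\ 0 < k,
         forall x : R * R, eval2 P' x =
           inplane qi (sqrtc (Complex 0 (pb mu1)))^-1 * eval2 P x
           * inplane qj (sqrtc (Complex 0 (pb mu2)))^-1,
         total_degree_lt P' ((d - 2) / 2) &
         {ae @leb2 R, forall x : R * R, f x =
           expu qi (pa mu1 * x.1 ^+ 2 + pd mu1 * x.1)
           * eval2 P' x * (expR (- k * enorm x ^+ 2))%:A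
           * expu qj (pa mu2 * x.2 ^+ 2 + pd mu2 * x.2)}])
  /\ (d <= 2 -> {ae @leb2 R, forall x : R * R, f x = 0}).
Proof.
have {}hf := (LpH2P f).1 hf.
have {}hint : (\int[@leb2 R]_w \int[@leb2 R]_x (hintF mu1 mu2 QQPFT2 f d (x, w))%:E < +oo)%E := hint.
have [f0|nf] := pselect {ae @leb2 R, forall x : R * R, f x = 0}.
  (* For [f = 0] any positive [k] will do, with zero polynomials. *)
  split => // ; exists 1, 0, 0; split => //.
  - by move=> x; rewrite /eval2 !horner0 mulr0 mul0r.
  - by move=> m n; rewrite !coef0 eqxx.
  - by apply: (ae_imp _ f0) => x ->; rewrite /eval2 !horner0 mulr0 !mul0r.
have [kappa [N [a [p [P [/andP[k0 k1] p1 sP HP hc]]]]]] := gaussian_form hb1 hb2 hQ hf hd hint nf.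
have /choice[c hc'] : forall m, exists c : nat -> nat -> R, pdeg N c /\
    {ae @leb2 R, forall x, q0 (axis R m * gf mu1 mu2 f x) =
      pol2 N c x * expR (- ((4 * kappa)^-1 - 2^-1) * enorm x ^+ 2)}.
  by move=> m; have [c0 c1 c2] := hc m; exists c0.
set k := (4 * kappa)^-1 - 2^-1 in hc'.
have kp : 0 < k.
  by rewrite subr_gt0 ltf_pV2 ?posrE ?mulr_gt0 //; lra.
have kk : 2 * (1 + 2 * k) * kappa = 1 by rewrite /k; field; rewrite gt_eqF.
(* With [n] the largest total degree in the coordinate of index [m], the growth argument gives
   [n + N < d - 2], and [n <= N] turns it into [2 n < d - 2]. *)
have deg m i j : c m i j != 0 -> (i + j)%:R < (d - 2) / 2.
  move=> cij; pose S n := `[< exists i j, (i + j)%N = n /\ c m i j != 0 >].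
  have Sij : S (i + j)%N by apply/asboolP; exists i, j.
  have SN n : S n -> (n <= N)%N by move/asboolP => [i' [j' [<- /(hc' m).1]]].
  have exS : exists n, S n by exists (i + j)%N.
  case: (ex_maxnP exS SN) => n Sn max; have nN := SN n Sn.
  move: Sn => /asboolP[i0 [j0 [e0 c0]]].
  have dc : pdeg n (c m) by move=> i' j' c'; apply: max; apply/asboolP; exists i', j'.
  have h := degree_bound hb1 hb2 hQ hf hd hint kp kk p1 sP HP (hc' m).2 dc nN e0 c0.
  have ijn : (i + j)%:R <= n%:R :> R by rewrite ler_nat; exact: max.
  have nN' : n%:R <= N%:R :> R by rewrite ler_nat.
  by rewrite natrD in h; rewrite ltr_pdivlMr //; lra.
have hae := ae_all (fun m => (hc' m).2).
split; last first.
  (* For [d <= 2] no natural number lies below [(d - 2) / 2], so all coefficients vanish. *)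
  move=> d2; apply: (@gf_axis_ae0 R mu1 mu2 f); apply: (ae_imp _ hae) => x h m.
  rewrite h /pol2 big1 ?mul0r // => i _; rewrite big1 // => j _.
  have [->|/deg ij] := eqVneq (c m i j) 0; first by rewrite mul0r.
  by exfalso; have := ler0n R (i + j); lra.
pose e i j := Quat (c 0%N i j) (c 1%N i j) (c 2%N i j) (c 3%N i j).
(* [P'] is what the analysis yields; [P] is defined from it by multiplying each coefficient by the
   two square roots, which their inverses in the statement undo. *)
exists k, (poly2 N (fun i j => inplane qi (sqrtc (Complex 0 (pb mu1))) * e i j *
  inplane qj (sqrtc (Complex 0 (pb mu2))))), (poly2 N e); split => //.
- by move=> x; rewrite eval2_sandwich ?sqrtc_imaginary_neq0.
- move=> m n /coef_poly2 en; apply: contrapT => h.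
  have z l : c l m n = 0 by apply: contrapT => /eqP /deg.
  by case/eqP: en; rewrite /e !z.
- apply: (ae_imp _ hae) => x h; rewrite [LHS](demodK mu1 mu2) -[demod _ _ _ _]/(gf mu1 mu2 f x).
  congr (_ * _); rewrite -[RHS]mulrA; congr (_ * _).
  rewrite mulr_algr [LHS]quat_axis !h.
  have s0 := @coord_eval2 R (@q0 R) N e x (fun _ _ => erefl) erefl (fun _ _ => erefl).
  have s1 := @coord_eval2 R (@q1 R) N e x (fun _ _ => erefl) erefl (fun _ _ => erefl).
  have s2 := @coord_eval2 R (@q2 R) N e x (fun _ _ => erefl) erefl (fun _ _ => erefl).
  have s3 := @coord_eval2 R (@q3 R) N e x (fun _ _ => erefl) erefl (fun _ _ => erefl).
  move: s0 s1 s2 s3; case: (eval2 (poly2 N e) x) => A B A' B' /= -> -> -> ->.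
  by congr Quat; rewrite mulrC.
Qed.
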